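(* Let $0<r_\ast<R_\ast<\infty$ and $\mathbb A^\ast=\{\xi\in\mathbb C: r_\ast<|\xi|<R_\ast\}$. Let $\mathbb S=\{(\xi,w(\xi)):\xi\in\mathbb A^\ast\}\subset\mathbb C\times\mathbb R\cong\mathbb R^3$ be a minimal graph over $\mathbb A^\ast$, i.e. the graph of a $\mathscr C^2$ function $w:\mathbb A^\ast\to\mathbb R$ satisfying the minimal surface equation (zero mean curvature), and assume $\mathbb S$ is conformally equivalent to a circular annulus $A(r,R)=\{z: r<|z|<R\}$, $0<r<R<\infty$. Then $$\operatorname{Mod}\mathbb S\leqslant \log\left(\frac{R_\ast}{r_\ast}+\sqrt{\frac{R_\ast^2}{r_\ast^2}-1}\right).$$ Equality holds if and only if $\mathbb S$ is the upper slab of a catenoid, i.e. $w(\xi)=c\pm r_\ast\log\Big(\frac{|\xi|+\sqrt{|\xi|^2-r_\ast^2}}{r_\ast}\Big)$ for some constant $c\in\mathbb R$.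
   Context: The conformal modulus of a doubly connected surface $\mathbb S$ that is the image of an annulus $A(r,R)$, $0<r<R<\infty$, under a conformal map is $\operatorname{Mod}\mathbb S=\log(R/r)$; this is independent of the choice of conformal parametrization. *)

(* Defs.v *)
(* classical reals. C is identified with R x R, a function
   on C is a two-variable real function (fun x y => ...). *)
From Stdlib Require Import Reals.
Open Scope R_scope.

Definition cnorm (x y : R) : R := sqrt (x * x + y * y).

Definition annulus (a b : R) (x y : R) : Prop := a < cnorm x y < b.

Definition cont2_at (f : R -> R -> R) (x y : R) : Prop :=
  forall eps, 0 < eps -> exists delta, 0 < delta /\
    forall x' y', (x' - x) * (x' - x) + (y' - y) * (y' - y) < delta * delta ->
      Rabs (f x' y' - f x y) < eps.

Definition C1_on (U : R -> R -> Prop) (f fx fy : R -> R -> R) : Prop :=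
  forall x y, U x y ->
    derivable_pt_lim (fun t => f t y) x (fx x y) /\
    derivable_pt_lim (fun t => f x t) y (fy x y) /\
    cont2_at fx x y /\ cont2_at fy x y.

Definition minimal_graph (U : R -> R -> Prop) (w : R -> R -> R) : Prop :=
  exists wx wy wxx wxy wyx wyy : R -> R -> R,
    C1_on U w wx wy /\ C1_on U wx wxx wxy /\ C1_on U wy wyx wyy /\
    forall x y, U x y ->
      (1 + wy x y * wy x y) * wxx x y
      - 2 * wx x y * wy x y * wxy x y
      + (1 + wx x y * wx x y) * wyy x y = 0.

(* The graph S = {(xi, w xi) : xi in A(rs,Rs)} is conformally equivalent to
   the annulus A(r,R): there is a C^1 bijection (s,t) |-> (u s t, v s t) from
   A(r,R) onto A(rs,Rs) such that the map
   f(s,t) = (u s t, v s t, w (u s t) (v s t)) : A(r,R) -> S is a conformal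
   immersion (|f_s| = |f_t| > 0, f_s . f_t = 0). *)
Definition graph_conf_equiv_annulus (rs Rs : R) (w : R -> R -> R) (r R0 : R) : Prop :=
  exists u v : R -> R -> R,
    (forall s t, annulus r R0 s t -> annulus rs Rs (u s t) (v s t)) /\
    (forall x y, annulus rs Rs x y ->
       exists s t, annulus r R0 s t /\ u s t = x /\ v s t = y) /\
    (forall s t s' t', annulus r R0 s t -> annulus r R0 s' t' ->
       u s t = u s' t' -> v s t = v s' t' -> s = s' /\ t = t') /\
    exists us ut vs vt hs ht : R -> R -> R,
      C1_on (annulus r R0) u us ut /\
      C1_on (annulus r R0) v vs vt /\
      C1_on (annulus r R0) (fun s t => w (u s t) (v s t)) hs ht /\
      forall s t, annulus r R0 s t ->
        us s t * us s t + vs s t * vs s t + hs s t * hs s t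
          = ut s t * ut s t + vt s t * vt s t + ht s t * ht s t /\
        us s t * ut s t + vs s t * vt s t + hs s t * ht s t = 0 /\
        0 < us s t * us s t + vs s t * vs s t + hs s t * hs s t.

Definition catenoid_height (rs c sgn : R) (x y : R) : R :=
  c + sgn * rs * ln ((cnorm x y + sqrt (cnorm x y * cnorm x y - rs * rs)) / rs).

(* Main.v *)
(** Put logarithmic coordinates [t + i s] on the conformal annulus, so that [0 < t < T = ln (R0 / r)]. By minimality the
    horizontal projection [h = u + i v] of the graph is harmonic in these coordinates, and it is a homeomorphism onto the
    annulus; scaling to [rs = 1] and reversing [t] or [s] if needed, it preserves orientation, with [|h| -> 1] as [t -> 0]
    and [|h| -> R = Rs / rs] as [t -> T]. The bound is then the Nitsche inequality [cosh T <= R], where equality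
    must force [h = cosh t e^(i (s + c))].

    Thin annuli ([T <= 1]). Let [U(t)] be the mean of [|h|^2] over the circle [t] and [E(t)] the mean of [u v_s - v u_s].
    For explicit multipliers, [A U + B E + C U'] is nondecreasing, because its derivative is the integral of a
    nonnegative quadratic form in [h_t - tanh t h] and [h_s - i h]; its limits at the two ends give the bound.

    Thick annuli ([T >= 1]). Since [h(t, .)] winds around 0, its harmonic extension to the disc vanishes at some point,
    which stays away from the circle. For the Poisson kernel [q] of that point, [q h] has mean zero. The half-derivative
    inequality for [q |h|^2] at a time when the mean of [q |h|^2] increases, combined with the exact evolution of the
    Fourier modes of [h] from [t] to [t + tau], bounds [U(t + tau)] below by [cosh^2 tau] up to an error tending to 0.
    All modes other than [1] and [-1] carry a definite surplus, which settles the equality case.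

    If [h = cosh t e^(i (s + c))], conformality gives [w_s = 0] and [w_t = +-rs], a catenoid. Conversely, on a catenoid
    [arccosh |h|] is conjugate to the angle of [h], so its variance over circles is convex in [t]; it vanishes at both ends,
    hence [arccosh |h| = W t] with an integer [W], and injectivity of [h] gives [W = 1]. *)

Require Import Defs.
From Stdlib Require Import Reals Lra Psatz ZArith ClassicalEpsilon.
From Coquelicot Require Import Coquelicot.
Open Scope R_scope.

(** Near [t = 0] only [|h|] is controlled: no boundary values of [h] are available and its energy
    has no a priori bound there. Every boundary fact therefore enters as a one-sided limit:
    [U1 >= 0] by convexity, [area >= 1] by degree, smallness of a mean on a nearby circle. The split
    at [T = 1] comes from the thin method: its quadratic form is nonnegative only if [|B| <= 2 C],
    and at [t = 0] this reads [tau <= 1]. The thick method asks for [coth tau <= 4/3], that is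
    [e^(2 tau) >= 7], which holds from slightly below 1 on. As it treats [tau < T] and then lets
    [tau] tend to [T], the two ranges meet. The Poisson weight of the thick method deals with mode
    0, which is affine in [t] and has no favourable coefficient: a large mean of [h] on the inner
    circle would spoil the estimate. With the weight [q] the relevant mean is that of [q h], which
    can be made to vanish. The half-derivative inequality survives the weight, because its extra
    density [q^2 - m0 q] has mean zero and [|h|] is almost constant. *)

(** * Continuous functions and their means over a period *)

Definition cont (f : R -> R) : Prop := forall x, continuous f x.
Definition periodic (f : R -> R) : Prop := forall x, f (x + 2 * PI) = f x.

Lemma cont_const c : cont (fun _ => c).
Proof. intros x; apply continuous_const. Qed.
Lemma cont_id : cont (fun x => x).
Proof. intros x; apply continuous_id. Qed.
Lemma cont_plus f g : cont f -> cont g -> cont (fun x => f x + g x).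
Proof. intros F G x; apply (continuous_plus f g); auto. Qed.
Lemma cont_minus f g : cont f -> cont g -> cont (fun x => f x - g x).
Proof. intros F G x; apply (continuous_minus f g); auto. Qed.
Lemma cont_opp f : cont f -> cont (fun x => - f x).
Proof. intros F x; apply (continuous_opp f); auto. Qed.
Lemma cont_mult f g : cont f -> cont g -> cont (fun x => f x * g x).
Proof. intros F G x; apply (continuous_mult f g); auto. Qed.
Lemma cont_comp f g : cont f -> cont g -> cont (fun x => g (f x)).
Proof. intros F G x; apply (continuous_comp f g); auto. Qed.
Lemma cont_inv f : cont f -> (forall x, f x <> 0) -> cont (fun x => / f x).
Proof.
intros F H x. apply (continuous_comp f Rinv); auto.
apply continuity_pt_filterlim, continuity_pt_inv; [apply continuity_pt_id | apply H].
Qed.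
Lemma cont_div f g : cont f -> cont g -> (forall x, g x <> 0) -> cont (fun x => f x / g x).
Proof. intros F G H; apply cont_mult; auto; now apply cont_inv. Qed.
Lemma derive_cont f df : (forall x, is_derive f x (df x)) -> cont f.
Proof. intros H x; apply (ex_derive_continuous f); eexists; apply H. Qed.
Lemma cont_sin : cont sin.
Proof. apply (derive_cont _ cos); intros x; auto_derive; auto; ring. Qed.
Lemma cont_cos : cont cos.
Proof. apply (derive_cont _ (fun x => - sin x)); intros x; auto_derive; auto; ring. Qed.
Lemma cont_Rabs f : cont f -> cont (fun x => Rabs (f x)).
Proof.
intros F; apply (cont_comp f Rabs); auto.
intros x; apply continuity_pt_filterlim, Rcontinuity_abs.
Qed.
Lemma cont_ext f g : (forall x, f x = g x) -> cont f -> cont g.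
Proof. intros H F x; apply (continuous_ext f); auto. Qed.
Lemma cont_Rsqrt f : cont f -> cont (fun x => sqrt (f x)).
Proof. intros F x; apply continuous_comp; auto; apply continuous_sqrt. Qed.

Lemma cont_abs : cont Rabs.
Proof. apply (cont_Rabs (fun x => x)), cont_id. Qed.

#[export] Hint Resolve cont_const cont_id cont_sin cont_cos cont_abs : cnt.

(** Continuity by structural recursion. The cases [Rplus ?a], [Rminus ?a] and [Rmult ?a] catch
    functions such as [fun x => a + x] after eta-contraction. *)
Ltac cnt :=
  lazymatch goal with
  | |- cont (fun x => x) => apply cont_id
  | |- cont (fun _ => ?c) => apply (cont_const c)
  | |- cont (fun x => _ + _) => apply cont_plus; cnt
  | |- cont (fun x => _ - _) => apply cont_minus; cnt
  | |- cont (fun x => - _) => apply cont_opp; cnt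
  | |- cont (fun x => _ * _) => apply cont_mult; cnt
  | |- cont (fun x => / _) => apply cont_inv; [cnt | try (intros; solve [auto | intro; lra])]
  | |- cont (fun x => _ / _) => apply cont_div; [cnt | cnt | try (intros; solve [auto | intro; lra])]
  | |- cont (fun x => Rabs _) => apply cont_Rabs; cnt
  | |- cont (fun x => sin _) => apply (cont_comp _ sin); [cnt | apply cont_sin]
  | |- cont (fun x => cos _) => apply (cont_comp _ cos); [cnt | apply cont_cos]
  | |- cont (Rplus ?a) => apply (cont_plus (fun _ => a) (fun x => x)); cnt
  | |- cont (Rminus ?a) => apply (cont_minus (fun _ => a) (fun x => x)); cnt
  | |- cont (Rmult ?a) => apply (cont_mult (fun _ => a) (fun x => x)); cnt
  | _ => first [assumption | apply cont_const | solve [auto with cnt] | solve [eauto 3 with cnt] | idtac]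
  end.

Lemma PI2_pos : 0 < 2 * PI.
Proof. generalize PI_RGT_0; lra. Qed.

Lemma sq_ge0 x : 0 <= x * x.
Proof. nra. Qed.

Lemma sq_eq0 x : x * x = 0 -> x = 0.
Proof. exact (Rsqr_0_uniq x). Qed.

Lemma continuous_eps (f : R -> R) x : continuous f x -> forall e, 0 < e -> exists d, 0 < d /\ forall y, Rabs (y - x) < d -> Rabs (f y - f x) < e.
Proof.
intros C e He. destruct (proj1 (filterlim_locally (F:=locally x) f _) C (mkposreal e He)) as [d Hd].
exists d. split. apply cond_pos. intros y Hy. apply Hd. exact Hy.
Qed.

Lemma locally_Ioo lo hi (P : R -> Prop) t : lo < t < hi -> (forall x, lo < x < hi -> P x) -> locally t P.
Proof.
intros Ht H. assert (p : 0 < Rmin (t - lo) (hi - t)) by (apply Rmin_pos; lra).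
exists (mkposreal _ p); simpl. intros x Hx. apply H.
unfold ball in Hx; simpl in Hx; unfold AbsRing_ball, abs, minus, plus, opp in Hx; simpl in Hx.
assert (h1 := Rmin_l (t - lo) (hi - t)). assert (h2 := Rmin_r (t - lo) (hi - t)).
apply Rabs_def2 in Hx; lra.
Qed.

Definition mean (f : R -> R) : R := RInt f 0 (2 * PI) / (2 * PI).

Lemma cont_ex_RInt f a b : cont f -> ex_RInt f a b.
Proof. intros F; apply (ex_RInt_continuous f); auto. Qed.
#[export] Hint Resolve cont_ex_RInt : cnt.

Lemma mean_ext f g : (forall x, f x = g x) -> mean f = mean g.
Proof. intros H; unfold mean; f_equal; apply RInt_ext; auto. Qed.

Lemma mean_plus f g : cont f -> cont g -> mean (fun x => f x + g x) = mean f + mean g.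
Proof.
intros F G; unfold mean.
replace (RInt (fun x => f x + g x) 0 (2 * PI)) with (RInt f 0 (2*PI) + RInt g 0 (2*PI)).
- field; generalize PI2_pos; lra.
- symmetry; apply (RInt_plus f g); auto with cnt.
Qed.

Lemma mean_scal c f : cont f -> mean (fun x => c * f x) = c * mean f.
Proof.
intros F; unfold mean.
replace (RInt (fun x => c * f x) 0 (2 * PI)) with (c * RInt f 0 (2*PI)).
- field; generalize PI2_pos; lra.
- symmetry; apply (RInt_scal f); auto with cnt.
Qed.

Lemma mean_opp f : cont f -> mean (fun x => - f x) = - mean f.
Proof.
intros F; rewrite <- (Rmult_1_l (mean f)), <- Ropp_mult_distr_l_reverse, <- mean_scal; auto.
apply mean_ext; intros; ring.
Qed.

Lemma mean_minus f g : cont f -> cont g -> mean (fun x => f x - g x) = mean f - mean g.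
Proof.
intros F G; unfold Rminus; rewrite <- mean_opp; auto.
apply mean_plus; auto; now apply cont_opp.
Qed.

Lemma mean_const c : mean (fun _ => c) = c.
Proof.
unfold mean; rewrite RInt_const; unfold scal; simpl; unfold mult; simpl.
field; generalize PI2_pos; lra.
Qed.

Lemma mean_le f g : cont f -> cont g -> (forall x, f x <= g x) -> mean f <= mean g.
Proof.
intros F G H; unfold mean; apply Rmult_le_compat_r.
- apply Rlt_le, Rinv_0_lt_compat, PI2_pos.
- apply RInt_le; auto with cnt; generalize PI2_pos; lra.
Qed.

Lemma mean_ge0 f : cont f -> (forall x, 0 <= f x) -> 0 <= mean f.
Proof. intros F H; rewrite <- (mean_const 0); apply mean_le; auto with cnt. Qed.

Lemma mean_gt0 f : cont f -> (forall x, 0 < f x) -> 0 < mean f.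
Proof.
intros F H; unfold mean; apply Rmult_lt_0_compat.
- apply RInt_gt_0; auto; apply PI2_pos.
- apply Rinv_0_lt_compat, PI2_pos.
Qed.

Lemma mean_bound f B : cont f -> (forall x, Rabs (f x) <= B) -> Rabs (mean f) <= B.
Proof.
intros F H; apply Rabs_le; split.
- rewrite <- (mean_const (-B)); apply mean_le; auto with cnt.
  intros x; generalize (H x); intros K; apply Rabs_le_between in K; lra.
- rewrite <- (mean_const B); apply mean_le; auto with cnt.
  intros x; generalize (H x); intros K; apply Rabs_le_between in K; lra.
Qed.

Lemma mean_Rabs f : cont f -> Rabs (mean f) <= mean (fun x => Rabs (f x)).
Proof.
intros F; apply Rabs_le; split.
- rewrite <- mean_opp by now apply cont_Rabs.
  apply mean_le; try now apply cont_opp, cont_Rabs. auto.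
  intros x; generalize (Rabs_maj2 (f x)); lra.
- apply mean_le; auto. now apply cont_Rabs. intros; apply Rle_abs.
Qed.

Lemma mean_deriv0 f df : (forall x, is_derive f x (df x)) -> cont df -> periodic f -> mean df = 0.
Proof.
intros D C P; unfold mean.
rewrite (is_RInt_unique df 0 (2*PI) (minus (f (2*PI)) (f 0))).
- replace (2*PI) with (0 + 2*PI) at 1 by ring; rewrite P; rewrite minus_eq_zero.
  unfold zero; simpl; field; generalize PI2_pos; lra.
- apply (is_RInt_derive f df); auto.
Qed.

Lemma is_derive_mult_R f g x df dg : is_derive f x df -> is_derive g x dg ->
  is_derive (fun y => f y * g y) x (df * g x + f x * dg).
Proof.
intros F G; apply (is_derive_mult f g); auto; intros; apply Rmult_comm.
Qed.

Lemma mean_ibp f df g dg : (forall x, is_derive f x (df x)) -> (forall x, is_derive g x (dg x)) ->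
  cont df -> cont dg -> periodic f -> periodic g ->
  mean (fun x => f x * dg x) = - mean (fun x => df x * g x).
Proof.
intros F G CF CG PF PG.
assert (cont f) by (eapply derive_cont; eauto).
assert (cont g) by (eapply derive_cont; eauto).
assert (E : mean (fun x => df x * g x + f x * dg x) = 0).
{ apply (mean_deriv0 (fun x => f x * g x)).
  - intros x; now apply is_derive_mult_R.
  - cnt.
  - intros x; now rewrite PF, PG. }
rewrite mean_plus in E by cnt; lra.
Qed.

(** A positive value persists on an interval, which is clipped to [[0, 2 PI]] and contributes a
    positive integral. Points outside the period are brought back by a multiple of [2 PI]. *)
Lemma mean_sq_zero f : cont f -> (forall x, 0 <= f x) -> periodic f -> mean f = 0 -> forall x, f x = 0.
Proof.
intros F P Per H.
assert (ZZ : forall x, 0 <= x <= 2 * PI -> f x = 0).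
{ intros x0 Hx0. apply NNPP; intros N.
  assert (Pos : 0 < f x0) by (destruct (P x0); auto; congruence).
  assert (Fx := F x0).
  destruct (continuous_eps f x0 Fx (f x0 / 2) ltac:(lra)) as (d & Dp & Hd).
  assert (Hd' : forall y, Rabs (y - x0) < d -> f x0 / 2 < f y) by (intros y Hy; specialize (Hd y Hy); apply Rabs_def2 in Hd; lra).
  assert (Hp := PI2_pos).
  set (a := Rmax 0 (x0 - d/2)). set (b := Rmin (2*PI) (x0 + d/2)).
  assert (ab : a < b).
  { unfold a, b, Rmax, Rmin; destruct Rle_dec; destruct Rle_dec; try lra. }
  assert (a0 : 0 <= a) by apply Rmax_l.
  assert (b0 : b <= 2*PI) by apply Rmin_l.
  assert (a1 : x0 - d/2 <= a) by apply Rmax_r.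
  assert (b1 : b <= x0 + d/2) by apply Rmin_r.
  assert (I : RInt f 0 (2*PI) = 0).
  { unfold mean in H; apply Rmult_integral in H; destruct H as [H|H]; auto.
    apply Rinv_neq_0_compat in H; [easy | lra]. }
  assert (C1 : RInt f 0 a + RInt f a (2*PI) = RInt f 0 (2*PI)) by (apply (RInt_Chasles f); auto with cnt).
  assert (C2 : RInt f a b + RInt f b (2*PI) = RInt f a (2*PI)) by (apply (RInt_Chasles f); auto with cnt).
  assert (0 <= RInt f 0 a) by (apply RInt_ge_0; auto with cnt).
  assert (0 <= RInt f b (2*PI)) by (apply RInt_ge_0; auto with cnt).
  assert (0 < RInt f a b).
  { apply RInt_gt_0; auto. intros y Hy; generalize (Hd' y); intros K.
    assert (Rabs (y - x0) < d) by (apply Rabs_def1; lra). specialize (K H2); lra. }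
  lra. }
assert (PN : forall (n:nat) x, f (x + INR n * (2*PI)) = f x).
{ induction n; intros x. simpl; f_equal; ring.
  rewrite S_INR. replace (x + (INR n + 1) * (2*PI)) with ((x + INR n * (2*PI)) + 2*PI) by ring.
  now rewrite Per. }
assert (PZ : forall (n:Z) x, f (x + IZR n * (2*PI)) = f x).
{ intros n x; destruct (Z_le_gt_dec 0 n).
  - rewrite <- (Z2Nat.id n) by lia; rewrite <- INR_IZR_INZ; apply PN.
  - rewrite <- (PN (Z.to_nat (-n)) (x + IZR n * (2*PI))). rewrite INR_IZR_INZ, Z2Nat.id by lia.
    f_equal; rewrite opp_IZR; ring. }
intros x. assert (Hp := PI2_pos).
destruct (archimed (- x / (2*PI))) as [A1 A2].
set (n := up (-x/(2*PI))) in *.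
rewrite <- (PZ n x); apply ZZ.
assert (E : - x = -x/(2*PI) * (2*PI)) by (field; lra).
split; nra.
Qed.

Lemma mean_CS f g : cont f -> cont g ->
  mean (fun x => f x * g x) * mean (fun x => f x * g x) <=
  mean (fun x => f x * f x) * mean (fun x => g x * g x).
Proof.
intros F G.
set (A := mean (fun x => f x * f x)); set (B := mean (fun x => f x * g x)); set (C := mean (fun x => g x * g x)).
assert (Q : forall s, 0 <= A * s * s + 2 * B * s + C).
{ intros s. replace (A*s*s + 2*B*s + C) with (mean (fun x => (s * f x + g x) * (s * f x + g x))).
  - apply mean_ge0; [cnt | intros; apply sq_ge0].
  - rewrite (mean_ext _ (fun x => (s*s)*(f x * f x) + ((2*s) * (f x * g x) + g x * g x))) by (intros; ring).
    rewrite mean_plus by cnt. rewrite mean_plus by cnt. rewrite !mean_scal by cnt. unfold A, B, C; ring. }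
assert (0 <= A) by (apply mean_ge0; [cnt | intros; apply sq_ge0]).
assert (0 <= C) by (apply mean_ge0; [cnt | intros; apply sq_ge0]).
destruct (Req_dec A 0) as [Z|Z].
- rewrite Z in *. assert (B = 0). { apply NNPP; intros NB.
  (* For [A = 0] the quadratic degenerates to [2 B s + C], which equals -1 at this [s]. *)
  generalize (Q (-(C+1)/(2*B))); intros K. replace (0 * (- (C + 1) / (2 * B)) * (- (C + 1) / (2 * B)) + 2 * B * (- (C + 1) / (2 * B)) + C) with (-1) in K by (field; auto). lra. }
  rewrite H1; lra.
- generalize (Q (- B / A)); intros K.
  replace (A * (- B / A) * (- B / A) + 2 * B * (- B / A) + C) with ((A * C - B * B) / A) in K by (field; auto).
  assert (0 <= (A*C - B*B)/A * A) by (apply Rmult_le_pos; auto).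
  replace ((A*C - B*B)/A * A) with (A*C - B*B) in H1 by (field; auto). lra.
Qed.

Lemma RInt_translate f a b c : cont f -> RInt (fun y => f (y + c)) a b = RInt f (a + c) (b + c).
Proof.
intros F.
assert (E : RInt (fun y => scal 1 (f (y + c))) a b = RInt f (a + c) (b + c)).
{ apply (RInt_comp f (fun y => y + c) (fun _ => 1)); auto.
  intros; split. auto_derive; auto; ring. apply continuous_const. }
rewrite <- E; apply RInt_ext; intros x _; unfold scal; simpl; unfold mult; simpl; ring.
Qed.

Lemma periodic_RInt f a : cont f -> periodic f -> RInt f a (a + 2*PI) = RInt f 0 (2*PI).
Proof.
intros F P.
assert (C1 : RInt f 0 a + RInt f a (a+2*PI) = RInt f 0 (a+2*PI)) by (apply (RInt_Chasles f); auto with cnt).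
assert (C2 : RInt f 0 (2*PI) + RInt f (2*PI) (a+2*PI) = RInt f 0 (a+2*PI)) by (apply (RInt_Chasles f); auto with cnt).
assert (S : RInt f (0+2*PI) (a+2*PI) = RInt f 0 a).
{ rewrite <- RInt_translate; auto. apply RInt_ext; intros; apply P. }
rewrite Rplus_0_l in S. lra.
Qed.

Lemma mean_shift f c : cont f -> periodic f -> mean (fun x => f (x + c)) = mean f.
Proof.
intros F P; unfold mean; f_equal.
rewrite RInt_translate; auto. rewrite <- (periodic_RInt f c); auto. f_equal; ring.
Qed.

Lemma mean_reflect f : cont f -> periodic f -> mean (fun x => f (- x)) = mean f.
Proof.
intros F P; unfold mean; f_equal.
assert (E : RInt (fun y => scal (-1) (f (- y))) 0 (2*PI) = RInt f (-0) (-(2*PI))).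
{ apply (RInt_comp f (fun y => - y) (fun _ => -1)); auto.
  intros; split. auto_derive; auto; ring. apply continuous_const. }
assert (E1 : RInt (fun y => scal (-1) (f (- y))) 0 (2*PI) = -1 * RInt (fun y => f (-y)) 0 (2*PI)).
{ apply (RInt_scal (fun y => f (-y))). apply cont_ex_RInt; apply (cont_comp (fun y => - y) f); auto. cnt. }
assert (E2 : - RInt f (-0) (-(2*PI)) = RInt f (-(2*PI)) (-0)) by (apply (opp_RInt_swap f); auto with cnt).
assert (E3 := periodic_RInt f (-(2*PI)) F P).
replace (-(2*PI)+2*PI) with (-0) in E3 by ring.
lra.
Qed.

(** * Compactness of rectangles and differentiability in two variables *)

(** Choice selects a scale at every point, and compactness bounds from below the scales that are
    needed to cover the rectangle; monotonicity in [d] lets the bound replace them. It serves both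
    for extreme values and for the properness of a chart. *)
Lemma compact_rect a b a' b' (Q : R -> R -> R -> Prop) :
  (forall d d' x y, 0 < d' <= d -> Q d x y -> Q d' x y) ->
  (forall u v, a <= u <= b -> a' <= v <= b' -> exists d, 0 < d /\
     forall x y, a <= x <= b -> a' <= y <= b' -> Rabs (x - u) < d -> Rabs (y - v) < d -> Q d x y) ->
  exists d, 0 < d /\ forall x y, a <= x <= b -> a' <= y <= b' -> Q d x y.
Proof.
intros Mono H.
assert (H' : forall u v, exists d : posreal, a <= u <= b -> a' <= v <= b' ->
  forall x y, a <= x <= b -> a' <= y <= b' -> Rabs (x - u) < d -> Rabs (y - v) < d -> Q d x y).
{ intros u v. destruct (classic (a <= u <= b /\ a' <= v <= b')) as [[K1 K2]|K].
  - destruct (H u v K1 K2) as (d & D & E). exists (mkposreal d D); auto.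
  - exists (mkposreal 1 Rlt_0_1); intros; tauto. }
set (delta := fun u v => proj1_sig (constructive_indefinite_description _ (H' u v))).
destruct (compactness_value_2d a b a' b' delta) as [d Hd].
exists d; split; [apply cond_pos|].
intros x y Hx Hy. specialize (Hd x y Hx Hy). apply NNPP in Hd.
destruct Hd as (u & v & Hu & Hv & Cu & Cv & Dd).
apply (Mono (delta u v)). split; auto; apply cond_pos.
unfold delta in *. destruct (constructive_indefinite_description _ (H' u v)) as [e He]; simpl in *.
auto.
Qed.

(** Without a minimum every value is undercut elsewhere, so near each point [f] exceeds its infimum
    by a positive amount. [compact_rect] makes this amount uniform, against the definition of the
    infimum. *)
Lemma evt2 (f : R -> R -> R) a b a' b' : a <= b -> a' <= b' ->
  (forall x y, a <= x <= b -> a' <= y <= b' -> continuity_2d_pt f x y) ->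
  exists x y, a <= x <= b /\ a' <= y <= b' /\ forall u v, a <= u <= b -> a' <= v <= b' -> f x y <= f u v.
Proof.
intros ab ab' C. apply NNPP; intros N.
assert (K : forall x y, a <= x <= b -> a' <= y <= b' -> exists u v, a <= u <= b /\ a' <= v <= b' /\ f u v < f x y).
{ intros x y Hx Hy; apply NNPP; intros M; apply N; exists x, y; repeat split; try tauto; try lra.
  intros u v Hu Hv; apply Rnot_lt_le; intros L; apply M; exists u, v; auto. }
set (E := fun m => exists x y, a <= x <= b /\ a' <= y <= b' /\ m = - f x y).
assert (Bd : bound E).
(* Writing the lower bound as [- / d] turns local boundedness into a property monotone in [d]. *)
{ destruct (compact_rect a b a' b' (fun d x y => - / d <= f x y)) as (d & Dp & Hd).
  - intros d d' x y [h1 h2] h3. apply Rle_trans with (2 := h3).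
    apply Ropp_le_contravar. apply Rinv_le_contravar; auto.
  - intros u v Hu Hv. destruct (C u v Hu Hv (mkposreal 1 Rlt_0_1)) as [d Hd].
    set (g := Rmin d (/ (Rabs (f u v) + 1))).
    assert (Ap := Rabs_pos (f u v)).
    assert (Ip : 0 < / (Rabs (f u v) + 1)) by (apply Rinv_0_lt_compat; lra).
    assert (gp : 0 < g) by (apply Rmin_pos; auto; apply cond_pos).
    exists g; split; auto. intros x y Hx Hy Kx Ky.
    assert (g <= d) by apply Rmin_l. assert (g <= / (Rabs (f u v) + 1)) by apply Rmin_r.
    specialize (Hd x y ltac:(lra) ltac:(lra)). simpl in Hd. apply Rabs_def2 in Hd.
    assert (Rabs (f u v) + 1 <= / g).
    { rewrite <- (Rinv_inv (Rabs (f u v) + 1)). apply Rinv_le_contravar; auto. }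
    generalize (Rabs_maj2 (f u v)); lra.
  - exists (/ d). intros m (x & y & Hx & Hy & ->). specialize (Hd x y Hx Hy). lra. }
assert (Ne : exists m, E m) by (exists (- f a a'), a, a'; repeat split; lra).
destruct (completeness E Bd Ne) as [m [Ub Lub]].
destruct (compact_rect a b a' b' (fun d x y => - m + d <= f x y)) as (d & Dp & Hd).
- intros; lra.
- intros x y Hx Hy. destruct (K x y Hx Hy) as (u & v & Hu & Hv & L).
  assert (- f u v <= m) by (apply Ub; exists u, v; auto).
  assert (P : 0 < (f x y + m) / 2) by lra.
  destruct (C x y Hx Hy (mkposreal _ P)) as [d Hd]. simpl in Hd.
  exists (Rmin d ((f x y + m)/2)). split. apply Rmin_pos; auto; apply cond_pos.
  intros x' y' _ _ Kx Ky.
  assert (h1 := Rmin_l d ((f x y + m)/2)). assert (h2 := Rmin_r d ((f x y + m)/2)).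
  specialize (Hd x' y' ltac:(lra) ltac:(lra)). apply Rabs_def2 in Hd. lra.
- assert (m <= m - d); [|lra]. apply Lub. intros z (x & y & Hx & Hy & ->).
  specialize (Hd x y Hx Hy); lra.
Qed.

Lemma C1_differentiable (f fx fy : R -> R -> R) x y :
  locally_2d (fun u v => is_derive (fun z => f z v) u (fx u v)) x y ->
  (locally_2d (fun u v => is_derive (fun z => f u z) v (fy u v)) x y) ->
  continuity_2d_pt fx x y -> continuity_2d_pt fy x y ->
  differentiable_pt_lim f x y (fx x y) (fy x y).
Proof.
intros [d1 H1] [d2 H2] Cx Cy eps.
assert (Pe : 0 < eps / 2) by (generalize (cond_pos eps); lra).
destruct (Cx (mkposreal _ Pe)) as [d3 H3]. destruct (Cy (mkposreal _ Pe)) as [d4 H4]. simpl in *.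
set (d := Rmin (Rmin d1 d2) (Rmin d3 d4)).
assert (dp : 0 < d) by (repeat apply Rmin_pos; apply cond_pos).
assert (l1 : d <= d1) by (eapply Rle_trans; [apply Rmin_l | apply Rmin_l]).
assert (l2 : d <= d2) by (eapply Rle_trans; [apply Rmin_l | apply Rmin_r]).
assert (l3 : d <= d3) by (eapply Rle_trans; [apply Rmin_r | apply Rmin_l]).
assert (l4 : d <= d4) by (eapply Rle_trans; [apply Rmin_r | apply Rmin_r]).
exists (mkposreal d dp); simpl; intros u v Hu Hv.
destruct (MVT_cor4 (fun z => f z v) (fun z => fx z v) x (Rabs (u - x))) with (b := u) as (c & E1 & K1).
{ intros c Hc; apply H1; lra. }
{ lra. }
destruct (MVT_cor4 (fun z => f x z) (fun z => fy x z) y (Rabs (v - y))) with (b := v) as (c' & E2 & K2).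
{ intros c' Hc; apply H2; [rewrite Rminus_diag, Rabs_R0; apply cond_pos | lra]. }
{ lra. }
replace (f u v - f x y - (fx x y * (u - x) + fy x y * (v - y))) with
  ((fx c v - fx x y) * (u - x) + (fy x c' - fy x y) * (v - y)) by (cbv beta in *; lra).
eapply Rle_trans; [apply Rabs_triang|]. rewrite !Rabs_mult.
assert (A1 : Rabs (fx c v - fx x y) < eps / 2) by (apply H3; lra).
assert (A2 : Rabs (fy x c' - fy x y) < eps / 2).
{ apply H4; [rewrite Rminus_diag, Rabs_R0; apply cond_pos | lra]. }
assert (B1 := Rmax_l (Rabs (u-x)) (Rabs (v-y))). assert (B2 := Rmax_r (Rabs (u-x)) (Rabs (v-y))).
assert (0 <= Rabs (u-x)) by apply Rabs_pos. assert (0 <= Rabs (v-y)) by apply Rabs_pos.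
assert (0 <= Rabs (fx c v - fx x y)) by apply Rabs_pos. assert (0 <= Rabs (fy x c' - fy x y)) by apply Rabs_pos.
nra.
Qed.

Lemma continuity_2d_slice2 f x y : continuity_2d_pt f x y -> continuous (fun z => f x z) y.
Proof.
intros C. apply filterlim_locally. intros eps. destruct (C eps) as [d Hd]. exists d.
intros z Hz. apply Hd; auto. rewrite Rminus_diag, Rabs_R0; apply cond_pos.
Qed.

(** * Functions of class [C^1] on a cylinder *)

(** A function on the cylinder is a function on a strip that is periodic in [s]. The partial
    derivatives are explicit data, so that sums, products and compositions compute them and the
    integral formulas can name them. *)
Record C1cyl (lo hi : R) (f ft fs : R -> R -> R) : Prop := {
  c1_dt : forall t s, lo < t < hi -> is_derive (fun x => f x s) t (ft t s);
  c1_ds : forall t s, lo < t < hi -> is_derive (fun x => f t x) s (fs t s);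
  c1_ct : forall t s, lo < t < hi -> continuity_2d_pt ft t s;
  c1_cs : forall t s, lo < t < hi -> continuity_2d_pt fs t s;
  c1_per : forall t, lo < t < hi -> periodic (f t) }.
Arguments c1_dt {lo hi f ft fs} _.
Arguments c1_ds {lo hi f ft fs} _.
Arguments c1_ct {lo hi f ft fs} _.
Arguments c1_cs {lo hi f ft fs} _.
Arguments c1_per {lo hi f ft fs} _.

Lemma locally_2d_strip lo hi (P : R -> R -> Prop) t s : lo < t < hi ->
  (forall t s, lo < t < hi -> P t s) -> locally_2d P t s.
Proof.
intros Ht H. assert (p : 0 < Rmin (t - lo) (hi - t)) by (apply Rmin_pos; lra).
exists (mkposreal _ p); simpl; intros u v Hu _. apply H.
assert (h1 := Rmin_l (t - lo) (hi - t)). assert (h2 := Rmin_r (t - lo) (hi - t)).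
apply Rabs_def2 in Hu; lra.
Qed.

Lemma c1_diff lo hi f ft fs t s : C1cyl lo hi f ft fs -> lo < t < hi ->
  differentiable_pt_lim f t s (ft t s) (fs t s).
Proof.
intros F Ht. apply C1_differentiable.
- apply (locally_2d_strip lo hi); auto. apply F.
- apply (locally_2d_strip lo hi); auto. apply F.
- now apply F.
- now apply F.
Qed.

Lemma c1_cf {lo hi f ft fs t s} : C1cyl lo hi f ft fs -> lo < t < hi -> continuity_2d_pt f t s.
Proof.
intros F Ht; apply differentiable_continuity_pt. eexists; eexists; eapply c1_diff; eauto.
Qed.

Lemma c1_per_s {lo hi f ft fs t} : C1cyl lo hi f ft fs -> lo < t < hi -> periodic (fs t).
Proof.
intros F Ht s.
assert (D1 : is_derive (fun x => f t (x + 2*PI)) s (fs t (s + 2*PI))).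
{ rewrite <- (Rmult_1_l (fs t (s+2*PI))).
  apply (is_derive_comp (fun x => f t x) (fun x => x + 2*PI)). now apply F. auto_derive; auto; ring. }
assert (D2 : is_derive (fun x => f t x) s (fs t (s + 2*PI))).
{ apply (is_derive_ext (fun x => f t (x + 2*PI))); auto. intros; now apply (c1_per F). }
rewrite <- (is_derive_unique _ _ _ D2). symmetry. rewrite <- (is_derive_unique (fun x => f t x) s (fs t s)); auto.
now apply F.
Qed.

Lemma c1_per_t {lo hi f ft fs t} : C1cyl lo hi f ft fs -> lo < t < hi -> periodic (ft t).
Proof.
intros F Ht s.
assert (D2 : is_derive (fun x => f x s) t (ft t (s + 2*PI))).
{ apply (is_derive_ext_loc (fun x => f x (s + 2*PI))); [|now apply F].
  apply (locally_Ioo lo hi); auto. intros u Hu. now apply (c1_per F). }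
rewrite <- (is_derive_unique _ _ _ D2). rewrite <- (is_derive_unique (fun x => f x s) t (ft t s)); auto.
now apply F.
Qed.

Lemma c1_cont_f {lo hi f ft fs t} : C1cyl lo hi f ft fs -> lo < t < hi -> cont (f t).
Proof. intros F Ht s. apply continuity_2d_slice2 with (f := f). eapply c1_cf; eauto. Qed.
Lemma c1_cont_t {lo hi f ft fs t} : C1cyl lo hi f ft fs -> lo < t < hi -> cont (ft t).
Proof. intros F Ht s. apply continuity_2d_slice2. now apply F. Qed.
Lemma c1_cont_s {lo hi f ft fs t} : C1cyl lo hi f ft fs -> lo < t < hi -> cont (fs t).
Proof. intros F Ht s. apply continuity_2d_slice2. now apply F. Qed.

Lemma c1_ext lo hi f ft fs ft' fs' : (forall t s, lo < t < hi -> ft t s = ft' t s) ->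
  (forall t s, lo < t < hi -> fs t s = fs' t s) -> C1cyl lo hi f ft fs -> C1cyl lo hi f ft' fs'.
Proof.
intros h1 h2 F; constructor; intros.
- rewrite <- h1 by auto; now apply F.
- rewrite <- h2 by auto; now apply F.
- apply (continuity_2d_pt_ext_loc ft). apply (locally_2d_strip lo hi); auto. now apply F.
- apply (continuity_2d_pt_ext_loc fs). apply (locally_2d_strip lo hi); auto. now apply F.
- now apply (c1_per F).
Qed.

Lemma c1_plus {lo hi f ft fs g gt gs} : C1cyl lo hi f ft fs -> C1cyl lo hi g gt gs ->
  C1cyl lo hi (fun t s => f t s + g t s) (fun t s => ft t s + gt t s) (fun t s => fs t s + gs t s).
Proof.
intros F G; constructor; intros.
- apply (is_derive_plus (fun x => f x s) (fun x => g x s)); [now apply F | now apply G].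
- apply (is_derive_plus (fun x => f t x) (fun x => g t x)); [now apply F | now apply G].
- apply continuity_2d_pt_plus; [now apply F | now apply G].
- apply continuity_2d_pt_plus; [now apply F | now apply G].
- intros x; now rewrite (c1_per F), (c1_per G).
Qed.

Lemma c1_mult {lo hi f ft fs g gt gs} : C1cyl lo hi f ft fs -> C1cyl lo hi g gt gs ->
  C1cyl lo hi (fun t s => f t s * g t s) (fun t s => ft t s * g t s + f t s * gt t s)
    (fun t s => fs t s * g t s + f t s * gs t s).
Proof.
intros F G.
assert (CF : forall t s, lo < t < hi -> continuity_2d_pt f t s) by (intros; eapply c1_cf; eauto).
assert (CG : forall t s, lo < t < hi -> continuity_2d_pt g t s) by (intros; eapply c1_cf; eauto).
constructor; intros.
- apply (is_derive_mult_R (fun x => f x s) (fun x => g x s)); [now apply F | now apply G].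
- apply (is_derive_mult_R (fun x => f t x) (fun x => g t x)); [now apply F | now apply G].
- apply continuity_2d_pt_plus; apply continuity_2d_pt_mult; auto; [now apply F | now apply G].
- apply continuity_2d_pt_plus; apply continuity_2d_pt_mult; auto; [now apply F | now apply G].
- intros x; now rewrite (c1_per F), (c1_per G).
Qed.

Lemma c1_circle lo hi (g dg : R -> R) : (forall s, is_derive g s (dg s)) -> cont dg -> periodic g ->
  C1cyl lo hi (fun _ s => g s) (fun _ _ => 0) (fun _ s => dg s).
Proof.
intros D C P; constructor; intros; auto.
- apply (is_derive_const (g s)).
- apply continuity_2d_pt_const.
- apply (continuity_1d_2d_pt_comp dg (fun _ v => v)); [|apply continuity_2d_pt_id2].
  apply continuity_pt_filterlim, C.
Qed.

Lemma c1_time lo hi (g dg : R -> R) : (forall t, lo < t < hi -> is_derive g t (dg t)) ->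
  (forall t, lo < t < hi -> continuous dg t) ->
  C1cyl lo hi (fun t _ => g t) (fun t _ => dg t) (fun _ _ => 0).
Proof.
intros D C; constructor; intros; auto.
- apply (is_derive_const (g t)).
- apply (continuity_1d_2d_pt_comp dg (fun u _ => u)); [|apply continuity_2d_pt_id1].
  apply continuity_pt_filterlim, C; auto.
- apply continuity_2d_pt_const.
- intros x; auto.
Qed.

Lemma c1_const lo hi c : C1cyl lo hi (fun _ _ => c) (fun _ _ => 0) (fun _ _ => 0).
Proof.
apply (c1_circle lo hi (fun _ => c) (fun _ => 0)); [intros; apply (is_derive_const c) | apply cont_const | now intros x].
Qed.

Lemma c1_scal lo hi c f ft fs : C1cyl lo hi f ft fs ->
  C1cyl lo hi (fun t s => c * f t s) (fun t s => c * ft t s) (fun t s => c * fs t s).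
Proof.
intros F. eapply c1_ext; [| | apply (c1_mult (c1_const lo hi c) F)]; intros; simpl; ring.
Qed.

Lemma c1_minus {lo hi f ft fs g gt gs} : C1cyl lo hi f ft fs -> C1cyl lo hi g gt gs ->
  C1cyl lo hi (fun t s => f t s - g t s) (fun t s => ft t s - gt t s) (fun t s => fs t s - gs t s).
Proof.
intros F G; constructor; intros.
- apply (is_derive_minus (fun x => f x s) (fun x => g x s)); [now apply F | now apply G].
- apply (is_derive_minus (fun x => f t x) (fun x => g t x)); [now apply F | now apply G].
- apply continuity_2d_pt_minus; [now apply F | now apply G].
- apply continuity_2d_pt_minus; [now apply F | now apply G].
- intros x; now rewrite (c1_per F), (c1_per G).
Qed.

Lemma c1_comp lo hi (psi dpsi : R -> R) f ft fs : C1cyl lo hi f ft fs ->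
  (forall t s, lo < t < hi -> is_derive psi (f t s) (dpsi (f t s))) ->
  (forall t s, lo < t < hi -> continuous dpsi (f t s)) ->
  C1cyl lo hi (fun t s => psi (f t s)) (fun t s => dpsi (f t s) * ft t s) (fun t s => dpsi (f t s) * fs t s).
Proof.
intros F D C.
assert (CF : forall t s, lo < t < hi -> continuity_2d_pt f t s) by (intros; eapply c1_cf; eauto).
assert (CD : forall t s, lo < t < hi -> continuity_2d_pt (fun t s => dpsi (f t s)) t s).
{ intros; apply continuity_1d_2d_pt_comp; auto. apply continuity_pt_filterlim, C; auto. }
constructor; intros.
- rewrite Rmult_comm. apply (is_derive_comp psi (fun x => f x s)); auto. now apply F.
- rewrite Rmult_comm. apply (is_derive_comp psi (fun x => f t x)); auto. now apply F.
- apply continuity_2d_pt_mult; auto; now apply F.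
- apply continuity_2d_pt_mult; auto; now apply F.
- intros x; now rewrite (c1_per F).
Qed.

(** The representative is chosen before [f], so one reduction serves several periodic functions at
    once, such as [cos] and [sin] of one angle. *)
Lemma per_reduce x : exists y, 0 <= y <= 2 * PI /\ forall f, periodic f -> f x = f y.
Proof.
assert (Hp := PI2_pos).
destruct (archimed (- x / (2*PI))) as [A1 A2].
set (n := up (-x/(2*PI))) in *.
exists (x + IZR n * (2*PI)). split.
- assert (E : - x = -x/(2*PI) * (2*PI)) by (field; lra). split; nra.
- intros f Per.
  assert (PN : forall (n:nat) x, f (x + INR n * (2*PI)) = f x).
  { induction n0; intros z. simpl; f_equal; ring.
    rewrite S_INR. replace (z + (INR n0 + 1) * (2*PI)) with ((z + INR n0 * (2*PI)) + 2*PI) by ring.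
    now rewrite Per. }
  destruct (Z_le_gt_dec 0 n).
  + rewrite <- (Z2Nat.id n) by lia; rewrite <- INR_IZR_INZ; now rewrite PN.
  + rewrite <- (PN (Z.to_nat (-n)) (x + IZR n * (2*PI))). rewrite INR_IZR_INZ, Z2Nat.id by lia.
    f_equal; rewrite opp_IZR; ring.
Qed.

Lemma strip_unif lo hi g t : lo < t < hi ->
  (forall t s, lo < t < hi -> continuity_2d_pt g t s) -> (forall t, lo < t < hi -> periodic (g t)) ->
  forall eps, 0 < eps -> exists d, 0 < d /\ forall x, Rabs (x - t) < d -> lo < x < hi /\
    forall s, Rabs (g x s - g t s) < eps.
Proof.
intros Ht C P eps He.
set (e0 := Rmin (t - lo) (hi - t) / 2).
assert (h1 := Rmin_l (t - lo) (hi - t)). assert (h2 := Rmin_r (t - lo) (hi - t)).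
assert (p : 0 < Rmin (t - lo) (hi - t)) by (apply Rmin_pos; lra).
assert (e0p : 0 < e0) by (unfold e0; lra).
destruct (uniform_continuity_2d g (t - e0) (t + e0) 0 (2*PI)) with (eps := mkposreal eps He) as [d Hd].
{ intros; apply C; unfold e0 in *; lra. }
exists (Rmin d e0). split. apply Rmin_pos; auto; apply cond_pos.
intros x Hx. assert (k1 := Rmin_l d e0). assert (k2 := Rmin_r d e0).
assert (Hx' := Rabs_def2 _ _ Hx).
assert (Lx : lo < x < hi) by (unfold e0 in *; lra).
split; auto. intros s. destruct (per_reduce s) as (y & Hy & E).
rewrite (E (g x)), (E (g t)) by (apply P; auto).
apply (Hd t y x y); try lra. rewrite Rminus_diag, Rabs_R0; apply cond_pos.
Qed.

Lemma strip_bounded lo hi g a b : lo < a -> a <= b -> b < hi ->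
  (forall t s, lo < t < hi -> continuity_2d_pt g t s) -> (forall t, lo < t < hi -> periodic (g t)) ->
  exists t0 s0, a <= t0 <= b /\ forall t s, a <= t <= b -> g t0 s0 <= g t s.
Proof.
intros h1 h2 h3 C P.
destruct (evt2 g a b 0 (2*PI)) as (t0 & s0 & A & B & M); auto.
- generalize PI2_pos; lra.
- intros; apply C; lra.
- exists t0, s0; split; auto. intros t s Ht. destruct (per_reduce s) as (y & Hy & E).
  rewrite (E (g t)) by (apply P; lra). auto.
Qed.

Lemma mean_derive {lo hi f ft fs} t : C1cyl lo hi f ft fs -> lo < t < hi ->
  is_derive (fun x => mean (f x)) t (mean (ft t)).
Proof.
intros F Ht. apply is_derive_Reals. intros eps He.
destruct (strip_unif lo hi ft t Ht) with (eps := eps/2) as (d & dp & Hd); try lra.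
- now apply F.
- intros; eapply c1_per_t; eauto.
- exists (mkposreal d dp); simpl. intros h Hh Hhd.
  assert (Hx : lo < t + h < hi) by (apply Hd; replace (t+h-t) with h by ring; auto).
  assert (k1 := c1_cont_f F Ht). assert (k2 := c1_cont_f F Hx). assert (k3 := c1_cont_t F Ht).
  assert (E : (mean (f (t+h)) - mean (f t))/h - mean (ft t) = mean (fun s => (/h * f (t+h) s - /h * f t s) - ft t s)).
  { rewrite mean_minus by cnt. rewrite mean_minus by cnt. rewrite !mean_scal by cnt. field; auto. }
  rewrite E. apply Rle_lt_trans with (eps/2); [|lra]. apply mean_bound.
  { cnt. }
  intros s.
  destruct (MVT_cor4 (fun z => f z s) (fun z => ft z s) t (Rabs h)) with (b := t + h) as (c & E1 & K1).
  { intros c Hc. apply F. apply Hd; lra. }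
  { replace (t+h-t) with h by ring; lra. }
  replace (t+h-t) with h in * by ring.
  replace (/h * f (t+h) s - /h * f t s - ft t s) with (ft c s - ft t s).
  + apply Rlt_le, Hd; lra.
  + cbv beta in E1. replace (f (t+h) s) with (f t s + ft c s * h) by lra. field; auto.
Qed.

(* Only first derivatives of [f] and [k] are used: the increment of [k] is integrated by parts
   before the difference quotient is taken. *)
Lemma mean_stokes {lo hi f ft fs k kt ks} t : C1cyl lo hi f ft fs -> C1cyl lo hi k kt ks -> lo < t < hi ->
  is_derive (fun x => mean (fun s => f x s * ks x s)) t
    (mean (fun s => ft t s * ks t s - fs t s * kt t s)).
Proof.
intros F K Ht. apply is_derive_Reals. intros eps He.
assert (BC : forall g, (forall t s, lo < t < hi -> continuity_2d_pt g t s) -> (forall t, lo < t < hi -> periodic (g t)) ->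
   exists B, 0 < B /\ forall s, Rabs (g t s) <= B).
{ intros g C P. destruct (strip_bounded lo hi g t t) as (t0 & s0 & A & M); try lra; auto.
  destruct (strip_bounded lo hi (fun x y => - g x y) t t) as (t1 & s1 & A1 & M1); try lra; auto.
  { intros; apply continuity_2d_pt_opp; auto. } { intros x Hx y; rewrite P; auto. }
  exists (Rabs (g t0 s0) + Rabs (g t1 s1) + 1). split.
  - generalize (Rabs_pos (g t0 s0)) (Rabs_pos (g t1 s1)); lra.
  - intros s; specialize (M t s ltac:(lra)); specialize (M1 t s ltac:(lra)). simpl in *.
    assert (l1 := Rabs_maj2 (g t0 s0)). assert (l2 := Rle_abs (g t1 s1)).
    assert (l3 := Rabs_pos (g t0 s0)). assert (l4 := Rabs_pos (g t1 s1)). apply Rabs_le; lra. }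
assert (Cft := c1_ct F). assert (Cks := c1_cs K). assert (Ckt := c1_ct K).
assert (Cfs := c1_cs F).
assert (Pft : forall t, lo < t < hi -> periodic (ft t)) by (intros; eapply c1_per_t; eauto).
assert (Pfs : forall t, lo < t < hi -> periodic (fs t)) by (intros; eapply c1_per_s; eauto).
assert (Pkt : forall t, lo < t < hi -> periodic (kt t)) by (intros; eapply c1_per_t; eauto).
assert (Pks : forall t, lo < t < hi -> periodic (ks t)) by (intros; eapply c1_per_s; eauto).
destruct (BC ft Cft Pft) as (B1 & B1p & HB1). destruct (BC ks Cks Pks) as (B2 & B2p & HB2).
destruct (BC fs Cfs Pfs) as (B3 & B3p & HB3).
set (M := B1 + B2 + B3 + 1).
(* The error splits into three products of an increment below [e] with a factor bounded through [M];
   the part [e <= 1] is what bounds [ks] on the nearby circle by [B2 + 1]. *)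
set (e := Rmin 1 (eps / (4 * M))).
assert (Mp : 0 < M) by (unfold M; lra).
assert (ep : 0 < e) by (apply Rmin_pos; [lra | apply Rdiv_lt_0_compat; lra]).
assert (e1 : e <= 1) by apply Rmin_l.
assert (e2 : e * M <= eps / 4).
{ apply Rle_trans with (eps / (4*M) * M). apply Rmult_le_compat_r; [lra | apply Rmin_r]. right; field; lra. }
destruct (strip_unif lo hi ft t Ht Cft Pft e ep) as (d1 & d1p & H1).
destruct (strip_unif lo hi ks t Ht Cks Pks e ep) as (d2 & d2p & H2).
destruct (strip_unif lo hi kt t Ht Ckt Pkt e ep) as (d3 & d3p & H3).
set (d := Rmin d1 (Rmin d2 d3)).
assert (dp : 0 < d) by (repeat apply Rmin_pos; auto).
assert (l1 : d <= d1) by apply Rmin_l.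
assert (l2 : d <= d2) by (eapply Rle_trans; [apply Rmin_r | apply Rmin_l]).
assert (l3 : d <= d3) by (eapply Rle_trans; [apply Rmin_r | apply Rmin_r]).
exists (mkposreal d dp); simpl. intros h Hh Hhd.
assert (Hx : lo < t + h < hi) by (apply H1; replace (t+h-t) with h by ring; lra).
assert (Cs : forall x, lo < x < hi -> cont (f x) /\ cont (ft x) /\ cont (fs x) /\ cont (k x) /\ cont (kt x) /\ cont (ks x)).
{ intros x Hxx; repeat split; [eapply c1_cont_f | eapply c1_cont_t | eapply c1_cont_s | eapply c1_cont_f | eapply c1_cont_t | eapply c1_cont_s]; eauto. }
destruct (Cs t Ht) as (c1 & c2 & c3 & c4 & c5 & c6). destruct (Cs (t+h) Hx) as (c1' & c2' & c3' & c4' & c5' & c6').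
assert (IBP : mean (fun s => f t s * (ks (t+h) s - ks t s)) = - mean (fun s => fs t s * (k (t+h) s - k t s))).
{ apply (mean_ibp (f t) (fs t) (fun s => k (t+h) s - k t s) (fun s => ks (t+h) s - ks t s)).
  - intros; now apply F.
  - intros x; apply (is_derive_minus (k (t+h)) (k t)); now apply K.
  - auto.
  - cnt.
  - now apply (c1_per F).
  - intros x; now rewrite !(c1_per K). }
assert (E : (mean (fun s => f (t+h) s * ks (t+h) s) - mean (fun s => f t s * ks t s))/h
      - mean (fun s => ft t s * ks t s - fs t s * kt t s) =
   mean (fun s => /h * ((f (t+h) s - f t s) * ks (t+h) s) - /h * (fs t s * (k (t+h) s - k t s))
         - (ft t s * ks t s - fs t s * kt t s))).
{ rewrite !mean_minus by cnt.
  rewrite !mean_scal by cnt.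
  replace (mean (fun s => (f (t+h) s - f t s) * ks (t+h) s)) with
    (mean (fun s => f (t+h) s * ks (t+h) s) - mean (fun s => f t s * ks t s) - mean (fun s => f t s * (ks (t+h) s - ks t s))).
  - rewrite IBP. field; auto.
  - rewrite <- !mean_minus by cnt. apply mean_ext; intros; ring. }
rewrite E. apply Rle_lt_trans with (eps/2); [|lra]. apply mean_bound. cnt.
intros s.
destruct (MVT_cor4 (fun z => f z s) (fun z => ft z s) t (Rabs h)) with (b := t + h) as (c & E1 & K1).
{ intros z Hz. apply F. apply H1; lra. } { replace (t+h-t) with h by ring; lra. }
destruct (MVT_cor4 (fun z => k z s) (fun z => kt z s) t (Rabs h)) with (b := t + h) as (c' & E2 & K2).
{ intros z Hz. apply K. apply H1; lra. } { replace (t+h-t) with h by ring; lra. }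
cbv beta in E1, E2. replace (t+h-t) with h in * by ring. rewrite E1, E2.
replace (/ h * (ft c s * h * ks (t + h) s) - / h * (fs t s * (kt c' s * h)) - (ft t s * ks t s - fs t s * kt t s))
  with ((ft c s - ft t s) * ks (t+h) s + ft t s * (ks (t+h) s - ks t s) - fs t s * (kt c' s - kt t s)) by (field; auto).
assert (A1 : Rabs (ft c s - ft t s) < e) by (apply H1; lra).
assert (A2 : Rabs (ks (t+h) s - ks t s) < e) by (apply H2; replace (t+h-t) with h by ring; lra).
assert (A3 : Rabs (kt c' s - kt t s) < e) by (apply H3; lra).
assert (A4 : Rabs (ks (t+h) s) <= B2 + 1).
{ replace (ks (t+h) s) with ((ks (t+h) s - ks t s) + ks t s) by ring.
  eapply Rle_trans; [apply Rabs_triang|]. generalize (HB2 s); lra. }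
assert (G : forall a b A B, Rabs a <= A -> Rabs b <= B -> Rabs (a * b) <= A * B).
{ intros; rewrite Rabs_mult; apply Rmult_le_compat; auto; apply Rabs_pos. }
assert (G1 := G _ _ _ _ (Rlt_le _ _ A1) A4). assert (G2 := G _ _ _ _ (HB1 s) (Rlt_le _ _ A2)).
assert (G3 := G _ _ _ _ (HB3 s) (Rlt_le _ _ A3)).
unfold Rminus at 1. eapply Rle_trans; [apply Rabs_triang|]. rewrite Rabs_Ropp.
eapply Rle_trans; [apply Rplus_le_compat; [apply Rabs_triang | apply Rle_refl]|].
unfold M in e2. nra.
Qed.

(** * Harmonic homeomorphisms of annuli *)

Ltac rring := match goal with |- @eq _ ?a ?b => change (@eq R a b); ring end.

Record cylmap := { hT : R; hR : R;
  hu : R -> R -> R; hut : R -> R -> R; hus : R -> R -> R;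
  hv : R -> R -> R; hvt : R -> R -> R; hvs : R -> R -> R }.

(* Harmonicity in weak form, tested against [p]: conformal charts are only assumed to be [C^1]. *)
Definition weak_harmonic T (ft fs : R -> R -> R) : Prop :=
  forall p pt ps, C1cyl 0 T p pt ps -> forall t, 0 < t < T ->
  is_derive (fun x => mean (fun s => p x s * ft x s)) t (mean (fun s => pt t s * ft t s + ps t s * fs t s)).

Definition nsq D t s := hu D t s * hu D t s + hv D t s * hv D t s.
Definition jac D t s := hut D t s * hvs D t s - hus D t s * hvt D t s.

(** The normalised situation: [h = u + i v] maps the cylinder into the annulus of radii 1 and [hR].
    The boundary conditions [k_0] and [k_1] are uniform limits of [|h|^2] alone. Of the
    homeomorphism, the positive Jacobian is kept; together with the boundary conditions it yields a
    positive winding number. *)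
Record core (D : cylmap) : Prop := {
  k_T : 0 < hT D; k_R : 1 < hR D;
  k_u : C1cyl 0 (hT D) (hu D) (hut D) (hus D);
  k_v : C1cyl 0 (hT D) (hv D) (hvt D) (hvs D);
  k_hu : weak_harmonic (hT D) (hut D) (hus D);
  k_hv : weak_harmonic (hT D) (hvt D) (hvs D);
  k_J : forall t s, 0 < t < hT D -> 0 < jac D t s;
  k_N : forall t s, 0 < t < hT D -> 1 < nsq D t s < hR D * hR D;
  k_0 : forall e, 0 < e -> exists d, 0 < d /\ forall t s, 0 < t < hT D -> t < d -> nsq D t s < 1 + e;
  k_1 : forall e, 0 < e -> exists d, 0 < d /\ forall t s, 0 < t < hT D -> hT D - d < t -> hR D * hR D - e < nsq D t s }.

Lemma incr lo hi f df x y : (forall t, lo < t < hi -> is_derive f t (df t)) ->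
  (forall t, lo < t < hi -> 0 <= df t) -> lo < x -> x <= y -> y < hi -> f x <= f y.
Proof.
intros D P h1 h2 h3.
destruct (MVT_gen f x y df) as (c & Hc & E).
- intros z; rewrite Rmin_left, Rmax_right by auto; intros; apply D; lra.
- intros z; rewrite Rmin_left, Rmax_right by auto; intros. apply continuity_pt_filterlim.
  apply (ex_derive_continuous f). eexists; apply D; lra.
- rewrite Rmin_left, Rmax_right in Hc by auto. generalize (P c ltac:(lra)); nra.
Qed.

Lemma const_on lo hi f x y : (forall t, lo < t < hi -> is_derive f t 0) -> lo < x < hi -> lo < y < hi -> f x = f y.
Proof.
assert (G : forall x y, (forall t, lo < t < hi -> is_derive f t 0) -> lo < x -> x <= y -> y < hi -> f x = f y).
{ intros a b H h1 h2 h3. apply Rle_antisym.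
  - apply (incr lo hi f (fun _ => 0)); auto; intros; lra.
  - assert (- f a <= - f b); [|lra].
    apply (incr lo hi (fun x => - f x) (fun _ => 0)); auto; try (intros; lra).
    intros t Ht. rewrite <- Ropp_0. apply (is_derive_opp f), H; auto. }
intros H Hx Hy. destruct (Rle_dec x y); [apply G; auto; lra | symmetry; apply G; auto; lra].
Qed.

(** The square of the positive part, a convex function of class [C^1]. Combinations of its
    translates are the cutoffs in [|h|^2] used below. *)
Definition pos2 x := Rmax 0 x * Rmax 0 x.
Lemma pos2_derive x : is_derive pos2 x (2 * Rmax 0 x).
Proof.
destruct (Rtotal_order x 0) as [H|[H|H]].
- rewrite Rmax_left by lra. replace (2*0) with 0 by ring.
  apply (is_derive_ext_loc (fun _ => 0)); [|apply (is_derive_const 0)].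
  apply (locally_Ioo (2 * x) 0); [lra|]; intros y Hy.
  unfold pos2; rewrite Rmax_left by lra; rring.
- subst x. rewrite Rmax_left by lra. apply is_derive_Reals. intros eps He.
  exists (mkposreal eps He); simpl; intros h Hh Hd.
  unfold pos2. rewrite Rplus_0_l, (Rmax_left 0 0) by lra.
  unfold Rmax; destruct Rle_dec.
  + replace ((h*h - 0*0)/h - 2*0) with h by (field; auto). auto.
  + replace ((0*0 - 0*0)/h - 2*0) with 0 by (field; auto). rewrite Rabs_R0; auto.
- rewrite Rmax_right by lra.
  apply (is_derive_ext_loc (fun x => x * x)).
  + apply (locally_Ioo 0 (2 * x)); [lra|]; intros y Hy.
    unfold pos2; rewrite Rmax_right by lra; rring.
  + auto_derive; auto; ring.
Qed.
Lemma cont_Rmax0 : cont (fun x => Rmax 0 x).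
Proof.
apply (cont_ext (fun x => (x + Rabs x) / 2)).
- intros x. unfold Rmax, Rabs; destruct Rle_dec; destruct Rcase_abs; lra.
- cnt.
Qed.

(** * The winding number of the circles and its positivity *)

(** This is [|h|^2] times the [s]-derivative of the angle of [h]. *)
Definition omega D t s := hu D t s * hvs D t s - hv D t s * hus D t s.

Ltac cyl H Ht :=
  let a1 := fresh "c" in assert (a1 := c1_cont_f (k_u _ H) Ht);
  let a2 := fresh "c" in assert (a2 := c1_cont_f (k_v _ H) Ht);
  let a3 := fresh "c" in assert (a3 := c1_cont_t (k_u _ H) Ht);
  let a4 := fresh "c" in assert (a4 := c1_cont_t (k_v _ H) Ht);
  let a5 := fresh "c" in assert (a5 := c1_cont_s (k_u _ H) Ht);
  let a6 := fresh "c" in assert (a6 := c1_cont_s (k_v _ H) Ht).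

Lemma c1_nsq D : core D -> C1cyl 0 (hT D) (nsq D)
  (fun t s => 2 * (hu D t s * hut D t s + hv D t s * hvt D t s))
  (fun t s => 2 * (hu D t s * hus D t s + hv D t s * hvs D t s)).
Proof.
intros H. eapply c1_ext; [| | eapply c1_plus; eapply c1_mult; apply H]; intros; simpl; ring.
Qed.

(* On two one-forms: [d (psi(N) (u dv - v du)) = 2 (psi + N psi') du dv]. *)
Lemma psi_form D psi dpsi t : core D -> 0 < t < hT D ->
  (forall x, 1 < x -> is_derive psi x (dpsi x)) -> (forall x, 1 < x -> continuous dpsi x) ->
  is_derive (fun t => mean (fun s => psi (nsq D t s) * omega D t s)) t
    (mean (fun s => 2 * jac D t s * (psi (nsq D t s) + nsq D t s * dpsi (nsq D t s)))).
Proof.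
intros H Ht Dp Cp.
assert (Fp : C1cyl 0 (hT D) (fun t s => psi (nsq D t s))
   (fun t s => dpsi (nsq D t s) * (2 * (hu D t s * hut D t s + hv D t s * hvt D t s)))
   (fun t s => dpsi (nsq D t s) * (2 * (hu D t s * hus D t s + hv D t s * hvs D t s)))).
{ apply (c1_comp _ _ psi dpsi _ _ _ (c1_nsq D H)); intros; [apply Dp | apply Cp]; now apply (k_N _ H). }
assert (F1 := c1_mult Fp (k_u _ H)). assert (F2 := c1_mult Fp (k_v _ H)).
assert (S1 := mean_stokes t F1 (k_v _ H) Ht).
assert (S2 := mean_stokes t F2 (k_u _ H) Ht). simpl in S1, S2.
assert (S := is_derive_minus _ _ _ _ _ S1 S2).
cyl H Ht. assert (cN := c1_cont_f (c1_nsq D H) Ht).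
assert (cp := c1_cont_f Fp Ht). simpl in cp.
assert (cd : cont (fun s => dpsi (nsq D t s))).
{ intros s. apply (continuous_comp (nsq D t) dpsi); auto. apply Cp. now apply (k_N _ H). }
unfold minus, plus, opp in S; simpl in S.
rewrite <- mean_opp in S by cnt. rewrite <- mean_plus in S by cnt.
match type of S with is_derive _ _ (mean ?f) =>
  replace (mean (fun s => 2 * jac D t s * (psi (nsq D t s) + nsq D t s * dpsi (nsq D t s)))) with (mean f) end.
2:{ apply mean_ext; intros s; unfold jac, nsq; ring. }
eapply is_derive_ext_loc; [|exact S].
apply (locally_Ioo 0 (hT D)); auto. intros x Hx. simpl.
assert (cpx := c1_cont_f Fp Hx). simpl in cpx. cyl H Hx.
rewrite <- mean_opp by cnt. rewrite <- mean_plus by cnt. apply mean_ext; intros s; unfold omega; ring.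
Qed.

Definition wind D t := mean (fun s => / nsq D t s * omega D t s).

(** For [psi x = 1 / x] the factor [psi + N psi'] in [psi_form] vanishes. *)
Lemma wind_const D t t' : core D -> 0 < t < hT D -> 0 < t' < hT D -> wind D t = wind D t'.
Proof.
intros H Ht Ht'. apply (const_on 0 (hT D)); auto. intros x Hx.
assert (S := psi_form D Rinv (fun x => - / (x * x)) x H Hx).
replace 0 with (mean (fun s => 2 * jac D x s * (/ nsq D x s + nsq D x s * - / (nsq D x s * nsq D x s)))).
- apply S.
  + intros y Hy. auto_derive. lra. field; lra.
  + intros y Hy. apply (ex_derive_continuous (fun x => - / (x*x))). auto_derive. nra.
- rewrite <- (mean_const 0). apply mean_ext; intros s. assert (K := k_N _ H x s Hx). field; lra.
Qed.

Lemma cont_jac D t : core D -> 0 < t < hT D -> cont (jac D t).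
Proof. intros H Ht. cyl H Ht. unfold jac. cnt. Qed.
Lemma cont_omega D t : core D -> 0 < t < hT D -> cont (omega D t).
Proof. intros H Ht. cyl H Ht. unfold omega. cnt. Qed.
Lemma cont_nsq D t : core D -> 0 < t < hT D -> cont (nsq D t).
Proof. intros H Ht. cyl H Ht. unfold nsq. cnt. Qed.

(** This is [psi_form] for [psi x = chi x / x], where [psi + x psi' = chi']. Hence the integral is
    monotone in [t] as soon as [chi] is monotone. *)
Lemma chi_form D chi dchi t : core D -> 0 < t < hT D ->
  (forall x, is_derive chi x (dchi x)) -> cont dchi ->
  is_derive (fun t => mean (fun s => chi (nsq D t s) / nsq D t s * omega D t s)) t
    (mean (fun s => 2 * jac D t s * dchi (nsq D t s))).
Proof.
intros H Ht Dc Cc.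
assert (cc : cont chi) by (eapply derive_cont; eauto).
replace (mean (fun s => 2 * jac D t s * dchi (nsq D t s))) with
 (mean (fun s => 2 * jac D t s * ((fun x => chi x / x) (nsq D t s) + nsq D t s * (fun x => dchi x / x - chi x / (x * x)) (nsq D t s)))).
- apply (psi_form D (fun x => chi x / x) (fun x => dchi x / x - chi x / (x * x))); auto.
  + intros x Hx. replace (dchi x / x - chi x / (x*x)) with (dchi x * / x + chi x * (- / (x*x))) by (field; lra).
    apply (is_derive_mult_R chi Rinv); auto. auto_derive; [lra | field; lra].
  + intros x Hx.
    apply (continuous_minus (fun x => dchi x * / x) (fun x => chi x * / (x*x))).
    * apply (continuous_mult dchi Rinv); auto. apply (ex_derive_continuous Rinv). auto_derive; lra.
    * apply (continuous_mult chi (fun x => / (x*x))); auto. apply (ex_derive_continuous (fun x => / (x*x))). auto_derive; nra.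
- apply mean_ext; intros s. assert (K := k_N _ H t s Ht). simpl. field; lra.
Qed.

Lemma mean_pos_pt f : cont f -> (forall x, 0 <= f x) -> periodic f -> forall x, 0 < f x -> 0 < mean f.
Proof.
intros F P Per x Hx. destruct (mean_ge0 f F P) as [h|h]; auto.
assert (K := mean_sq_zero f F P Per (eq_sym h) x). lra.
Qed.

Lemma per_nsq D t : core D -> 0 < t < hT D -> periodic (nsq D t).
Proof. intros H Ht; apply (c1_per (c1_nsq D H)); auto. Qed.
Lemma per_jac D t : core D -> 0 < t < hT D -> periodic (jac D t).
Proof.
intros H Ht s. unfold jac.
rewrite (c1_per_t (k_u _ H) Ht), (c1_per_s (k_u _ H) Ht), (c1_per_t (k_v _ H) Ht), (c1_per_s (k_v _ H) Ht). auto.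
Qed.

Lemma cont_clamp a b : cont (fun x => Rmax a (Rmin b x)).
Proof.
apply (cont_ext (fun x => (a + (b + x - Rabs (b - x)) / 2 + Rabs (a - (b + x - Rabs (b - x)) / 2)) / 2)).
- intros x. unfold Rmax, Rmin, Rabs; repeat destruct Rcase_abs; repeat destruct Rle_dec; lra.
- cnt.
Qed.

Lemma IVT_Icc f a b y : a <= b -> (forall x, a <= x <= b -> continuous f x) ->
  f a <= y <= f b \/ f b <= y <= f a -> exists x, a <= x <= b /\ f x = y.
Proof.
intros ab C Hy.
set (g := fun x => f (Rmax a (Rmin b x))).
assert (Cl : forall x, a <= Rmax a (Rmin b x) <= b).
{ intros x. unfold Rmax, Rmin; repeat destruct Rle_dec; lra. }
destruct (IVT_gen g a b y) as (x & Hx & E).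
- intros x. apply continuity_pt_filterlim. apply (continuous_comp (fun x => Rmax a (Rmin b x)) f).
  apply cont_clamp. apply C, Cl.
- assert (ga : g a = f a) by (unfold g; rewrite (Rmin_right b a), (Rmax_left a a) by lra; auto).
  assert (gb : g b = f b) by (unfold g; rewrite (Rmin_left b b), (Rmax_right a b) by lra; auto).
  rewrite ga, gb. unfold Rmin, Rmax; repeat destruct Rle_dec; lra.
- exists (Rmax a (Rmin b x)); split; auto.
Qed.

(** A nondecreasing cutoff [chi] of [|h|^2], zero near the inner boundary and constant near the
    outer one, makes the integral of [chi_form] vanish at the first end and equal a positive
    multiple of the winding number at the second. It is nondecreasing in between, and strictly
    increasing at some time. *)
Lemma wind_pos D t : core D -> 0 < t < hT D -> 0 < wind D t.
Proof.
intros H Ht. assert (R1 := k_R _ H).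
set (d := (hR D * hR D - 1) / 5). assert (dp : 0 < d) by (unfold d; nra).
(* The derivative of [chi] is a tent on [[1 + d, 1 + 3 d]] with peak [2 d]; beyond the tent [chi] is
   the second difference [2 d^2]. Taking a fifth of [hR^2 - 1] for [d] leaves room on both sides. *)
set (chi := fun x => pos2 (x - (1 + d)) - 2 * pos2 (x - (1 + 2 * d)) + pos2 (x - (1 + 3 * d))).
set (dchi := fun x => 2 * Rmax 0 (x - (1 + d)) - 2 * (2 * Rmax 0 (x - (1 + 2 * d))) + 2 * Rmax 0 (x - (1 + 3 * d))).
assert (Dp : forall a x, is_derive (fun x => pos2 (x - a)) x (2 * Rmax 0 (x - a))).
{ intros a x. rewrite <- (Rmult_1_l (2 * _)). apply (is_derive_comp pos2 (fun x => x - a)). apply pos2_derive. auto_derive; auto; ring. }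
assert (Dc : forall x, is_derive chi x (dchi x)).
{ intros x. unfold chi, dchi. apply (is_derive_plus (fun x => pos2 (x - (1 + d)) - 2 * pos2 (x - (1 + 2 * d)))); auto.
  apply (is_derive_minus (fun x => pos2 (x - (1 + d))) (fun x => 2 * pos2 (x - (1 + 2 * d)))); auto.
  apply (is_derive_scal (fun x => pos2 (x - (1 + 2*d)))); auto. }
assert (Cm : forall a, cont (fun x => Rmax 0 (x - a))) by (intros a; apply (cont_comp (fun x => x - a) (fun x => Rmax 0 x)); [cnt | apply cont_Rmax0]).
assert (Cc : cont dchi) by (unfold dchi; cnt; apply Cm).
assert (Pc : forall x, 0 <= dchi x).
{ intros x; unfold dchi, Rmax; repeat destruct Rle_dec; lra. }
set (Z := fun t => mean (fun s => chi (nsq D t s) / nsq D t s * omega D t s)).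
set (dZ := fun t => mean (fun s => 2 * jac D t s * dchi (nsq D t s))).
assert (DZ : forall t, 0 < t < hT D -> is_derive Z t (dZ t)) by (intros; now apply chi_form).
assert (cdZ : forall t, 0 < t < hT D -> cont (fun s => 2 * jac D t s * dchi (nsq D t s))).
{ intros x Hx. assert (k1 := cont_jac D x H Hx). assert (k2 := cont_nsq D x H Hx). cnt.
  apply (cont_comp (nsq D x) dchi); auto. }
assert (PZ : forall t, 0 < t < hT D -> 0 <= dZ t).
{ intros x Hx. apply mean_ge0; auto. intros s. assert (k := k_J _ H x s Hx). generalize (Pc (nsq D x s)); intros.
  apply Rmult_le_pos; lra. }
destruct (k_0 _ H d dp) as (d0 & d0p & H0). destruct (k_1 _ H d dp) as (d1 & d1p & H1).
assert (TP := k_T _ H).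
set (ta := Rmin (d0/2) (hT D / 3)). set (tb := Rmax (hT D - d1/2) (2 * hT D / 3)).
assert (Hta : 0 < ta < hT D /\ ta < d0 /\ ta <= hT D/3).
{ unfold ta, Rmin; destruct Rle_dec; lra. }
assert (Htb : 0 < tb < hT D /\ hT D - d1 < tb /\ 2 * hT D/3 <= tb).
{ unfold tb, Rmax; destruct Rle_dec; lra. }
assert (Za : Z ta = 0).
{ unfold Z. rewrite <- (mean_const 0). apply mean_ext; intros s.
  assert (k := H0 ta s (proj1 Hta) (proj1 (proj2 Hta))). unfold chi, pos2. rewrite !Rmax_left by lra.
  unfold Rdiv; ring. }
assert (Zb : Z tb = 2 * d * d * wind D tb).
{ unfold Z, wind. rewrite <- mean_scal.
  2:{ assert (k1 := cont_omega D tb H (proj1 Htb)). assert (k2 := cont_nsq D tb H (proj1 Htb)). cnt.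
      intros s; generalize (k_N _ H tb s (proj1 Htb)); lra. }
  apply mean_ext; intros s. assert (k := H1 tb s (proj1 Htb) (proj1 (proj2 Htb))).
  assert (k' := k_N _ H tb s (proj1 Htb)).
  assert (E : hR D * hR D = 1 + 5 * d) by (unfold d; field). rewrite E in k.
  unfold chi, pos2. rewrite !Rmax_right by lra. field; lra. }
(* At this time the point with [s = 0] lies at the peak of the tent, so the derivative of [Z] is
   strictly positive there. *)
destruct (IVT_Icc (fun x => nsq D x 0) ta tb (1 + 2 * d)) as (t1 & K1 & K2).
{ lra. }
{ intros x Hx. apply (ex_derive_continuous (fun x => nsq D x 0)). eexists. apply (c1_nsq D H). lra. }
{ left. assert (k := H0 ta 0 (proj1 Hta) (proj1 (proj2 Hta))). assert (k' := H1 tb 0 (proj1 Htb) (proj1 (proj2 Htb))).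
  assert (E : hR D * hR D = 1 + 5 * d) by (unfold d; field). lra. }
assert (T1 : 0 < t1 < hT D) by lra.
assert (Pos : 0 < dZ t1).
{ apply (mean_pos_pt _ (cdZ t1 T1)) with (x := 0).
  - intros s. assert (k := k_J _ H t1 s T1). generalize (Pc (nsq D t1 s)); intros. apply Rmult_le_pos; lra.
  - intros s. now rewrite (per_jac D t1 H T1), (per_nsq D t1 H T1).
  - assert (k := k_J _ H t1 0 T1). simpl in K2. rewrite K2. unfold dchi.
    rewrite (Rmax_right 0 (1 + 2*d - (1 + d))) by lra. rewrite !Rmax_left by lra.
    apply Rmult_lt_0_compat; lra. }
assert (M : forall x y, 0 < x -> x <= y -> y < hT D -> Z x <= Z y) by (intros; apply (incr 0 (hT D) Z dZ); auto).
assert (Ztb : 0 < Z tb).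
{ apply Rnot_le_lt; intros L.
  assert (Cst : forall x, ta <= x <= tb -> Z x = 0).
  { intros x Hx. assert (a1 := M ta x ltac:(lra) ltac:(lra) ltac:(lra)). assert (a2 := M x tb ltac:(lra) ltac:(lra) ltac:(lra)). lra. }
  assert (t1 <> ta).
  { intros ->. assert (k := H0 ta 0 (proj1 Hta) (proj1 (proj2 Hta))). simpl in K2; lra. }
  assert (t1 <> tb).
  { intros ->. assert (k := H1 tb 0 (proj1 Htb) (proj1 (proj2 Htb))).
    assert (E : hR D * hR D = 1 + 5 * d) by (unfold d; field). simpl in K2; lra. }
  assert (Dz := is_derive_unique _ _ _ (DZ t1 T1)).
  rewrite (Derive_ext_loc Z (fun _ => 0)) in Dz.
  - rewrite Derive_const in Dz. lra.
  - apply (locally_Ioo ta tb); [lra | intros; apply Cst; lra]. }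
rewrite (wind_const D t tb); auto; try tauto. rewrite Zb in Ztb.
assert (0 < d * d) by nra. nra.
Qed.

Lemma const_R f x y : (forall t, is_derive f t 0) -> f x = f y.
Proof.
intros H. set (lo := Rmin x y - 1). set (hi := Rmax x y + 1).
assert (h1 := Rmin_l x y). assert (h2 := Rmin_r x y). assert (h3 := Rmax_l x y). assert (h4 := Rmax_r x y).
apply (const_on lo hi); auto; unfold lo, hi; lra.
Qed.

Lemma cos_eq_1_Z x : cos x = 1 -> exists k : Z, x = IZR k * (2 * PI).
Proof.
intros C.
assert (S : sin (x/2) = 0).
{ assert (E : cos x = 1 - 2 * sin (x/2) * sin (x/2)).
  { replace x with (2 * (x/2)) at 1 by field. apply cos_2a_sin. }
  rewrite C in E. nra. }
destruct (sin_eq_0_0 _ S) as [k K]. exists k. replace x with (2 * (x/2)) by field. rewrite K; ring.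
Qed.

Lemma inv_sqrt_derive x : 0 < x -> is_derive (fun x => / sqrt x) x (- / (2 * x * sqrt x)).
Proof.
intros H. assert (S := sqrt_lt_R0 _ H). assert (E : x = sqrt x * sqrt x) by (symmetry; apply sqrt_sqrt; lra).
auto_derive. repeat split; lra. set (y := sqrt x) in *. rewrite E. field. lra.
Qed.

(* With [phi' = (a b' - b a')/(a^2+b^2)], the unit vector [(a + i b) e^{-i phi} / |a + i b|] is constant. *)
Lemma winding_integer a da b db : (forall s, is_derive a s (da s)) -> (forall s, is_derive b s (db s)) ->
  cont da -> cont db -> periodic a -> periodic b -> (forall s, 0 < a s * a s + b s * b s) ->
  exists k : Z, mean (fun s => (a s * db s - b s * da s) / (a s * a s + b s * b s)) = IZR k.
Proof.
intros Da Db Ca Cb Pa Pb N.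
assert (ca : cont a) by (eapply derive_cont; eauto). assert (cb : cont b) by (eapply derive_cont; eauto).
set (n := fun s => a s * a s + b s * b s).
set (g := fun s => (a s * db s - b s * da s) / n s).
assert (cn : cont n) by (unfold n; cnt).
assert (cg : cont g). { unfold g; cnt. intros s; specialize (N s); unfold n; lra. }
set (phi := fun s => RInt g 0 s).
assert (Dphi : forall s, is_derive phi s (g s)).
{ intros s. apply (is_derive_RInt g phi 0 s); auto. exists (mkposreal 1 Rlt_0_1); intros y _.
  apply (RInt_correct g). auto with cnt. }
set (r := fun s => / sqrt (n s)).
assert (Dn : forall s, is_derive n s (2 * (a s * da s + b s * db s))).
{ intros s. unfold n.
  replace (2 * (a s * da s + b s * db s)) with ((da s * a s + a s * da s) + (db s * b s + b s * db s)) by ring.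
  apply (is_derive_plus (fun s => a s * a s) (fun s => b s * b s)); apply is_derive_mult_R; auto. }
assert (Dr : forall s, is_derive r s (- (a s * da s + b s * db s) / n s * r s)).
{ intros s. assert (K : 0 < n s) by apply N. assert (K' := sqrt_lt_R0 _ K).
  replace (- (a s * da s + b s * db s) / n s * r s) with ((2 * (a s * da s + b s * db s)) * (- / (2 * n s * sqrt (n s)))).
  - apply (is_derive_comp (fun x => / sqrt x) n); auto.
    apply inv_sqrt_derive; lra.
  - unfold r. field. lra. }
assert (Dc : forall s, is_derive (fun s => cos (phi s)) s (- sin (phi s) * g s)).
{ intros s. replace (- sin (phi s) * g s) with (g s * (- sin (phi s))) by ring.
  apply (is_derive_comp cos phi); auto. auto_derive; auto; ring. }
assert (Ds : forall s, is_derive (fun s => sin (phi s)) s (cos (phi s) * g s)).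
{ intros s. rewrite Rmult_comm. apply (is_derive_comp sin phi); auto. auto_derive; auto; ring. }
assert (A0 : forall s, is_derive (fun s => (a s * cos (phi s) + b s * sin (phi s)) * r s) s 0).
{ intros s. assert (K : 0 < n s) by apply N.
  replace 0 with (((da s * cos (phi s) + a s * (- sin (phi s) * g s)) + (db s * sin (phi s) + b s * (cos (phi s) * g s))) * r s
     + (a s * cos (phi s) + b s * sin (phi s)) * (- (a s * da s + b s * db s) / n s * r s)).
  - apply (is_derive_mult_R (fun s => a s * cos (phi s) + b s * sin (phi s)) r); auto.
    apply (is_derive_plus (fun s => a s * cos (phi s)) (fun s => b s * sin (phi s)));
     [apply (is_derive_mult_R a (fun s => cos (phi s))) | apply (is_derive_mult_R b (fun s => sin (phi s)))]; auto.
  - unfold g, n in *. field. lra. }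
assert (B0 : forall s, is_derive (fun s => (b s * cos (phi s) - a s * sin (phi s)) * r s) s 0).
{ intros s. assert (K : 0 < n s) by apply N.
  replace 0 with (((db s * cos (phi s) + b s * (- sin (phi s) * g s)) - (da s * sin (phi s) + a s * (cos (phi s) * g s))) * r s
     + (b s * cos (phi s) - a s * sin (phi s)) * (- (a s * da s + b s * db s) / n s * r s)).
  - apply (is_derive_mult_R (fun s => b s * cos (phi s) - a s * sin (phi s)) r); auto.
    apply (is_derive_minus (fun s => b s * cos (phi s)) (fun s => a s * sin (phi s)));
     [apply (is_derive_mult_R b (fun s => cos (phi s))) | apply (is_derive_mult_R a (fun s => sin (phi s)))]; auto.
  - unfold g, n in *. field. lra. }
assert (E1 := const_R _ (0 + 2*PI) 0 A0). assert (E2 := const_R _ (0 + 2*PI) 0 B0). cbv beta in E1, E2.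
assert (Rp : r (0 + 2*PI) = r 0) by (unfold r, n; now rewrite Pa, Pb).
rewrite Pa, Pb, Rp in E1, E2.
assert (p0 : phi 0 = 0) by (unfold phi; apply (RInt_point 0 g)). rewrite p0, cos_0, sin_0, Rplus_0_l in E1, E2.
assert (K : 0 < n 0) by apply N. assert (r0 : 0 < r 0) by (apply Rinv_0_lt_compat, sqrt_lt_R0; auto).
assert (F1 : a 0 * cos (phi (2*PI)) + b 0 * sin (phi (2*PI)) = a 0).
{ apply (Rmult_eq_reg_r (r 0)); lra. }
assert (F2 : b 0 * cos (phi (2*PI)) - a 0 * sin (phi (2*PI)) = b 0).
{ apply (Rmult_eq_reg_r (r 0)); lra. }
assert (C1 : cos (phi (2*PI)) = 1).
{ apply (Rmult_eq_reg_l (n 0)); [|lra]. unfold n.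
  replace ((a 0 * a 0 + b 0 * b 0) * cos (phi (2 * PI))) with (a 0 * (a 0 * cos (phi (2*PI)) + b 0 * sin (phi (2*PI))) + b 0 * (b 0 * cos (phi (2*PI)) - a 0 * sin (phi (2*PI)))) by ring.
  rewrite F1, F2; ring. }
destruct (cos_eq_1_Z _ C1) as [k Hk]. exists k. unfold mean.
change (phi (2*PI) / (2*PI) = IZR k). rewrite Hk. field. generalize PI_RGT_0; lra.
Qed.

Lemma wind_Z D t : core D -> 0 < t < hT D -> exists k : Z, (1 <= k)%Z /\ wind D t = IZR k.
Proof.
intros H Ht. cyl H Ht.
destruct (winding_integer (hu D t) (hus D t) (hv D t) (hvs D t)) as [k Hk]; auto.
- intros; now apply H.
- intros; now apply H.
- apply H; auto.
- apply H; auto.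
- intros s. generalize (k_N _ H t s Ht); unfold nsq; lra.
- exists k. assert (E : wind D t = IZR k).
  { rewrite <- Hk. apply mean_ext; intros s. unfold omega, nsq, Rdiv. ring. }
  split; auto. assert (P := wind_pos D t H Ht). rewrite E in P. apply lt_IZR in P. lia.
Qed.

Lemma wind_ge1 D t : core D -> 0 < t < hT D -> 1 <= wind D t.
Proof. intros H Ht. destruct (wind_Z D t H Ht) as (k & K & ->). now apply IZR_le. Qed.

(** * Circle means of [|h|^2], of the area form and of the energy *)

(** The signed area enclosed by the curve [h(t, .)], divided by [PI]. *)
Definition area D t := mean (omega D t).
Definition U D t := mean (nsq D t).
(** Half of the derivative of [U]. *)
Definition U1 D t := mean (fun s => hu D t s * hut D t s + hv D t s * hvt D t s).

Lemma U_derive D t : core D -> 0 < t < hT D -> is_derive (U D) t (2 * U1 D t).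
Proof.
intros H Ht. cyl H Ht. unfold U1. rewrite <- mean_scal by cnt. apply (mean_derive _ (c1_nsq D H) Ht).
Qed.

Definition energy D t := mean (fun s => hut D t s * hut D t s + hvt D t s * hvt D t s + (hus D t s * hus D t s + hvs D t s * hvs D t s)).

(** The weak form of harmonicity is tested against [u] and [v] themselves, so no second derivative
    of [h] appears. *)
Lemma U1_derive D t : core D -> 0 < t < hT D -> is_derive (U1 D) t (energy D t).
Proof.
intros H Ht. assert (A := k_hu _ H _ _ _ (k_u _ H) t Ht). assert (B := k_hv _ H _ _ _ (k_v _ H) t Ht).
cyl H Ht.
replace (energy D t) with (mean (fun s => hut D t s * hut D t s + hus D t s * hus D t s) + mean (fun s => hvt D t s * hvt D t s + hvs D t s * hvs D t s)).
- eapply is_derive_ext_loc; [|apply (is_derive_plus _ _ _ _ _ A B)].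
  apply (locally_Ioo 0 (hT D)); auto. intros x Hx. unfold plus; simpl. cyl H Hx.
  rewrite <- mean_plus by cnt. auto.
- rewrite <- mean_plus by cnt. apply mean_ext; intros; ring.
Qed.

Lemma energy_ge0 D t : core D -> 0 < t < hT D -> 0 <= energy D t.
Proof.
intros H Ht. cyl H Ht. apply mean_ge0. cnt. intros s.
assert (k1 := sq_ge0 (hut D t s)). assert (k2 := sq_ge0 (hvt D t s)). assert (k3 := sq_ge0 (hus D t s)). assert (k4 := sq_ge0 (hvs D t s)). lra.
Qed.

Lemma U1_incr D x y : core D -> 0 < x -> x <= y -> y < hT D -> U1 D x <= U1 D y.
Proof.
intros H. apply (incr 0 (hT D) _ (energy D)); intros; [now apply U1_derive | now apply energy_ge0].
Qed.

Lemma U_gt1 D t : core D -> 0 < t < hT D -> 1 < U D t < hR D * hR D.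
Proof.
intros H Ht. assert (c := cont_nsq D t H Ht). split.
- apply Rlt_0_minus. unfold U. rewrite <- (mean_const 1), <- mean_minus by cnt.
  apply mean_gt0. cnt. intros s; generalize (k_N _ H t s Ht); lra.
- apply Rlt_0_minus. unfold U. rewrite <- (mean_const (hR D * hR D)), <- mean_minus by cnt.
  apply mean_gt0. cnt. intros s; generalize (k_N _ H t s Ht); lra.
Qed.

Lemma U_lim0 D e : core D -> 0 < e -> exists d, 0 < d /\ forall t, 0 < t < hT D -> t < d -> U D t <= 1 + e.
Proof.
intros H He. destruct (k_0 _ H e He) as (d & dp & Hd). exists d; split; auto. intros t Ht Htd.
rewrite <- (mean_const (1 + e)). assert (c := cont_nsq D t H Ht). apply mean_le; auto. cnt.
intros s; generalize (Hd t s Ht Htd); lra.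
Qed.

(* [U] is convex, exceeds 1 and tends to 1 at the inner boundary. *)
Lemma U1_ge0 D t : core D -> 0 < t < hT D -> 0 <= U1 D t.
Proof.
intros H Ht. apply Rnot_lt_le; intros L.
assert (G := U_gt1 D t H Ht).
destruct (U_lim0 D ((U D t - 1)/2) H) as (d & dp & Hd); [lra|].
set (x := Rmin (d/2) (t/2)).
assert (Hx : 0 < x /\ x < d /\ x < t) by (unfold x, Rmin; destruct Rle_dec; lra).
assert (k := Hd x ltac:(lra) ltac:(lra)).
destruct (MVT_gen (U D) x t (fun y => 2 * U1 D y)) as (c & Hc & E).
- intros y; rewrite Rmin_left, Rmax_right by lra; intros; apply U_derive; auto; lra.
- intros y; rewrite Rmin_left, Rmax_right by lra; intros. apply continuity_pt_filterlim.
  apply (ex_derive_continuous (U D)). eexists; apply U_derive; auto; lra.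
- rewrite Rmin_left, Rmax_right in Hc by lra. assert (M := U1_incr D c t H ltac:(lra) ltac:(lra) ltac:(lra)). nra.
Qed.

Lemma area_derive D t : core D -> 0 < t < hT D -> is_derive (area D) t (2 * mean (jac D t)).
Proof.
intros H Ht. assert (c := cont_jac D t H Ht). rewrite <- mean_scal by cnt.
assert (S := psi_form D (fun _ => 1) (fun _ => 0) t H Ht).
apply (is_derive_ext (fun t => mean (fun s => 1 * omega D t s))).
{ intros x; apply mean_ext; intros; ring. }
replace (mean (fun s => 2 * jac D t s)) with (mean (fun s => 2 * jac D t s * (1 + nsq D t s * 0))) by (apply mean_ext; intros; ring).
apply S; intros. apply (is_derive_const 1). apply continuous_const.
Qed.

(** The difference [area - wind] is the integral of [chi_form] for [chi x = x - 1]. Approximations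
    of this [chi] that vanish near 1 give integrals that are 0 for small [t] and nondecreasing, so
    the difference is nonnegative, and [wind >= 1]. *)
Lemma area_ge1 D t : core D -> 0 < t < hT D -> 1 <= area D t.
Proof.
intros H Ht. apply Rle_trans with (1 := wind_ge1 D t H Ht).
assert (cN := cont_nsq D t H Ht). assert (cO := cont_omega D t H Ht). assert (cJ := cont_jac D t H Ht).
assert (N0 : forall s, nsq D t s <> 0) by (intros s e; generalize (k_N _ H t s Ht); lra).
assert (E : area D t - wind D t = mean (fun s => (nsq D t s - 1) / nsq D t s * omega D t s)).
{ unfold area, wind. rewrite <- mean_minus by cnt. apply mean_ext; intros s. field; auto. }
destruct (strip_bounded 0 (hT D) (nsq D) t t) as (t0 & s0 & A & M); try lra.
{ intros; eapply c1_cf; [apply (c1_nsq D H) | auto]. }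
{ intros; now apply per_nsq. }
assert (t0 = t) by lra; subst t0.
set (m := nsq D t s0 - 1). assert (mp : 0 < m) by (unfold m; generalize (k_N _ H t s0 Ht); lra).
set (B := mean (fun s => Rabs (omega D t s))). assert (Bp : 0 <= B) by (apply mean_ge0; [cnt | intros; apply Rabs_pos]).
apply Rminus_le. apply le_epsilon. intros eps He. rewrite Rplus_0_l.
(* The part [d <= m/2] puts the whole circle [t], where [|h|^2 >= 1 + m], into the region where
   [chi] is affine; the other part bounds the error by [eps]. *)
set (d := Rmin (m/2) (eps / (2 * (B + 1)))).
assert (dp : 0 < d) by (apply Rmin_pos; [lra | apply Rdiv_lt_0_compat; lra]).
assert (d1 : d <= m/2) by apply Rmin_l.
assert (d2 : 2 * d * B <= eps).
{ apply Rle_trans with (2 * (eps / (2*(B+1))) * B). apply Rmult_le_compat_r; auto. assert (d <= eps / (2 * (B + 1))) by apply Rmin_r. lra.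
  apply Rle_trans with (2 * (eps / (2*(B+1))) * (B + 1)).
  - apply Rmult_le_compat_l; [|lra]. apply Rmult_le_pos; [lra | apply Rlt_le, Rdiv_lt_0_compat; lra].
  - right; field; lra. }
(* Zero below [1 + d] and of slope 1 above [1 + 2 d], where it equals [x - 1 - 3 d / 2]. *)
set (chi := fun x => (pos2 (x - (1 + d)) - pos2 (x - (1 + 2 * d))) / (2 * d)).
set (dchi := fun x => (2 * Rmax 0 (x - (1 + d)) - 2 * Rmax 0 (x - (1 + 2 * d))) / (2 * d)).
assert (Dp : forall a x, is_derive (fun x => pos2 (x - a)) x (2 * Rmax 0 (x - a))).
{ intros a x. rewrite <- (Rmult_1_l (2 * _)). apply (is_derive_comp pos2 (fun x => x - a)). apply pos2_derive. auto_derive; auto; ring. }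
assert (Dc : forall x, is_derive chi x (dchi x)).
{ intros x. unfold chi, dchi.
  replace ((2 * Rmax 0 (x - (1 + d)) - 2 * Rmax 0 (x - (1 + 2 * d))) / (2 * d)) with (/ (2 * d) * (2 * Rmax 0 (x - (1 + d)) - 2 * Rmax 0 (x - (1 + 2 * d)))) by (field; lra).
  apply (is_derive_ext (fun x => / (2*d) * (pos2 (x - (1 + d)) - pos2 (x - (1 + 2 * d))))). { intros; apply Rmult_comm. }
  apply (is_derive_scal (fun x => pos2 (x - (1 + d)) - pos2 (x - (1 + 2 * d)))).
  apply (is_derive_minus (fun x => pos2 (x - (1 + d))) (fun x => pos2 (x - (1 + 2 * d)))); auto. }
assert (Cm : forall a, cont (fun x => Rmax 0 (x - a))) by (intros a; apply (cont_comp (fun x => x - a) (fun x => Rmax 0 x)); [cnt | apply cont_Rmax0]).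
assert (Cc : cont dchi) by (unfold dchi; cnt; apply Cm).
assert (cchi : cont chi) by (eapply derive_cont; eauto).
assert (Pc : forall x, 0 <= dchi x).
{ intros x; unfold dchi. apply Rmult_le_pos; [|apply Rlt_le, Rinv_0_lt_compat; lra].
  unfold Rmax; repeat destruct Rle_dec; lra. }
set (Z := fun t => mean (fun s => chi (nsq D t s) / nsq D t s * omega D t s)).
destruct (k_0 _ H d dp) as (d0 & d0p & H0).
set (x := Rmin (d0/2) (t/2)).
assert (Hx : 0 < x /\ x < d0 /\ x < t) by (unfold x, Rmin; destruct Rle_dec; lra).
assert (Zx : Z x = 0).
{ unfold Z. rewrite <- (mean_const 0). apply mean_ext; intros s.
  assert (k := H0 x s ltac:(lra) ltac:(lra)). unfold chi, pos2. rewrite !Rmax_left by lra.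
  unfold Rdiv; ring. }
assert (Zt : Z x <= Z t).
{ apply (incr 0 (hT D) Z (fun t => mean (fun s => 2 * jac D t s * dchi (nsq D t s)))); try lra.
  - intros; now apply chi_form.
  - intros y Hy. apply mean_ge0.
    + assert (k1 := cont_jac D y H Hy). assert (k2 := cont_nsq D y H Hy). cnt. apply (cont_comp (nsq D y) dchi); auto.
    + intros s. assert (k := k_J _ H y s Hy). generalize (Pc (nsq D y s)); intros. apply Rmult_le_pos; lra. }
assert (cx : cont (fun s => chi (nsq D t s))) by (apply (cont_comp (nsq D t) chi); auto).
assert (Dif : Rabs ((area D t - wind D t) - Z t) <= 2 * d * B).
{ rewrite E. unfold Z. rewrite <- mean_minus by cnt.
  eapply Rle_trans; [apply mean_Rabs; cnt|]. unfold B. rewrite <- mean_scal by cnt.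
  apply mean_le; [cnt | cnt |]. intros s.
  replace ((nsq D t s - 1) / nsq D t s * omega D t s - chi (nsq D t s) / nsq D t s * omega D t s) with
    (((nsq D t s - 1) - chi (nsq D t s)) / nsq D t s * omega D t s) by (field; auto).
  rewrite Rabs_mult. apply Rmult_le_compat_r; [apply Rabs_pos|].
  assert (k := k_N _ H t s Ht). assert (k' := M t s ltac:(lra)).
  unfold chi, pos2. rewrite !Rmax_right by (unfold m in *; lra).
  replace (nsq D t s - 1 - ((nsq D t s - (1 + d)) * (nsq D t s - (1 + d)) - (nsq D t s - (1 + 2 * d)) * (nsq D t s - (1 + 2 * d))) / (2 * d)) with (3/2 * d) by (field; lra).
  unfold Rdiv. rewrite Rabs_right.
  - assert (/ nsq D t s <= 1) by (rewrite <- Rinv_1; apply Rinv_le_contravar; lra).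
    assert (0 < / nsq D t s) by (apply Rinv_0_lt_compat; lra). nra.
  - apply Rle_ge, Rmult_le_pos; [lra | apply Rlt_le, Rinv_0_lt_compat; lra]. }
apply Rabs_le_between in Dif. lra.
Qed.

(** * The thin case *)

Lemma cosh_pos x : 0 < cosh x.
Proof. unfold cosh. generalize (exp_pos x) (exp_pos (-x)); lra. Qed.
Lemma sinh_ge0 x : 0 <= x -> 0 <= sinh x.
Proof.
intros H; unfold sinh. assert (exp (-x) <= exp x); [|lra].
destruct (Req_dec x 0) as [->|N]. rewrite Ropp_0; lra. apply Rlt_le, exp_increasing; lra.
Qed.
Lemma cosh2_sinh2 x : cosh x * cosh x - sinh x * sinh x = 1.
Proof.
assert (E : exp x * exp (-x) = 1) by (rewrite <- exp_plus, Rplus_opp_r; apply exp_0).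
unfold cosh, sinh. lra.
Qed.
Lemma is_derive_cosh x : is_derive cosh x (sinh x).
Proof. apply is_derive_Reals, derivable_pt_lim_cosh. Qed.
Lemma is_derive_sinh x : is_derive sinh x (cosh x).
Proof. apply is_derive_Reals, derivable_pt_lim_sinh. Qed.

Definition th x := sinh x / cosh x.
Lemma is_derive_th x : is_derive th x (1 - th x * th x).
Proof.
assert (P := cosh_pos x). assert (E := cosh2_sinh2 x).
replace (1 - th x * th x) with (cosh x * / cosh x + sinh x * (sinh x * - / (cosh x * cosh x))).
- apply (is_derive_mult_R sinh (fun x => / cosh x)). apply is_derive_sinh.
  apply (is_derive_comp Rinv cosh). 2: apply is_derive_cosh. auto_derive; [lra | field; lra].
- unfold th. field. lra.
Qed.
Lemma th_range x : 0 <= x -> 0 <= th x < 1.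
Proof.
intros H. assert (P := cosh_pos x). assert (S := sinh_ge0 x H). unfold th. split.
- apply Rmult_le_pos; auto. apply Rlt_le, Rinv_0_lt_compat; auto.
- apply (Rmult_lt_reg_r (cosh x)); auto. unfold Rdiv; rewrite Rmult_assoc, Rinv_l by lra.
  unfold cosh, sinh. generalize (exp_pos (-x)); lra.
Qed.

(** Convexity of [exp], from the tangent at the intermediate point [l x]: the inequality
    [1 + y <= exp y] is applied towards both ends of the chord. *)
Lemma exp_chord l x : 0 <= l <= 1 -> exp (l * x) <= 1 - l + l * exp x.
Proof.
intros Hl.
assert (P := exp_pos (l * x)).
assert (A : exp x = exp (l * x) * exp ((1 - l) * x)) by (rewrite <- exp_plus; f_equal; ring).
assert (B : 1 = exp (l * x) * exp (- (l * x))) by (rewrite <- exp_plus, Rplus_opp_r; symmetry; apply exp_0).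
assert (A1 : 1 + (1 - l) * x <= exp ((1 - l) * x)) by apply exp_ineq1_le.
assert (B1 : 1 + - (l * x) <= exp (- (l * x))) by apply exp_ineq1_le.
rewrite A. apply Rle_trans with ((1 - l) * (exp (l * x) * exp (- (l * x))) + l * (exp (l * x) * exp ((1 - l) * x))).
- assert (exp (l*x) * (1 + - (l*x)) <= exp (l*x) * exp (- (l*x))) by (apply Rmult_le_compat_l; lra).
  assert (exp (l*x) * (1 + (1 - l) * x) <= exp (l*x) * exp ((1 - l) * x)) by (apply Rmult_le_compat_l; lra). nra.
- rewrite <- B. lra.
Qed.

(* The multiplier [(A, B, C)] of the functional [A U + B area + C U'], where [U] is the mean of [|h|^2];
   it is fixed by requiring that the derivative of the functional be a form in
   [X = h_t - tanh t h] and [Y = h_s - i h], which both vanish for [h = cosh t e^{is}]. *)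
Definition mC tau t := cosh tau * (sinh tau - cosh tau * th t).
Definition mB tau t := 2 * cosh tau * ((tau - t) * sinh tau * (1 - th t * th t) - sinh tau * th t + cosh tau * (th t * th t)).
Definition mA tau t := cosh tau * cosh tau * (1 - th t * th t) - 2 * mC tau t * th t - mB tau t.

Lemma mC_derive tau t : is_derive (mC tau) t (- cosh tau * cosh tau * (1 - th t * th t)).
Proof.
unfold mC. replace (- cosh tau * cosh tau * (1 - th t * th t)) with (cosh tau * (0 - cosh tau * (1 - th t * th t))) by ring.
apply (is_derive_scal (fun t => sinh tau - cosh tau * th t)).
apply (is_derive_minus (fun t => sinh tau) (fun t => cosh tau * th t)). apply (is_derive_const (sinh tau)).
apply (is_derive_scal th), is_derive_th.
Qed.

Lemma th2_derive t : is_derive (fun t => th t * th t) t (2 * th t * (1 - th t * th t)).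
Proof.
replace (2 * th t * (1 - th t * th t)) with ((1 - th t * th t) * th t + th t * (1 - th t * th t)) by ring.
apply (is_derive_mult_R th th); apply is_derive_th.
Qed.

(** Matching the coefficients of [area], [U] and [U1] with the required form gives
    [B' = -4 C - 2 B tanh t], [A' = 2 C (1 + tanh^2 t) + 2 B tanh t] and [A + C' = -2 C tanh t - B].
    The last one is built into [mA]. *)
Lemma mB_derive tau t : is_derive (mB tau) t (- 4 * mC tau t - 2 * mB tau t * th t).
Proof.
unfold mB.
replace (-4 * mC tau t - _) with (2 * cosh tau * ((-1 * (sinh tau * (1 - th t * th t)) + (tau - t) * (sinh tau * (0 - 2 * th t * (1 - th t * th t)))
  - sinh tau * (1 - th t * th t)) + cosh tau * (2 * th t * (1 - th t * th t)))) by (unfold mC; ring).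
apply (is_derive_ext (fun t => 2 * cosh tau * (((tau - t) * (sinh tau * (1 - th t * th t)) - sinh tau * th t) + cosh tau * (th t * th t)))).
{ intros; rring. }
apply (is_derive_scal (fun t => ((tau - t) * (sinh tau * (1 - th t * th t)) - sinh tau * th t) + cosh tau * (th t * th t))).
apply (is_derive_plus (fun t => (tau - t) * (sinh tau * (1 - th t * th t)) - sinh tau * th t) (fun t => cosh tau * (th t * th t))).
- apply (is_derive_minus (fun t => (tau - t) * (sinh tau * (1 - th t * th t))) (fun t => sinh tau * th t)).
  + apply (is_derive_mult_R (fun t => tau - t) (fun t => sinh tau * (1 - th t * th t))).
    * auto_derive; auto; ring.
    * apply (is_derive_scal (fun t => 1 - th t * th t)). apply (is_derive_minus (fun _ => 1) (fun t => th t * th t)).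
      apply (is_derive_const 1). apply th2_derive.
  + apply (is_derive_scal th), is_derive_th.
- apply (is_derive_scal (fun t => th t * th t)), th2_derive.
Qed.

Lemma mA_derive tau t : is_derive (mA tau) t (2 * mC tau t * (1 + th t * th t) + 2 * mB tau t * th t).
Proof.
unfold mA.
replace (2 * mC tau t * (1 + th t * th t) + _) with
 ((cosh tau * cosh tau * (0 - 2 * th t * (1 - th t * th t)) - (2 * (- cosh tau * cosh tau * (1 - th t * th t)) * th t + 2 * mC tau t * (1 - th t * th t)))
  - (- 4 * mC tau t - 2 * mB tau t * th t)) by ring.
apply (is_derive_minus (fun t => cosh tau * cosh tau * (1 - th t * th t) - 2 * mC tau t * th t) (mB tau)); [|apply mB_derive].
apply (is_derive_minus (fun t => cosh tau * cosh tau * (1 - th t * th t)) (fun t => 2 * mC tau t * th t)).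
- apply (is_derive_scal (fun t => 1 - th t * th t)). apply (is_derive_minus (fun _ => 1) (fun t => th t * th t)).
  apply (is_derive_const 1). apply th2_derive.
- apply (is_derive_mult_R (fun t => 2 * mC tau t) th). apply (is_derive_scal (mC tau)), mC_derive. apply is_derive_th.
Qed.

Definition Phi D tau t := mA tau t * U D t + mB tau t * area D t + mC tau t * (2 * U1 D t).

(** [devX] and [devY] are [|X|^2] and [|Y|^2], and [devXY] is the determinant of the pair [(X, Y)].
    The determinant is at most half of [|X|^2 + |Y|^2] in absolute value, so the form with
    coefficients [2 C] and [2 B] is nonnegative when [|B| <= 2 C]. *)
Definition devX D t s := (hut D t s - th t * hu D t s) * (hut D t s - th t * hu D t s) + (hvt D t s - th t * hv D t s) * (hvt D t s - th t * hv D t s).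
Definition devY D t s := (hus D t s + hv D t s) * (hus D t s + hv D t s) + (hvs D t s - hu D t s) * (hvs D t s - hu D t s).
Definition devXY D t s := (hut D t s - th t * hu D t s) * (hvs D t s - hu D t s) - (hvt D t s - th t * hv D t s) * (hus D t s + hv D t s).

Lemma Phi_derive D tau t : core D -> 0 < t < hT D ->
  is_derive (Phi D tau) t (mean (fun s => 2 * mC tau t * (devX D t s + devY D t s) + 2 * mB tau t * devXY D t s)).
Proof.
intros H Ht. cyl H Ht.
assert (cO := cont_omega D t H Ht). assert (cN := cont_nsq D t H Ht). assert (cJ := cont_jac D t H Ht).
assert (E : mean (fun s => 2 * mC tau t * (devX D t s + devY D t s) + 2 * mB tau t * devXY D t s) =
 (((2 * mC tau t * (1 + th t * th t) + 2 * mB tau t * th t) * U D t + mA tau t * (2 * U1 D t))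
  + ((- 4 * mC tau t - 2 * mB tau t * th t) * area D t + mB tau t * (2 * mean (jac D t))))
  + ((- cosh tau * cosh tau * (1 - th t * th t)) * (2 * U1 D t) + mC tau t * (2 * energy D t))).
{ unfold U, U1, area, energy.
  assert (ch : cont (fun s => hu D t s * hut D t s + hv D t s * hvt D t s)) by cnt.
  assert (ce : cont (fun s => hut D t s * hut D t s + hvt D t s * hvt D t s + (hus D t s * hus D t s + hvs D t s * hvs D t s))) by cnt.
  rewrite <- !mean_scal by cnt.
  rewrite <- !mean_plus by (cnt; try apply cont_mult; auto with cnt).
  apply mean_ext; intros s. unfold mA, devX, devY, devXY, nsq, omega, jac. ring. }
rewrite E. unfold Phi.
apply (is_derive_plus (fun t => mA tau t * U D t + mB tau t * area D t) (fun t => mC tau t * (2 * U1 D t))).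
- apply (is_derive_plus (fun t => mA tau t * U D t) (fun t => mB tau t * area D t)).
  + apply (is_derive_mult_R (mA tau) (U D)). apply mA_derive. now apply U_derive.
  + apply (is_derive_mult_R (mB tau) (area D)). apply mB_derive. now apply area_derive.
- apply (is_derive_mult_R (mC tau) (fun t => 2 * U1 D t)). apply mC_derive.
  apply (is_derive_scal (U1 D)). now apply U1_derive.
Qed.

Lemma sinh_minus a b : sinh (a - b) = sinh a * cosh b - cosh a * sinh b.
Proof.
unfold sinh, cosh. unfold Rminus. rewrite Ropp_plus_distr, Ropp_involutive, !exp_plus. field.
Qed.

Lemma mC_ge0 tau t : 0 <= t <= tau -> 0 <= mC tau t.
Proof.
intros Ht. unfold mC. apply Rmult_le_pos; [apply Rlt_le, cosh_pos|].
assert (P := cosh_pos t).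
replace (sinh tau - cosh tau * th t) with (sinh (tau - t) * / cosh t) by (rewrite sinh_minus; unfold th; field; lra).
apply Rmult_le_pos; [apply sinh_ge0; lra | apply Rlt_le, Rinv_0_lt_compat; auto].
Qed.

Lemma mB_lower tau t : 0 <= t <= tau -> - (2 * mC tau t * th t) <= mB tau t.
Proof.
intros Ht. assert (T := th_range t ltac:(lra)). assert (C := mC_ge0 tau t Ht).
assert (S := sinh_ge0 tau ltac:(lra)). assert (P := cosh_pos tau).
replace (mB tau t) with (2 * cosh tau * ((tau - t) * sinh tau * (1 - th t * th t)) - 2 * mC tau t * th t) by (unfold mB, mC; ring).
assert (0 <= 2 * cosh tau * ((tau - t) * sinh tau * (1 - th t * th t))).
{ apply Rmult_le_pos; [lra|]. apply Rmult_le_pos; [apply Rmult_le_pos; lra |]. destruct T; nra. }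
lra.
Qed.

(* This is where [tau <= 1] enters. *)
Lemma mB_upper tau t : 0 <= t < tau -> tau <= 1 ->
  mB tau t + 2 * cosh tau * exp (- t) * / cosh t * (1 + th t) * (tau - t) * sinh tau * (/ tau - 1) <= 2 * mC tau t.
Proof.
intros Ht H1. assert (T := th_range t ltac:(lra)).
assert (S := sinh_ge0 tau ltac:(lra)). assert (P := cosh_pos tau). assert (Pt := cosh_pos t).
(* The chord of [exp] from 0 to [-2 tau] at the ratio [l = 1 - t / tau] gives [sinh (tau - t) >= (1
   - t / tau) e^(-t) sinh tau]. *)
set (l := (tau - t) / tau).
assert (l01 : 0 <= l <= 1).
{ unfold l; split. apply Rmult_le_pos; [lra | apply Rlt_le, Rinv_0_lt_compat; lra].
  apply (Rmult_le_reg_r tau); [lra|]. unfold Rdiv; rewrite Rmult_assoc, Rinv_l by lra; lra. }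
assert (K := exp_chord l (- (2 * tau)) l01).
replace (l * - (2 * tau)) with (- (2 * (tau - t))) in K by (unfold l; field; lra).
assert (K2 : (tau - t) * sinh tau * exp (-t) * / tau <= sinh (tau - t)).
{ assert (E1 : exp (- (2 * (tau - t))) = exp (-(tau - t)) * exp (-(tau-t))) by (rewrite <- exp_plus; f_equal; ring).
  assert (E2 : exp (- (2 * tau)) = exp (- tau) * exp (- tau)) by (rewrite <- exp_plus; f_equal; ring).
  assert (E3 : exp (tau - t) * exp (- (tau - t)) = 1) by (rewrite <- exp_plus, Rplus_opp_r; apply exp_0).
  assert (E4 : exp tau * exp (- tau) = 1) by (rewrite <- exp_plus, Rplus_opp_r; apply exp_0).
  assert (E5 : exp (tau - t) = exp tau * exp (- t)) by (rewrite <- exp_plus; auto).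
  rewrite E1, E2 in K. unfold sinh.
  replace ((tau - t) * ((exp tau - exp (- tau)) / 2) * exp (- t) * / tau) with (l * (exp (tau - t) - exp (tau - t) * (exp (-tau) * exp (-tau))) / 2).
  - assert (Pe := exp_pos (tau - t)).
    apply Rmult_le_compat_l with (r := exp (tau - t)) in K; [|lra].
    replace (exp (tau - t) * (exp (- (tau - t)) * exp (- (tau - t)))) with (exp (-(tau - t))) in K by (rewrite <- Rmult_assoc, E3; ring).
    lra.
  - unfold l. rewrite E5. replace (exp tau * exp (- t) * (exp (- tau) * exp (- tau))) with ((exp tau * exp (- tau)) * exp (-t) * exp (-tau)) by ring.
    rewrite E4. field. lra. }
assert (Et : exp (- t) * / cosh t = 1 - th t).
{ unfold th. replace (exp (-t)) with (cosh t - sinh t) by (unfold cosh, sinh; field). field; lra. }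
replace (2 * mC tau t) with (2 * cosh tau * (1 + th t) * (sinh (tau - t) * / cosh t) - (2 * cosh tau * (sinh tau - cosh tau * th t) * th t)).
2:{ rewrite sinh_minus. unfold mC, th. field; lra. }
replace (mB tau t) with (2 * cosh tau * (1 + th t) * ((tau - t) * sinh tau * (1 - th t)) - 2 * cosh tau * (sinh tau - cosh tau * th t) * th t) by (unfold mB; ring).
replace (2 * cosh tau * exp (- t) * / cosh t * (1 + th t) * (tau - t) * sinh tau * (/ tau - 1)) with
 (2 * cosh tau * (1 + th t) * (((tau - t) * sinh tau * exp (-t) * / tau) * / cosh t) - 2 * cosh tau * (1 + th t) * ((tau - t) * sinh tau * (1 - th t))).
2:{ rewrite <- Et. ring. }
assert ((tau - t) * sinh tau * exp (-t) * / tau * / cosh t <= sinh (tau - t) * / cosh t).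
{ apply Rmult_le_compat_r; auto. apply Rlt_le, Rinv_0_lt_compat; auto. }
assert (0 <= 2 * cosh tau * (1 + th t)) by (apply Rmult_le_pos; lra).
nra.
Qed.

(** The slack in [mB_upper]. It is positive for [0 <= t < tau < 1], which is what makes the equality
    case rigid. *)
Definition gap tau t := 2 * cosh tau * exp (- t) * / cosh t * (1 + th t) * (tau - t) * sinh tau * (/ tau - 1).
Lemma gap_ge0 tau t : 0 <= t < tau -> tau <= 1 -> 0 <= gap tau t.
Proof.
intros Ht H1. unfold gap. assert (T := th_range t ltac:(lra)).
assert (S := sinh_ge0 tau ltac:(lra)). assert (P := cosh_pos tau). assert (Pt := cosh_pos t). assert (Pe := exp_pos (-t)).
assert (0 < / cosh t) by (apply Rinv_0_lt_compat; auto).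
assert (1 <= / tau) by (rewrite <- Rinv_1; apply Rinv_le_contravar; lra).
repeat (first [lra | apply Rmult_le_pos]).
Qed.

(** A lower bound for both eigenvalues [2 C - B] and [2 C + B] of the form, from [mB_upper] and
    [mB_lower] respectively. *)
Definition coer tau t := Rmin (gap tau t) (2 * mC tau t * (1 - th t)).

Lemma form_lower D tau t s : core D -> 0 < t < hT D -> t < tau -> tau <= 1 -> 0 <= coer tau t /\
  coer tau t * (devX D t s + devY D t s) <= 2 * mC tau t * (devX D t s + devY D t s) + 2 * mB tau t * devXY D t s.
Proof.
intros H Ht Htt H1.
assert (L := mB_lower tau t ltac:(lra)). assert (Up := mB_upper tau t ltac:(lra) H1). fold (gap tau t) in Up.
assert (C := mC_ge0 tau t ltac:(lra)). assert (G := gap_ge0 tau t ltac:(lra) H1).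
assert (T := th_range t ltac:(lra)).
assert (M1 := Rmin_l (gap tau t) (2 * mC tau t * (1 - th t))). assert (M2 := Rmin_r (gap tau t) (2 * mC tau t * (1 - th t))).
assert (C1 : 0 <= 2 * mC tau t * (1 - th t)) by (apply Rmult_le_pos; lra).
fold (coer tau t) in *.
assert (M0 : 0 <= coer tau t) by (apply Rmin_glb; lra).
split; auto.
unfold devX, devY, devXY.
set (x1 := hut D t s - th t * hu D t s). set (x2 := hvt D t s - th t * hv D t s).
set (y1 := hus D t s + hv D t s). set (y2 := hvs D t s - hu D t s).
set (m := coer tau t) in *. set (B := mB tau t) in *. set (c := 2 * mC tau t) in *.
(* The form is diagonal in the two combinations whose squares are [|X|^2 + |Y|^2 - 2 det] and
   [|X|^2 + |Y|^2 + 2 det]. *)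
assert (Q1 : 0 <= (c - m - B) * ((x1 - y2) * (x1 - y2) + (x2 + y1) * (x2 + y1))).
{ apply Rmult_le_pos; [lra|]. generalize (sq_ge0 (x1 - y2)) (sq_ge0 (x2 + y1)); lra. }
assert (Q2 : 0 <= (c - m + B) * ((x1 + y2) * (x1 + y2) + (x2 - y1) * (x2 - y1))).
{ apply Rmult_le_pos; [lra|]. generalize (sq_ge0 (x1 + y2)) (sq_ge0 (x2 - y1)); lra. }
lra.
Qed.

Lemma dev_ge0 D t s : 0 <= devX D t s + devY D t s.
Proof.
unfold devX, devY. repeat apply Rplus_le_le_0_compat; apply sq_ge0.
Qed.

Lemma cont_dev D t : core D -> 0 < t < hT D -> cont (devX D t) /\ cont (devY D t) /\ cont (devXY D t).
Proof. intros H Ht. cyl H Ht. unfold devX, devY, devXY. repeat split; cnt. Qed.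

Lemma dPhi_ge D tau t : core D -> 0 < t < hT D -> t < tau -> tau <= 1 ->
  coer tau t * mean (fun s => devX D t s + devY D t s) <=
  mean (fun s => 2 * mC tau t * (devX D t s + devY D t s) + 2 * mB tau t * devXY D t s).
Proof.
intros H Ht h1 h2. destruct (cont_dev D t H Ht) as (c1 & c2 & c3).
rewrite <- mean_scal by cnt. apply mean_le. cnt. cnt. intros s. now apply form_lower.
Qed.

Lemma Phi_incr D tau x y : core D -> tau <= hT D -> tau <= 1 -> 0 < x -> x <= y -> y < tau -> Phi D tau x <= Phi D tau y.
Proof.
intros H h1 h2. apply (incr 0 tau _ (fun t => mean (fun s => 2 * mC tau t * (devX D t s + devY D t s) + 2 * mB tau t * devXY D t s))).
- intros t Ht; apply Phi_derive; auto; lra.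
- intros t Ht. eapply Rle_trans; [|apply dPhi_ge; auto; lra].
  destruct (form_lower D tau t 0 H) as [M _]; try lra.
  apply Rmult_le_pos; auto. destruct (cont_dev D t H ltac:(lra)) as (c1 & c2 & c3). apply mean_ge0; [cnt|]. intros; apply dev_ge0.
Qed.

Lemma th_eq tau : 1 - th tau * th tau = / (cosh tau * cosh tau).
Proof.
assert (P := cosh_pos tau). unfold th.
replace (1 - sinh tau / cosh tau * (sinh tau / cosh tau)) with ((cosh tau * cosh tau - sinh tau * sinh tau) / (cosh tau * cosh tau)) by (field; lra).
rewrite cosh2_sinh2. field; lra.
Qed.

(** At [t = tau] the multiplier is [(1, 0, 0)]. *)
Lemma Phi_end D tau : Phi D tau tau = U D tau.
Proof.
assert (P := cosh_pos tau).
assert (C0 : mC tau tau = 0) by (unfold mC, th; field; lra).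
assert (B0 : mB tau tau = 0) by (unfold mB, th; field; lra).
assert (A0 : mA tau tau = 1) by (unfold mA; rewrite C0, B0, th_eq; field; lra).
unfold Phi. rewrite A0, B0, C0; ring.
Qed.

Lemma cont_at (f : R -> R) (x l : R) : is_derive f x l -> continuous f x.
Proof. intros H; apply (ex_derive_continuous f); eexists; eauto. Qed.

Lemma limit_ge (f : R -> R) (x y d : R) : continuous f x -> 0 < d -> (forall t, x - d < t < x -> y <= f t) -> y <= f x.
Proof.
intros C Dp L. apply Rnot_lt_le; intros K.
destruct (continuous_eps f x C (y - f x) ltac:(lra)) as (e & ep & He).
set (t := x - Rmin e d / 2). assert (p : 0 < Rmin e d) by (apply Rmin_pos; auto).
assert (h1 := Rmin_l e d). assert (h2 := Rmin_r e d).
specialize (He t ltac:(unfold t; rewrite Rabs_left; lra)).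
specialize (L t ltac:(unfold t; lra)). apply Rabs_def2 in He. lra.
Qed.

Lemma Phi_tau D tau x : core D -> tau < hT D -> tau <= 1 -> 0 < x < tau -> Phi D tau x <= U D tau.
Proof.
intros H h1 h2 Hx. rewrite <- (Phi_end D tau).
apply (limit_ge (Phi D tau) tau _ (tau - x)). eapply cont_at; apply Phi_derive; auto; lra. lra.
intros t Ht. apply Phi_incr; auto; lra.
Qed.

(** At [t = 0] one has [A + B = cosh^2 tau]. There [U] tends to 1, while [area >= 1] and [U1 >= 0]
    enter with nonnegative weights, which gives the lower limit. *)
Lemma Phi_0 D tau e : core D -> 0 < tau -> tau <= hT D -> tau <= 1 -> 0 < e ->
  exists d, 0 < d /\ forall t, 0 < t < hT D -> t < d -> cosh tau * cosh tau - e <= Phi D tau t.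
Proof.
intros H h0 h1 h2 He.
assert (S0 : sinh 0 = 0) by (unfold sinh; rewrite Ropp_0; lra).
assert (T0 : th 0 = 0) by (unfold th; rewrite S0; unfold Rdiv; ring).
assert (B0 : mB tau 0 = 2 * cosh tau * (tau * sinh tau)) by (unfold mB; rewrite T0; ring).
assert (A0 : mA tau 0 + mB tau 0 = cosh tau * cosh tau) by (unfold mA; rewrite T0; ring).
assert (Bp : 0 < mB tau 0).
{ rewrite B0. assert (0 < sinh tau) by (rewrite <- S0; apply sinh_lt; auto). assert (P := cosh_pos tau).
  apply Rmult_lt_0_compat; [lra|]. apply Rmult_lt_0_compat; auto. }
assert (R1 := k_R _ H). set (M := hR D * hR D). assert (M1 : 1 < M) by (unfold M; nra).
(* The first bound keeps [mB] nonnegative for small [t], so that [area >= 1] may be multiplied by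
   it. *)
set (e' := Rmin (mB tau 0) (e / (8 * M))).
assert (e'p : 0 < e') by (apply Rmin_pos; auto; apply Rdiv_lt_0_compat; lra).
assert (e1 : e' <= mB tau 0) by apply Rmin_l. assert (e2 : e' * M <= e / 8).
{ apply Rle_trans with (e / (8 * M) * M). apply Rmult_le_compat_r; [lra | apply Rmin_r]. right; field; lra. }
assert (Cc : forall f, (forall t, ex_derive f t) -> exists d, 0 < d /\ forall t, 0 < t < d -> Rabs (f t - f 0) < e').
{ intros f Df. assert (C := ex_derive_continuous f 0 (Df 0)).
  destruct (continuous_eps f 0 C e' e'p) as (d & dp & Hd). exists d; split; auto. intros t Ht. apply Hd. rewrite Rabs_right; lra. }
destruct (Cc (mA tau)) as (d1 & d1p & H1). { intros t; eexists; apply mA_derive. }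
destruct (Cc (mB tau)) as (d2 & d2p & H2). { intros t; eexists; apply mB_derive. }
set (a := Rabs (mA tau 0) + 1). assert (ap : 0 < a) by (unfold a; generalize (Rabs_pos (mA tau 0)); lra).
destruct (U_lim0 D (e / (8 * a)) H) as (d3 & d3p & H3). { apply Rdiv_lt_0_compat; lra. }
exists (Rmin (Rmin d1 d2) (Rmin d3 tau)). split. { repeat apply Rmin_pos; auto. }
intros t Ht Hd.
assert (l1 : t < d1) by (eapply Rlt_le_trans; [exact Hd|]; eapply Rle_trans; [apply Rmin_l | apply Rmin_l]).
assert (l2 : t < d2) by (eapply Rlt_le_trans; [exact Hd|]; eapply Rle_trans; [apply Rmin_l | apply Rmin_r]).
assert (l3 : t < d3) by (eapply Rlt_le_trans; [exact Hd|]; eapply Rle_trans; [apply Rmin_r | apply Rmin_l]).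
assert (l4 : t < tau) by (eapply Rlt_le_trans; [exact Hd|]; eapply Rle_trans; [apply Rmin_r | apply Rmin_r]).
specialize (H1 t ltac:(lra)). specialize (H2 t ltac:(lra)). specialize (H3 t ltac:(lra) l3).
apply Rabs_def2 in H1. apply Rabs_def2 in H2.
assert (Ub := U_gt1 D t H Ht). fold M in Ub. assert (Ab := area_ge1 D t H Ht). assert (U1b := U1_ge0 D t H Ht).
assert (Cb := mC_ge0 tau t ltac:(lra)).
unfold Phi.
assert (Q1 : 0 <= mC tau t * (2 * U1 D t)) by (apply Rmult_le_pos; lra).
assert (Q2 : mB tau t <= mB tau t * area D t) by (rewrite <- (Rmult_1_r (mB tau t)) at 1; apply Rmult_le_compat_l; lra).
assert (Q3 : mA tau 0 * U D t - e / 8 <= mA tau t * U D t) by nra.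
assert (Q4 : mA tau 0 - e/8 <= mA tau 0 * U D t).
{ assert (- (a * (U D t - 1)) <= mA tau 0 * (U D t - 1)).
  { assert (- a <= mA tau 0) by (unfold a; generalize (Rabs_maj2 (mA tau 0)); lra). nra. }
  assert (a * (U D t - 1) <= e / 8).
  { apply Rle_trans with (a * (e / (8 * a))). apply Rmult_le_compat_l; lra. right; field; lra. }
  lra. }
assert (e' <= e/8) by nra.
lra.
Qed.

Theorem local_bound D tau : core D -> 0 < tau -> tau < hT D -> tau <= 1 -> cosh tau * cosh tau <= U D tau.
Proof.
intros H h0 h1 h2. apply le_epsilon. intros e He.
destruct (Phi_0 D tau e H h0 (Rlt_le _ _ h1) h2 He) as (d & dp & Hd).
set (x := Rmin (d/2) (tau/2)).
assert (Hx : 0 < x /\ x < d /\ x < tau) by (unfold x, Rmin; destruct Rle_dec; lra).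
assert (A := Hd x ltac:(lra) ltac:(lra)). assert (B := Phi_tau D tau x H h1 h2 ltac:(lra)). lra.
Qed.

Definition nitsche D := exists c, forall t s, 0 < t < hT D ->
  hu D t s = cosh t * cos (s + c) /\ hv D t s = cosh t * sin (s + c).

Lemma cont_cosh : cont cosh.
Proof. apply (derive_cont _ sinh), is_derive_cosh. Qed.
Lemma cont_sinh : cont sinh.
Proof. apply (derive_cont _ cosh), is_derive_sinh. Qed.
#[export] Hint Resolve cont_cosh cont_sinh : cnt.

(** For [tau = T] the functional is squeezed: at least [cosh^2 T] from the inner end, at most
    [hR^2 <= cosh^2 T] from the outer one. It is then constant, and since [coer] is positive for
    [T < 1] the deviations vanish. [Phi_tau] asks for [tau < T], so the upper bound reaches [T] by
    continuity in [tau]. *)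
Lemma local_dev D : core D -> hT D < 1 -> hR D <= cosh (hT D) ->
  forall t s, 0 < t < hT D -> devX D t s + devY D t s = 0.
Proof.
intros H h1 hle. assert (TP := k_T _ H). assert (R1 := k_R _ H). set (T := hT D) in *.
assert (Up : forall x, 0 < x < T -> Phi D T x <= cosh T * cosh T).
{ intros x Hx.
  assert (C : cont (fun tau => - Phi D tau x)).
  { unfold Phi, mA, mC, mB. cnt. }
  assert (- (cosh T * cosh T) <= - Phi D T x); [|lra].
  apply (limit_ge (fun tau => - Phi D tau x) T _ (T - x)); [apply C | lra |].
  intros tau Ht. assert (K := Phi_tau D tau x H ltac:(unfold T in *; lra) ltac:(lra) ltac:(lra)).
  assert (K2 := U_gt1 D tau H ltac:(unfold T in *; lra)).
  assert (hR D * hR D <= cosh T * cosh T) by (apply Rmult_le_compat; lra). lra. }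
assert (Lo : forall x, 0 < x < T -> cosh T * cosh T <= Phi D T x).
{ intros x Hx. apply le_epsilon. intros e He.
  destruct (Phi_0 D T e H TP (Rle_refl _) ltac:(lra) He) as (d & dp & Hd).
  set (y := Rmin (d/2) (x/2)).
  assert (Hy : 0 < y /\ y < d /\ y < x) by (unfold y, Rmin; destruct Rle_dec; lra).
  assert (A := Hd y ltac:(unfold T in *; lra) ltac:(lra)).
  assert (B := Phi_incr D T y x H (Rle_refl _) ltac:(lra) ltac:(lra) ltac:(lra) ltac:(lra)). lra. }
intros t s Ht.
assert (Dz := is_derive_unique _ _ _ (Phi_derive D T t H Ht)).
rewrite (Derive_ext_loc _ (fun _ => cosh T * cosh T)) in Dz.
2:{ apply (locally_Ioo 0 T); auto. intros x Hx. apply Rle_antisym; auto. }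
rewrite Derive_const in Dz.
assert (G := dPhi_ge D T t H Ht ltac:(lra) ltac:(lra)). rewrite <- Dz in G.
destruct (cont_dev D t H Ht) as (c1 & c2 & c3).
assert (M0 : 0 <= mean (fun s => devX D t s + devY D t s)) by (apply mean_ge0; [cnt | intros; apply dev_ge0]).
assert (Cp : 0 < coer T t).
{ assert (th1 := th_range t ltac:(lra)). assert (P := cosh_pos T). assert (Pt := cosh_pos t).
  assert (S0 : sinh 0 = 0) by (unfold sinh; rewrite Ropp_0; lra).
  assert (0 < sinh T) by (rewrite <- S0; apply sinh_lt; auto).
  assert (0 < / cosh t) by (apply Rinv_0_lt_compat; auto).
  apply Rmin_pos.
  - unfold gap. assert (1 < / T) by (rewrite <- Rinv_1; apply Rinv_lt_contravar; lra).
    assert (Pe := exp_pos (-t)). repeat (first [lra | apply Rmult_lt_0_compat]).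
  - assert (0 < mC T t).
    { unfold mC. apply Rmult_lt_0_compat; auto.
      replace (sinh T - cosh T * th t) with (sinh (T - t) * / cosh t) by (rewrite sinh_minus; unfold th; field; lra).
      apply Rmult_lt_0_compat; auto. rewrite <- S0; apply sinh_lt; lra. }
    repeat (first [lra | apply Rmult_lt_0_compat]). }
assert (Mz : mean (fun s => devX D t s + devY D t s) = 0) by nra.
apply (mean_sq_zero (fun s => devX D t s + devY D t s)); auto.
- cnt.
- intros; apply dev_ge0.
- intros y. unfold devX, devY.
  rewrite (c1_per_t (k_u _ H) Ht), (c1_per_s (k_u _ H) Ht), (c1_per_t (k_v _ H) Ht), (c1_per_s (k_v _ H) Ht).
  rewrite (c1_per (k_u _ H) t Ht), (c1_per (k_v _ H) t Ht). auto.
Qed.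

Lemma unit_angle a b : a * a + b * b = 1 -> exists c, a = cos c /\ b = sin c.
Proof.
intros E. assert (A1 : -1 <= a <= 1) by nra.
assert (Sq : sin (acos a) * sin (acos a) = b * b).
{ assert (K := sin2_cos2 (acos a)). unfold Rsqr in K. rewrite cos_acos in K by lra. lra. }
destruct (Rle_dec 0 (b * sin (acos a))) as [Hp|Hp].
- exists (acos a). split. now rewrite cos_acos. assert ((b - sin (acos a)) * (b + sin (acos a)) = 0) by lra.
  apply Rmult_integral in H. destruct H; [lra|]. assert (sin (acos a) = - b) by lra. rewrite H0 in *. nra.
- exists (- acos a). split. rewrite cos_neg. now rewrite cos_acos. rewrite sin_neg.
  assert ((b - sin (acos a)) * (b + sin (acos a)) = 0) by lra.
  apply Rmult_integral in H. destruct H; [|lra]. assert (sin (acos a) = b) by lra. rewrite H0 in *. nra.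
Qed.

(** The product of [a + i b] with [e^(-is)] is constant. *)
Lemma rotation_ode (a b : R -> R) : (forall s, is_derive a s (- b s)) -> (forall s, is_derive b s (a s)) ->
  forall s, a s = a 0 * cos s - b 0 * sin s /\ b s = b 0 * cos s + a 0 * sin s.
Proof.
intros Da Db.
assert (Dc : forall s, is_derive cos s (- sin s)) by (intros; auto_derive; auto; ring).
assert (Ds : forall s, is_derive sin s (cos s)) by (intros; auto_derive; auto; ring).
assert (E1 : forall s, is_derive (fun s => a s * cos s + b s * sin s) s 0).
{ intros s. replace 0 with ((- b s * cos s + a s * - sin s) + (a s * sin s + b s * cos s)) by rring.
  apply (is_derive_plus (fun s => a s * cos s) (fun s => b s * sin s)); apply is_derive_mult_R; auto. }
assert (E2 : forall s, is_derive (fun s => b s * cos s - a s * sin s) s 0).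
{ intros s. replace 0 with ((a s * cos s + b s * - sin s) - (- b s * sin s + a s * cos s)) by rring.
  apply (is_derive_minus (fun s => b s * cos s) (fun s => a s * sin s)); apply is_derive_mult_R; auto. }
intros s. assert (F1 := const_R _ s 0 E1). assert (F2 := const_R _ s 0 E2). cbv beta in F1, F2.
rewrite cos_0, sin_0 in F1, F2. assert (K := sin2_cos2 s). unfold Rsqr in K.
assert (G1 : a 0 = a s * cos s + b s * sin s) by lra. assert (G2 : b 0 = b s * cos s - a s * sin s) by lra.
rewrite G1, G2. split.
- replace ((a s * cos s + b s * sin s) * cos s - (b s * cos s - a s * sin s) * sin s) with (a s * (sin s * sin s + cos s * cos s)) by ring. rewrite K; ring.
- replace ((b s * cos s - a s * sin s) * cos s + (a s * cos s + b s * sin s) * sin s) with (b s * (sin s * sin s + cos s * cos s)) by ring. rewrite K; ring.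
Qed.

(** [X = 0] makes [h / cosh t] independent of [t], and [Y = 0] makes it rotate with unit speed in
    [s]. What is left is a complex amplitude. *)
Lemma dev_nitsche D : core D -> (forall t s, 0 < t < hT D -> devX D t s + devY D t s = 0) -> nitsche D.
Proof.
intros H Z. assert (TP := k_T _ H).
assert (Z' : forall t s, 0 < t < hT D -> hut D t s = th t * hu D t s /\ hvt D t s = th t * hv D t s /\ hus D t s = - hv D t s /\ hvs D t s = hu D t s).
{ intros t s Ht. specialize (Z t s Ht). unfold devX, devY in Z.
  set (x1 := hut D t s - th t * hu D t s) in *. set (x2 := hvt D t s - th t * hv D t s) in *.
  set (y1 := hus D t s + hv D t s) in *. set (y2 := hvs D t s - hu D t s) in *.
  assert (q1 := sq_ge0 x1). assert (q2 := sq_ge0 x2). assert (q3 := sq_ge0 y1). assert (q4 := sq_ge0 y2).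
  assert (x1 = 0) by (apply sq_eq0; lra). assert (x2 = 0) by (apply sq_eq0; lra).
  assert (y1 = 0) by (apply sq_eq0; lra). assert (y2 = 0) by (apply sq_eq0; lra).
  unfold x1, x2, y1, y2 in *. lra. }
assert (Dq : forall f ft, (forall t, 0 < t < hT D -> is_derive f t (ft t)) -> (forall t, 0 < t < hT D -> ft t = th t * f t) ->
   forall x y, 0 < x < hT D -> 0 < y < hT D -> f x / cosh x = f y / cosh y).
{ intros f ft Df Ef x y Hx Hy. apply (const_on 0 (hT D) (fun t => f t / cosh t) x y); auto.
  intros t Ht. assert (P := cosh_pos t).
  replace 0 with (ft t * / cosh t + f t * (sinh t * - / (cosh t * cosh t))).
  - apply (is_derive_mult_R f (fun t => / cosh t)); auto. apply (is_derive_comp Rinv cosh); [|apply is_derive_cosh].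
    auto_derive; [lra | field; lra].
  - rewrite Ef by auto. unfold th. field. lra. }
set (t0 := hT D / 2). assert (Ht0 : 0 < t0 < hT D) by (unfold t0; lra).
set (a := hu D t0 0 / cosh t0). set (b := hv D t0 0 / cosh t0).
assert (F : forall t s, 0 < t < hT D -> hu D t s = cosh t * (a * cos s - b * sin s) /\ hv D t s = cosh t * (b * cos s + a * sin s)).
{ intros t s Ht. assert (P := cosh_pos t). assert (P0 := cosh_pos t0).
  assert (Ru : forall x, hu D t x / cosh t = hu D t0 x / cosh t0).
  { intros x. apply (Dq (fun t => hu D t x) (fun t => hut D t x)); auto. intros; now apply H. intros; now apply Z'. }
  assert (Rv : forall x, hv D t x / cosh t = hv D t0 x / cosh t0).
  { intros x. apply (Dq (fun t => hv D t x) (fun t => hvt D t x)); auto. intros; now apply H. intros; now apply Z'. }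
  destruct (rotation_ode (hu D t0) (hv D t0)) with (s := s) as [E1 E2].
  { intros x. replace (- hv D t0 x) with (hus D t0 x) by now apply Z'. now apply H. }
  { intros x. replace (hu D t0 x) with (hvs D t0 x) by now apply Z'. now apply H. }
  assert (Fu : hu D t s = cosh t * (hu D t0 s / cosh t0)) by (rewrite <- Ru; field; lra).
  assert (Fv : hv D t s = cosh t * (hv D t0 s / cosh t0)) by (rewrite <- Rv; field; lra).
  rewrite Fu, Fv, E1, E2. unfold a, b. split; field; lra. }
(* The amplitude has modulus 1, because [|h| > 1] throughout and [|h|] tends to 1 at the inner
   end. *)
assert (ab : a * a + b * b = 1).
{ assert (NN : forall t, 0 < t < hT D -> nsq D t 0 = cosh t * cosh t * (a * a + b * b)).
  { intros t Ht. destruct (F t 0 Ht) as [E1 E2]. unfold nsq. rewrite E1, E2, cos_0, sin_0. ring. }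
  set (m := a * a + b * b) in *.
  assert (m >= 0) by (unfold m; generalize (sq_ge0 a) (sq_ge0 b); lra).
  apply Rle_antisym.
  - apply le_epsilon. intros e He. destruct (k_0 _ H e He) as (d & dp & Hd).
    set (x := Rmin (d/2) t0). assert (Hx : 0 < x /\ x < d /\ x <= t0) by (unfold x, Rmin; destruct Rle_dec; lra).
    assert (K := Hd x 0 ltac:(lra) ltac:(lra)). rewrite NN in K by lra.
    assert (1 <= cosh x * cosh x) by (generalize (cosh2_sinh2 x) (sq_ge0 (sinh x)); lra). nra.
  - apply le_epsilon. intros e He.
    assert (C : continuous (fun t => cosh t * cosh t) 0) by (apply (cont_mult cosh cosh); auto with cnt).
    destruct (continuous_eps (fun t => cosh t * cosh t) 0 C (e/(m+1)) ltac:(apply Rdiv_lt_0_compat; lra)) as (d & dp & Hd).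
    set (x := Rmin (d/2) t0).
    assert (Hx : 0 < x /\ x < d /\ x <= t0) by (unfold x, Rmin; destruct Rle_dec; lra).
    assert (K := k_N _ H x 0 ltac:(lra)). rewrite NN in K by lra.
    specialize (Hd x ltac:(rewrite Rabs_right; lra)). cbv beta in Hd.
    rewrite cosh_0 in Hd. apply Rabs_def2 in Hd.
    assert (cosh x * cosh x < 1 + e / (m+1)) by lra.
    assert (e / (m + 1) * m <= e).
    { apply Rle_trans with (e / (m+1) * (m + 1)). apply Rmult_le_compat_l; [apply Rlt_le, Rdiv_lt_0_compat; lra | lra]. right; field; lra. }
    nra. }
destruct (unit_angle a b ab) as (c & Ea & Eb).
exists c. intros t s Ht. destruct (F t s Ht) as [E1 E2]. rewrite E1, E2, Ea, Eb, cos_plus, sin_plus. split; ring.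
Qed.

(** * The Poisson kernel *)

(** [pd a x = |e^(ix) - a|^2], so [pk a] is the Poisson kernel of the point [a]. *)
Definition pd a x := 1 - 2 * a * cos x + a * a.
Definition pk a x := (1 - a * a) / pd a x.

Lemma pd_ge a x : 0 <= a -> (1 - a) * (1 - a) <= pd a x.
Proof. intros Ha. unfold pd. assert (K := COS_bound x). assert (0 <= 2 * a * (1 - cos x)) by (apply Rmult_le_pos; lra). lra. Qed.
Lemma pd_pos a x : -1 < a < 1 -> 0 < pd a x.
Proof.
intros Ha. unfold pd. assert (K := COS_bound x).
destruct (Rle_dec 0 a) as [h|h].
- assert (0 <= 2 * a * (1 - cos x)) by (apply Rmult_le_pos; lra).
  assert (0 < (1 - a) * (1 - a)) by (apply Rmult_lt_0_compat; lra). lra.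
- assert (0 <= 2 * - a * (1 + cos x)) by (apply Rmult_le_pos; lra).
  assert (0 < (1 + a) * (1 + a)) by (apply Rmult_lt_0_compat; lra). lra.
Qed.
Lemma pd_per a : periodic (pd a).
Proof. intros x. unfold pd. replace (x + 2 * PI) with (x + 2 * INR 1 * PI) by (simpl; ring). now rewrite cos_period. Qed.
Lemma cont_pd a : cont (pd a).
Proof. unfold pd; cnt. Qed.
Lemma cont_pk a : -1 < a < 1 -> cont (pk a).
Proof. intros Ha. unfold pk. apply cont_div; auto with cnt. apply cont_pd. intros x. generalize (pd_pos a x Ha); lra. Qed.
#[export] Hint Resolve cont_pk : cnt.
Lemma pk_per a : periodic (pk a).
Proof. intros x. unfold pk. now rewrite pd_per. Qed.
Lemma pk_even a x : pk a (- x) = pk a x.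
Proof. unfold pk, pd. now rewrite cos_neg. Qed.
Lemma pk_pos a x : -1 < a < 1 -> 0 < pk a x.
Proof. intros Ha. unfold pk. apply Rdiv_lt_0_compat; [nra | now apply pd_pos]. Qed.

Lemma per_cos k : periodic (fun x => cos (INR k * x)).
Proof. intros x. rewrite Rmult_plus_distr_l. replace (INR k * (2 * PI)) with (2 * INR k * PI) by ring. apply cos_period. Qed.
Lemma per_sin k : periodic (fun x => sin (INR k * x)).
Proof. intros x. rewrite Rmult_plus_distr_l. replace (INR k * (2 * PI)) with (2 * INR k * PI) by ring. apply sin_period. Qed.
Lemma per_cosZ k : periodic (fun x => cos (IZR k * x)).
Proof.
intros x. destruct (Z_le_dec 0 k) as [H|H].
- rewrite <- (Z2Nat.id k H), <- INR_IZR_INZ. apply per_cos.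
- replace k with (- Z.of_nat (Z.to_nat (-k)))%Z by lia. rewrite opp_IZR, <- INR_IZR_INZ.
  rewrite !Ropp_mult_distr_l_reverse, !cos_neg. apply per_cos.
Qed.
Lemma per_sinZ k : periodic (fun x => sin (IZR k * x)).
Proof.
intros x. destruct (Z_le_dec 0 k) as [H|H].
- rewrite <- (Z2Nat.id k H), <- INR_IZR_INZ. apply per_sin.
- replace k with (- Z.of_nat (Z.to_nat (-k)))%Z by lia. rewrite opp_IZR, <- INR_IZR_INZ.
  rewrite !Ropp_mult_distr_l_reverse, !sin_neg. f_equal. apply per_sin.
Qed.
Lemma per_mult f g : periodic f -> periodic g -> periodic (fun x => f x * g x).
Proof. intros F G x. now rewrite F, G. Qed.

Lemma mean_cosZ k : k <> 0%Z -> mean (fun x => cos (IZR k * x)) = 0.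
Proof.
intros K. assert (IZR k <> 0) by (apply not_0_IZR; auto).
apply (mean_deriv0 (fun x => sin (IZR k * x) / IZR k)).
- intros x. auto_derive; auto. field; auto.
- cnt.
- intros x. unfold Rdiv. f_equal. apply per_sinZ.
Qed.
Lemma mean_odd f : cont f -> periodic f -> (forall x, f (- x) = - f x) -> mean f = 0.
Proof.
intros C P O. assert (E := mean_reflect f C P). rewrite (mean_ext _ (fun x => - f x)) in E by auto.
rewrite mean_opp in E by auto. lra.
Qed.
Lemma mean_sinZ k : mean (fun x => sin (IZR k * x)) = 0.
Proof.
apply mean_odd; [cnt | apply per_sinZ |]. intros x. now rewrite Ropp_mult_distr_r_reverse, sin_neg.
Qed.

Lemma geom_le a c N x y : 0 <= a < 1 -> (forall k, (N <= k)%nat -> x <= y + c * a ^ k) -> x <= y.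
Proof.
intros Ha H. assert (L : is_lim_seq (fun k => y + c * a ^ k) y).
{ replace (Finite y) with (Rbar_plus y (Rbar_mult c 0)) by (simpl; f_equal; ring).
  apply is_lim_seq_plus'; [apply is_lim_seq_const|]. replace (c * 0) with (real (Rbar_mult c 0)) by reflexivity.
  apply (is_lim_seq_scal_l (fun k => a ^ k) c 0). apply is_lim_seq_geom. rewrite Rabs_right; lra. }
assert (K : Rbar_le x y); [|exact K].
apply (is_lim_seq_le_loc (fun _ => x) (fun k => y + c * a ^ k)); auto using is_lim_seq_const. exists N; auto.
Qed.

(* [d (n+1) - a d n] is multiplied by [1/a] at each step, so boundedness kills it. *)
Lemma bounded_rec a (d : nat -> R) B : 0 <= a < 1 -> (forall n, Rabs (d n) <= B) ->
  (forall n, (1 + a * a) * d (S n) = a * (d n + d (S (S n)))) -> forall n, d n = a ^ n * d 0%nat.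
Proof.
intros Ha Bd Rec.
assert (E : forall k n, d (S n) - a * d n = a ^ k * (d (S (k + n)) - a * d (k + n)%nat)).
{ induction k; intros n; [simpl; ring|]. rewrite IHk. simpl. assert (K := Rec (k + n)%nat).
  replace (d (S (k + n)) - a * d (k + n)%nat) with (a * (d (S (S (k + n))) - a * d (S (k + n)))) by lra. ring. }
assert (Z : forall n, d (S n) = a * d n).
{ intros n. assert (B0 : 0 <= B) by (eapply Rle_trans; [apply Rabs_pos | apply (Bd 0%nat)]).
  assert (Rabs (d (S n) - a * d n) <= 0).
  { apply (geom_le a (2 * B) 0); auto. intros k _. rewrite Rplus_0_l, (Rmult_comm (2 * B)).
    rewrite (E k n), Rabs_mult, (Rabs_right (a^k)) by (apply Rle_ge, pow_le; lra).
    apply Rmult_le_compat_l; [apply pow_le; lra|]. unfold Rminus.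
    eapply Rle_trans; [apply Rabs_triang|]. rewrite Rabs_Ropp, Rabs_mult, (Rabs_right a) by lra.
    generalize (Bd (S (k+n))) (Bd (k+n)%nat) (Rabs_pos (d (k+n)%nat)). intros. nra. }
  apply Rabs_le_between in H. lra. }
induction n; simpl; [ring|]. rewrite Z, IHn; ring.
Qed.

Lemma cos_rec n x : cos (INR n * x) + cos (INR (S (S n)) * x) = 2 * cos x * cos (INR (S n) * x).
Proof.
rewrite !S_INR. replace (INR n * x) with ((INR n + 1) * x - x) by ring.
replace ((INR n + 1 + 1) * x) with ((INR n + 1) * x + x) by ring. rewrite cos_plus, cos_minus. ring.
Qed.

Lemma mean_cosN k : mean (fun x => cos (INR (S k) * x)) = 0.
Proof. rewrite INR_IZR_INZ. apply mean_cosZ. lia. Qed.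

Lemma moment_rec a (w : R -> R) n : cont w ->
  (1 + a * a) * mean (fun x => w x * cos (INR (S n) * x)) - a * (mean (fun x => w x * cos (INR n * x)) + mean (fun x => w x * cos (INR (S (S n)) * x)))
  = mean (fun x => (w x * pd a x) * cos (INR (S n) * x)).
Proof.
intros W. assert (cont (pd a)) by apply cont_pd. rewrite <- mean_plus by cnt. rewrite <- !mean_scal by cnt.
rewrite <- mean_minus by cnt. apply mean_ext; intros x. unfold pd. generalize (cos_rec n x); intros E.
replace (w x * cos (INR n * x) + w x * cos (INR (S (S n)) * x)) with (w x * (cos (INR n * x) + cos (INR (S (S n)) * x))) by ring.
rewrite E; ring.
Qed.

Lemma moment0 a (w : R -> R) : cont w ->
  (1 + a * a) * mean w - 2 * a * mean (fun x => w x * cos (INR 1 * x)) = mean (fun x => w x * pd a x).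
Proof.
intros W. assert (cont (pd a)) by apply cont_pd. rewrite <- !mean_scal by cnt. rewrite <- mean_minus by cnt.
apply mean_ext; intros x. unfold pd. simpl INR. rewrite Rmult_1_l. ring.
Qed.

Lemma Rabs_cos x : Rabs (cos x) <= 1.
Proof. apply Rabs_le, COS_bound. Qed.

Lemma moment_bound (w : R -> R) n : cont w -> Rabs (mean (fun x => w x * cos (INR n * x))) <= mean (fun x => Rabs (w x)).
Proof.
intros W. eapply Rle_trans; [apply mean_Rabs; cnt|]. apply mean_le; [cnt..|]. intros x.
rewrite Rabs_mult. generalize (Rabs_cos (INR n * x)) (Rabs_pos (w x)). intros; nra.
Qed.

(** As [pk a] times [pd a] is constant, the cosine moments satisfy a three-term recursion whose
    bounded solutions are geometric; the moment against [pd a] itself fixes the factor. *)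
Lemma pk_moments a : 0 <= a < 1 -> forall n, mean (fun x => pk a x * cos (INR n * x)) = a ^ n.
Proof.
intros Ha. set (d n := mean (fun x => pk a x * cos (INR n * x))).
assert (C : cont (pk a)) by (apply cont_pk; lra).
assert (Pd : forall x, pk a x * pd a x = 1 - a * a) by (intros x; unfold pk; field; generalize (pd_pos a x ltac:(lra)); lra).
assert (E : forall n, d n = a ^ n * d 0%nat).
{ apply (bounded_rec a d (mean (fun x => Rabs (pk a x)))); auto. intros; now apply moment_bound.
  intros n. assert (K := moment_rec a (pk a) n C). rewrite (mean_ext (fun x => pk a x * pd a x * cos (INR (S n) * x)) (fun x => (1 - a * a) * cos (INR (S n) * x))) in K by (intros; now rewrite Pd).
  rewrite mean_scal in K by cnt. rewrite mean_cosN in K. fold (d n) (d (S n)) (d (S (S n))) in K. lra. }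
assert (E0 : mean (pk a) = d 0%nat) by (apply mean_ext; intros x; simpl; rewrite Rmult_0_l, cos_0; ring).
assert (K := moment0 a (pk a) C). fold (d 1%nat) in K. rewrite (mean_ext (fun x => pk a x * pd a x) (fun _ => 1 - a * a)) in K by auto.
rewrite mean_const, E0, (E 1%nat) in K. simpl in K.
assert (0 < 1 - a * a) by nra.
assert (H1 : d 0%nat = 1) by (apply (Rmult_eq_reg_l (1 - a * a)); lra). intros n. fold (d n). rewrite E, H1; ring.
Qed.

(** The mean of [pk a] squared. It is at least 1 and stays bounded while [a] stays away from 1. *)
Definition m0 a := (1 + a * a) / (1 - a * a).

Lemma pk2_moments a : 0 <= a < 1 -> forall n, mean (fun x => pk a x * pk a x * cos (INR n * x)) = a ^ n * (m0 a + INR n).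
Proof.
intros Ha. set (x n := mean (fun x => pk a x * pk a x * cos (INR n * x))).
assert (C : cont (pk a)) by (apply cont_pk; lra).
assert (Pd : forall x, pk a x * pk a x * pd a x = (1 - a * a) * pk a x) by (intros y; unfold pk; field; generalize (pd_pos a y ltac:(lra)); lra).
(* Here the recursion has the source [(1 - a^2) a^(n+1)], with the particular solution [n a^n];
   subtracting it leads back to the homogeneous case. *)
set (d n := x n - INR n * a ^ n).
assert (Bn : forall n, INR n * a ^ n <= / (1 - a)).
{ intros n. assert (G : forall n, INR n * a ^ n * (1 - a) <= 1 - a ^ n).
  { induction n0; [simpl; lra|]. rewrite S_INR; simpl. assert (0 <= a ^ n0) by (apply pow_le; lra).
    assert (a ^ n0 <= 1) by (rewrite <- (pow1 n0); apply pow_incr; lra).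
    assert (a * (INR n0 * a ^ n0 * (1 - a)) <= a * (1 - a ^ n0)) by (apply Rmult_le_compat_l; lra).
    assert (a * a ^ n0 <= 1 * 1) by (apply Rmult_le_compat; lra).
    assert (a * a ^ n0 * (1 - a) <= 1 * (1 - a)) by (apply Rmult_le_compat_r; lra). lra. }
  apply (Rmult_le_reg_r (1 - a)); [lra|]. rewrite Rinv_l by lra. generalize (G n) (pow_le a n ltac:(lra)). lra. }
assert (E : forall n, d n = a ^ n * d 0%nat).
{ apply (bounded_rec a d (mean (fun x => Rabs (pk a x * pk a x)) + / (1 - a))); auto.
  - intros n. unfold d, Rminus. eapply Rle_trans; [apply Rabs_triang|]. apply Rplus_le_compat.
    apply (moment_bound (fun x => pk a x * pk a x)); cnt. rewrite Rabs_Ropp, Rabs_right; auto.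
    apply Rle_ge, Rmult_le_pos; [apply pos_INR | apply pow_le; lra].
  - intros n. assert (K := moment_rec a (fun x => pk a x * pk a x) n ltac:(cnt)). cbv beta in K.
    rewrite (mean_ext (fun x => pk a x * pk a x * pd a x * cos (INR (S n) * x)) (fun x => (1 - a * a) * (pk a x * cos (INR (S n) * x)))) in K by (intros; rewrite Pd; ring).
    rewrite mean_scal in K by cnt. rewrite pk_moments in K by auto. fold (x n) (x (S n)) (x (S (S n))) in K.
    unfold d. rewrite !S_INR. simpl pow in *. lra. }
assert (E0 : mean (fun x => pk a x * pk a x) = x 0%nat) by (apply mean_ext; intros y; simpl; rewrite Rmult_0_l, cos_0; ring).
assert (K := moment0 a (fun x => pk a x * pk a x) ltac:(cnt)). cbv beta in K. fold (x 1%nat) in K.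
rewrite (mean_ext (fun x => pk a x * pk a x * pd a x) (fun x => (1 - a * a) * pk a x)) in K by auto.
rewrite mean_scal in K by cnt. replace (mean (pk a)) with 1 in K.
2:{ symmetry. erewrite mean_ext; [apply (pk_moments a Ha 0)|]. intros y; simpl; rewrite Rmult_0_l, cos_0; ring. }
assert (E1 := E 1%nat). unfold d in E1. simpl in E1.
assert (X0 : x 0%nat = m0 a). { unfold m0. apply (Rmult_eq_reg_r (1 - a * a)); [|nra]. field_simplify; [|nra]. nra. }
intros n. fold (x n). assert (En := E n). unfold d in En. simpl in En. rewrite <- X0. lra.
Qed.

Lemma m0_ge1 a : 0 <= a < 1 -> 1 <= m0 a.
Proof. intros Ha. unfold m0. apply (Rmult_le_reg_r (1 - a * a)); [nra|]. field_simplify; nra. Qed.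

Lemma mean_pk a : 0 <= a < 1 -> mean (pk a) = 1.
Proof. intros Ha. erewrite mean_ext; [apply (pk_moments a Ha 0)|]. intros y; simpl; rewrite Rmult_0_l, cos_0; ring. Qed.
Lemma mean_pk2 a : 0 <= a < 1 -> mean (fun x => pk a x * pk a x) = m0 a.
Proof. intros Ha. erewrite mean_ext; [etransitivity; [apply (pk2_moments a Ha 0)|]|]. simpl; ring. intros y; simpl; rewrite Rmult_0_l, cos_0; ring. Qed.

(* [pk a x = 1 + 2 sum a^n cos n x] *)
Definition pks a K x := 2 * sum_f_R0 (fun n => a ^ n * cos (INR n * x)) K - 1.

Lemma pks_eq a K x : pd a x * pks a K x = 1 - a * a - 2 * a ^ (S K) * (cos (INR (S K) * x) - a * cos (INR K * x)).
Proof.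
induction K.
- unfold pks, pd. simpl. rewrite Rmult_0_l, cos_0, !Rmult_1_l. ring.
- unfold pks in *. rewrite tech5.
  replace (pd a x * (2 * (sum_f_R0 (fun n => a ^ n * cos (INR n * x)) K + a ^ S K * cos (INR (S K) * x)) - 1))
  with (pd a x * (2 * sum_f_R0 (fun n => a ^ n * cos (INR n * x)) K - 1) + 2 * pd a x * a ^ S K * cos (INR (S K) * x)) by ring.
  rewrite IHK. unfold pd. assert (E := cos_rec K x).
  replace (cos (INR (S (S K)) * x)) with (2 * cos x * cos (INR (S K) * x) - cos (INR K * x)) by lra. simpl pow. ring.
Qed.

Lemma pks_error a K x : 0 <= a < 1 -> Rabs (pk a x - pks a K x) <= 4 / ((1 - a) * (1 - a)) * a ^ K.
Proof.
intros Ha. assert (P := pd_pos a x ltac:(lra)). assert (G := pd_ge a x ltac:(lra)).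
assert (E := pks_eq a K x).
replace (pk a x - pks a K x) with (2 * a ^ S K * (cos (INR (S K) * x) - a * cos (INR K * x)) * / pd a x).
2:{ unfold pk. apply (Rmult_eq_reg_r (pd a x)); [|lra]. field_simplify; lra. }
assert (ap : 0 <= a ^ K) by (apply pow_le; lra).
rewrite !Rabs_mult, (Rabs_right 2), (Rabs_right (a ^ S K)), (Rabs_right (/ pd a x)).
2: apply Rle_ge, Rlt_le, Rinv_0_lt_compat; auto. 2: apply Rle_ge, pow_le; lra. 2: lra.
assert (B : Rabs (cos (INR (S K) * x) - a * cos (INR K * x)) <= 2).
{ unfold Rminus. eapply Rle_trans; [apply Rabs_triang|]. rewrite Rabs_Ropp, Rabs_mult, (Rabs_right a) by lra.
  generalize (Rabs_cos (INR (S K) * x)) (Rabs_cos (INR K * x)) (Rabs_pos (cos (INR K * x))). intros; nra. }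
assert (I : / pd a x <= / ((1 - a) * (1 - a))) by (apply Rinv_le_contravar; nra).
assert (I0 : 0 < / pd a x) by (apply Rinv_0_lt_compat; auto).
replace (4 / ((1 - a) * (1 - a)) * a ^ K) with (2 * a ^ K * 2 * / ((1 - a) * (1 - a))) by (field; lra).
apply Rmult_le_compat; [|lra | |auto].
- apply Rmult_le_pos; [|apply Rabs_pos]. apply Rmult_le_pos; [lra | apply pow_le; lra].
- apply Rmult_le_compat; [ | apply Rabs_pos | |auto]. apply Rmult_le_pos; [lra|apply pow_le; lra]. simpl. nra.
Qed.

(** The harmonic extension of [g] to the disc, at the point [a e^(ix)]. *)
Definition pint a (g : R -> R) x := mean (fun s => pk a (x - s) * g s).

Lemma unif_cont g : cont g -> periodic g -> forall e, 0 < e -> exists d, 0 < d /\ forall x, Rabs x < d -> forall s, Rabs (g (x + s) - g s) < e.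
Proof.
intros C P e He.
destruct (strip_unif (-1) 1 (fun t s => g (t + s)) 0 ltac:(lra)) with (eps := e) as (d & dp & Hd); auto.
- intros t s Ht. intros eps. assert (Cg := C (t + s)).
  destruct (continuous_eps g (t+s) Cg eps (cond_pos eps)) as (d & dp & Hd).
  exists (mkposreal (d/2) ltac:(lra)); simpl. intros u v Hu Hv. apply Hd.
  replace (u + v - (t + s)) with ((u - t) + (v - s)) by ring. eapply Rle_lt_trans; [apply Rabs_triang|]. lra.
- intros t _ s. rewrite <- Rplus_assoc. apply P.
- exists d; split; auto. intros x Hx s. specialize (Hd x). rewrite Rminus_0_r in Hd. destruct (Hd Hx) as [_ Q].
  specialize (Q s). simpl in Q. now rewrite Rplus_0_l in Q.
Qed.

Lemma cont_bounded g : cont g -> periodic g -> exists B, 0 < B /\ forall x, Rabs (g x) <= B.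
Proof.
intros C P.
destruct (strip_bounded (-1) 1 (fun _ s => - Rabs (g s)) 0 0) as (t0 & s0 & _ & H); try lra.
- intros t s _ eps. assert (Cg : cont (fun s => - Rabs (g s))) by cnt.
  destruct (continuous_eps (fun s => - Rabs (g s)) s (Cg s) eps (cond_pos eps)) as (d & dp & Hd).
  exists (mkposreal d dp). intros u v _ Hv. apply Hd. exact Hv.
- intros t _ s. now rewrite P.
- exists (Rabs (g s0) + 1). split. generalize (Rabs_pos (g s0)); lra. intros x. specialize (H 0 x ltac:(lra)). lra.
Qed.

(** The majorant [1 - cos] is chosen because its mean against the Poisson kernel is exactly [1 - a].
    The approximation by Poisson integrals then needs no splitting of the circle. *)
Lemma near_cos g e : cont g -> periodic g -> 0 < e -> exists K, 0 <= K /\ forall x s, Rabs (g s - g x) <= e + K * (1 - cos (x - s)).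
Proof.
intros C P He. destruct (unif_cont g C P e He) as (d0 & dp0 & Hd0). destruct (cont_bounded g C P) as (B & Bp & HB).
set (d := Rmin d0 1). assert (Hd : 0 < d <= 1 /\ d <= d0) by (unfold d, Rmin; destruct Rle_dec; lra).
assert (PI1 := PI2_1). unfold PI2 in PI1.
assert (cd : cos d < 1) by (rewrite <- cos_0; apply cos_decreasing_1; lra).
exists (2 * B / (1 - cos d)). split. { apply Rlt_le, Rdiv_lt_0_compat; lra. }
intros x s. destruct (per_reduce (s - x)) as (y & Hy & E).
assert (Eg : g s = g (y + x)).
{ replace s with ((s - x) + x) by ring. apply (E (fun z => g (z + x))). intros z. replace (z + 2 * PI + x) with (z + x + 2 * PI) by ring. apply P. }
assert (Ec : cos (x - s) = cos y).
{ rewrite <- cos_neg. replace (- (x - s)) with (s - x) by ring. apply (E cos). intros z. replace (z + 2 * PI) with (z + 2 * INR 1 * PI) by (simpl; ring). apply cos_period. }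
rewrite Ec. assert (cy := COS_bound y).
assert (pos : 0 <= 2 * B / (1 - cos d) * (1 - cos y)).
{ apply Rmult_le_pos; [apply Rlt_le, Rdiv_lt_0_compat; lra | lra]. }
destruct (Rlt_dec y d) as [h1|h1]; [|destruct (Rlt_dec (2 * PI - d) y) as [h2|h2]].
- rewrite Eg. assert (K := Hd0 y ltac:(rewrite Rabs_right; lra) x). lra.
- rewrite Eg. replace (y + x) with ((y - 2 * PI + x) + 2 * PI) by ring. rewrite P.
  assert (K := Hd0 (y - 2 * PI) ltac:(rewrite Rabs_left1; lra) x). lra.
- assert (cos y <= cos d).
  { destruct (Rle_dec y PI). apply cos_decr_1; lra.
    replace (cos y) with (cos (2 * PI - y)). apply cos_decr_1; lra.
    rewrite <- cos_neg. replace (- (2 * PI - y)) with (y - 2 * INR 1 * PI) by (simpl; ring).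
    rewrite <- (cos_period (y - 2 * INR 1 * PI) 1). f_equal; ring. }
  assert (2 * B <= 2 * B / (1 - cos d) * (1 - cos y)).
  { apply Rle_trans with (2 * B / (1 - cos d) * (1 - cos d)). right; field; lra.
    apply Rmult_le_compat_l; [apply Rlt_le, Rdiv_lt_0_compat; lra | lra]. }
  generalize (HB s) (HB x). intros. eapply Rle_trans; [apply (Rabs_triang (g s) (- g x))|]. rewrite Rabs_Ropp. lra.
Qed.

Lemma cont_reflect_shift f x : cont f -> cont (fun s => f (x - s)).
Proof. intros C. apply cont_comp; auto. cnt. Qed.
#[export] Hint Resolve cont_reflect_shift : cnt.
Lemma mean_reflect_shift f x : cont f -> periodic f -> mean (fun s => f (x - s)) = mean f.
Proof.
intros C P. assert (P' : periodic (fun s => f (- s))).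
{ intros s. replace (- (s + 2 * PI)) with (- s - 2 * PI) by ring. rewrite <- P. f_equal; ring. }
rewrite (mean_ext _ (fun s => f (- (s + - x)))) by (intros; f_equal; ring).
assert (C' : cont (fun s => f (- s))) by (apply (cont_comp (fun s => - s) f); cnt).
rewrite (mean_shift (fun s => f (- s)) (-x)) by auto. now apply mean_reflect.
Qed.

Lemma pint_approx g e : cont g -> periodic g -> 0 < e -> exists d, 0 < d < 1 /\
  forall a x, 1 - d < a < 1 -> Rabs (pint a g x - g x) <= e.
Proof.
intros C P He. destruct (near_cos g (e/2) C P ltac:(lra)) as (K & K0 & HK).
exists (Rmin (1/2) (e / (2 * (K + 1)))). assert (Kp : 0 < e / (2 * (K + 1))) by (apply Rdiv_lt_0_compat; lra).
assert (m1 := Rmin_l (1/2) (e / (2 * (K + 1)))). assert (m2 := Rmin_r (1/2) (e / (2 * (K + 1)))).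
split. split; [apply Rmin_pos; lra | lra].
intros a x Ha. assert (Ha' : 0 <= a < 1) by lra. assert (Cp : cont (pk a)) by (apply cont_pk; lra).
assert (E1 : mean (fun s => pk a (x - s)) = 1) by (rewrite mean_reflect_shift; auto using pk_per; now apply mean_pk).
assert (E2 : mean (fun s => pk a (x - s) * (1 - cos (x - s))) = 1 - a).
{ rewrite (mean_reflect_shift (fun y => pk a y * (1 - cos y))).
  - rewrite (mean_ext _ (fun y => pk a y - pk a y * cos (INR 1 * y))) by (intros; simpl; rewrite Rmult_1_l; ring).
    rewrite mean_minus by cnt. rewrite mean_pk, pk_moments by auto. simpl; ring.
  - cnt.
  - intros y. rewrite pk_per. replace (y + 2 * PI) with (y + 2 * INR 1 * PI) by (simpl; ring). now rewrite cos_period. }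
assert (CE : cont (fun s => pk a (x - s) * (1 - cos (x - s)))) by (apply (cont_reflect_shift (fun y => pk a y * (1 - cos y))); cnt).
replace (g x) with (mean (fun s => pk a (x - s) * g x)).
2:{ rewrite (mean_ext _ (fun s => g x * pk a (x - s))) by (intros; ring). rewrite mean_scal by cnt. rewrite E1; ring. }
unfold pint. rewrite <- mean_minus by cnt.
eapply Rle_trans; [apply mean_Rabs; cnt|].
apply Rle_trans with (mean (fun s => e / 2 * pk a (x - s) + K * (pk a (x - s) * (1 - cos (x - s))))).
- apply mean_le; [cnt | |].
  + cnt.
  + intros s. rewrite <- Rmult_minus_distr_l, Rabs_mult, Rabs_right by (apply Rle_ge, Rlt_le, pk_pos; lra).
    assert (pp := pk_pos a (x - s) ltac:(lra)).
    assert (Q := Rmult_le_compat_l _ _ _ (Rlt_le _ _ pp) (HK x s)). lra.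
- rewrite mean_plus, !mean_scal, E1, E2.
  2-5: cnt.
  assert (K * (1 - a) <= e / 2); [|lra].
  apply Rle_trans with ((K + 1) * (e / (2 * (K + 1)))). apply Rmult_le_compat; lra. right; field; lra.
Qed.

Definition winding (u us v vs : R -> R) := mean (fun s => / (u s * u s + v s * v s) * (u s * vs s - v s * us s)).

(** Homotopy invariance, with [t] as the parameter: the angle form [(u dv - v du) / (u^2 + v^2)] is
    closed, and [mean_stokes] turns this into a zero derivative. *)
Lemma winding_const lo hi u ut us v vt vs t t' : C1cyl lo hi u ut us -> C1cyl lo hi v vt vs ->
  (forall t s, lo < t < hi -> 0 < u t s * u t s + v t s * v t s) -> lo < t < hi -> lo < t' < hi ->
  winding (u t) (us t) (v t) (vs t) = winding (u t') (us t') (v t') (vs t').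
Proof.
intros Hu Hv NZ Ht Ht'. apply (const_on lo hi (fun t => winding (u t) (us t) (v t) (vs t))); auto. clear t t' Ht Ht'. intros t Ht.
assert (exists I It Is, C1cyl lo hi I It Is /\ (forall t s, I t s = / (u t s * u t s + v t s * v t s)) /\
  (forall t s, lo < t < hi -> It t s = - (I t s * I t s) * (2 * (u t s * ut t s + v t s * vt t s))) /\
  (forall t s, lo < t < hi -> Is t s = - (I t s * I t s) * (2 * (u t s * us t s + v t s * vs t s)))) as (I & It & Is & Fp & EI & EIt & EIs).
{ assert (Nn := c1_plus (c1_mult Hu Hu) (c1_mult Hv Hv)). simpl in Nn.
  assert (Fp := c1_comp _ _ Rinv (fun x => - / (x * x)) _ _ _ Nn). simpl in Fp.
  match type of Fp with ?A -> ?B -> ?C => assert (HA : A); [|assert (HB : B); [|specialize (Fp HA HB)]] end.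
  { intros x s Hx. specialize (NZ x s Hx). auto_derive; [lra | field; lra]. }
  { intros x s Hx. specialize (NZ x s Hx). apply (ex_derive_continuous (fun x => - / (x*x))). auto_derive. apply Rmult_integral_contrapositive; lra. }
  eexists. eexists. eexists. split; [exact Fp|]. split; [reflexivity|].
  split; intros x s Hx; specialize (NZ x s Hx); field; lra. }
assert (F1 := c1_mult Fp Hu). assert (F2 := c1_mult Fp Hv).
assert (S1 := mean_stokes t F1 Hv Ht).
assert (S2 := mean_stokes t F2 Hu Ht). simpl in S1, S2.
assert (S := is_derive_minus _ _ _ _ _ S1 S2).
assert (c1 := c1_cont_f Hu Ht). assert (c2 := c1_cont_t Hu Ht). assert (c3 := c1_cont_s Hu Ht).
assert (c4 := c1_cont_f Hv Ht). assert (c5 := c1_cont_t Hv Ht). assert (c6 := c1_cont_s Hv Ht).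
assert (c7 := c1_cont_f Fp Ht). assert (c8 := c1_cont_t Fp Ht). assert (c9 := c1_cont_s Fp Ht).
unfold minus, plus, opp in S; simpl in S. rewrite <- mean_opp in S by cnt. rewrite <- mean_plus in S by cnt.
match type of S with is_derive _ _ (mean ?f) => replace (mean f) with 0 in S end.
2:{ symmetry. rewrite <- (mean_const 0). apply mean_ext; intros s. rewrite EIt, EIs, EI by auto. specialize (NZ t s Ht). field; lra. }
eapply is_derive_ext_loc; [|exact S].
apply (locally_Ioo lo hi); auto. intros x Hx. simpl. assert (d7 := c1_cont_f Fp Hx).
assert (d1 := c1_cont_f Hu Hx). assert (d3 := c1_cont_s Hu Hx).
assert (d4 := c1_cont_f Hv Hx). assert (d6 := c1_cont_s Hv Hx).
rewrite <- mean_opp by cnt. rewrite <- mean_plus by cnt. apply mean_ext; intros s. rewrite EI; ring.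
Qed.

(** The argument of Rouche: the segment from [(u, v)] to [(p, q)] avoids the origin. *)
Lemma winding_near (u us v vs p ps q qs : R -> R) :
  (forall s, is_derive u s (us s)) -> (forall s, is_derive v s (vs s)) -> (forall s, is_derive p s (ps s)) -> (forall s, is_derive q s (qs s)) ->
  cont us -> cont vs -> cont ps -> cont qs -> periodic u -> periodic v -> periodic p -> periodic q ->
  (forall s, (p s - u s) * (p s - u s) + (q s - v s) * (q s - v s) < u s * u s + v s * v s) ->
  winding u us v vs = winding p ps q qs.
Proof.
intros Du Dv Dp Dq Cu Cv Cp Cq Pu Pv Pp Pq Near.
(* The homotopy parameter [sin^2 t] is smooth on an open interval and stays in [[0, 1]], with values
   0 at [t = 0] and 1 at [t = PI / 2]; both end curves thus lie inside the strip. *)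
assert (S1 : C1cyl (-1) 3 (fun t _ => sin t * sin t) (fun t _ => cos t * sin t + sin t * cos t) (fun _ _ => 0)).
{ apply (c1_time _ _ (fun t => sin t * sin t) (fun t => cos t * sin t + sin t * cos t)).
  - intros t _. apply (is_derive_mult_R sin sin); auto_derive; auto; ring.
  - intros t _. assert (C : cont (fun t => cos t * sin t + sin t * cos t)) by cnt. apply C. }
assert (F := c1_plus (c1_circle (-1) 3 u us Du Cu Pu)
  (c1_mult S1 (c1_minus (c1_circle (-1) 3 p ps Dp Cp Pp) (c1_circle (-1) 3 u us Du Cu Pu)))).
assert (G := c1_plus (c1_circle (-1) 3 v vs Dv Cv Pv)
  (c1_mult S1 (c1_minus (c1_circle (-1) 3 q qs Dq Cq Pq) (c1_circle (-1) 3 v vs Dv Cv Pv)))).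
simpl in F, G. assert (P2 := PI2_1). unfold PI2 in P2. assert (P4 := PI_4).
assert (K := winding_const (-1) 3 _ _ _ _ _ _ 0 (PI/2) F G). cbv beta in K. rewrite sin_0, sin_PI2 in K.
assert (E1 : winding u us v vs = winding (fun s => u s + 0 * 0 * (p s - u s)) (fun s => us s + (0 * (p s - u s) + 0 * 0 * (ps s - us s))) (fun s => v s + 0 * 0 * (q s - v s)) (fun s => vs s + (0 * (q s - v s) + 0 * 0 * (qs s - vs s)))).
{ apply mean_ext; intros s. f_equal; [f_equal|]; ring. }
assert (E2 : winding p ps q qs = winding (fun s => u s + 1 * 1 * (p s - u s)) (fun s => us s + (0 * (p s - u s) + 1 * 1 * (ps s - us s))) (fun s => v s + 1 * 1 * (q s - v s)) (fun s => vs s + (0 * (q s - v s) + 1 * 1 * (qs s - vs s)))).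
{ apply mean_ext; intros s. f_equal; [f_equal|]; ring. }
rewrite E1, E2. apply K; try lra.
intros t s _. specialize (Near s). assert (SB := SIN_bound t). set (m := sin t * sin t).
assert (0 <= m <= 1) by (unfold m; nra).
set (x := u s) in *. set (y := v s) in *. set (a := p s - x) in *. set (b := q s - y) in *.
destruct (Rlt_dec 0 ((x + m * a) * (x + m * a) + (y + m * b) * (y + m * b))) as [h|h]; auto. exfalso.
assert (q1 := sq_ge0 (x + m * a)). assert (q2 := sq_ge0 (y + m * b)).
assert (x + m * a = 0) by (apply sq_eq0; lra).
assert (y + m * b = 0) by (apply sq_eq0; lra).
assert (x = - (m * a)) by lra. assert (y = - (m * b)) by lra.
assert (x * x + y * y = m * m * (a * a + b * b)) by (rewrite H2, H3; ring).
assert (0 <= a * a + b * b) by (generalize (sq_ge0 a) (sq_ge0 b); lra).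
assert (m * m <= 1 * 1) by (apply Rmult_le_compat; lra).
assert (m * m * (a * a + b * b) <= 1 * 1 * (a * a + b * b)) by (apply Rmult_le_compat_r; auto). lra.
Qed.

Lemma c1_diffarg lo hi (Q dQ : R -> R) : (forall s, is_derive Q s (dQ s)) -> cont dQ -> periodic Q ->
  C1cyl lo hi (fun x y => Q (x - y)) (fun x y => dQ (x - y)) (fun x y => - dQ (x - y)).
Proof.
intros D C P. assert (CC : forall x y, continuity_2d_pt (fun x y => dQ (x - y)) x y).
{ intros x y eps. destruct (continuous_eps dQ (x-y) (C (x-y)) eps (cond_pos eps)) as (d & dp & Hd).
  exists (mkposreal (d/2) ltac:(lra)); simpl. intros u v Hu Hv. apply Hd.
  replace (u - v - (x - y)) with ((u - x) + - (v - y)) by ring. eapply Rle_lt_trans; [apply Rabs_triang|]. rewrite Rabs_Ropp. lra. }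
constructor; intros.
- replace (dQ (t - s)) with (1 * dQ (t - s)) by ring. apply (is_derive_comp Q (fun x => x - s)); auto. auto_derive; auto.
- replace (- dQ (t - s)) with ((-1) * dQ (t - s)) by ring. apply (is_derive_comp Q (fun x => t - x)); auto. auto_derive; auto; ring.
- auto.
- apply continuity_2d_pt_opp; auto.
- intros s. replace (t - (s + 2 * PI)) with (t - s - 2 * PI) by ring. rewrite <- (P (t - s - 2 * PI)). f_equal; ring.
Qed.

Lemma c1_reflect lo hi q qt qs x : C1cyl lo hi q qt qs ->
  C1cyl lo hi (fun t y => q t (x - y)) (fun t y => qt t (x - y)) (fun t y => - qs t (x - y)).
Proof.
intros F.
assert (G : forall g t s, continuity_2d_pt g t (x - s) -> continuity_2d_pt (fun t y => g t (x - y)) t s).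
{ intros g t s C eps. destruct (C eps) as [d Hd]. exists d. intros u v Hu Hv. apply Hd; auto.
  replace (x - v - (x - s)) with (- (v - s)) by ring. now rewrite Rabs_Ropp. }
constructor; intros.
- now apply F.
- replace (- qs t (x - s)) with ((-1) * qs t (x - s)) by ring. apply (is_derive_comp (q t) (fun y => x - y)). now apply F. auto_derive; auto; ring.
- apply G. now apply F.
- apply continuity_2d_pt_opp. apply (G qs). now apply F.
- intros s. replace (x - (s + 2 * PI)) with (x - s - 2 * PI) by ring. rewrite <- (c1_per F t H (x - s - 2 * PI)). f_equal; ring.
Qed.

Lemma conv_cont lo hi k g t x : lo < t < hi -> (forall t s, lo < t < hi -> continuity_2d_pt k t s) ->
  (forall t, lo < t < hi -> cont (k t)) -> (forall t, lo < t < hi -> periodic (k t)) -> cont g -> periodic g ->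
  continuity_2d_pt (fun t x => mean (fun y => k t (x - y) * g y)) t x.
Proof.
intros Ht Ck Ckt Pk Cg Pg [eps He]. destruct (cont_bounded g Cg Pg) as (B & Bp & HB).
set (e := eps / (4 * B)). assert (ep : 0 < e) by (apply Rdiv_lt_0_compat; lra).
destruct (strip_unif lo hi k t Ht Ck Pk e ep) as (d1 & dp1 & H1).
destruct (unif_cont (k t) (Ckt t Ht) (Pk t Ht) e ep) as (d2 & dp2 & H2).
exists (mkposreal (Rmin d1 d2) ltac:(apply Rmin_pos; auto)); simpl. intros t' x' Ht' Hx'.
assert (m1 := Rmin_l d1 d2). assert (m2 := Rmin_r d1 d2).
destruct (H1 t' ltac:(lra)) as [Ht2 H1']. assert (Ck' := Ckt t' Ht2). assert (Ck'' := Ckt t Ht).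
rewrite <- mean_minus by cnt. apply Rle_lt_trans with (eps / 2); [|lra].
apply mean_bound; [cnt|]. intros y. rewrite <- Rmult_minus_distr_r, Rabs_mult.
replace (eps / 2) with ((e + e) * B) by (unfold e; field; lra).
apply Rmult_le_compat; try apply Rabs_pos; auto.
replace (k t' (x' - y) - k t (x - y)) with ((k t' (x' - y) - k t (x' - y)) + (k t (x' - y) - k t (x - y))) by ring.
eapply Rle_trans; [apply Rabs_triang|]. apply Rplus_le_compat. left; apply H1'.
left. replace (x' - y) with ((x' - x) + (x - y)) by ring. apply H2. lra.
Qed.

Lemma c1_pk : exists qt qs, C1cyl (-1) 1 pk qt qs.
Proof.
assert (dc : forall s, is_derive cos s (- sin s)) by (intros; auto_derive; auto; ring).
assert (Pc : periodic cos) by (intros y; replace (y + 2 * PI) with (y + 2 * INR 1 * PI) by (simpl; ring); apply cos_period).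
assert (A := c1_time (-1) 1 (fun t => t) (fun _ => 1)).
assert (A1 : C1cyl (-1) 1 (fun t _ => t) (fun _ _ => 1) (fun _ _ => 0)).
{ apply A. intros; auto_derive; auto. intros; apply continuous_const. }
assert (B := c1_circle (-1) 1 cos (fun s => - sin s) dc ltac:(cnt) Pc).
assert (P := c1_plus (c1_minus (c1_const (-1) 1 1) (c1_mult (c1_scal _ _ 2 _ _ _ A1) B)) (c1_mult A1 A1)).
assert (I := c1_comp _ _ Rinv (fun x => - / (x * x)) _ _ _ P). simpl in I.
match type of I with ?A -> ?B -> ?C => assert (HA : A); [|assert (HB : B); [|specialize (I HA HB)]] end.
{ intros t s Ht. assert (K := pd_pos t s Ht). unfold pd in K. auto_derive; [lra | field; lra]. }
{ intros t s Ht. assert (K := pd_pos t s Ht). unfold pd in K. apply (ex_derive_continuous (fun x => - / (x*x))). auto_derive. apply Rmult_integral_contrapositive; lra. }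
assert (Q := c1_mult (c1_minus (c1_const (-1) 1 1) (c1_mult A1 A1)) I). simpl in Q.
eexists. eexists. exact Q.
Qed.

Lemma pint_swap a g x : -1 < a < 1 -> cont g -> periodic g -> pint a g x = mean (fun y => g (x - y) * pk a y).
Proof.
intros Ha C P. unfold pint.
rewrite <- (mean_reflect_shift (fun y => pk a (x - y) * g y) x).
- apply mean_ext; intros y. replace (x - (x - y)) with y by ring. ring.
- cnt.
- intros y. rewrite P. f_equal. replace (x - (y + 2 * PI)) with (x - y - 2 * PI) by ring. rewrite <- (pk_per a (x - y - 2 * PI)). f_equal; ring.
Qed.

Lemma pint_per a g : periodic (pint a g).
Proof. intros x. apply mean_ext; intros y. f_equal. rewrite <- (pk_per a (x - y)). f_equal; ring. Qed.

(** The radial derivative falls on the kernel, the angular one on [g] after a substitution. The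
    latter is again a Poisson integral, and at [a = 0] it is the mean of [dg], which is zero. *)
Lemma pint_c1 (g dg : R -> R) : (forall s, is_derive g s (dg s)) -> cont dg -> periodic g ->
  exists gt, C1cyl (-1) 1 (fun a x => pint a g x) gt (fun a x => pint a dg x).
Proof.
intros D Cd P. assert (C : cont g) by (apply (derive_cont g dg); auto).
assert (Pd : periodic dg) by (apply (c1_per_s (t := 0) (c1_circle (-1) 1 g dg D Cd P)); lra).
destruct c1_pk as (qt & qs & Q).
exists (fun a x => mean (fun y => qt a (x - y) * g y)). constructor.
- intros a x Ha.
  assert (M := c1_mult (c1_reflect _ _ _ _ _ x Q) (c1_circle (-1) 1 g dg D Cd P)).
  assert (K := mean_derive a M Ha). simpl in K. unfold pint.
  erewrite mean_ext; [exact K|]. intros; simpl; ring.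
- intros a x Ha.
  assert (Cp := cont_pk a Ha).
  apply (is_derive_ext (fun x => mean (fun y => g (x - y) * pk a y))). intros z. symmetry. now apply pint_swap.
  rewrite pint_swap by auto.
  assert (dpk : forall y, is_derive (pk a) y (qs a y)) by (intros y; apply (c1_ds Q); auto).
  assert (M := c1_mult (c1_diffarg (x - 1) (x + 1) g dg D Cd P) (c1_circle (x-1) (x+1) (pk a) (qs a) dpk (c1_cont_s Q Ha) (pk_per a))).
  assert (K := mean_derive x M ltac:(lra)). simpl in K.
  erewrite mean_ext; [exact K|]. intros; simpl; ring.
- intros a x Ha. apply (conv_cont (-1) 1); auto.
  + apply Q.
  + intros t Ht. apply (c1_cont_t Q Ht).
  + intros t Ht. apply (c1_per_t Q Ht).
- intros a x Ha. apply (conv_cont (-1) 1); auto.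
  + intros. now apply (c1_cf Q).
  + apply cont_pk.
  + intros; apply pk_per.
- intros a _. apply pint_per.
Qed.

(** A negative radius denotes the antipodal point. This makes [a = 0] an interior parameter of the
    strip, as [winding_const] asks. *)
Lemma pint_neg a g x : pint (- a) g x = pint a g (x + PI).
Proof.
apply mean_ext; intros y. f_equal. unfold pk, pd. replace (x + PI - y) with (x - y + PI) by ring. rewrite neg_cos. f_equal; ring.
Qed.

(** If the extension had no zero, its restrictions to circles of radius [a] would be a homotopy in
    the punctured plane from a curve near the given one to the constant curve at [a = 0], and the
    winding number would vanish. *)
Lemma poisson_zero (u us v vs : R -> R) :
  (forall s, is_derive u s (us s)) -> (forall s, is_derive v s (vs s)) -> cont us -> cont vs -> periodic u -> periodic v ->
  (forall s, 1 <= u s * u s + v s * v s) -> winding u us v vs <> 0 ->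
  exists a x, 0 <= a < 1 /\ pint a u x = 0 /\ pint a v x = 0.
Proof.
intros Du Dv Cu Cv Pu Pv N1 W. apply NNPP; intros NZ. apply W.
assert (cu := derive_cont u us Du). assert (cv := derive_cont v vs Dv).
assert (NZ' : forall a x, -1 < a < 1 -> 0 < pint a u x * pint a u x + pint a v x * pint a v x).
{ assert (NP : forall a x, 0 <= a < 1 -> 0 < pint a u x * pint a u x + pint a v x * pint a v x).
  { intros a x Ha. assert (q1 := sq_ge0 (pint a u x)). assert (q2 := sq_ge0 (pint a v x)).
    destruct (Rlt_dec 0 (pint a u x * pint a u x + pint a v x * pint a v x)) as [h|h]; auto. exfalso; apply NZ.
    exists a, x. split; auto. split; apply sq_eq0; lra. }
  intros a x Ha. destruct (Rle_dec 0 a). apply NP; lra.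
  replace a with (- - a) by ring. rewrite !(pint_neg (- a)). apply NP; lra. }
destruct (pint_c1 u us Du Cu Pu) as (ut & U1). destruct (pint_c1 v vs Dv Cv Pv) as (vt & V1).
destruct (pint_approx u (1/2) cu Pu ltac:(lra)) as (d1 & dp1 & H1).
destruct (pint_approx v (1/2) cv Pv ltac:(lra)) as (d2 & dp2 & H2).
set (a := 1 - Rmin d1 d2 / 2). assert (0 < Rmin d1 d2) by (apply Rmin_pos; lra).
assert (m1 := Rmin_l d1 d2). assert (m2 := Rmin_r d1 d2). assert (Ha : -1 < a < 1) by (unfold a; lra).
assert (c1 := c1_cont_s U1 Ha). assert (c2 := c1_cont_s V1 Ha).
assert (e1 : forall s, is_derive (pint a u) s (pint a us s)) by (intros s; exact (c1_ds U1 a s Ha)).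
assert (e2 : forall s, is_derive (pint a v) s (pint a vs s)) by (intros s; exact (c1_ds V1 a s Ha)).
rewrite (winding_near u us v vs (pint a u) (pint a us) (pint a v) (pint a vs)); auto using pint_per.
- assert (K := winding_const (-1) 1 _ _ _ _ _ _ a 0 U1 V1 NZ' Ha ltac:(lra)). cbv beta in K.
  etransitivity; [exact K|]. unfold winding. etransitivity; [|apply (mean_const 0)]. apply mean_ext; intros s.
  assert (Z : forall g dg, (forall s, is_derive g s (dg s)) -> cont dg -> periodic g -> pint 0 dg s = 0).
  { intros g dg D C P. unfold pint. rewrite (mean_ext _ dg). apply (mean_deriv0 g dg); auto.
    intros y. unfold pk, pd. field. }
  cbv beta. rewrite (Z u us), (Z v vs) by auto. ring.
- intros s. assert (A1 := H1 a s ltac:(unfold a; lra)). assert (A2 := H2 a s ltac:(unfold a; lra)). specialize (N1 s).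
  assert (Q : forall x, Rabs x <= 1/2 -> x * x <= 1/4).
  { intros x Hx. apply Rabs_le_between in Hx. assert (0 <= (1/2 - x) * (1/2 + x)) by (apply Rmult_le_pos; lra). lra. }
  apply Q in A1. apply Q in A2. lra.
Qed.

(** * Trigonometric polynomials *)

Fixpoint zs (K : nat) (F : Z -> R) : R := match K with
  | O => F 0%Z
  | S k => zs k F + (F (Z.of_nat (S k)) + F (- Z.of_nat (S k))%Z)
  end.
Fixpoint ps (K : nat) (F : nat -> R) : R := match K with O => 0 | S k => ps k F + F (S k) end.

Lemma zs_O F : zs 0 F = F 0%Z.
Proof. reflexivity. Qed.
Lemma zs_S K F : zs (S K) F = zs K F + (F (Z.of_nat (S K)) + F (- Z.of_nat (S K))%Z).
Proof. reflexivity. Qed.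
Lemma ps_S K F : ps (S K) F = ps K F + F (S K).
Proof. reflexivity. Qed.
Ltac zsimp := rewrite ?zs_S, ?zs_O, ?ps_S; cbv beta.

Lemma zs_ext K F G : (forall n, (Z.abs n <= Z.of_nat K)%Z -> F n = G n) -> zs K F = zs K G.
Proof. induction K; intros H; zsimp; [apply H; lia|]. rewrite IHK by (intros; apply H; lia). rewrite !H by lia. auto. Qed.
Lemma zs_plus K F G : zs K (fun n => F n + G n) = zs K F + zs K G.
Proof. induction K; zsimp; auto. rewrite IHK; ring. Qed.
Lemma zs_scal K c F : zs K (fun n => c * F n) = c * zs K F.
Proof. induction K; zsimp; auto. rewrite IHK; ring. Qed.
Lemma zs_minus K F G : zs K (fun n => F n - G n) = zs K F - zs K G.
Proof. induction K; zsimp; auto. rewrite IHK; ring. Qed.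
Lemma zs_0 K F : (forall n, (Z.abs n <= Z.of_nat K)%Z -> F n = 0) -> zs K F = 0.
Proof. intros H. rewrite (zs_ext K F (fun n => 0 * 0)). rewrite (zs_scal K 0 (fun _ => 0)); ring. intros; rewrite H; auto; ring. Qed.
Lemma zs_le K F G : (forall n, (Z.abs n <= Z.of_nat K)%Z -> F n <= G n) -> zs K F <= zs K G.
Proof. induction K; intros H; zsimp; [apply H; lia|]. generalize (IHK ltac:(intros; apply H; lia)) (H (Z.of_nat (S K)) ltac:(lia)) (H (- Z.of_nat (S K))%Z ltac:(lia)). lra. Qed.
Lemma zs_ge0 K F : (forall n, (Z.abs n <= Z.of_nat K)%Z -> 0 <= F n) -> 0 <= zs K F.
Proof. intros H. rewrite <- (zs_0 K (fun _ => 0)) by auto. now apply zs_le. Qed.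
Lemma zs_neg K F : zs K (fun n => F (- n)%Z) = zs K F.
Proof. induction K; zsimp; auto. rewrite IHK, Z.opp_involutive. ring. Qed.
Lemma zs_swap K L F : zs K (fun n => zs L (fun m => F n m)) = zs L (fun m => zs K (fun n => F n m)).
Proof. induction K; zsimp; auto. rewrite IHK, <- !zs_plus. auto. Qed.
Lemma zs_single K F k : (Z.abs k <= Z.of_nat K)%Z -> (forall n, n <> k -> F n = 0) -> zs K F = F k.
Proof.
intros Hk H. induction K; zsimp. f_equal; lia.
destruct (Z_le_dec (Z.abs k) (Z.of_nat K)) as [h|h].
- rewrite IHK by auto. rewrite (H (Z.of_nat (S K))), (H (- Z.of_nat (S K))%Z) by lia. ring.
- rewrite zs_0 by (intros; apply H; lia). destruct (Z_le_dec 0 k).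
  + replace k with (Z.of_nat (S K)) by lia. rewrite (H (- _)%Z) by lia. ring.
  + replace k with (- Z.of_nat (S K))%Z by lia. rewrite (H (Z.of_nat _)) by lia. ring.
Qed.
Lemma zs_ge_term K F k : (Z.abs k <= Z.of_nat K)%Z -> (forall n, 0 <= F n) -> F k <= zs K F.
Proof.
intros Hk H. induction K; zsimp. replace k with 0%Z by lia; lra.
destruct (Z_le_dec (Z.abs k) (Z.of_nat K)) as [h|h].
- generalize (IHK h) (H (Z.of_nat (S K))) (H (- Z.of_nat (S K))%Z); lra.
- generalize (zs_ge0 K F ltac:(auto)) (H (Z.of_nat (S K))) (H (- Z.of_nat (S K))%Z).
  destruct (Z_le_dec 0 k); [replace k with (Z.of_nat (S K)) by lia | replace k with (- Z.of_nat (S K))%Z by lia]; lra.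
Qed.
Lemma cont_zs K (F : Z -> R -> R) : (forall n, cont (F n)) -> cont (fun x => zs K (fun n => F n x)).
Proof. intros H. induction K; [apply H|]. apply (cont_plus (fun x => zs K (fun n => F n x)) (fun x => F (Z.of_nat (S K)) x + F (- Z.of_nat (S K))%Z x)); auto. apply cont_plus; auto. Qed.
Lemma mean_zs K (F : Z -> R -> R) : (forall n, cont (F n)) -> mean (fun x => zs K (fun n => F n x)) = zs K (fun n => mean (F n)).
Proof.
intros H. induction K; [reflexivity|]. assert (C := cont_zs K F H). assert (c1 := H (Z.of_nat (S K))). assert (c2 := H (- Z.of_nat (S K))%Z).
rewrite zs_S, <- IHK, <- !mean_plus by cnt. reflexivity.
Qed.
Lemma ps_ext K F G : (forall n, (1 <= n <= K)%nat -> F n = G n) -> ps K F = ps K G.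
Proof. induction K; intros H; first [rewrite !ps_S; cbv beta | simpl]; auto. rewrite IHK by (intros; apply H; lia). rewrite H by lia. auto. Qed.
Lemma ps_le K F G : (forall n, (1 <= n <= K)%nat -> F n <= G n) -> ps K F <= ps K G.
Proof. induction K; intros H; first [rewrite !ps_S; cbv beta | simpl]; [lra|]. generalize (IHK ltac:(intros; apply H; lia)) (H (S K) ltac:(lia)). lra. Qed.
Lemma ps_plus K F G : ps K (fun n => F n + G n) = ps K F + ps K G.
Proof. induction K; first [rewrite !ps_S; cbv beta | simpl]; [ring|]. rewrite IHK; ring. Qed.
Lemma ps_scal K c F : ps K (fun n => c * F n) = c * ps K F.
Proof. induction K; first [rewrite !ps_S; cbv beta | simpl]; [ring|]. rewrite IHK; ring. Qed.
Lemma cont_ps K (F : nat -> R -> R) : (forall n, cont (F n)) -> cont (fun x => ps K (fun n => F n x)).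
Proof. intros H. induction K; [apply (cont_const 0)|]. apply (cont_plus (fun x => ps K (fun n => F n x)) (F (S K))); auto. Qed.
Lemma mean_ps K (F : nat -> R -> R) : (forall n, cont (F n)) -> mean (fun x => ps K (fun n => F n x)) = ps K (fun n => mean (F n)).
Proof.
intros H. induction K; [apply (mean_const 0)|]. assert (C := cont_ps K F H). assert (c1 := H (S K)).
rewrite ps_S, <- IHK, <- mean_plus by cnt. reflexivity.
Qed.
Lemma zs_ps_swap K L F : zs K (fun n => ps L (fun j => F n j)) = ps L (fun j => zs K (fun n => F n j)).
Proof. induction K; zsimp; auto. rewrite IHK, <- !ps_plus. auto. Qed.

Definition tu K (xr xi : Z -> R) s := zs K (fun n => xr n * cos (IZR n * s) - xi n * sin (IZR n * s)).
Definition tv K (xr xi : Z -> R) s := zs K (fun n => xr n * sin (IZR n * s) + xi n * cos (IZR n * s)).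
Definition fr (gu gv : R -> R) (n : Z) := mean (fun s => gu s * cos (IZR n * s) + gv s * sin (IZR n * s)).
Definition fi (gu gv : R -> R) (n : Z) := mean (fun s => gv s * cos (IZR n * s) - gu s * sin (IZR n * s)).

Lemma cont_tu K xr xi : cont (tu K xr xi).
Proof. apply (cont_zs K (fun n s => xr n * cos (IZR n * s) - xi n * sin (IZR n * s))). intros; cnt. Qed.
Lemma cont_tv K xr xi : cont (tv K xr xi).
Proof. apply (cont_zs K (fun n s => xr n * sin (IZR n * s) + xi n * cos (IZR n * s))). intros; cnt. Qed.
#[export] Hint Resolve cont_tu cont_tv : cnt.

Lemma pairing K xr xi gu gv : cont gu -> cont gv ->
  mean (fun s => gu s * tu K xr xi s + gv s * tv K xr xi s) = zs K (fun n => fr gu gv n * xr n + fi gu gv n * xi n).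
Proof.
intros Cu Cv. rewrite (mean_ext _ (fun s => zs K (fun n => xr n * (gu s * cos (IZR n * s) + gv s * sin (IZR n * s)) + xi n * (gv s * cos (IZR n * s) - gu s * sin (IZR n * s))))).
- rewrite (mean_zs K (fun n s => xr n * (gu s * cos (IZR n * s) + gv s * sin (IZR n * s)) + xi n * (gv s * cos (IZR n * s) - gu s * sin (IZR n * s)))) by (intros; cnt).
  apply zs_ext; intros n _. rewrite mean_plus, !mean_scal by cnt. unfold fr, fi. ring.
- intros s. unfold tu, tv. rewrite <- !zs_scal, <- zs_plus. apply zs_ext; intros; ring.
Qed.

(** With vanishing sine moments, multiplication by [Q] acts on Fourier coefficients as the real
    Toeplitz matrix [k (n - m)], on real and imaginary parts separately. *)
Definition moments (Q : R -> R) (k : Z -> R) := cont Q /\ forall n, mean (fun s => Q s * cos (IZR n * s)) = k n /\ mean (fun s => Q s * sin (IZR n * s)) = 0.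

Lemma fr_trig Q k K xr xi m : moments Q k -> fr (fun s => Q s * tu K xr xi s) (fun s => Q s * tv K xr xi s) m = zs K (fun n => k (n - m)%Z * xr n).
Proof.
intros [C M]. unfold fr. rewrite (mean_ext _ (fun s => zs K (fun n => xr n * (Q s * cos (IZR (n - m) * s)) - xi n * (Q s * sin (IZR (n - m) * s))))).
- rewrite (mean_zs K (fun n s => xr n * (Q s * cos (IZR (n - m) * s)) - xi n * (Q s * sin (IZR (n - m) * s)))) by (intros; cnt).
  apply zs_ext; intros n _. rewrite mean_minus, !mean_scal by cnt. destruct (M (n - m)%Z) as [-> ->]. ring.
- intros s. unfold tu, tv. rewrite !(Rmult_comm (_ * zs _ _)), <- !Rmult_assoc, <- !zs_scal, <- zs_plus. apply zs_ext; intros n _.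
  rewrite minus_IZR, Rmult_minus_distr_r, cos_minus, sin_minus. ring.
Qed.
Lemma fi_trig Q k K xr xi m : moments Q k -> fi (fun s => Q s * tu K xr xi s) (fun s => Q s * tv K xr xi s) m = zs K (fun n => k (n - m)%Z * xi n).
Proof.
intros [C M]. unfold fi. rewrite (mean_ext _ (fun s => zs K (fun n => xi n * (Q s * cos (IZR (n - m) * s)) + xr n * (Q s * sin (IZR (n - m) * s))))).
- rewrite (mean_zs K (fun n s => xi n * (Q s * cos (IZR (n - m) * s)) + xr n * (Q s * sin (IZR (n - m) * s)))) by (intros; cnt).
  apply zs_ext; intros n _. rewrite mean_plus, !mean_scal by cnt. destruct (M (n - m)%Z) as [-> ->]. ring.
- intros s. unfold tu, tv. rewrite !(Rmult_comm (_ * zs _ _)), <- !Rmult_assoc, <- !zs_scal, <- zs_minus. apply zs_ext; intros n _.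
  rewrite minus_IZR, Rmult_minus_distr_r, cos_minus, sin_minus. ring.
Qed.

Lemma bilinear Q k K xr xi yr yi : moments Q k ->
  mean (fun s => Q s * (tu K xr xi s * tu K yr yi s + tv K xr xi s * tv K yr yi s)) =
  zs K (fun m => zs K (fun n => k (n - m)%Z * (xr n * yr m + xi n * yi m))).
Proof.
intros M. assert (C := proj1 M).
rewrite (mean_ext _ (fun s => (Q s * tu K xr xi s) * tu K yr yi s + (Q s * tv K xr xi s) * tv K yr yi s)) by (intros; ring).
rewrite (pairing K yr yi (fun s => Q s * tu K xr xi s) (fun s => Q s * tv K xr xi s)) by cnt.
apply zs_ext; intros m _. rewrite (fr_trig Q k), (fi_trig Q k) by auto.
rewrite Rmult_comm, (Rmult_comm _ (yi m)), <- !zs_scal, <- zs_plus. apply zs_ext; intros; ring.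
Qed.

Lemma moments_even Q (k : nat -> R) : cont Q -> periodic Q -> (forall s, Q (- s) = Q s) ->
  (forall n, mean (fun s => Q s * cos (INR n * s)) = k n) -> moments Q (fun n => k (Z.abs_nat n)).
Proof.
intros C P E M. split; auto. intros n. split.
- rewrite <- M. apply mean_ext; intros s. f_equal. rewrite INR_IZR_INZ, Zabs2Nat.id_abs.
  destruct (Z_le_dec 0 n). now rewrite Z.abs_eq. rewrite Z.abs_neq, opp_IZR by lia.
  now rewrite Ropp_mult_distr_l_reverse, cos_neg.
- apply mean_odd; [cnt | apply per_mult; auto; apply per_sinZ |].
  intros s. rewrite E, Ropp_mult_distr_r_reverse, sin_neg. ring.
Qed.
Lemma moments_pk a : 0 <= a < 1 -> moments (pk a) (fun n => a ^ Z.abs_nat n).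
Proof. intros Ha. apply (moments_even (pk a) (fun n => a ^ n)); auto using pk_per, pk_even. apply cont_pk; lra. now apply pk_moments. Qed.
Lemma moments_pk2 a : 0 <= a < 1 -> moments (fun s => pk a s * pk a s) (fun n => a ^ Z.abs_nat n * (m0 a + INR (Z.abs_nat n))).
Proof.
intros Ha. assert (C : cont (pk a)) by (apply cont_pk; lra).
apply (moments_even (fun s => pk a s * pk a s) (fun n => a ^ n * (m0 a + INR n))).
- cnt.
- apply per_mult; apply pk_per.
- intros s; now rewrite pk_even.
- now apply pk2_moments.
Qed.
Lemma moments_1 : moments (fun _ => 1) (fun n => if Z.eq_dec n 0 then 1 else 0).
Proof.
split; [cnt|]. intros n. rewrite (mean_ext (fun s => 1 * sin (IZR n * s)) (fun s => sin (IZR n * s))) by (intros; ring). rewrite mean_sinZ. split; auto.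
rewrite (mean_ext _ (fun s => cos (IZR n * s))) by (intros; ring).
destruct Z.eq_dec; [|now apply mean_cosZ]. subst. rewrite (mean_ext _ (fun _ => 1)). apply mean_const. intros. now rewrite Rmult_0_l, cos_0.
Qed.

(** Its coefficients are [|n| a^|n|]: this is the half-derivative of the Poisson kernel, that is the
    operator [|n|] applied to it. In particular its mean is zero. *)
Definition dk a s := pk a s * pk a s - m0 a * pk a s.
Lemma moments_dk a : 0 <= a < 1 -> moments (dk a) (fun n => a ^ Z.abs_nat n * INR (Z.abs_nat n)).
Proof.
intros Ha. destruct (moments_pk a Ha) as [C M]. destruct (moments_pk2 a Ha) as [C2 M2]. split. unfold dk; cnt.
intros n. destruct (M n) as [A B]. destruct (M2 n) as [A2 B2]. unfold dk.
rewrite (mean_ext _ (fun s => pk a s * pk a s * cos (IZR n * s) - m0 a * (pk a s * cos (IZR n * s)))) by (intros; ring).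
rewrite (mean_ext (fun s => (_ - _) * sin _) (fun s => pk a s * pk a s * sin (IZR n * s) - m0 a * (pk a s * sin (IZR n * s)))) by (intros; ring).
rewrite !mean_minus, !mean_scal by cnt. rewrite A, B, A2, B2. split; ring.
Qed.

Lemma fr_coef K xr xi m : (Z.abs m <= Z.of_nat K)%Z -> fr (tu K xr xi) (tv K xr xi) m = xr m.
Proof.
intros Hm. etransitivity; [|etransitivity; [apply (fr_trig _ _ K xr xi m moments_1)|]].
- apply mean_ext; intros; ring.
- rewrite (zs_single K _ m); auto. rewrite Z.sub_diag; simpl; ring. intros n Hn. destruct Z.eq_dec; [lia|ring].
Qed.
Lemma fi_coef K xr xi m : (Z.abs m <= Z.of_nat K)%Z -> fi (tu K xr xi) (tv K xr xi) m = xi m.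
Proof.
intros Hm. etransitivity; [|etransitivity; [apply (fi_trig _ _ K xr xi m moments_1)|]].
- apply mean_ext; intros; ring.
- rewrite (zs_single K _ m); auto. rewrite Z.sub_diag; simpl; ring. intros n Hn. destruct Z.eq_dec; [lia|ring].
Qed.

Lemma mean_trig_sq K xr xi : mean (fun s => tu K xr xi s * tu K xr xi s + tv K xr xi s * tv K xr xi s) = zs K (fun n => xr n * xr n + xi n * xi n).
Proof.
rewrite pairing by cnt. apply zs_ext; intros n Hn. now rewrite fr_coef, fi_coef.
Qed.

Lemma dist_trig K xr xi gu gv : cont gu -> cont gv ->
  mean (fun s => (gu s - tu K xr xi s) * (gu s - tu K xr xi s) + (gv s - tv K xr xi s) * (gv s - tv K xr xi s)) =
  mean (fun s => gu s * gu s + gv s * gv s) - 2 * zs K (fun n => fr gu gv n * xr n + fi gu gv n * xi n) + zs K (fun n => xr n * xr n + xi n * xi n).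
Proof.
intros Cu Cv. rewrite <- pairing, <- mean_trig_sq by cnt. rewrite <- mean_scal, <- mean_minus, <- mean_plus by cnt.
apply mean_ext; intros; ring.
Qed.

Lemma bessel K gu gv : cont gu -> cont gv ->
  zs K (fun n => fr gu gv n * fr gu gv n + fi gu gv n * fi gu gv n) <= mean (fun s => gu s * gu s + gv s * gv s).
Proof.
intros Cu Cv. assert (E := dist_trig K (fr gu gv) (fi gu gv) gu gv Cu Cv).
assert (P : 0 <= mean (fun s => (gu s - tu K (fr gu gv) (fi gu gv) s) * (gu s - tu K (fr gu gv) (fi gu gv) s) + (gv s - tv K (fr gu gv) (fi gu gv) s) * (gv s - tv K (fr gu gv) (fi gu gv) s))).
{ apply mean_ge0; [cnt|]. intros s. generalize (sq_ge0 (gu s - tu K (fr gu gv) (fi gu gv) s)) (sq_ge0 (gv s - tv K (fr gu gv) (fi gu gv) s)); lra. }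
lra.
Qed.

Lemma best_approx K xr xi gu gv : cont gu -> cont gv ->
  mean (fun s => (gu s - tu K (fr gu gv) (fi gu gv) s) * (gu s - tu K (fr gu gv) (fi gu gv) s) + (gv s - tv K (fr gu gv) (fi gu gv) s) * (gv s - tv K (fr gu gv) (fi gu gv) s))
  <= mean (fun s => (gu s - tu K xr xi s) * (gu s - tu K xr xi s) + (gv s - tv K xr xi s) * (gv s - tv K xr xi s)).
Proof.
intros Cu Cv. rewrite !dist_trig by auto.
assert (0 <= zs K (fun n => (xr n - fr gu gv n) * (xr n - fr gu gv n) + (xi n - fi gu gv n) * (xi n - fi gu gv n))).
{ apply zs_ge0; intros n _. generalize (sq_ge0 (xr n - fr gu gv n)) (sq_ge0 (xi n - fi gu gv n)); lra. }
rewrite (zs_ext K _ (fun n => (xr n * xr n + xi n * xi n) - 2 * (fr gu gv n * xr n + fi gu gv n * xi n) + (fr gu gv n * fr gu gv n + fi gu gv n * fi gu gv n))) in H by (intros; ring).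
rewrite zs_plus, zs_minus, zs_scal in H. lra.
Qed.

Lemma ps_geom a K : (1 - a * a) * ps K (fun j => a ^ (j - 1) * a ^ (j - 1)) = 1 - a ^ K * a ^ K.
Proof.
induction K; [simpl; ring|]. rewrite ps_S, Rmult_plus_distr_l, IHK. replace (S K - 1)%nat with K by lia. simpl; ring.
Qed.

(** Cauchy-Schwarz against the geometric weights, whose squares sum to less than [1 / (1 - a^2)]. *)
Lemma ps_CS a K (p : nat -> R) : 0 <= a < 1 ->
  (1 - a * a) * (ps K (fun j => a ^ (j - 1) * p j) * ps K (fun j => a ^ (j - 1) * p j)) <= ps K (fun j => p j * p j).
Proof.
intros Ha. set (k := ps K (fun j => a ^ (j - 1) * p j)). set (c := (1 - a * a) * k).
assert (P : 0 <= ps K (fun j => (p j - c * a ^ (j - 1)) * (p j - c * a ^ (j - 1)))).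
{ rewrite <- (Rmult_0_l (ps K (fun _ => 0))), <- ps_scal. apply ps_le. intros. rewrite Rmult_0_l. apply sq_ge0. }
rewrite (ps_ext K _ (fun j => (p j * p j + (-2 * c) * (a ^ (j - 1) * p j)) + (c * c) * (a ^ (j - 1) * a ^ (j - 1)))) in P by (intros; ring).
rewrite !ps_plus, !ps_scal in P. fold k in P. assert (G := ps_geom a K).
assert (E : c * c * ps K (fun j => a ^ (j - 1) * a ^ (j - 1)) = c * k * (1 - a ^ K * a ^ K)) by (rewrite <- G; unfold c; ring).
assert (ck : 0 <= c * k) by (unfold c; generalize (sq_ge0 k); assert (0 <= 1 - a * a) by nra; intros; rewrite Rmult_assoc; now apply Rmult_le_pos).
assert (0 <= c * k * (a ^ K * a ^ K)) by (apply Rmult_le_pos; auto; apply sq_ge0).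
fold c. rewrite <- Rmult_assoc. fold c. lra.
Qed.

(* With [P_j = e^(-ij s) sum_(n >= j) c_n e^(ins)] one has [P_j = c_j + e P_(j+1)], so
   [(e - a) sum_j a^(j-1) P_j] telescopes to [sum_j (e^(ij s) - a^j) c_j]. *)
Lemma telescoping a er ei (pr pi cr ci : nat -> R) K :
  (forall j, (1 <= j <= K)%nat -> pr j = cr j + (er * pr (S j) - ei * pi (S j))) ->
  (forall j, (1 <= j <= K)%nat -> pi j = ci j + (er * pi (S j) + ei * pr (S j))) ->
  let kr := ps K (fun j => a ^ (j - 1) * pr j) in let ki := ps K (fun j => a ^ (j - 1) * pi j) in
  (er - a) * kr - ei * ki = (er * pr 1%nat - ei * pi 1%nat) - a ^ K * (er * pr (S K) - ei * pi (S K)) - ps K (fun j => a ^ j * cr j) /\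
  (er - a) * ki + ei * kr = (er * pi 1%nat + ei * pr 1%nat) - a ^ K * (er * pi (S K) + ei * pr (S K)) - ps K (fun j => a ^ j * ci j).
Proof.
intros Hr Hi. induction K; cbv zeta; [simpl; split; ring|].
destruct IHK as [E1 E2]; [intros; apply Hr; lia | intros; apply Hi; lia |].
rewrite !ps_S. replace (S K - 1)%nat with K by lia. specialize (Hr (S K) ltac:(lia)). specialize (Hi (S K) ltac:(lia)).
set (kr := ps K (fun j => a ^ (j - 1) * pr j)) in *. set (ki := ps K (fun j => a ^ (j - 1) * pi j)) in *.
split.
- replace ((er - a) * (kr + a ^ K * pr (S K)) - ei * (ki + a ^ K * pi (S K))) with (((er - a) * kr - ei * ki) + a ^ K * (er * pr (S K) - ei * pi (S K)) - a * a ^ K * pr (S K)) by ring.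
  rewrite E1. rewrite Hr at 3. simpl pow. ring.
- replace ((er - a) * (ki + a ^ K * pi (S K)) + ei * (kr + a ^ K * pr (S K))) with (((er - a) * ki + ei * kr) + a ^ K * (er * pi (S K) + ei * pr (S K)) - a * a ^ K * pi (S K)) by ring.
  rewrite E2. rewrite Hi at 3. simpl pow. ring.
Qed.

Definition cut (j : nat) (x : Z -> R) n := if Z_le_dec (Z.of_nat j) n then x n else 0.

Lemma tu_cut_0 K j xr xi s : (K < j)%nat -> tu K (cut j xr) (cut j xi) s = 0 /\ tv K (cut j xr) (cut j xi) s = 0.
Proof.
intros H. split; apply zs_0; intros n Hn; unfold cut; destruct Z_le_dec; try lia; ring.
Qed.

Lemma tu_cut_S K j xr xi s : (1 <= j <= K)%nat ->
  tu K (cut j xr) (cut j xi) s = (xr (Z.of_nat j) * cos (IZR (Z.of_nat j) * s) - xi (Z.of_nat j) * sin (IZR (Z.of_nat j) * s)) + tu K (cut (S j) xr) (cut (S j) xi) s /\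
  tv K (cut j xr) (cut j xi) s = (xr (Z.of_nat j) * sin (IZR (Z.of_nat j) * s) + xi (Z.of_nat j) * cos (IZR (Z.of_nat j) * s)) + tv K (cut (S j) xr) (cut (S j) xi) s.
Proof.
intros H.
assert (G : forall F : R -> R -> Z -> R, (forall n, F 0 0 n = 0) -> zs K (fun n => F (cut j xr n) (cut j xi n) n) = F (xr (Z.of_nat j)) (xi (Z.of_nat j)) (Z.of_nat j) + zs K (fun n => F (cut (S j) xr n) (cut (S j) xi n) n)).
{ intros F F0. rewrite (zs_ext K _ (fun n => (if Z.eq_dec n (Z.of_nat j) then F (xr n) (xi n) n else 0) + F (cut (S j) xr n) (cut (S j) xi n) n)).
  - rewrite zs_plus. f_equal. rewrite (zs_single K _ (Z.of_nat j)) by (try lia; intros n Hn; destruct Z.eq_dec; auto; lia).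
    destruct Z.eq_dec; auto; lia.
  - intros n _. unfold cut. destruct Z.eq_dec; repeat destruct Z_le_dec; try lia; rewrite ?F0; ring. }
split.
- apply (G (fun a b n => a * cos (IZR n * s) - b * sin (IZR n * s))). intros; ring.
- apply (G (fun a b n => a * sin (IZR n * s) + b * cos (IZR n * s))). intros; ring.
Qed.

Lemma zs_cut1 K a (x : Z -> R) : zs K (fun n => a ^ Z.abs_nat n * cut 1 x n) = ps K (fun j => a ^ j * x (Z.of_nat j)).
Proof.
induction K. { rewrite zs_O. unfold cut. destruct Z_le_dec; [lia|]. simpl; ring. }
rewrite zs_S, ps_S, IHK. unfold cut at 1 2. destruct Z_le_dec; [|lia]. destruct Z_le_dec; [lia|].
replace (Z.abs_nat (Z.of_nat (S K))) with (S K) by lia. ring.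
Qed.

(* The square of the modulus of the left-hand side is bounded by Cauchy-Schwarz,
   and [|e - a|^2 = pd a]. *)
Lemma positive_part a K xr xi s : 0 <= a < 1 ->
  let A := zs K (fun n => a ^ Z.abs_nat n * cut 1 xr n) in let B := zs K (fun n => a ^ Z.abs_nat n * cut 1 xi n) in
  pk a s * pk a s * ((tu K (cut 1 xr) (cut 1 xi) s - A) * (tu K (cut 1 xr) (cut 1 xi) s - A) + (tv K (cut 1 xr) (cut 1 xi) s - B) * (tv K (cut 1 xr) (cut 1 xi) s - B))
  <= pk a s * ps K (fun j => tu K (cut j xr) (cut j xi) s * tu K (cut j xr) (cut j xi) s + tv K (cut j xr) (cut j xi) s * tv K (cut j xr) (cut j xi) s).
Proof.
intros Ha. cbv zeta. rewrite !zs_cut1.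
set (pr j := tu K (cut j xr) (cut j xi) s * cos (INR j * s) + tv K (cut j xr) (cut j xi) s * sin (INR j * s)).
set (pi j := tv K (cut j xr) (cut j xi) s * cos (INR j * s) - tu K (cut j xr) (cut j xi) s * sin (INR j * s)).
assert (SC : forall y, sin y * sin y + cos y * cos y = 1) by (intros y; apply sin2_cos2).
destruct (telescoping a (cos s) (sin s) pr pi (fun j => xr (Z.of_nat j)) (fun j => xi (Z.of_nat j)) K) as [E1 E2].
{ intros j Hj. unfold pr, pi. destruct (tu_cut_S K j xr xi s Hj) as [-> ->]. rewrite <- !INR_IZR_INZ, S_INR.
  replace ((INR j + 1) * s) with (INR j * s + s) by ring. rewrite cos_plus, sin_plus.
  set (U := tu K (cut (S j) xr) (cut (S j) xi) s). set (V := tv K (cut (S j) xr) (cut (S j) xi) s).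
  assert (Q := SC (INR j * s)). assert (Q1 := SC s). set (c := cos (INR j * s)) in *. set (d := sin (INR j * s)) in *. set (e := cos s) in *. set (f := sin s) in *.
  replace (xr (Z.of_nat j)) with (xr (Z.of_nat j) * (d * d + c * c)) at 3 by (rewrite Q; ring).
  transitivity (xr (Z.of_nat j) * (d * d + c * c) + (U * c + V * d) * 1); [ring|]. rewrite <- Q1. ring. }
{ intros j Hj. unfold pr, pi. destruct (tu_cut_S K j xr xi s Hj) as [-> ->]. rewrite <- !INR_IZR_INZ, S_INR.
  replace ((INR j + 1) * s) with (INR j * s + s) by ring. rewrite cos_plus, sin_plus.
  set (U := tu K (cut (S j) xr) (cut (S j) xi) s). set (V := tv K (cut (S j) xr) (cut (S j) xi) s).
  assert (Q := SC (INR j * s)). assert (Q1 := SC s). set (c := cos (INR j * s)) in *. set (d := sin (INR j * s)) in *. set (e := cos s) in *. set (f := sin s) in *.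
  replace (xi (Z.of_nat j)) with (xi (Z.of_nat j) * (d * d + c * c)) at 3 by (rewrite Q; ring).
  transitivity (xi (Z.of_nat j) * (d * d + c * c) + (V * c - U * d) * 1); [ring|]. rewrite <- Q1. ring. }
assert (Z1 : pr (S K) = 0) by (unfold pr; destruct (tu_cut_0 K (S K) xr xi s ltac:(lia)) as [-> ->]; ring).
assert (Z2 : pi (S K) = 0) by (unfold pi; destruct (tu_cut_0 K (S K) xr xi s ltac:(lia)) as [-> ->]; ring).
rewrite Z1, Z2 in E1, E2.
assert (F1 : cos s * pr 1%nat - sin s * pi 1%nat = tu K (cut 1 xr) (cut 1 xi) s).
{ unfold pr, pi. simpl INR. rewrite Rmult_1_l. transitivity (tu K (cut 1 xr) (cut 1 xi) s * (sin s * sin s + cos s * cos s)); [ring|]. rewrite SC; ring. }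
assert (F2 : cos s * pi 1%nat + sin s * pr 1%nat = tv K (cut 1 xr) (cut 1 xi) s).
{ unfold pr, pi. simpl INR. rewrite Rmult_1_l. transitivity (tv K (cut 1 xr) (cut 1 xi) s * (sin s * sin s + cos s * cos s)); [ring|]. rewrite SC; ring. }
rewrite F1 in E1. rewrite F2 in E2.
set (kr := ps K (fun j => a ^ (j - 1) * pr j)) in *. set (ki := ps K (fun j => a ^ (j - 1) * pi j)) in *.
set (A := ps K (fun j => a ^ j * xr (Z.of_nat j))) in *. set (B := ps K (fun j => a ^ j * xi (Z.of_nat j))) in *.
replace (tu K (cut 1 xr) (cut 1 xi) s - A) with ((cos s - a) * kr - sin s * ki) by lra.
replace (tv K (cut 1 xr) (cut 1 xi) s - B) with ((cos s - a) * ki + sin s * kr) by lra.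
assert (PP := pk_pos a s ltac:(lra)). assert (dp := pd_pos a s ltac:(lra)). rewrite Rmult_assoc. apply Rmult_le_compat_l; [lra|].
replace (pk a s * (((cos s - a) * kr - sin s * ki) * ((cos s - a) * kr - sin s * ki) + ((cos s - a) * ki + sin s * kr) * ((cos s - a) * ki + sin s * kr))) with ((1 - a * a) * (kr * kr) + (1 - a * a) * (ki * ki)).
- rewrite (ps_ext K _ (fun j => pr j * pr j + pi j * pi j)).
  + rewrite ps_plus. apply Rplus_le_compat; now apply ps_CS.
  + intros j _. unfold pr, pi. assert (Q := SC (INR j * s)). set (c := cos (INR j * s)) in *. set (d := sin (INR j * s)) in *.
    set (U := tu K (cut j xr) (cut j xi) s). set (V := tv K (cut j xr) (cut j xi) s).
    transitivity ((U * U + V * V) * (d * d + c * c)); [rewrite Q; ring | ring].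
- assert (dE : pd a s = (cos s - a) * (cos s - a) + sin s * sin s) by (unfold pd; assert (Q := SC s); lra).
  unfold pk. apply (Rmult_eq_reg_r (pd a s)); [|lra].
  transitivity ((1 - a * a) * (kr * kr + ki * ki) * pd a s); [ring|]. rewrite dE at 1.
  unfold Rdiv. field_simplify; [|lra]. ring.
Qed.

(** The frequencies at most [-j], reduced to [cut] by reflection: complex conjugation exchanges the
    two sides, as [tu_cutm] records. *)
Definition cutm j (x : Z -> R) n := cut j (fun k => x (- k)%Z) (- n)%Z.

Lemma tu_cutm K j xr xi s :
  tu K (cutm j xr) (cutm j xi) s = tu K (cut j (fun k => xr (- k)%Z)) (cut j (fun k => - xi (- k)%Z)) s /\
  tv K (cutm j xr) (cutm j xi) s = - tv K (cut j (fun k => xr (- k)%Z)) (cut j (fun k => - xi (- k)%Z)) s.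
Proof.
unfold tu, tv. split.
- rewrite <- zs_neg. apply zs_ext; intros n _. unfold cutm, cut. rewrite opp_IZR, Ropp_mult_distr_l_reverse, cos_neg, sin_neg, Z.opp_involutive.
  destruct Z_le_dec; ring.
- replace (- zs K _) with ((-1) * zs K (fun n => cut j (fun k => xr (- k)%Z) n * sin (IZR n * s) + cut j (fun k => - xi (- k)%Z) n * cos (IZR n * s))) by ring.
  rewrite <- zs_scal, <- zs_neg. apply zs_ext; intros n _. unfold cutm, cut. rewrite opp_IZR, Ropp_mult_distr_l_reverse, cos_neg, sin_neg, Z.opp_involutive.
  destruct Z_le_dec; ring.
Qed.

Definition ind (j : nat) (n : Z) := if Z_le_dec (Z.of_nat j) n then 1 else 0.
Lemma cut_ind j x n : cut j x n = ind j n * x n.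
Proof. unfold cut, ind. destruct Z_le_dec; ring. Qed.
Lemma cutm_ind j x n : cutm j x n = ind j (- n) * x n.
Proof. unfold cutm. rewrite cut_ind, Z.opp_involutive. auto. Qed.
Lemma ps_ind K n m : ps K (fun j => ind j n * ind j m) = IZR (Z.max 0 (Z.min (Z.min n m) (Z.of_nat K))).
Proof.
induction K. simpl. f_equal; lia. rewrite ps_S, IHK. unfold ind.
destruct Z_le_dec; [destruct Z_le_dec|].
- replace (1 * 1) with (IZR 1) by ring. rewrite <- plus_IZR. f_equal; lia.
- rewrite Rmult_0_r, Rplus_0_r. f_equal; lia.
- rewrite Rmult_0_l, Rplus_0_r. f_equal; lia.
Qed.

(** For equal signs [|n| + |m| = |n - m| + 2 min(|n|, |m|)], and the minimum counts the [j >= 1]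
    below both; for opposite signs the counts are zero and [|n| + |m| = |n - m|]. This splits the
    half-derivative form into one convolution term and the weighted norms of the tails. *)
Lemma abs_split K n m : (Z.abs n <= Z.of_nat K)%Z -> (Z.abs m <= Z.of_nat K)%Z ->
  IZR (Z.abs n) + IZR (Z.abs m) = INR (Z.abs_nat (n - m)) + 2 * (ps K (fun j => ind j n * ind j m) + ps K (fun j => ind j (- n) * ind j (- m))).
Proof.
intros Hn Hm. rewrite !ps_ind, INR_IZR_INZ, Zabs2Nat.id_abs, <- !plus_IZR, <- mult_IZR, <- plus_IZR. f_equal. lia.
Qed.

(** * The half-derivative inequality with a Poisson weight *)

Section PositivePart.
Variables (a : R) (K : nat) (xr xi : Z -> R).
Hypothesis Ha : 0 <= a < 1.
(** [A + i B] is the value at the point [a] of the analytic function [F] with the positive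
    frequencies, so [pu + i pv] is [F - F(a)]. The primed constants and [mu + i mv] are the same for
    the negative frequencies. *)
Let A := zs K (fun n => a ^ Z.abs_nat n * cut 1 xr n).
Let B := zs K (fun n => a ^ Z.abs_nat n * cut 1 xi n).
Let A' := zs K (fun n => a ^ Z.abs_nat n * cutm 1 xr n).
Let B' := zs K (fun n => a ^ Z.abs_nat n * cutm 1 xi n).
Let pu s := tu K (cut 1 xr) (cut 1 xi) s - A.
Let pv s := tv K (cut 1 xr) (cut 1 xi) s - B.
Let mu s := tu K (cutm 1 xr) (cutm 1 xi) s - A'.
Let mv s := tv K (cutm 1 xr) (cutm 1 xi) s - B'.
Let sh (x : Z -> R) c n := if Z.eq_dec n 0 then - c else x n.

Lemma shift_tu x y c d s : x 0%Z = 0 -> y 0%Z = 0 -> tu K (sh x c) (sh y d) s = tu K x y s - c /\ tv K (sh x c) (sh y d) s = tv K x y s - d.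
Proof.
intros X Y. split.
- unfold tu. rewrite (zs_ext K _ (fun n => (x n * cos (IZR n * s) - y n * sin (IZR n * s)) + (if Z.eq_dec n 0 then - c else 0))).
  + rewrite zs_plus, (zs_single K (fun n => if Z.eq_dec n 0 then - c else 0) 0); [simpl; ring | lia | intros; destruct Z.eq_dec; auto; lia].
  + intros n _. unfold sh. destruct Z.eq_dec; [subst; rewrite X, Y, Rmult_0_l, sin_0, cos_0|]; ring.
- unfold tv. rewrite (zs_ext K _ (fun n => (x n * sin (IZR n * s) + y n * cos (IZR n * s)) + (if Z.eq_dec n 0 then - d else 0))).
  + rewrite zs_plus, (zs_single K (fun n => if Z.eq_dec n 0 then - d else 0) 0); [simpl; ring | lia | intros; destruct Z.eq_dec; auto; lia].
  + intros n _. unfold sh. destruct Z.eq_dec; [subst; rewrite X, Y, Rmult_0_l, sin_0, cos_0|]; ring.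
Qed.

Lemma cut_0 x : cut 1 x 0 = 0.
Proof. unfold cut. destruct Z_le_dec; auto; lia. Qed.

(** For [n >= 0 >= m] the coefficient of [pk^2] splits, since [|n - m| = n + |m|]. The constant
    subtracted at frequency 0 cancels the part proportional to [m0 + |m|], and only the factor
    [a^|m|] keeps a trace of [m]. *)
Lemma shift_moment (x : Z -> R) m : (m <= 0)%Z ->
  zs K (fun n => a ^ Z.abs_nat (n - m) * (m0 a + INR (Z.abs_nat (n - m))) * sh (cut 1 x) (zs K (fun n => a ^ Z.abs_nat n * cut 1 x n)) n) =
  a ^ Z.abs_nat m * zs K (fun n => a ^ Z.abs_nat n * INR (Z.abs_nat n) * cut 1 x n).
Proof.
intros Hm. set (S0 := zs K (fun n => a ^ Z.abs_nat n * cut 1 x n)).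
rewrite (zs_ext K _ (fun n => ((if Z.eq_dec n 0 then - S0 * (a ^ Z.abs_nat m * (m0 a + INR (Z.abs_nat m))) else 0) +
   a ^ Z.abs_nat m * (m0 a + INR (Z.abs_nat m)) * (a ^ Z.abs_nat n * cut 1 x n)) + a ^ Z.abs_nat m * (a ^ Z.abs_nat n * INR (Z.abs_nat n) * cut 1 x n))).
- rewrite !zs_plus, !zs_scal. fold S0. rewrite (zs_single K _ 0); [|lia | intros; destruct Z.eq_dec; auto; lia].
  destruct Z.eq_dec; [ring|lia].
- intros n _. unfold sh. destruct Z.eq_dec.
  + subst. rewrite cut_0. replace (Z.abs_nat (0 - m)) with (Z.abs_nat m) by lia. ring.
  + unfold cut. destruct Z_le_dec; [|ring]. replace (Z.abs_nat (n - m)) with (Z.abs_nat n + Z.abs_nat m)%nat by lia.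
    rewrite plus_INR, pow_add. ring.
Qed.

(** By [shift_moment] the coefficients of [pk^2 (pu + i pv)] at frequencies [m <= 0] are multiples
    of [a^|m|]. Paired with the coefficients of [mu + i mv] they give the value of that function at
    [a], which is 0 after the subtraction. *)
Lemma cross_zero : mean (fun s => pk a s * pk a s * (pu s * mu s + pv s * mv s)) = 0.
Proof.
assert (c0 : cut 1 xr 0 = 0 /\ cut 1 xi 0 = 0) by (split; apply cut_0).
assert (c1 : cutm 1 xr 0 = 0 /\ cutm 1 xi 0 = 0) by (split; apply cut_0).
rewrite (mean_ext _ (fun s => pk a s * pk a s * (tu K (sh (cut 1 xr) A) (sh (cut 1 xi) B) s * tu K (sh (cutm 1 xr) A') (sh (cutm 1 xi) B') s +
  tv K (sh (cut 1 xr) A) (sh (cut 1 xi) B) s * tv K (sh (cutm 1 xr) A') (sh (cutm 1 xi) B') s))).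
2:{ intros s. destruct (shift_tu (cut 1 xr) (cut 1 xi) A B s) as [-> ->]; try tauto.
    destruct (shift_tu (cutm 1 xr) (cutm 1 xi) A' B' s) as [-> ->]; try tauto. }
rewrite (bilinear (fun s => pk a s * pk a s) _ K _ _ _ _ (moments_pk2 a Ha)).
set (Sr := zs K (fun n => a ^ Z.abs_nat n * INR (Z.abs_nat n) * cut 1 xr n)).
set (Si := zs K (fun n => a ^ Z.abs_nat n * INR (Z.abs_nat n) * cut 1 xi n)).
rewrite (zs_ext K _ (fun m => Sr * (a ^ Z.abs_nat m * sh (cutm 1 xr) A' m) + Si * (a ^ Z.abs_nat m * sh (cutm 1 xi) B' m))).
- rewrite zs_plus, !zs_scal.
  assert (G : forall x c, c = zs K (fun n => a ^ Z.abs_nat n * cutm 1 x n) -> zs K (fun m => a ^ Z.abs_nat m * sh (cutm 1 x) c m) = 0).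
  { intros x c Hc. rewrite (zs_ext K _ (fun n => a ^ Z.abs_nat n * cutm 1 x n + (if Z.eq_dec n 0 then - c else 0))).
    - rewrite zs_plus, (zs_single K (fun n => if Z.eq_dec n 0 then - c else 0) 0); [simpl; lra | lia | intros; destruct Z.eq_dec; auto; lia].
    - intros n _. unfold sh. destruct Z.eq_dec; [|ring]. subst n. replace (cutm 1 x 0) with 0 by (symmetry; apply cut_0). simpl; ring. }
  rewrite !G by reflexivity. ring.
- intros m _. destruct (Z_le_dec m 0) as [Hm|Hm].
  + rewrite (zs_ext K _ (fun n => sh (cutm 1 xr) A' m * (a ^ Z.abs_nat (n - m) * (m0 a + INR (Z.abs_nat (n - m))) * sh (cut 1 xr) A n) + sh (cutm 1 xi) B' m * (a ^ Z.abs_nat (n - m) * (m0 a + INR (Z.abs_nat (n - m))) * sh (cut 1 xi) B n))) by (intros; ring).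
    rewrite zs_plus, !zs_scal. unfold A, B. rewrite !shift_moment by auto. fold Sr Si. ring.
  + assert (Z : forall x c, sh (cutm 1 x) c m = 0).
    { intros x c. unfold sh, cutm, cut. destruct Z.eq_dec; [lia|]. destruct Z_le_dec; [lia|auto]. }
    rewrite !Z. rewrite zs_0; [ring | intros; ring].
Qed.

Let bu := fr (fun s => pk a s * tu K xr xi s) (fun s => pk a s * tv K xr xi s).
Let bv := fi (fun s => pk a s * tu K xr xi s) (fun s => pk a s * tv K xr xi s).

(** The form on the right has the symbol [|n|], symmetrised to [(|n| + |m|) / 2] and split by
    [abs_split]. The part [|n - m|] is the mean against [dk]. The counting parts are weighted norms
    of the tails of both signs, bounded below by [positive_part], and [cross_zero] adds the two
    signs to the square of [f - b_0]. *)
Lemma half_derivative_bound :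
  mean (fun s => dk a s * (tu K xr xi s * tu K xr xi s + tv K xr xi s * tv K xr xi s)) / 2 +
  mean (fun s => pk a s * pk a s * ((tu K xr xi s - bu 0) * (tu K xr xi s - bu 0) + (tv K xr xi s - bv 0) * (tv K xr xi s - bv 0)))
  <= zs K (fun n => IZR (Z.abs n) * (bu n * xr n + bv n * xi n)).
Proof.
assert (Cp : cont (pk a)) by (apply cont_pk; lra). assert (Cd : cont (dk a)) by (unfold dk; cnt).
assert (Mp := moments_pk a Ha).
set (d n m := a ^ Z.abs_nat (n - m) * (xr n * xr m + xi n * xi m)).
assert (Sym : forall n m, d n m = d m n).
{ intros n m. unfold d. replace (Z.abs_nat (n - m)) with (Z.abs_nat (m - n)) by lia. ring. }
assert (E : zs K (fun n => IZR (Z.abs n) * (bu n * xr n + bv n * xi n)) = zs K (fun m => zs K (fun n => (IZR (Z.abs n) + IZR (Z.abs m)) / 2 * d n m))).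
{ transitivity (zs K (fun m => zs K (fun n => IZR (Z.abs m) * d n m))).
  - apply zs_ext; intros m _. unfold bu, bv. rewrite (fr_trig _ _ K xr xi m Mp), (fi_trig _ _ K xr xi m Mp).
    rewrite zs_scal. f_equal. rewrite (Rmult_comm _ (xr m)), (Rmult_comm _ (xi m)), <- !zs_scal, <- zs_plus. apply zs_ext; intros; unfold d; ring.
  - assert (W : zs K (fun m => zs K (fun n => IZR (Z.abs m) * d n m)) = zs K (fun m => zs K (fun n => IZR (Z.abs n) * d n m))).
    { rewrite zs_swap. apply zs_ext; intros m _. apply zs_ext; intros n _. rewrite Sym. auto. }
    transitivity (zs K (fun m => zs K (fun n => IZR (Z.abs m) * d n m)) / 2 + zs K (fun m => zs K (fun n => IZR (Z.abs n) * d n m)) / 2).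
    rewrite <- W; field. unfold Rdiv. rewrite !(Rmult_comm _ (/ 2)), <- !zs_scal, <- zs_plus. apply zs_ext; intros m _.
    rewrite <- !zs_scal, <- zs_plus. apply zs_ext; intros; field. }
rewrite E. clear E.
(* The indicators [ind j n] and [ind j m] are absorbed into the coefficients, which become [cut j]
   and [cutm j] of them. *)
assert (E : zs K (fun m => zs K (fun n => (IZR (Z.abs n) + IZR (Z.abs m)) / 2 * d n m)) =
  zs K (fun m => zs K (fun n => / 2 * (a ^ Z.abs_nat (n - m) * INR (Z.abs_nat (n - m)) * (xr n * xr m + xi n * xi m)))) +
  (ps K (fun j => zs K (fun m => zs K (fun n => a ^ Z.abs_nat (n - m) * (cut j xr n * cut j xr m + cut j xi n * cut j xi m)))) +
   ps K (fun j => zs K (fun m => zs K (fun n => a ^ Z.abs_nat (n - m) * (cutm j xr n * cutm j xr m + cutm j xi n * cutm j xi m)))))).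
{ rewrite <- !zs_ps_swap. rewrite <- !zs_plus. apply zs_ext; intros m Hm. rewrite <- !zs_ps_swap, <- !zs_plus. apply zs_ext; intros n Hn.
  rewrite (abs_split K n m Hn Hm).
  rewrite (ps_ext K (fun j => a ^ Z.abs_nat (n - m) * (cut j xr n * cut j xr m + cut j xi n * cut j xi m)) (fun j => d n m * (ind j n * ind j m))) by (intros; rewrite !cut_ind; unfold d; ring).
  rewrite (ps_ext K (fun j => a ^ Z.abs_nat (n - m) * (cutm j xr n * cutm j xr m + cutm j xi n * cutm j xi m)) (fun j => d n m * (ind j (- n) * ind j (- m)))) by (intros; rewrite !cutm_ind; unfold d; ring).
  rewrite !ps_scal. unfold d. field. }
rewrite E. clear E. apply Rplus_le_compat.
{ right. rewrite (bilinear (dk a) _ K xr xi xr xi (moments_dk a Ha)). unfold Rdiv. rewrite Rmult_comm, <- zs_scal. apply zs_ext; intros m _. rewrite <- zs_scal. apply zs_ext; intros; ring. }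
rewrite (ps_ext K _ (fun j => mean (fun s => pk a s * (tu K (cut j xr) (cut j xi) s * tu K (cut j xr) (cut j xi) s + tv K (cut j xr) (cut j xi) s * tv K (cut j xr) (cut j xi) s)))).
2:{ intros j _. symmetry. apply (bilinear (pk a) _ K _ _ _ _ Mp). }
rewrite (ps_ext K (fun j => zs K _) (fun j => mean (fun s => pk a s * (tu K (cutm j xr) (cutm j xi) s * tu K (cutm j xr) (cutm j xi) s + tv K (cutm j xr) (cutm j xi) s * tv K (cutm j xr) (cutm j xi) s)))).
2:{ intros j _. symmetry. apply (bilinear (pk a) _ K _ _ _ _ Mp). }
rewrite <- !mean_ps by (intros; cnt).
assert (Cu : cont pu /\ cont pv /\ cont mu /\ cont mv) by (unfold pu, pv, mu, mv; repeat split; cnt). destruct Cu as (Cu1 & Cu2 & Cu3 & Cu4).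
replace (mean (fun s => pk a s * pk a s * ((tu K xr xi s - bu 0) * (tu K xr xi s - bu 0) + (tv K xr xi s - bv 0) * (tv K xr xi s - bv 0))))
  with (mean (fun s => pk a s * pk a s * (pu s * pu s + pv s * pv s)) + mean (fun s => pk a s * pk a s * (mu s * mu s + mv s * mv s)) + 2 * mean (fun s => pk a s * pk a s * (pu s * mu s + pv s * mv s))).
2:{ rewrite <- mean_scal, <- !mean_plus by cnt.
    (* The coefficient 0 of [pk f] is the harmonic extension of [f] at the point [a]: the constant
       term plus the values there of the two half series. *)
    assert (b0 : bu 0 = xr 0%Z + A + A' /\ bv 0 = xi 0%Z + B + B').
    { unfold bu, bv. rewrite (fr_trig _ _ K xr xi 0 Mp), (fi_trig _ _ K xr xi 0 Mp).
      assert (G : forall x : Z -> R, zs K (fun n => a ^ Z.abs_nat (n - 0) * x n) = x 0%Z + zs K (fun n => a ^ Z.abs_nat n * cut 1 x n) + zs K (fun n => a ^ Z.abs_nat n * cutm 1 x n)).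
      { intros x. rewrite (zs_ext K _ (fun n => (if Z.eq_dec n 0 then x 0%Z else 0) + a ^ Z.abs_nat n * cut 1 x n + a ^ Z.abs_nat n * cutm 1 x n)).
        - rewrite !zs_plus, (zs_single K (fun n => if Z.eq_dec n 0 then x 0%Z else 0) 0); [simpl; auto | lia | intros; destruct Z.eq_dec; auto; lia].
        - intros n _. rewrite Z.sub_0_r. unfold cutm, cut. rewrite Z.opp_involutive. destruct Z.eq_dec; repeat destruct Z_le_dec; try lia; subst; simpl; ring. }
      rewrite !G. auto. }
    destruct b0 as [-> ->]. apply mean_ext; intros s.
    assert (T : forall F : R -> R -> Z -> R, (forall n, F 0 0 n = 0) -> zs K (fun n => F (xr n) (xi n) n) = F (xr 0%Z) (xi 0%Z) 0%Z + zs K (fun n => F (cut 1 xr n) (cut 1 xi n) n) + zs K (fun n => F (cutm 1 xr n) (cutm 1 xi n) n)).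
    { intros F F0. rewrite (zs_ext K _ (fun n => (if Z.eq_dec n 0 then F (xr 0%Z) (xi 0%Z) 0%Z else 0) + F (cut 1 xr n) (cut 1 xi n) n + F (cutm 1 xr n) (cutm 1 xi n) n)).
      - rewrite !zs_plus, (zs_single K (fun n => if Z.eq_dec n 0 then F (xr 0%Z) (xi 0%Z) 0%Z else 0) 0); [simpl; auto | lia | intros; destruct Z.eq_dec; auto; lia].
      - intros n _. unfold cutm, cut. rewrite !Z.opp_involutive. destruct Z.eq_dec; repeat destruct Z_le_dec; try lia; subst; rewrite ?F0; ring. }
    assert (Tu : tu K xr xi s = xr 0%Z + tu K (cut 1 xr) (cut 1 xi) s + tu K (cutm 1 xr) (cutm 1 xi) s).
    { unfold tu. rewrite (T (fun a b n => a * cos (IZR n * s) - b * sin (IZR n * s))) by (intros; ring). rewrite Rmult_0_l, sin_0, cos_0. ring. }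
    assert (Tv : tv K xr xi s = xi 0%Z + tv K (cut 1 xr) (cut 1 xi) s + tv K (cutm 1 xr) (cutm 1 xi) s).
    { unfold tv. rewrite (T (fun a b n => a * sin (IZR n * s) + b * cos (IZR n * s))) by (intros; ring). rewrite Rmult_0_l, sin_0, cos_0. ring. }
    rewrite Tu, Tv. unfold pu, pv, mu, mv. ring. }
rewrite cross_zero, Rmult_0_r, Rplus_0_r.
assert (CS : forall xr xi, cont (fun s => ps K (fun j => pk a s * (tu K (cut j xr) (cut j xi) s * tu K (cut j xr) (cut j xi) s + tv K (cut j xr) (cut j xi) s * tv K (cut j xr) (cut j xi) s)))).
{ intros yr yi. apply (cont_ps K (fun j s => pk a s * (tu K (cut j yr) (cut j yi) s * tu K (cut j yr) (cut j yi) s + tv K (cut j yr) (cut j yi) s * tv K (cut j yr) (cut j yi) s))). intros; cnt. }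
apply Rplus_le_compat.
- apply mean_le; [cnt | apply CS |]. intros s. rewrite ps_scal. apply (positive_part a K xr xi s Ha).
- rewrite (mean_ext (fun s => ps K _) (fun s => ps K (fun j => pk a s * (tu K (cut j (fun k => xr (- k)%Z)) (cut j (fun k => - xi (- k)%Z)) s * tu K (cut j (fun k => xr (- k)%Z)) (cut j (fun k => - xi (- k)%Z)) s
    + tv K (cut j (fun k => xr (- k)%Z)) (cut j (fun k => - xi (- k)%Z)) s * tv K (cut j (fun k => xr (- k)%Z)) (cut j (fun k => - xi (- k)%Z)) s)))).
  2:{ intros s. apply ps_ext; intros j _. destruct (tu_cutm K j xr xi s) as [-> ->]. ring. }
  apply mean_le; [cnt | apply CS |]. intros s. rewrite ps_scal.
  assert (P := positive_part a K (fun k => xr (- k)%Z) (fun k => - xi (- k)%Z) s Ha). cbv zeta in P.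
  eapply Rle_trans; [|exact P]. right. unfold mu, mv. destruct (tu_cutm K 1 xr xi s) as [-> ->].
  assert (EA : A' = zs K (fun n => a ^ Z.abs_nat n * cut 1 (fun k => xr (- k)%Z) n)).
  { unfold A'. rewrite <- zs_neg. apply zs_ext; intros n _. unfold cutm. rewrite Z.opp_involutive. f_equal. f_equal; lia. }
  assert (EB : B' = - zs K (fun n => a ^ Z.abs_nat n * cut 1 (fun k => - xi (- k)%Z) n)).
  { unfold B'. rewrite <- zs_neg. replace (- zs K _) with ((-1) * zs K (fun n => a ^ Z.abs_nat n * cut 1 (fun k => - xi (- k)%Z) n)) by ring. rewrite <- zs_scal.
    apply zs_ext; intros n _. unfold cutm, cut. rewrite Z.opp_involutive. replace (Z.abs_nat (- n)) with (Z.abs_nat n) by lia. destruct Z_le_dec; ring. }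
  rewrite EA, EB. ring.
Qed.
End PositivePart.

Lemma zs_odd K F : (forall n, F (- n)%Z = - F n) -> zs K F = 0.
Proof.
intros H. assert (E := zs_neg K F). rewrite (zs_ext K _ (fun n => (-1) * F n)) in E by (intros; rewrite H; ring).
rewrite zs_scal in E. lra.
Qed.

Lemma pks_zs a K y : pks a K y = zs K (fun n => a ^ Z.abs_nat n * cos (IZR n * y)).
Proof.
induction K.
- unfold pks, zs. simpl. rewrite Rmult_0_l, cos_0. ring.
- rewrite zs_S, <- IHK. unfold pks. rewrite tech5. replace (Z.abs_nat (- Z.of_nat (S K))) with (S K) by lia.
  replace (Z.abs_nat (Z.of_nat (S K))) with (S K) by lia. rewrite opp_IZR, Ropp_mult_distr_l_reverse, cos_neg, <- INR_IZR_INZ. ring.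
Qed.

Lemma cont_pks a K : cont (pks a K).
Proof.
apply (cont_ext (fun y => zs K (fun n => a ^ Z.abs_nat n * cos (IZR n * y)))). intros; symmetry; apply pks_zs.
apply (cont_zs K (fun n y => a ^ Z.abs_nat n * cos (IZR n * y))). intros; cnt.
Qed.
#[export] Hint Resolve cont_pks : cnt.

(** Convolution with the truncated kernel multiplies the coefficients by [a^|n|]; the sine
    contributions are odd in [n] and cancel. *)
Lemma pks_conv a K gu gv x : cont gu -> cont gv ->
  tu K (fun n => a ^ Z.abs_nat n * fr gu gv n) (fun n => a ^ Z.abs_nat n * fi gu gv n) x = mean (fun s => pks a K (x - s) * gu s) /\
  tv K (fun n => a ^ Z.abs_nat n * fr gu gv n) (fun n => a ^ Z.abs_nat n * fi gu gv n) x = mean (fun s => pks a K (x - s) * gv s).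
Proof.
intros Cu Cv.
assert (G : forall g : R -> R, cont g -> mean (fun s => pks a K (x - s) * g s) = zs K (fun n => a ^ Z.abs_nat n * mean (fun s => cos (IZR n * (x - s)) * g s))).
{ intros g C. rewrite (mean_ext _ (fun s => zs K (fun n => a ^ Z.abs_nat n * (cos (IZR n * (x - s)) * g s)))).
  - rewrite (mean_zs K (fun n s => a ^ Z.abs_nat n * (cos (IZR n * (x - s)) * g s))) by (intros; cnt). apply zs_ext; intros n _. now rewrite mean_scal by cnt.
  - intros s. rewrite pks_zs, Rmult_comm, <- zs_scal. apply zs_ext; intros; ring. }
assert (O : forall g : R -> R, cont g -> zs K (fun n => a ^ Z.abs_nat n * mean (fun s => sin (IZR n * (x - s)) * g s)) = 0).
{ intros g C. apply zs_odd. intros n. replace (Z.abs_nat (- n)) with (Z.abs_nat n) by lia.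
  rewrite (mean_ext (fun s => sin (IZR (- n) * (x - s)) * g s) (fun s => - (sin (IZR n * (x - s)) * g s))).
  rewrite mean_opp by cnt. ring. intros s. rewrite opp_IZR, Ropp_mult_distr_l_reverse, sin_neg. ring. }
split.
- rewrite G by auto. unfold tu. transitivity (zs K (fun n => a ^ Z.abs_nat n * mean (fun s => cos (IZR n * (x - s)) * gu s) - a ^ Z.abs_nat n * mean (fun s => sin (IZR n * (x - s)) * gv s))).
  + apply zs_ext; intros n _. rewrite <- Rmult_minus_distr_l, <- mean_minus by cnt. unfold fr, fi.
    rewrite !Rmult_assoc, <- Rmult_minus_distr_l. f_equal. rewrite !(Rmult_comm (mean _)), <- !mean_scal, <- mean_minus by cnt.
    apply mean_ext; intros s. replace (IZR n * (x - s)) with (IZR n * x - IZR n * s) by ring. rewrite cos_minus, sin_minus. ring.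
  + rewrite zs_minus, O by auto. ring.
- rewrite G by auto. unfold tv. transitivity (zs K (fun n => a ^ Z.abs_nat n * mean (fun s => cos (IZR n * (x - s)) * gv s) + a ^ Z.abs_nat n * mean (fun s => sin (IZR n * (x - s)) * gu s))).
  + apply zs_ext; intros n _. rewrite <- Rmult_plus_distr_l, <- mean_plus by cnt. unfold fr, fi.
    rewrite !Rmult_assoc, <- Rmult_plus_distr_l. f_equal. rewrite !(Rmult_comm (mean _)), <- !mean_scal, <- mean_plus by cnt.
    apply mean_ext; intros s. replace (IZR n * (x - s)) with (IZR n * x - IZR n * s) by ring. rewrite cos_minus, sin_minus. ring.
  + rewrite zs_plus, O by auto. ring.
Qed.

(** * Mean-square convergence of Fourier partial sums *)

Definition su gu gv K := tu K (fr gu gv) (fi gu gv).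
Definition sv gu gv K := tv K (fr gu gv) (fi gu gv).
Definition err gu gv K := mean (fun s => (gu s - su gu gv K s) * (gu s - su gu gv K s) + (gv s - sv gu gv K s) * (gv s - sv gu gv K s)).
Lemma cont_su gu gv K : cont (su gu gv K).
Proof. apply cont_tu. Qed.
Lemma cont_sv gu gv K : cont (sv gu gv K).
Proof. apply cont_tv. Qed.
#[export] Hint Resolve cont_su cont_sv : cnt.

Lemma err_ge0 gu gv K : cont gu -> cont gv -> 0 <= err gu gv K.
Proof.
intros Cu Cv. apply mean_ge0; [cnt|]. intros s. generalize (sq_ge0 (gu s - su gu gv K s)) (sq_ge0 (gv s - sv gu gv K s)); lra.
Qed.

(** Partial sums are the best approximations, so it suffices to exhibit one good trigonometric
    polynomial: the Poisson integral with radius close to 1, truncated at [K], which is uniformly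
    close to the function. *)
Lemma L2_convergence gu gv : cont gu -> cont gv -> periodic gu -> periodic gv -> is_lim_seq (err gu gv) 0.
Proof.
intros Cu Cv Pu Pv. apply is_lim_seq_spec. intros [e He]; simpl.
set (d := Rmin 1 (e / 16)). assert (Hd : 0 < d <= 1 /\ d <= e / 16).
{ unfold d. assert (K1 := Rmin_l 1 (e/16)). assert (K2 := Rmin_r 1 (e/16)). split; [split|]; auto. apply Rmin_pos; lra. }
destruct (pint_approx gu d Cu Pu ltac:(lra)) as (d1 & dp1 & H1). destruct (pint_approx gv d Cv Pv ltac:(lra)) as (d2 & dp2 & H2).
destruct (cont_bounded gu Cu Pu) as (B1 & Bp1 & HB1). destruct (cont_bounded gv Cv Pv) as (B2 & Bp2 & HB2).
set (a := 1 - Rmin d1 d2 / 2). assert (0 < Rmin d1 d2) by (apply Rmin_pos; lra).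
assert (m1 := Rmin_l d1 d2). assert (m2 := Rmin_r d1 d2). assert (Ha : 0 <= a < 1) by (unfold a; lra).
set (c := 4 / ((1 - a) * (1 - a)) * (B1 + B2)). assert (cp : 0 < c).
{ unfold c. apply Rmult_lt_0_compat; [|lra]. apply Rdiv_lt_0_compat; [lra|]. apply Rmult_lt_0_compat; lra. }
destruct (pow_lt_1_zero a ltac:(rewrite Rabs_right; lra) (d / c)) as (N & HN). apply Rdiv_lt_0_compat; lra.
exists N. intros K HK. rewrite Rminus_0_r, Rabs_right by (apply Rle_ge, err_ge0; auto).
eapply Rle_lt_trans; [apply (best_approx K (fun n => a ^ Z.abs_nat n * fr gu gv n) (fun n => a ^ Z.abs_nat n * fi gu gv n) gu gv Cu Cv)|].
apply Rle_lt_trans with (8 * d * d); [|nra].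
assert (aK : c * a ^ K <= d).
{ specialize (HN K HK). rewrite Rabs_right in HN by (apply Rle_ge, pow_le; lra). apply Rlt_le in HN. apply (Rmult_le_compat_l c) in HN; [|lra].
  replace (c * (d / c)) with d in HN by (field; lra). auto. }
assert (G : forall (g : R -> R) B x, cont g -> (forall s, Rabs (g s) <= B) -> B <= B1 + B2 -> Rabs (pint a g x - g x) <= d ->
   (g x - mean (fun s => pks a K (x - s) * g s)) * (g x - mean (fun s => pks a K (x - s) * g s)) <= 4 * d * d).
{ intros g B x C HB HB' Hp. assert (Cp : cont (pk a)) by (apply cont_pk; lra).
  assert (Q : Rabs (pint a g x - mean (fun s => pks a K (x - s) * g s)) <= d).
  { unfold pint. rewrite <- mean_minus by cnt. eapply Rle_trans; [|exact aK]. apply mean_bound; [cnt|].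
    intros s. rewrite <- Rmult_minus_distr_r, Rabs_mult. assert (P := pks_error a K (x - s) Ha).
    replace (c * a ^ K) with (4 / ((1 - a) * (1 - a)) * a ^ K * (B1 + B2)) by (unfold c; ring).
    apply Rmult_le_compat; try apply Rabs_pos; auto. generalize (HB s); lra. }
  set (X := mean (fun s => pks a K (x - s) * g s)) in *. apply Rabs_le_between in Q. apply Rabs_le_between in Hp.
  assert (0 <= (2 * d - (g x - X)) * (2 * d + (g x - X))) by (apply Rmult_le_pos; lra). lra. }
rewrite <- (mean_const (8 * d * d)). apply mean_le; [cnt..|]. intros x.
destruct (pks_conv a K gu gv x Cu Cv) as [-> ->].
assert (X1 := G gu B1 x Cu HB1 ltac:(lra) (H1 a x ltac:(unfold a; lra))).
assert (X2 := G gv B2 x Cv HB2 ltac:(lra) (H2 a x ltac:(unfold a; lra))). lra.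
Qed.

Lemma young x y l : 0 < l -> x * y <= x * x / (2 * l) + l / 2 * (y * y).
Proof.
intros Hl. assert (P := sq_ge0 (x - l * y)). apply (Rmult_le_reg_l (2 * l)); [lra|].
replace (2 * l * (x * x / (2 * l) + l / 2 * (y * y))) with (x * x + l * y * (l * y)) by (field; lra). lra.
Qed.

(** A weighted Parseval formula. It carries inequalities proved for trigonometric polynomials over
    to the circles of [h], whose Fourier series need not converge pointwise. *)
Lemma lim_product Q fu fv gu gv : cont Q -> periodic Q -> cont fu -> cont fv -> cont gu -> cont gv ->
  periodic fu -> periodic fv -> periodic gu -> periodic gv ->
  is_lim_seq (fun K => mean (fun s => Q s * (su fu fv K s * su gu gv K s + sv fu fv K s * sv gu gv K s))) (mean (fun s => Q s * (fu s * gu s + fv s * gv s))).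
Proof.
intros CQ PQ Cfu Cfv Cgu Cgv Pfu Pfv Pgu Pgv. destruct (cont_bounded Q CQ PQ) as (B & Bp & HB).
apply is_lim_seq_spec. intros [e He]; simpl.
set (nf := mean (fun s => fu s * fu s + fv s * fv s)). set (ng := mean (fun s => gu s * gu s + gv s * gv s)).
assert (nf0 : 0 <= nf) by (apply mean_ge0; [cnt|]; intros s; generalize (sq_ge0 (fu s)) (sq_ge0 (fv s)); lra).
assert (ng0 : 0 <= ng) by (apply mean_ge0; [cnt|]; intros s; generalize (sq_ge0 (gu s)) (sq_ge0 (gv s)); lra).
set (l := e / (2 * B * (nf + ng + 1))). assert (lp : 0 < l).
{ apply Rdiv_lt_0_compat; auto. apply Rmult_lt_0_compat; lra. }
set (c := B * (1 / 2 + 1 / (2 * l))). assert (cp : 0 < c).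
{ apply Rmult_lt_0_compat; auto. assert (0 < 1 / (2 * l)) by (apply Rdiv_lt_0_compat; lra). lra. }
assert (Lf := L2_convergence fu fv Cfu Cfv Pfu Pfv). assert (Lg := L2_convergence gu gv Cgu Cgv Pgu Pgv).
apply is_lim_seq_spec in Lf. apply is_lim_seq_spec in Lg.
assert (ep : 0 < e / (4 * c)) by (apply Rdiv_lt_0_compat; lra).
destruct (Lf (mkposreal _ ep)) as (N1 & H1). destruct (Lg (mkposreal _ ep)) as (N2 & H2). simpl in H1, H2.
exists (max N1 N2). intros K HK. specialize (H1 K ltac:(lia)). specialize (H2 K ltac:(lia)).
rewrite Rminus_0_r, Rabs_right in H1 by (apply Rle_ge, err_ge0; auto). rewrite Rminus_0_r, Rabs_right in H2 by (apply Rle_ge, err_ge0; auto).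
rewrite <- mean_minus by cnt.
apply Rle_lt_trans with (c * (err fu fv K + err gu gv K) + B * (l / 2) * (nf + ng)).
- unfold err, nf, ng. rewrite <- !mean_plus, <- !mean_scal, <- mean_plus by cnt.
  eapply Rle_trans; [apply mean_Rabs; cnt|]. apply mean_le; [cnt..|]. intros s.
  set (a := fu s - su fu fv K s). set (b := fv s - sv fu fv K s). set (a' := gu s - su gu gv K s). set (b' := gv s - sv gu gv K s).
  replace (su fu fv K s) with (fu s - a) by (unfold a; ring). replace (sv fu fv K s) with (fv s - b) by (unfold b; ring).
  replace (su gu gv K s) with (gu s - a') by (unfold a'; ring). replace (sv gu gv K s) with (gv s - b') by (unfold b'; ring).
  rewrite <- Rmult_minus_distr_l, Rabs_mult.
  apply Rle_trans with (B * ((1 / 2 + 1 / (2 * l)) * (a * a + b * b + (a' * a' + b' * b')) + l / 2 * (fu s * fu s + fv s * fv s + (gu s * gu s + gv s * gv s)))).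
  2:{ right. unfold c. ring. }
  apply Rmult_le_compat; try apply Rabs_pos; auto.
  assert (Y : forall x y, Rabs (x * y) <= x * x / (2 * l) + l / 2 * (y * y)).
  { intros x y. apply Rabs_le. split; [|now apply young]. assert (Z := young (-x) y l lp). lra. }
  assert (Y1 : forall x y, Rabs (x * y) <= x * x / 2 + y * y / 2).
  { intros x y. apply Rabs_le. generalize (sq_ge0 (x - y)) (sq_ge0 (x + y)). lra. }
  replace ((fu s - a) * (gu s - a') + (fv s - b) * (gv s - b') - (fu s * gu s + fv s * gv s)) with (a * a' + b * b' - a * gu s - b * gv s - a' * fu s - b' * fv s) by ring.
  assert (z1 := Y a (gu s)). assert (z2 := Y b (gv s)). assert (z3 := Y a' (fu s)). assert (z4 := Y b' (fv s)). assert (z5 := Y1 a a'). assert (z6 := Y1 b b').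
  apply Rabs_le_between in z1, z2, z3, z4, z5, z6.
  replace (1 / (2 * l)) with (/ (2 * l)) by (unfold Rdiv; ring). unfold Rdiv in z1, z2, z3, z4. apply Rabs_le.
  set (il := / (2 * l)) in *. lra.
- assert (c * (err fu fv K + err gu gv K) < e / 2).
  { apply Rlt_le_trans with (c * (e / (4 * c) + e / (4 * c))). apply Rmult_lt_compat_l; lra. right; field; lra. }
  assert (B * (l / 2) * (nf + ng) <= e / 2); [|lra].
  apply Rle_trans with (B * (l / 2) * (nf + ng + 1)). apply Rmult_le_compat_l; [|lra]. apply Rmult_le_pos; lra.
  unfold l. apply Rle_trans with (e / 4); [|lra]. right. field. lra.
Qed.

(** * Fourier modes of harmonic functions on the cylinder *)

(** The test functions depend on [s] only. The second derivative in [t] exists after averaging,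
    although [f] is only of class [C^1]. *)
Lemma mode_ode {T f ft fs} (g dg : R -> R) nu t : C1cyl 0 T f ft fs -> weak_harmonic T ft fs ->
  (forall s, is_derive g s (dg s)) -> (forall s, is_derive dg s (- (nu * nu) * g s)) -> periodic g -> 0 < t < T ->
  is_derive (fun t => mean (fun s => f t s * g s)) t (mean (fun s => ft t s * g s)) /\
  is_derive (fun t => mean (fun s => ft t s * g s)) t (nu * nu * mean (fun s => f t s * g s)).
Proof.
intros F W Dg Ddg Pg Ht. assert (Cdg : cont dg) by exact (derive_cont dg _ Ddg). assert (Cg : cont g) by exact (derive_cont g _ Dg).
assert (G := c1_circle 0 T g dg Dg Cdg Pg).
assert (Pdg : periodic dg) by (apply (c1_per_s G Ht)).
assert (c1 := c1_cont_f F Ht). assert (c2 := c1_cont_t F Ht). assert (c3 := c1_cont_s F Ht).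
split.
- assert (K := mean_derive t (c1_mult F G) Ht). simpl in K.
  erewrite (mean_ext (fun s => ft t s * g s)); [exact K|]. intros; simpl; ring.
- assert (K := W _ _ _ G t Ht). cbv beta in K.
  replace (nu * nu * mean (fun s => f t s * g s)) with (mean (fun s => 0 * ft t s + dg s * fs t s)).
  + apply (is_derive_ext (fun x => mean (fun s => g s * ft x s))); auto. intros x; apply mean_ext; intros; ring.
  + rewrite (mean_ext _ (fun s => dg s * fs t s)) by (intros; ring).
    rewrite (mean_ibp dg (fun s => - (nu * nu) * g s) (f t) (fs t)); auto.
    * rewrite <- mean_opp, <- mean_scal by cnt. apply mean_ext; intros; ring.
    * intros; now apply F.
    * cnt.
    * now apply F.
Qed.

(** The solution is written as the decaying part of [f t] plus a multiple of the growing combination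
    [f' + nu f]. The first is what Poisson extension to radius [e^(-d)] does to a mode; the second
    is the defect to be estimated. *)
Lemma ode_solve T (f f1 : R -> R) nu t d : 0 < nu -> (forall t, 0 < t < T -> is_derive f t (f1 t) /\ is_derive f1 t (nu * nu * f t)) ->
  0 < t < T -> 0 < t + d < T -> nu * f (t + d) = nu * exp (- (nu * d)) * f t + (f1 t + nu * f t) * sinh (nu * d).
Proof.
intros Hn D Ht Htd.
assert (E : forall sg, (sg = 1 \/ sg = -1) -> (f1 (t + d) + sg * nu * f (t + d)) * exp (- (sg * nu * (t + d))) = (f1 t + sg * nu * f t) * exp (- (sg * nu * t))).
{ intros sg Hs. apply (const_on 0 T (fun t => (f1 t + sg * nu * f t) * exp (- (sg * nu * t)))); auto.
  intros x Hx. destruct (D x Hx) as [D1 D2].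
  replace 0 with ((nu * nu * f x + sg * nu * f1 x) * exp (- (sg * nu * x)) + (f1 x + sg * nu * f x) * (- (sg * nu) * exp (- (sg * nu * x)))).
  2:{ assert (sg * sg = 1) by (destruct Hs; subst; ring). transitivity ((1 - sg * sg) * (nu * nu * f x * exp (- (sg * nu * x)))); [ring | rewrite H; ring]. }
  apply (is_derive_mult_R (fun x => f1 x + sg * nu * f x) (fun x => exp (- (sg * nu * x)))).
  - apply (is_derive_plus f1 (fun x => sg * nu * f x)); auto. apply (is_derive_scal f x (sg * nu)); auto.
  - auto_derive; auto; ring. }
assert (E1 := E 1 (or_introl eq_refl)). assert (E2 := E (-1) (or_intror eq_refl)).
assert (X : forall sg, exp (- (sg * nu * (t + d))) = exp (- (sg * nu * t)) * exp (- (sg * nu * d))) by (intros; rewrite <- exp_plus; f_equal; ring).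
rewrite X in E1. rewrite X in E2.
assert (F1 : (f1 (t + d) + nu * f (t + d)) * exp (- (nu * d)) = f1 t + nu * f t).
{ apply (Rmult_eq_reg_r (exp (- (1 * nu * t)))); [|apply Rgt_not_eq, exp_pos]. replace (- (nu * d)) with (- (1 * nu * d)) by ring. lra. }
assert (F2 : (f1 (t + d) - nu * f (t + d)) * exp (nu * d) = f1 t - nu * f t).
{ apply (Rmult_eq_reg_r (exp (- (-1 * nu * t)))); [|apply Rgt_not_eq, exp_pos]. replace (nu * d) with (- (-1 * nu * d)) by ring. lra. }
assert (I : exp (nu * d) * exp (- (nu * d)) = 1) by (rewrite <- exp_plus, Rplus_opp_r; apply exp_0).
unfold sinh.
assert (G1 : f1 (t + d) + nu * f (t + d) = (f1 t + nu * f t) * exp (nu * d)).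
{ rewrite <- F1. rewrite Rmult_assoc, (Rmult_comm (exp (- _))), I. ring. }
assert (G2 : f1 (t + d) - nu * f (t + d) = (f1 t - nu * f t) * exp (- (nu * d))).
{ rewrite <- F2. rewrite Rmult_assoc, I. ring. }
lra.
Qed.

Lemma sinh_pos x : 0 < x -> 0 < sinh x.
Proof. intros H. rewrite <- sinh_0. now apply sinh_lt. Qed.

Lemma cosh_ge1 x : 1 <= cosh x.
Proof. assert (K := cosh2_sinh2 x). assert (P := cosh_pos x). assert (Q := sq_ge0 (sinh x)). nra. Qed.

Lemma sinh_star x l : 0 <= l <= 1 -> 0 <= x -> sinh (l * x) <= l * sinh x.
Proof.
intros Hl Hx. assert (K : l * sinh 0 - sinh (l * 0) <= l * sinh x - sinh (l * x)).
- apply (incr (-1) (x + 1) (fun x => l * sinh x - sinh (l * x)) (fun x => l * (cosh x - cosh (l * x)))); try lra.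
  + intros z _. unfold sinh, cosh. auto_derive; auto. field.
  + intros z _. apply Rmult_le_pos; [lra|]. assert (E1 := exp_chord l z Hl). assert (E2 := exp_chord l (- z) Hl).
    assert (c1 := cosh_ge1 z). replace (l * - z) with (- (l * z)) in E2 by ring.
    assert (cosh (l * z) <= 1 - l + l * cosh z) by (unfold cosh; lra). nra.
- rewrite Rmult_0_r, sinh_0 in K. lra.
Qed.

Lemma exp_nat x n : exp x ^ n = exp (INR n * x).
Proof. induction n. simpl. now rewrite Rmult_0_l, exp_0. rewrite S_INR, Rmult_plus_distr_r, Rmult_1_l, exp_plus, <- IHn. simpl; ring. Qed.

Lemma sinh_ratio a b : 0 <= a -> a <= b -> 0 < b -> sinh a <= exp (a - b) * sinh b.
Proof.
intros h0 h1 h2. unfold sinh. replace (exp (a - b) * ((exp b - exp (- b)) / 2)) with ((exp a - exp (a - b - b)) / 2).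
- assert (exp (a - b - b) <= exp (- a)); [|lra]. destruct (Req_dec a b) as [->|]. right; f_equal; ring. left; apply exp_increasing; lra.
- replace (exp a) with (exp (a - b) * exp b) by (rewrite <- exp_plus; f_equal; ring).
  replace (exp (a - b - b)) with (exp (a - b) * exp (- b)) by (rewrite <- exp_plus; f_equal; ring). field.
Qed.

(** The rate in [poisson_defect]: twice the sum of geometric bounds with ratio [e^(-T/4)], and once
    more for mode 0. *)
Definition decay T Rb := let sg := T / 4 in let b := exp (- (T / 4)) in 2 * Rb / sg * (2 / (1 - b) + 1).

(** The circle [t + d] is compared with the harmonic extension of the circle [t] to radius [e^(-d)].
    Mode by mode they differ by the growing part, which the bound at time [t + T/2] makes
    exponentially small in the frequency. The factor [r < 1] is an Abel regularisation that makes
    the series converge. *)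
Lemma poisson_defect T Rb f ft fs t d r x : C1cyl 0 T f ft fs -> weak_harmonic T ft fs -> 0 < T ->
  (forall t s, 0 < t < T -> Rabs (f t s) <= Rb) -> 0 < t < T / 2 -> 0 < d <= T / 4 -> 0 <= r < 1 ->
  Rabs (pint r (f (t + d)) x - pint (r * exp (- d)) (f t) x) <= decay T Rb * d.
Proof.
intros F W TP HB Ht Hd Hr.
assert (Rb0 : 0 <= Rb) by (eapply Rle_trans; [apply Rabs_pos | apply (HB t 0); lra]).
assert (Htd : 0 < t + d < T) by lra. assert (Ht' : 0 < t < T) by lra.
assert (c1 := c1_cont_f F Ht'). assert (c2 := c1_cont_f F Htd).
assert (ed : 0 < exp (- d) < 1) by (split; [apply exp_pos | rewrite <- exp_0; apply exp_increasing; lra]).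
set (a := r * exp (- d)). assert (Ha : 0 <= a <= r) by (unfold a; split; [apply Rmult_le_pos; lra | nra]).
set (A n t := mean (fun s => f t s * cos (INR n * (s - x)))). set (A1 n t := mean (fun s => ft t s * cos (INR n * (s - x)))).
assert (Ab : forall n t, 0 < t < T -> Rabs (A n t) <= Rb).
{ intros n y Hy. assert (cy := c1_cont_f F Hy). apply mean_bound; [cnt|]. intros s. rewrite Rabs_mult.
  generalize (HB y s Hy) (Rabs_cos (INR n * (s - x))) (Rabs_pos (f y s)). intros; nra. }
assert (AD : forall n t, 0 < t < T -> is_derive (A n) t (A1 n t) /\ is_derive (A1 n) t (INR n * INR n * A n t)).
{ intros n y Hy. apply (@mode_ode T f ft fs (fun s => cos (INR n * (s - x))) (fun s => - INR n * sin (INR n * (s - x)))); auto.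
  - intros s. generalize (INR n); intros k. unfold Rminus. auto_derive; auto; ring.
  - intros s. generalize (INR n); intros k. unfold Rminus. auto_derive; auto; ring.
  - intros s. replace (INR n * (s + 2 * PI - x)) with (INR n * (s - x) + 2 * INR n * PI) by ring. apply cos_period. }
set (sg := T / 4). set (b := exp (- sg)). assert (sp : 0 < sg) by (unfold sg; lra).
assert (hb : 0 < b < 1) by (split; [apply exp_pos | rewrite <- exp_0; apply exp_increasing; lra]).
set (c := 2 * Rb / sg * d). assert (cp : 0 <= c).
{ unfold c, Rdiv. apply Rmult_le_pos; [|lra]. apply Rmult_le_pos; [lra|]. apply Rlt_le, Rinv_0_lt_compat; auto. }
assert (Dn : forall n, Rabs (A n (t + d) - exp (- (INR n * d)) * A n t) <= c * b ^ n).
(* The growing part is bounded at distance [T/2] and used at distance [d <= T/4]. Passing from [d]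
   to [T/4] costs [d / (T/4)] by convexity of [sinh], and from [T/4] to [T/2] gains the factor
   [b^n]. *)
{ intros n. set (tau := T / 2). assert (Htt : 0 < t + tau < T) by (unfold tau; lra).
  destruct n as [|n].
  - simpl INR. rewrite Rmult_0_l, Ropp_0, exp_0, Rmult_1_l. simpl pow. rewrite Rmult_1_r.
    assert (L : forall e, 0 < t + e < T -> A 0%nat (t + e) = A 0%nat t + A1 0%nat t * e).
    { intros e He. assert (C1 : forall z, 0 < z < T -> A1 0%nat z = A1 0%nat t).
      { intros z Hz. apply (const_on 0 T); auto. intros y Hy. destruct (AD 0%nat y Hy) as [_ Q]. simpl in Q. now rewrite !Rmult_0_l in Q. }
      assert (E : A 0%nat (t + e) - A1 0%nat t * (t + e) = A 0%nat t - A1 0%nat t * t); [|lra].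
      apply (const_on 0 T (fun z => A 0%nat z - A1 0%nat t * z)); auto. intros z Hz. destruct (AD 0%nat z Hz) as [Q _]. rewrite C1 in Q by auto.
      replace 0 with (A1 0%nat t - A1 0%nat t * 1) by ring. apply (is_derive_minus (A 0%nat) (fun z => A1 0%nat t * z)); auto. auto_derive; auto; ring. }
    rewrite L by auto. assert (K := L tau Htt). assert (B1 := Ab 0%nat t Ht'). assert (B2 := Ab 0%nat _ Htt). rewrite K in B2.
    apply Rabs_le_between in B1. apply Rabs_le_between in B2.
    replace (A 0%nat t + A1 0%nat t * d - A 0%nat t) with (A1 0%nat t * tau * (d / tau)) by (unfold tau; field; lra).
    rewrite Rabs_mult. rewrite (Rabs_right (d / tau)) by (apply Rle_ge, Rlt_le, Rdiv_lt_0_compat; unfold tau; lra).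
    apply Rle_trans with (2 * Rb * (d / tau)).
    + apply Rmult_le_compat_r. apply Rlt_le, Rdiv_lt_0_compat; unfold tau; lra. apply Rabs_le; lra.
    + unfold c. apply Rle_trans with (Rb / sg * d). right; unfold tau, sg; field; lra.
      unfold Rdiv. apply Rmult_le_compat_r; [lra|]. apply Rmult_le_compat_r; [|lra]. apply Rlt_le, Rinv_0_lt_compat; auto.
  - set (nu := INR (S n)). assert (np : 0 < nu) by (apply lt_0_INR; lia).
    assert (E1 := ode_solve T (A (S n)) (A1 (S n)) nu t d np (AD (S n)) Ht' Htd).
    assert (E2 := ode_solve T (A (S n)) (A1 (S n)) nu t tau np (AD (S n)) Ht' Htt).
    set (rho := A1 (S n) t + nu * A (S n) t) in *.
    assert (Bt := Ab (S n) t Ht'). assert (Btt := Ab (S n) _ Htt).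
    assert (et : 0 < exp (- (nu * tau)) < 1).
    { split; [apply exp_pos|]. rewrite <- exp_0; apply exp_increasing. assert (0 < nu * tau) by (apply Rmult_lt_0_compat; unfold tau; lra). lra. }
    assert (R1 : Rabs rho * sinh (nu * tau) <= 2 * nu * Rb).
    { rewrite <- (Rabs_right (sinh (nu * tau))) by (apply Rle_ge, Rlt_le, sinh_pos, Rmult_lt_0_compat; unfold tau; lra).
      rewrite <- Rabs_mult. replace (rho * sinh (nu * tau)) with (nu * (A (S n) (t + tau) - exp (- (nu * tau)) * A (S n) t)) by lra.
      rewrite Rabs_mult, (Rabs_right nu) by lra. apply Rabs_le_between in Bt. apply Rabs_le_between in Btt.
      replace (2 * nu * Rb) with (nu * (2 * Rb)) by ring. apply Rmult_le_compat_l; [lra|]. apply Rabs_le.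
      set (e := exp (- (nu * tau))) in *. set (y := A (S n) t) in *. assert (- Rb <= e * y <= Rb) by nra. lra. }
    apply (Rmult_le_reg_l nu); auto. rewrite <- (Rabs_right nu) at 1 by lra. rewrite <- Rabs_mult.
    replace (nu * (A (S n) (t + d) - exp (- (nu * d)) * A (S n) t)) with (rho * sinh (nu * d)) by lra.
    rewrite Rabs_mult, (Rabs_right (sinh (nu * d))) by (apply Rle_ge, Rlt_le, sinh_pos, Rmult_lt_0_compat; lra).
    assert (S1 : sinh (nu * d) <= d / sg * sinh (nu * sg)).
    { replace (nu * d) with (d / sg * (nu * sg)) by (field; lra). apply sinh_star.
      - split. apply Rlt_le, Rdiv_lt_0_compat; lra. apply (Rmult_le_reg_r sg); auto. unfold Rdiv. rewrite Rmult_assoc, Rinv_l by lra. unfold sg; lra.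
      - apply Rmult_le_pos; lra. }
    assert (S2 : sinh (nu * sg) <= b ^ S n * sinh (nu * tau)).
    { replace (b ^ S n) with (exp (nu * sg - nu * tau)).
      apply sinh_ratio. apply Rmult_le_pos; lra. apply Rmult_le_compat_l; unfold sg, tau; lra. apply Rmult_lt_0_compat; unfold tau; lra.
      unfold b. rewrite exp_nat. f_equal. unfold nu, sg, tau. field. }
    assert (d0 : 0 < d / sg) by (apply Rdiv_lt_0_compat; lra).
    apply Rle_trans with (Rabs rho * (d / sg * (b ^ S n * sinh (nu * tau)))).
    + apply Rmult_le_compat_l; [apply Rabs_pos|]. eapply Rle_trans; [exact S1|]. apply Rmult_le_compat_l; lra.
    + replace (Rabs rho * (d / sg * (b ^ S n * sinh (nu * tau)))) with ((d / sg * b ^ S n) * (Rabs rho * sinh (nu * tau))) by ring.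
      apply Rle_trans with ((d / sg * b ^ S n) * (2 * nu * Rb)).
      * apply Rmult_le_compat_l; auto. apply Rmult_le_pos; [lra | apply pow_le; lra].
      * right. unfold c. field. lra. }
assert (PS : forall q K y, cont (f y) -> mean (fun s => pks q K (x - s) * f y s) = 2 * sum_f_R0 (fun n => q ^ n * A n y) K - A 0%nat y).
{ intros q K y C. induction K.
  - simpl sum_f_R0. rewrite (mean_ext _ (fun s => f y s * cos (INR 0 * (s - x)))). fold (A 0%nat y); simpl; ring.
    intros s. unfold pks. simpl. rewrite !Rmult_0_l, cos_0. ring.
  - rewrite tech5. replace (2 * (sum_f_R0 (fun n => q ^ n * A n y) K + q ^ S K * A (S K) y) - A 0%nat y) with ((2 * sum_f_R0 (fun n => q ^ n * A n y) K - A 0%nat y) + 2 * q ^ S K * A (S K) y) by ring.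
    rewrite <- IHK. unfold A. rewrite <- mean_scal, <- mean_plus by cnt. apply mean_ext; intros s. unfold pks. rewrite tech5.
    replace (INR (S K) * (x - s)) with (- (INR (S K) * (s - x))) by ring. rewrite cos_neg. ring. }
assert (Diff : forall K, Rabs (mean (fun s => pks r K (x - s) * f (t + d) s) - mean (fun s => pks a K (x - s) * f t s)) <= decay T Rb * d).
{ intros K. rewrite !PS by auto.
  assert (G : Rabs (sum_f_R0 (fun n => r ^ n * A n (t + d)) K - sum_f_R0 (fun n => a ^ n * A n t) K) <= c * / (1 - b)).
  { apply Rle_trans with (c * sum_f_R0 (fun n => b ^ n) K).
    - clear PS. induction K.
      + assert (Q := Dn 0%nat). simpl in Q. rewrite Rmult_0_l, Ropp_0, exp_0, Rmult_1_l in Q. simpl. rewrite !Rmult_1_l. exact Q.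
      + rewrite !tech5. assert (Q := Dn (S K)). unfold a. rewrite Rpow_mult_distr, exp_nat. fold a.
        replace (INR (S K) * - d) with (- (INR (S K) * d)) by ring.
        match goal with |- Rabs (?s1 + r ^ S K * ?p - (?s2 + r ^ S K * ?e * ?q)) <= _ => replace (s1 + r ^ S K * p - (s2 + r ^ S K * e * q)) with ((s1 - s2) + r ^ S K * (p - e * q)) by ring end.
        eapply Rle_trans; [apply Rabs_triang|]. rewrite Rmult_plus_distr_l. apply Rplus_le_compat; auto.
        rewrite Rabs_mult, Rabs_right by (apply Rle_ge, pow_le; lra).
        assert (r ^ S K <= 1) by (rewrite <- (pow1 (S K)); apply pow_incr; lra). assert (0 <= r ^ S K) by (apply pow_le; lra).
        generalize (Rabs_pos (A (S K) (t + d) - exp (- (INR (S K) * d)) * A (S K) t)). intros. nra.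
    - apply Rmult_le_compat_l; auto. rewrite tech3 by lra. assert (0 < b ^ S K) by (apply pow_lt; lra).
      unfold Rdiv. rewrite <- (Rmult_1_l (/ (1 - b))) at 2. apply Rmult_le_compat_r; [apply Rlt_le, Rinv_0_lt_compat; lra | lra]. }
  assert (Q := Dn 0%nat). simpl in Q. rewrite Rmult_0_l, Ropp_0, exp_0, Rmult_1_l, Rmult_1_r in Q.
  set (s1 := sum_f_R0 (fun n => r ^ n * A n (t + d)) K) in *. set (s2 := sum_f_R0 (fun n => a ^ n * A n t) K) in *.
  apply Rabs_le_between in G. apply Rabs_le_between in Q.
  replace (decay T Rb * d) with (2 * (c * / (1 - b)) + c). apply Rabs_le; lra.
  unfold decay, c, b, sg. field. split; [unfold b, sg in hb; lra | lra]. }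
apply (geom_le r (8 / ((1 - r) * (1 - r)) * Rb) 0); auto. intros K _.
assert (Er : forall q y, 0 <= q <= r -> 0 < y < T -> cont (f y) -> Rabs (pint q (f y) x - mean (fun s => pks q K (x - s) * f y s)) <= 4 / ((1 - r) * (1 - r)) * Rb * r ^ K).
{ intros q y Hq Hy C. assert (Cp : cont (pk q)) by (apply cont_pk; lra). unfold pint. rewrite <- mean_minus by cnt. apply mean_bound; [cnt|].
  intros s. rewrite <- Rmult_minus_distr_r, Rabs_mult. assert (P := pks_error q K (x - s) ltac:(lra)).
  assert (q1 : q ^ K <= r ^ K) by (apply pow_incr; lra). assert (q0 : 0 <= q ^ K) by (apply pow_le; lra).
  assert (I : / ((1 - q) * (1 - q)) <= / ((1 - r) * (1 - r))).
  { apply Rinv_le_contravar. apply Rmult_lt_0_compat; lra. apply Rmult_le_compat; lra. }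
  assert (I0 : 0 < / ((1 - q) * (1 - q))) by (apply Rinv_0_lt_compat, Rmult_lt_0_compat; lra).
  replace (4 / ((1 - r) * (1 - r)) * Rb * r ^ K) with ((4 * / ((1 - r) * (1 - r)) * r ^ K) * Rb) by (unfold Rdiv; ring).
  apply Rmult_le_compat; try apply Rabs_pos; auto. eapply Rle_trans; [exact P|]. unfold Rdiv. apply Rmult_le_compat; lra. }
assert (X1 := Er r (t + d) ltac:(lra) Htd c2). assert (X2 := Er a t Ha Ht' c1). specialize (Diff K).
apply Rabs_le_between in X1. apply Rabs_le_between in X2. apply Rabs_le_between in Diff.
replace (8 / ((1 - r) * (1 - r)) * Rb * r ^ K) with (2 * (4 / ((1 - r) * (1 - r)) * Rb * r ^ K)) by (field; lra).
apply Rabs_le; lra.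
Qed.

(** * Rotations, and the choice of an adapted circle *)

(** Rotation moves the zero [a e^(ix)] of the harmonic extension to the real point [a], so that the
    weight is the even function [pk a]. *)
Definition rot D x := {| hT := hT D; hR := hR D;
  hu := fun t s => hu D t (s + x); hut := fun t s => hut D t (s + x); hus := fun t s => hus D t (s + x);
  hv := fun t s => hv D t (s + x); hvt := fun t s => hvt D t (s + x); hvs := fun t s => hvs D t (s + x) |}.

Lemma c1_rot lo hi f ft fs x : C1cyl lo hi f ft fs ->
  C1cyl lo hi (fun t s => f t (s + x)) (fun t s => ft t (s + x)) (fun t s => fs t (s + x)).
Proof.
intros F.
assert (G : forall g t s, continuity_2d_pt g t (s + x) -> continuity_2d_pt (fun t y => g t (y + x)) t s).
{ intros g t s C eps. destruct (C eps) as [d Hd]. exists d. intros u v Hu Hv. apply Hd; auto.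
  replace (v + x - (s + x)) with (v - s) by ring. auto. }
constructor; intros.
- now apply F.
- replace (fs t (s + x)) with (1 * fs t (s + x)) by ring. apply (is_derive_comp (f t) (fun y => y + x)). now apply F. auto_derive; auto; ring.
- apply G. now apply F.
- apply (G fs). now apply F.
- intros s. replace (s + 2 * PI + x) with (s + x + 2 * PI) by ring. now apply (c1_per F).
Qed.

Lemma mean_unshift (p g : R -> R) x : cont p -> cont g -> periodic p -> periodic g ->
  mean (fun s => p s * g (s + x)) = mean (fun s => p (s - x) * g s).
Proof.
intros Cp Cg Pp Pg. rewrite <- (mean_shift (fun s => p (s - x) * g s) x).
- apply mean_ext; intros s. f_equal. f_equal; ring.
- apply cont_mult; auto. apply (cont_comp (fun s => s - x) p); cnt.
- intros s. rewrite Pg. f_equal. replace (s + 2 * PI - x) with (s - x + 2 * PI) by ring. apply Pp.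
Qed.

Lemma wh_rot T f ft fs x : C1cyl 0 T f ft fs -> weak_harmonic T ft fs -> weak_harmonic T (fun t s => ft t (s + x)) (fun t s => fs t (s + x)).
Proof.
intros F W p pt ps P t Ht. assert (P' := c1_rot _ _ _ _ _ (- x) P). assert (K := W _ _ _ P' t Ht). cbv beta in K.
assert (E : forall y, 0 < y < T -> mean (fun s => p y s * ft y (s + x)) = mean (fun s => p y (s + - x) * ft y s)).
{ intros y Hy. apply mean_unshift. apply (c1_cont_f P Hy). apply (c1_cont_t F Hy). apply (c1_per P y Hy). apply (c1_per_t F Hy). }
apply (is_derive_ext_loc (fun y => mean (fun s => p y (s + - x) * ft y s))).
{ apply (locally_Ioo 0 T); auto. intros y Hy. symmetry; auto. }
assert (a1 := c1_cont_t P Ht). assert (a2 := c1_cont_s P Ht). assert (a3 := c1_cont_t F Ht). assert (a4 := c1_cont_s F Ht).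
assert (b1 := c1_cont_t P' Ht). assert (b2 := c1_cont_s P' Ht). cbv beta in b1, b2.
assert (b3 := c1_cont_t (c1_rot _ _ _ _ _ x F) Ht). assert (b4 := c1_cont_s (c1_rot _ _ _ _ _ x F) Ht). cbv beta in b3, b4.
rewrite mean_plus by cnt. rewrite mean_plus in K by cnt.
rewrite (mean_unshift (pt t) (ft t) x), (mean_unshift (ps t) (fs t) x); auto.
- apply (c1_per_s P Ht).
- apply (c1_per_s F Ht).
- apply (c1_per_t P Ht).
- apply (c1_per_t F Ht).
Qed.

Lemma core_rot D x : core D -> core (rot D x).
Proof.
intros H. constructor; try (apply H); simpl.
- apply c1_rot, H.
- apply c1_rot, H.
- eapply wh_rot; apply H.
- eapply wh_rot; apply H.
- intros t s Ht. apply (k_J _ H t (s + x) Ht).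
- intros t s Ht. apply (k_N _ H t (s + x) Ht).
- intros e He. destruct (k_0 _ H e He) as (d & dp & Hd). exists d; split; auto. intros t s h1 h2. apply (Hd t (s + x)); auto.
- intros e He. destruct (k_1 _ H e He) as (d & dp & Hd). exists d; split; auto. intros t s h1 h2. apply (Hd t (s + x)); auto.
Qed.

Lemma core_bound D : core D -> forall t s, 0 < t < hT D -> Rabs (hu D t s) <= hR D /\ Rabs (hv D t s) <= hR D.
Proof.
intros H t s Ht. assert (K := k_N _ H t s Ht). assert (R1 := k_R _ H). unfold nsq in K.
assert (q1 := sq_ge0 (hu D t s)). assert (q2 := sq_ge0 (hv D t s)).
split; rewrite <- (Rabs_right (hR D)) by lra; apply Rsqr_le_abs_0; unfold Rsqr; lra.
Qed.

Lemma pint_boundary D g gt gs Rb t d x : 0 < D -> C1cyl 0 D g gt gs -> weak_harmonic D gt gs ->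
  (forall t s, 0 < t < D -> Rabs (g t s) <= Rb) -> 0 < t < D / 2 -> 0 < d <= D / 4 ->
  Rabs (g (t + d) x - pint (exp (- d)) (g t) x) <= decay D Rb * d.
Proof.
intros DP G W B Ht Hd. assert (Htd : 0 < t + d < D) by lra. assert (Ht' : 0 < t < D) by lra.
assert (ed : 0 < exp (- d) < 1) by (split; [apply exp_pos | rewrite <- exp_0; apply exp_increasing; lra]).
apply le_epsilon. intros e He.
destruct (pint_approx (g (t + d)) (e/2)) as (d1 & dp1 & H1). apply (c1_cont_f G Htd). apply (c1_per G _ Htd). lra.
destruct (pint_c1 (g t) (gs t)) as (qt & Q). intros; now apply G. apply (c1_cont_s G Ht'). apply (c1_per G _ Ht').
assert (C : continuous (fun a => pint a (g t) x) (exp (- d))).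
{ apply (ex_derive_continuous (fun a => pint a (g t) x)). eexists. apply (c1_dt Q). lra. }
assert (He2 : 0 < e/2) by lra.
destruct (continuous_eps (fun a => pint a (g t) x) (exp (-d)) C (e/2) He2) as (d2 & dp2 & H2).
set (r := 1 - Rmin d1 d2 / 2). assert (m1 := Rmin_l d1 d2). assert (m2 := Rmin_r d1 d2). assert (0 < Rmin d1 d2) by (apply Rmin_pos; lra).
assert (Hr : 0 <= r < 1) by (unfold r; lra).
assert (K := poisson_defect D Rb g gt gs t d r x G W DP B Ht Hd Hr).
assert (A1 := H1 r x ltac:(unfold r; lra)).
assert (A2 : Rabs (pint (r * exp (- d)) (g t) x - pint (exp (- d)) (g t) x) < e / 2).
{ apply H2.
  replace (r * exp (- d) - exp (- d)) with (- ((1 - r) * exp (- d))) by ring. rewrite Rabs_Ropp, Rabs_right by (apply Rle_ge, Rmult_le_pos; lra).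
  apply Rle_lt_trans with (1 - r). rewrite <- (Rmult_1_r (1 - r)) at 2. apply Rmult_le_compat_l; lra. unfold r; lra. }
apply Rabs_le_between in K. apply Rabs_le_between in A1. apply Rabs_lt_between in A2. apply Rabs_le; lra.
Qed.

(** At radius [e^(-d)] the extension differs from [h(t + d, x)], of modulus greater than 1, by at
    most a multiple of [d]. So there is no zero for small [d], uniformly in [t]. *)
Lemma zero_bound D : core D -> exists am, 0 <= am < 1 /\ forall t a x, 0 < t < hT D / 2 -> 0 <= a < 1 ->
  pint a (hu D t) x = 0 -> pint a (hv D t) x = 0 -> a <= am.
Proof.
intros H. assert (TP := k_T _ H). assert (R1 := k_R _ H). set (c := decay (hT D) (hR D)).
assert (cp : 0 <= c).
{ unfold c, decay. assert (0 < exp (- (hT D / 4)) < 1) by (split; [apply exp_pos | rewrite <- exp_0; apply exp_increasing; lra]).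
  assert (0 < 2 * hR D / (hT D / 4)) by (apply Rdiv_lt_0_compat; lra).
  assert (0 < 2 / (1 - exp (- (hT D / 4)))) by (apply Rdiv_lt_0_compat; lra). apply Rmult_le_pos; lra. }
set (sg := Rmin (hT D / 4) (1 / (2 * (c + 1)))). assert (i2 : 0 < 1 / (2 * (c + 1))) by (apply Rdiv_lt_0_compat; lra).
assert (sp : 0 < sg) by (apply Rmin_pos; lra). assert (m1 := Rmin_l (hT D / 4) (1 / (2 * (c + 1)))). assert (m2 := Rmin_r (hT D / 4) (1 / (2 * (c + 1)))). fold sg in m1, m2.
exists (exp (- sg)). split. { split; [apply Rlt_le, exp_pos | rewrite <- exp_0; apply exp_increasing; lra]. }
intros t a x Ht Ha Zu Zv. apply Rnot_lt_le. intros L.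
assert (ap : 0 < a) by (eapply Rlt_trans; [apply exp_pos | exact L]).
set (d := - ln a). assert (ea : exp (- d) = a) by (unfold d; rewrite Ropp_involutive; apply exp_ln; auto).
assert (dp : 0 < d). { unfold d. assert (ln a < ln 1) by (apply ln_increasing; lra). rewrite ln_1 in *; lra. }
assert (ds : d < sg). { rewrite <- ea in L. apply exp_lt_inv in L. lra. }
assert (Ku := pint_boundary (hT D) _ _ _ (hR D) t d x TP (k_u _ H) (k_hu _ H) ltac:(intros; now apply core_bound) Ht ltac:(lra)).
assert (Kv := pint_boundary (hT D) _ _ _ (hR D) t d x TP (k_v _ H) (k_hv _ H) ltac:(intros; now apply core_bound) Ht ltac:(lra)).
rewrite ea, Zu, Rminus_0_r in Ku. rewrite ea, Zv, Rminus_0_r in Kv. fold c in Ku, Kv.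
assert (cd : c * d <= 1 / 2).
{ apply Rle_trans with ((c + 1) * (1 / (2 * (c + 1)))). apply Rmult_le_compat; lra. right; field; lra. }
assert (N := k_N _ H (t + d) x ltac:(lra)). unfold nsq in N.
assert (Q : forall y, Rabs y <= c * d -> y * y <= 1 / 4).
{ intros y Hy. apply Rabs_le_between in Hy. assert (0 <= (1/2 - y) * (1/2 + y)) by (apply Rmult_le_pos; lra). lra. }
apply Q in Ku. apply Q in Kv. lra.
Qed.

Lemma pint_rot a g x : -1 < a < 1 -> cont g -> periodic g -> pint a g x = mean (fun s => pk a s * g (s + x)).
Proof.
intros Ha C P. rewrite mean_unshift; auto using pk_per; [|cnt].
apply mean_ext; intros s. f_equal. rewrite <- pk_even. f_equal; ring.
Qed.

Lemma m0_bound a am : 0 <= a <= am -> am < 1 -> m0 a <= 2 / (1 - am).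
Proof.
intros Ha Hm. unfold m0. assert (0 < 1 - a * a) by nra.
apply (Rmult_le_reg_r ((1 - a * a) * (1 - am))). apply Rmult_lt_0_compat; lra.
replace ((1 + a * a) / (1 - a * a) * ((1 - a * a) * (1 - am))) with ((1 + a * a) * (1 - am)) by (field; lra).
replace (2 / (1 - am) * ((1 - a * a) * (1 - am))) with (2 * (1 - a * a)) by (field; lra).
apply Rle_trans with ((1 + a * a) * (1 - a)). apply Rmult_le_compat_l; [generalize (sq_ge0 a); lra | lra].
replace (2 * (1 - a * a)) with ((2 * (1 + a)) * (1 - a)) by ring. apply Rmult_le_compat_r; [lra|].
assert (a * a <= 1 * 1) by (apply Rmult_le_compat; lra). lra.
Qed.

Lemma U1_rot D x t : core D -> 0 < t < hT D -> U1 (rot D x) t = U1 D t.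
Proof.
intros H Ht. unfold U1. simpl. cyl H Ht.
apply (mean_shift (fun s => hu D t s * hut D t s + hv D t s * hvt D t s) x); [cnt|].
intros s. rewrite (c1_per (k_u _ H) t Ht), (c1_per (k_v _ H) t Ht), (c1_per_t (k_u _ H) Ht), (c1_per_t (k_v _ H) Ht). auto.
Qed.

Lemma weighted_derive D p dp t : core D -> (forall s, is_derive p s (dp s)) -> cont dp -> periodic p -> 0 < t < hT D ->
  is_derive (fun t => mean (fun s => p s * nsq D t s)) t (2 * mean (fun s => p s * (hu D t s * hut D t s + hv D t s * hvt D t s))).
Proof.
intros H Dp Cdp Pp Ht. assert (Cp : cont p) by exact (derive_cont p _ Dp). cyl H Ht.
assert (K := mean_derive t (c1_mult (c1_circle 0 (hT D) p dp Dp Cdp Pp) (c1_nsq D H)) Ht). simpl in K.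
rewrite <- mean_scal by cnt. erewrite mean_ext; [exact K|]. intros; simpl; ring.
Qed.

(** The energy is not bounded near the inner end, but its integral is the increment of [U1]. Hence
    Young's inequality with a free parameter [de], rather than a Lipschitz bound. *)
Lemma drift D a (g gt gs : R -> R -> R) de t t' : core D -> 0 <= a < 1 -> C1cyl 0 (hT D) g gt gs -> 0 < de ->
  (forall t, 0 < t < hT D -> mean (fun s => gt t s * gt t s) <= energy D t) -> 0 < t -> t <= t' -> t' < hT D ->
  Rabs (mean (fun s => pk a s * g t' s) - mean (fun s => pk a s * g t s)) <= m0 a / (2 * de) * (t' - t) + de / 2 * (U1 D t' - U1 D t).
Proof.
intros H Ha G dp En h1 h2 h3. destruct c1_pk as (qt & qs & Q). assert (a1 : -1 < a < 1) by lra.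
assert (Cp := cont_pk a a1).
assert (dpk : forall y, is_derive (pk a) y (qs a y)) by (intros y; apply (c1_ds Q); auto).
assert (Dm : forall y, 0 < y < hT D -> is_derive (fun y => mean (fun s => pk a s * g y s)) y (mean (fun s => pk a s * gt y s))).
{ intros y Hy. assert (K := mean_derive y (c1_mult (c1_circle 0 (hT D) (pk a) (qs a) dpk (c1_cont_s Q a1) (pk_per a)) G) Hy). simpl in K.
  erewrite mean_ext; [exact K|]. intros; simpl; ring. }
assert (Bd : forall y, 0 < y < hT D -> Rabs (mean (fun s => pk a s * gt y s)) <= m0 a / (2 * de) + de / 2 * energy D y).
{ intros y Hy. assert (Cg := c1_cont_t G Hy).
  assert (forall sg, sg * sg = 1 -> sg * mean (fun s => pk a s * gt y s) <= m0 a / (2 * de) + de / 2 * energy D y).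
  { intros sg Hs. apply Rle_trans with (m0 a / (2 * de) + de / 2 * mean (fun s => gt y s * gt y s)).
    2:{ apply Rplus_le_compat_l, Rmult_le_compat_l; [lra | auto]. }
    unfold Rdiv at 1. rewrite (Rmult_comm (m0 a)), <- mean_pk2, <- !mean_scal, <- mean_plus by (auto; cnt).
    apply mean_le; [cnt..|]. intros s. assert (Y := young (pk a s) (sg * gt y s) de dp).
    replace (sg * gt y s * (sg * gt y s)) with (sg * sg * (gt y s * gt y s)) in Y by ring. rewrite Hs in Y. unfold Rdiv in *. lra. }
  assert (E1 := H0 1 ltac:(ring)). assert (E2 := H0 (-1) ltac:(ring)). apply Rabs_le; lra. }
assert (DB : forall sg y, 0 < y < hT D -> is_derive (fun y => m0 a / (2 * de) * y + de / 2 * U1 D y + sg * mean (fun s => pk a s * g y s)) y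
   (m0 a / (2 * de) * 1 + de / 2 * energy D y + sg * mean (fun s => pk a s * gt y s))).
{ intros sg y Hy. apply (is_derive_plus (fun y => m0 a / (2 * de) * y + de / 2 * U1 D y) (fun y => sg * mean (fun s => pk a s * g y s))).
  - apply (is_derive_plus (fun y => m0 a / (2 * de) * y) (fun y => de / 2 * U1 D y)).
    + auto_derive; auto; ring.
    + apply (is_derive_scal (U1 D) y (de / 2)). now apply U1_derive.
  - apply (is_derive_scal (fun y => mean (fun s => pk a s * g y s)) y sg). auto. }
assert (K1 := incr 0 (hT D) _ _ t t' (DB 1)). assert (K2 := incr 0 (hT D) _ _ t t' (DB (-1))). cbv beta in K1, K2.
assert (P1 := K1 ltac:(intros y Hy; assert (b := Bd y Hy); apply Rabs_le_between in b; lra) h1 h2 h3).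
assert (P2 := K2 ltac:(intros y Hy; assert (b := Bd y Hy); apply Rabs_le_between in b; lra) h1 h2 h3).
apply Rabs_le; lra.
Qed.

(** At a small [t0] the mean of [pk a] times the rotated [h] is zero for suitable [a] and rotation
    [x]. The same mean of [|h|^2] exceeds 1 at [t0] and tends to 1 at the inner end, so its
    derivative is nonnegative at some earlier time [t]. By [drift] the first mean is still small
    there. *)
Lemma good_slice D : core D -> exists am, 0 <= am < 1 /\ forall e, 0 < e -> exists t a x, 0 < t < e /\ 0 < t < hT D /\ 0 <= a <= am /\
  0 <= mean (fun s => pk a s * (hu (rot D x) t s * hut (rot D x) t s + hv (rot D x) t s * hvt (rot D x) t s)) /\
  mean (fun s => pk a s * hu (rot D x) t s) * mean (fun s => pk a s * hu (rot D x) t s) + mean (fun s => pk a s * hv (rot D x) t s) * mean (fun s => pk a s * hv (rot D x) t s) <= e.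
Proof.
intros H. destruct (zero_bound D H) as (am & Ham & Z). exists am; split; auto. intros e He. assert (TP := k_T _ H).
set (Um := U1 D (hT D / 2)). assert (U0 := U1_ge0 D (hT D / 2) H ltac:(lra)). fold Um in U0.
set (et := Rmin 1 (e / 2)). assert (ep : 0 < et <= 1 /\ et <= e / 2).
{ assert (m1 := Rmin_l 1 (e/2)). assert (m2 := Rmin_r 1 (e/2)). unfold et. split; [split|]; auto. apply Rmin_pos; lra. }
set (de := et / (Um + 1)). assert (dp : 0 < de) by (apply Rdiv_lt_0_compat; lra).
set (M := 2 / (1 - am)). assert (Mp : 0 < M) by (apply Rdiv_lt_0_compat; lra).
(* Both terms of the drift are then at most [et / 2]: the energy term by the choice of [de], the
   term proportional to time by [t0 <= de et / M]. *)
set (t0 := Rmin (Rmin e (hT D / 2)) (de * et / M) / 2).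
assert (p1 : 0 < de * et / M) by (apply Rdiv_lt_0_compat; [apply Rmult_lt_0_compat|]; lra).
assert (Ht0 : 0 < t0 /\ t0 < e /\ t0 < hT D / 2 /\ t0 <= de * et / M).
{ assert (a1 := Rmin_l (Rmin e (hT D / 2)) (de * et / M)). assert (a2 := Rmin_r (Rmin e (hT D / 2)) (de * et / M)).
  assert (a3 := Rmin_l e (hT D / 2)). assert (a4 := Rmin_r e (hT D / 2)). assert (a5 : 0 < Rmin (Rmin e (hT D / 2)) (de * et / M)) by (repeat apply Rmin_pos; lra).
  unfold t0. lra. }
assert (h0 : 0 < t0 < hT D) by lra.
destruct (poisson_zero (hu D t0) (hus D t0) (hv D t0) (hvs D t0)) as (a & x & Ha & Zu & Zv).
{ intros; now apply (k_u _ H). } { intros; now apply (k_v _ H). }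
{ apply (c1_cont_s (k_u _ H) h0). } { apply (c1_cont_s (k_v _ H) h0). }
{ apply (c1_per (k_u _ H) _ h0). } { apply (c1_per (k_v _ H) _ h0). }
{ intros s. assert (N := k_N _ H t0 s h0). unfold nsq in N. lra. }
{ assert (W := wind_ge1 D t0 H h0). change (winding (hu D t0) (hus D t0) (hv D t0) (hvs D t0)) with (wind D t0). lra. }
assert (aam := Z t0 a x ltac:(lra) Ha Zu Zv).
assert (H' := core_rot D x H). set (D' := rot D x) in *.
rewrite pint_rot in Zu, Zv; try lra.
2: apply (c1_cont_f (k_v _ H) h0). 2: apply (c1_per (k_v _ H) _ h0).
2: apply (c1_cont_f (k_u _ H) h0). 2: apply (c1_per (k_u _ H) _ h0).
destruct c1_pk as (qt & qs & Q). assert (a1 : -1 < a < 1) by lra. assert (Cp := cont_pk a a1).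
assert (dpk : forall y, is_derive (pk a) y (qs a y)) by (intros y; apply (c1_ds Q); auto).
set (F t := mean (fun s => pk a s * nsq D' t s)).
assert (F0 : 1 < F t0).
{ cyl H' h0. assert (cN := c1_cont_f (c1_nsq D' H') h0). assert (0 < mean (fun s => pk a s * (nsq D' t0 s - 1))).
  - apply mean_gt0; [cnt|]. intros s. apply Rmult_lt_0_compat; [now apply pk_pos|]. assert (N := k_N _ H' t0 s h0). lra.
  - rewrite (mean_ext _ (fun s => pk a s * nsq D' t0 s - pk a s)) in H0 by (intros; ring). rewrite mean_minus, mean_pk in H0 by (auto; cnt). fold (F t0) in H0. lra. }
destruct (k_0 _ H' (F t0 - 1) ltac:(lra)) as (d & ddp & Hd).
set (t1 := Rmin d t0 / 2). assert (Ht1 : 0 < t1 /\ t1 < d /\ t1 < t0).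
{ assert (b1 := Rmin_l d t0). assert (b2 := Rmin_r d t0). assert (0 < Rmin d t0) by (apply Rmin_pos; lra). unfold t1; lra. }
assert (h1 : 0 < t1 < hT D) by lra.
assert (F1 : F t1 < F t0).
{ cyl H' h1. assert (cN := c1_cont_f (c1_nsq D' H') h1). assert (0 < mean (fun s => pk a s * (F t0 - nsq D' t1 s))).
  - apply mean_gt0; [cnt|]. intros s. apply Rmult_lt_0_compat; [now apply pk_pos|]. assert (N := Hd t1 s h1 ltac:(lra)). lra.
  - rewrite (mean_ext _ (fun s => F t0 * pk a s - pk a s * nsq D' t1 s)) in H0 by (intros; ring). rewrite mean_minus, mean_scal, mean_pk in H0 by (auto; cnt). fold (F t1) in H0. lra. }
destruct (MVT_gen F t1 t0 (fun t => 2 * mean (fun s => pk a s * (hu D' t s * hut D' t s + hv D' t s * hvt D' t s)))) as (t & Ht & E).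
{ intros y Hy. rewrite Rmin_left, Rmax_right in Hy by lra. apply (weighted_derive D' (pk a) (qs a)); auto. apply (c1_cont_s Q a1). apply pk_per. change (hT D') with (hT D); lra. }
{ intros y Hy. rewrite Rmin_left, Rmax_right in Hy by lra. apply continuity_pt_filterlim. apply (ex_derive_continuous F). eexists.
  apply (weighted_derive D' (pk a) (qs a)); auto. apply (c1_cont_s Q a1). apply pk_per. change (hT D') with (hT D); lra. }
rewrite Rmin_left, Rmax_right in Ht by lra.
assert (ht : 0 < t < hT D) by lra.
exists t, a, x. fold D'. split; [lra|]. split; auto. split; [lra|]. split.
{ apply Rnot_lt_le. intros L. set (m := mean (fun s => pk a s * (hu D' t s * hut D' t s + hv D' t s * hvt D' t s))) in E.
  change (m < 0) in L. assert (0 < - m * (t0 - t1)) by (apply Rmult_lt_0_compat; lra). lra. }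
assert (En : forall y, 0 < y < hT D' -> mean (fun s => hut D' y s * hut D' y s) <= energy D' y /\ mean (fun s => hvt D' y s * hvt D' y s) <= energy D' y).
{ intros y Hy. cyl H' Hy. unfold energy. split; (apply mean_le; [cnt..|]); intros s;
  generalize (sq_ge0 (hut D' y s)) (sq_ge0 (hvt D' y s)) (sq_ge0 (hus D' y s)) (sq_ge0 (hvs D' y s)); lra. }
assert (t0T : t0 < hT D') by (change (hT D') with (hT D); lra).
assert (tp : 0 < t) by lra. assert (tt : t <= t0) by lra.
assert (Ku := drift D' a _ _ _ de t t0 H' Ha (k_u _ H') dp (fun y Hy => proj1 (En y Hy)) tp tt t0T).
assert (Kv := drift D' a _ _ _ de t t0 H' Ha (k_v _ H') dp (fun y Hy => proj2 (En y Hy)) tp tt t0T).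
unfold D' in Ku at 1. unfold D' in Kv at 1. simpl in Ku, Kv. rewrite Zu in Ku. rewrite Zv in Kv. fold D' in Ku, Kv.
assert (B : m0 a / (2 * de) * (t0 - t) + de / 2 * (U1 D' t0 - U1 D' t) <= et).
{ assert (I1 := U1_ge0 D' t H' ltac:(auto)). assert (I2 := U1_incr D' t0 (hT D / 2) H' ltac:(lra) ltac:(lra) ltac:(change (hT D') with (hT D); lra)).
  unfold D' in I2 at 2. rewrite (U1_rot D x (hT D / 2) H ltac:(lra)) in I2. fold Um in I2.
  assert (X1 : de / 2 * (U1 D' t0 - U1 D' t) <= et / 2).
  { apply Rle_trans with (de / 2 * (Um + 1)). apply Rmult_le_compat_l; lra. right; unfold de; field; lra. }
  assert (X2 : m0 a / (2 * de) * (t0 - t) <= et / 2); [|lra].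
  assert (mb := m0_bound a am ltac:(lra) ltac:(lra)). fold M in mb. assert (mg := m0_ge1 a Ha).
  apply Rle_trans with (M / (2 * de) * (de * et / M)).
  - apply Rmult_le_compat; try lra. apply Rlt_le, Rdiv_lt_0_compat; lra.
    unfold Rdiv. apply Rmult_le_compat_r; auto. apply Rlt_le, Rinv_0_lt_compat; lra.
  - right; field; lra. }
assert (Qq : forall y, Rabs (0 - y) <= et -> y * y <= e / 2).
{ intros y Hy. apply Rabs_le_between in Hy. assert (0 <= (et - y) * (et + y)) by (apply Rmult_le_pos; lra). assert (et * et <= 1 * et) by (apply Rmult_le_compat_r; lra). lra. }
assert (Y1 := Qq _ (Rle_trans _ _ _ Ku B)). assert (Y2 := Qq _ (Rle_trans _ _ _ Kv B)).
eapply Rle_trans; [apply Rplus_le_compat; [exact Y1 | exact Y2] | lra].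
Qed.

(** * The thick case *)

(* [c' + |n| c = kk n (c(t + tau) - exp(-|n| tau) c(t))] along a Fourier mode [c'' = n^2 c]. *)
Definition kk tau n := if Z.eq_dec n 0 then / tau else IZR (Z.abs n) / sinh (IZR (Z.abs n) * tau).

(** [e^(2 tau) >= 7] is the same as [coth tau <= 4/3]. The threshold lies below 1 so that values
    [tau < T] remain when [T = 1]. *)
Lemma exp_2tau tau : 99 / 100 <= tau -> 7 <= exp (2 * tau).
Proof.
intros H. apply Rle_trans with (exp (198 / 100)).
2:{ destruct (Req_dec (198/100) (2 * tau)) as [->|]; [lra|]. left; apply exp_increasing; lra. }
(* [1 + x <= e^x] at [x = 1.98 / 64], followed by six squarings rounded downwards. *)
replace (198 / 100) with (INR 64 * (198 / 6400)) by (simpl; field). rewrite <- exp_nat.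
assert (E : 1 + 198 / 6400 <= exp (198 / 6400)) by (left; apply exp_ineq1; lra).
apply Rle_trans with ((1 + 198 / 6400) ^ 64); [|apply pow_incr; lra].
assert (S : forall x y n, 0 <= x -> 0 <= y -> y <= x * x -> y ^ n <= x ^ (2 * n)).
{ intros x y n hx hy h. rewrite pow_mult. apply pow_incr. simpl. lra. }
apply Rle_trans with ((10628 / 10000) ^ 32); [|apply (S _ _ 32%nat); lra].
apply Rle_trans with ((11295 / 10000) ^ 16); [|apply (S _ _ 16%nat); lra].
apply Rle_trans with ((12757 / 10000) ^ 8); [|apply (S _ _ 8%nat); lra].
apply Rle_trans with ((16274 / 10000) ^ 4); [|apply (S _ _ 4%nat); lra].
apply Rle_trans with ((26484 / 10000) ^ 2); [|apply (S _ _ 2%nat); lra].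
simpl. lra.
Qed.

Section Coefficients.
Variable tau : R.
Hypothesis Ht : 99 / 100 <= tau.
Let C := cosh tau.
Let s := sinh tau.
Let r := C / s.

Lemma sC : 0 < s /\ 0 < C /\ C * C - s * s = 1 /\ exp (- tau) = C - s /\ exp tau = C + s.
Proof.
repeat split. apply sinh_pos; lra. apply cosh_pos. apply cosh2_sinh2.
unfold C, s, cosh, sinh; field. unfold C, s, cosh, sinh; field.
Qed.

Lemma r_range : 1 < r <= 4 / 3.
Proof.
destruct sC as (h1 & h2 & h3 & h4 & h5). assert (E := exp_2tau tau Ht).
replace (2 * tau) with (tau + tau) in E by ring. rewrite exp_plus, h5 in E.
assert (C = r * s) by (unfold r; field; lra).
assert (0 < C - s) by (rewrite <- h4; apply exp_pos).
split.
- apply (Rmult_lt_reg_r s); lra.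
- apply (Rmult_le_reg_r s); auto. rewrite <- H.
  assert ((C + s) * (C - s) = 1) by lra.
  assert (7 * (C - s) <= C + s). { assert ((C + s) * (C + s) * (C - s) = C + s) by (rewrite Rmult_assoc, H1; ring). rewrite <- H2. apply Rmult_le_compat_r; lra. } lra.
Qed.

Lemma C_r : C * C * (r * r - 1) = r * r.
Proof. destruct sC as (h1 & h2 & h3 & _). unfold r. field_simplify; [|lra..]. replace (s ^ 2) with (C * C - 1) by (simpl; lra). field. replace (C * C - 1) with (s * s) by lra. nra. Qed.

Lemma s_kk_1 n : Z.abs n = 1%Z -> s * kk tau n = 1 /\ kk tau n * exp (- (IZR (Z.abs n) * tau)) = r - 1.
Proof.
intros H. destruct sC as (h1 & h2 & h3 & h4 & _). unfold kk. destruct Z.eq_dec; [lia|]. rewrite H, !Rmult_1_l. fold s. rewrite h4. split; unfold r; field; lra.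
Qed.

Lemma sinh_step x : sinh (x + tau) = sinh x * C + cosh x * s.
Proof. unfold C, s, sinh, cosh. replace (- (x + tau)) with (- x + - tau) by ring. rewrite !exp_plus. field. Qed.
Lemma cosh_step x : cosh (x + tau) = cosh x * C + sinh x * s.
Proof. unfold C, s, sinh, cosh. replace (- (x + tau)) with (- x + - tau) by ring. rewrite !exp_plus. field. Qed.

(** The case 3 uses [sinh (3 tau) = s (3 C^2 + s^2)] with [C^2 >= 16/7]. Each further step
    multiplies by at least [e^tau >= 13/5], more than the ratio [(n + 1) / n]. *)
Lemma sinh_large n : (3 <= n)%nat -> 5 / 2 * INR n * s <= sinh (INR n * tau).
Proof.
intros Hn. destruct sC as (h1 & h2 & h3 & h4 & h5). destruct r_range as [r1 r2]. assert (CC := C_r).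
assert (C2 : 16 / 7 <= C * C).
{ apply (Rmult_le_reg_r (r * r - 1)); [nra|]. rewrite CC. nra. }
induction Hn as [|n Hn IH].
- replace (INR 3) with 3 by (simpl; ring). replace (3 * tau) with (tau + tau + tau) by ring. rewrite sinh_step, sinh_step, cosh_step. fold C s.
  replace ((s * C + C * s) * C + (C * C + s * s) * s) with (s * (3 * (C * C) + s * s)) by ring. replace (s * s) with (C * C - 1) by lra. nra.
- rewrite S_INR. replace ((INR n + 1) * tau) with (INR n * tau + tau) by ring. rewrite sinh_step.
  assert (nb : 3 <= INR n) by (apply (le_INR 3) in Hn; simpl in Hn; lra).
  assert (sc : sinh (INR n * tau) <= cosh (INR n * tau)) by (unfold sinh, cosh; generalize (exp_pos (- (INR n * tau))); lra).
  assert (E2 : 13 / 5 <= C + s).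
  { assert (E := exp_2tau tau Ht). replace (2 * tau) with (tau + tau) in E by ring. rewrite exp_plus, h5 in E.
    apply Rnot_lt_le; intros L. assert ((C + s) * (C + s) < 13 / 5 * (13 / 5)) by (apply Rmult_le_0_lt_compat; lra). lra. }
  set (x := sinh (INR n * tau)) in *. set (y := cosh (INR n * tau)) in *.
  assert (0 < x) by nra.
  apply Rle_trans with (x * (C + s)); [|nra].
  apply Rle_trans with (5 / 2 * INR n * s * (13 / 5)); [nra|]. apply Rmult_le_compat; nra.
Qed.

(* With [r = coth tau <= 4/3]: the case [n = 2] is explicit, for [n >= 3] the factor [(s kk)^2] is at most [4/25]. *)
Lemma mode_coefficient n : (2 <= Z.abs n)%Z ->
  let w := r - 1 - kk tau n * exp (- (IZR (Z.abs n) * tau)) in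
  0 <= w <= r - 1 /\ 1 / 25 <= r / 2 * (1 - (s * kk tau n) * (s * kk tau n)) - w * (1 + 32 / 100).
Proof.
intros Hn w. destruct sC as (h1 & h2 & h3 & h4 & h5). destruct r_range as [r1 r2].
assert (rs : C = r * s) by (unfold r; field; lra).
assert (kE : kk tau n = IZR (Z.abs n) / sinh (IZR (Z.abs n) * tau)) by (unfold kk; destruct Z.eq_dec; auto; lia).
destruct (Z.eq_dec (Z.abs n) 2) as [E|E].
- assert (ss : sinh (2 * tau) = 2 * s * C) by (replace (2 * tau) with (tau + tau) by ring; rewrite sinh_step; fold C s; ring).
  assert (sk : s * kk tau n = / C) by (rewrite kE, E, ss; field; lra).
  assert (ek : kk tau n * exp (- (IZR (Z.abs n) * tau)) = (r - 1) * (r - 1) / r).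
  { rewrite E. replace (- (2 * tau)) with (- tau + - tau) by ring. rewrite exp_plus, h4. rewrite kE, E, ss. rewrite rs. field. split; lra. }
  unfold w. rewrite ek, sk.
  replace (r - 1 - (r - 1) * (r - 1) / r) with ((r - 1) / r) by (field; lra).
  assert (iC : / C * / C = (r * r - 1) / (r * r)).
  { assert (K := C_r). apply (Rmult_eq_reg_r (C * C * (r * r))); [|apply Rmult_integral_contrapositive; split; nra]. field_simplify; [|lra..]. nra. }
  rewrite iC. split; [split|].
  + apply Rlt_le, Rdiv_lt_0_compat; lra.
  + apply (Rmult_le_reg_r r); [lra|]. unfold Rdiv. rewrite Rmult_assoc, Rinv_l by lra. nra.
  + apply (Rmult_le_reg_r r); [lra|].
    replace ((r / 2 * (1 - (r * r - 1) / (r * r)) - (r - 1) / r * (1 + 32 / 100)) * r) with (1 / 2 - (r - 1) * (132 / 100)) by (field; lra). lra.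
- set (m := Z.to_nat (Z.abs n)). assert (mE : IZR (Z.abs n) = INR m) by (unfold m; rewrite INR_IZR_INZ, Z2Nat.id by lia; auto).
  assert (L := sinh_large m ltac:(unfold m; lia)). assert (mb : 3 <= INR m) by (change 3 with (IZR 3); rewrite <- mE; apply IZR_le; lia).
  assert (wE : w = r - 1 - kk tau n * exp (- (INR m * tau))) by (unfold w; rewrite mE; auto). clearbody w.
  rewrite mE in *. assert (P : 0 < sinh (INR m * tau)) by nra.
  assert (e0 : 0 < exp (- (INR m * tau))) by apply exp_pos.
  assert (k0 : 0 < kk tau n) by (rewrite kE; apply Rdiv_lt_0_compat; lra).
  assert (sk : 0 < s * kk tau n <= 2 / 5).
  { split. nra. rewrite kE. apply (Rmult_le_reg_r (sinh (INR m * tau))); auto.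
    replace (s * (INR m / sinh (INR m * tau)) * sinh (INR m * tau)) with (s * INR m) by (field; lra). lra. }
  assert (ke : kk tau n * exp (- (INR m * tau)) <= r - 1).
  { apply (Rmult_le_reg_l s); auto. replace (s * (r - 1)) with (C - s) by lra. rewrite <- h4, <- Rmult_assoc.
    apply Rle_trans with (1 * exp (- (INR m * tau))). apply Rmult_le_compat_r; lra.
    rewrite Rmult_1_l. left. apply exp_increasing. nra. }
  assert (kp : 0 < kk tau n * exp (- (INR m * tau))) by (apply Rmult_lt_0_compat; auto).
  split; [lra|].
  assert ((s * kk tau n) * (s * kk tau n) <= 2 / 5 * (2 / 5)) by (apply Rmult_le_compat; lra).
  set (g := (s * kk tau n) * (s * kk tau n)) in *. assert (w <= r - 1) by lra.
  assert (r / 2 * (1 - 4 / 25) <= r / 2 * (1 - g)) by (apply Rmult_le_compat_l; lra). lra.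
Qed.

Lemma kk_pos n : 0 < kk tau n.
Proof.
unfold kk. destruct Z.eq_dec. apply Rinv_0_lt_compat; lra. assert (0 < IZR (Z.abs n)) by (apply IZR_lt; lia).
apply Rdiv_lt_0_compat; auto. apply sinh_pos, Rmult_lt_0_compat; lra.
Qed.

(** The weight of [|x|^2] in the completed square. With it [kk / al = cosh tau] for the modes 1 and
    -1, so the square vanishes exactly on the expected growth [x = cosh tau b]. *)
Let al := / (s * C).

Lemma al_pos : 0 < al.
Proof. destruct sC as (h1 & h2 & _). apply Rinv_0_lt_compat, Rmult_lt_0_compat; auto. Qed.
Lemma al_C : al / 2 * (C * C) = r / 2.
Proof. destruct sC as (h1 & h2 & _). unfold al, r. field. lra. Qed.

(** The square is kept rather than dropped: in the equality case its smallness determines [x] from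
    [b]. *)
Lemma complete_square k br bi xr xi : k * (br * xr + bi * xi) =
  al / 2 * (xr * xr + xi * xi) + r / 2 * ((s * k) * (s * k)) * (br * br + bi * bi)
  - al / 2 * ((xr - k / al * br) * (xr - k / al * br) + (xi - k / al * bi) * (xi - k / al * bi)).
Proof. destruct sC as (h1 & h2 & _). unfold al, r. field. lra. Qed.

Definition big (n : Z) := if Z_le_dec 2 (Z.abs n) then 1 else 0.

(** Modes 1 and -1 lose nothing, since [s kk = 1] and [kk e^(-tau) = r - 1]. For [|n| >= 2] the
    coefficient of [<b, c>] has the excess [w], paid by the surplus of [mode_coefficient] and by a
    multiple of [|b - c|^2]. Mode 0 is bounded by the smallness of [b_0]. *)
Lemma per_mode n br bi cr ci xr xi e Rb : 0 < e -> 0 < Rb -> (n = 0%Z -> br * br + bi * bi <= e * e /\ cr * cr + ci * ci <= Rb * Rb) ->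
  kk tau n * (br * (xr - exp (- (IZR (Z.abs n) * tau)) * cr) + bi * (xi - exp (- (IZR (Z.abs n) * tau)) * ci)) <=
  al / 2 * (xr * xr + xi * xi) + r / 2 * (br * br + bi * bi) - (r - 1) * (br * cr + bi * ci)
  - al / 2 * ((xr - kk tau n / al * br) * (xr - kk tau n / al * br) + (xi - kk tau n / al * bi) * (xi - kk tau n / al * bi))
  - 1 / 25 * (big n * (br * br + bi * bi)) + (r - 1) / (128 / 100) * ((br - cr) * (br - cr) + (bi - ci) * (bi - ci))
  + (if Z.eq_dec n 0 then (r / 2 * ((s / tau) * (s / tau)) * e + (r - 1 + / tau) * Rb) * e else 0).
Proof.
intros He HR Z0. destruct r_range as [r1 r2]. destruct sC as (h1 & h2 & h3 & h4 & h5).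
replace (kk tau n * (br * (xr - exp (- (IZR (Z.abs n) * tau)) * cr) + bi * (xi - exp (- (IZR (Z.abs n) * tau)) * ci)))
 with (kk tau n * (br * xr + bi * xi) - kk tau n * exp (- (IZR (Z.abs n) * tau)) * (br * cr + bi * ci)) by ring.
rewrite complete_square. set (sq := al / 2 * ((xr - kk tau n / al * br) * _ + _)).
set (ch := kk tau n * exp (- (IZR (Z.abs n) * tau))) in *.
assert (d0 : 0 <= (br - cr) * (br - cr) + (bi - ci) * (bi - ci)) by (generalize (sq_ge0 (br - cr)) (sq_ge0 (bi - ci)); lra).
assert (b0 : 0 <= br * br + bi * bi) by (generalize (sq_ge0 br) (sq_ge0 bi); lra).
assert (dp : 0 <= (r - 1) / (128 / 100) * ((br - cr) * (br - cr) + (bi - ci) * (bi - ci))) by (apply Rmult_le_pos; lra).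
unfold big. destruct (Z.eq_dec n 0) as [E|E]; [|destruct (Z.eq_dec (Z.abs n) 1) as [E1|E1]].
- destruct Z_le_dec; [lia|]. destruct (Z0 E) as [B0 C0]. subst n.
  assert (kE : kk tau 0 = / tau) by reflexivity. unfold ch. rewrite kE. replace (s * / tau) with (s / tau) by reflexivity.
  simpl Z.abs. rewrite Rmult_0_l, Ropp_0, exp_0, Rmult_1_r.
  assert (it : 0 < / tau) by (apply Rinv_0_lt_compat; lra).
  assert (G : - (e * Rb) <= br * cr + bi * ci <= e * Rb).
  { assert (sg : forall g, g * g = 1 -> g * (br * cr + bi * ci) <= e * Rb).
    { intros g Hg. apply (Rmult_le_reg_l (2 * (e * Rb))). apply Rmult_lt_0_compat; [lra | apply Rmult_lt_0_compat; auto].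
      assert (P1 := sq_ge0 (Rb * br - e * g * cr)). assert (P2 := sq_ge0 (Rb * bi - e * g * ci)).
      assert (P3 : Rb * Rb * (br * br + bi * bi) <= Rb * Rb * (e * e)) by (apply Rmult_le_compat_l; auto; apply sq_ge0).
      assert (P4 : e * e * (cr * cr + ci * ci) <= e * e * (Rb * Rb)) by (apply Rmult_le_compat_l; auto; apply sq_ge0).
      assert (P5 : e * e * (g * g) * (cr * cr + ci * ci) = e * e * (cr * cr + ci * ci)) by (rewrite Hg; ring). lra. }
    assert (g1 := sg 1 ltac:(ring)). assert (g2 := sg (-1) ltac:(ring)). lra. }
  set (ga := br * cr + bi * ci) in *. set (be := br * br + bi * bi) in *.
  assert (A1 : r / 2 * (s / tau * (s / tau)) * be <= r / 2 * (s / tau * (s / tau)) * (e * e)).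
  { apply Rmult_le_compat_l; auto. apply Rmult_le_pos; [lra | apply sq_ge0]. }
  assert (A2 : (r - 1 - / tau) * ga <= (r - 1 + / tau) * (e * Rb)).
  { assert ((r - 1) * ga <= (r - 1) * (e * Rb)) by (apply Rmult_le_compat_l; lra).
    assert (/ tau * - ga <= / tau * (e * Rb)) by (apply Rmult_le_compat_l; lra). lra. }
  assert (0 <= r / 2 * be) by (apply Rmult_le_pos; lra). lra.
- destruct Z_le_dec; [lia|]. destruct (s_kk_1 n E1) as [K1 K2]. unfold ch. rewrite K1, K2. lra.
- destruct Z_le_dec; [|lia]. destruct (mode_coefficient n ltac:(lia)) as [W1 W2]. fold ch in W1, W2.
  set (w := r - 1 - ch) in *. set (g := s * kk tau n * (s * kk tau n)) in *.
  (* Expanding [|0.64 b + (b - c)|^2 >= 0]; hence 0.32 and 1.28, half and twice 0.64. *)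
  assert (Y : br * cr + bi * ci <= (1 + 32 / 100) * (br * br + bi * bi) + 1 / (128 / 100) * ((br - cr) * (br - cr) + (bi - ci) * (bi - ci))).
  { assert (P1 := sq_ge0 (64 / 100 * br + (br - cr))). assert (P2 := sq_ge0 (64 / 100 * bi + (bi - ci))). lra. }
  assert (Y2 : w * (br * cr + bi * ci) <= w * ((1 + 32 / 100) * (br * br + bi * bi)) + (r - 1) / (128 / 100) * ((br - cr) * (br - cr) + (bi - ci) * (bi - ci))).
  { apply Rle_trans with (w * ((1 + 32 / 100) * (br * br + bi * bi) + 1 / (128 / 100) * ((br - cr) * (br - cr) + (bi - ci) * (bi - ci)))).
    apply Rmult_le_compat_l; lra. rewrite Rmult_plus_distr_l. apply Rplus_le_compat_l.
    replace (w * (1 / (128 / 100) * ((br - cr) * (br - cr) + (bi - ci) * (bi - ci)))) with (w / (128 / 100) * ((br - cr) * (br - cr) + (bi - ci) * (bi - ci))) by field.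
    apply Rmult_le_compat_r; lra. }
  set (be := br * br + bi * bi) in *. set (ga := br * cr + bi * ci) in *.
  assert (Y3 : 1 / 25 * be <= (r / 2 * (1 - g) - w * (1 + 32 / 100)) * be) by (apply Rmult_le_compat_r; auto).
  replace ch with (r - 1 - w) by (unfold w; ring). lra.
Qed.
End Coefficients.

Definition hr D t := fr (hu D t) (hv D t).
Definition hi D t := fi (hu D t) (hv D t).
Definition dr D t := fr (hut D t) (hvt D t).
Definition di D t := fi (hut D t) (hvt D t).

Lemma coef_derive D n t : core D -> 0 < t < hT D ->
  (is_derive (fun t => hr D t n) t (dr D t n) /\ is_derive (fun t => dr D t n) t (IZR (Z.abs n) * IZR (Z.abs n) * hr D t n)) /\
  (is_derive (fun t => hi D t n) t (di D t n) /\ is_derive (fun t => di D t n) t (IZR (Z.abs n) * IZR (Z.abs n) * hi D t n)).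
Proof.
intros H Ht. set (k := IZR n). assert (kk : IZR (Z.abs n) * IZR (Z.abs n) = k * k).
{ unfold k. rewrite abs_IZR, <- Rabs_mult, Rabs_right; auto. apply Rle_ge, sq_ge0. }
rewrite kk. set (nu := IZR (Z.abs n)) in *.
assert (Cc : forall s, is_derive (fun s => cos (k * s)) s (- k * sin (k * s))) by (intros s; auto_derive; auto; ring).
assert (Cs : forall s, is_derive (fun s => sin (k * s)) s (k * cos (k * s))) by (intros s; auto_derive; auto; ring).
assert (Cc2 : forall s, is_derive (fun s => - k * sin (k * s)) s (- (nu * nu) * cos (k * s))) by (intros s; rewrite kk; auto_derive; auto; ring).
assert (Cs2 : forall s, is_derive (fun s => k * cos (k * s)) s (- (nu * nu) * sin (k * s))) by (intros s; rewrite kk; auto_derive; auto; ring).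
destruct (mode_ode _ _ nu t (k_u _ H) (k_hu _ H) Cc Cc2 (per_cosZ n) Ht) as [a1 a2].
destruct (mode_ode _ _ nu t (k_u _ H) (k_hu _ H) Cs Cs2 (per_sinZ n) Ht) as [a3 a4].
destruct (mode_ode _ _ nu t (k_v _ H) (k_hv _ H) Cc Cc2 (per_cosZ n) Ht) as [a5 a6].
destruct (mode_ode _ _ nu t (k_v _ H) (k_hv _ H) Cs Cs2 (per_sinZ n) Ht) as [a7 a8].
assert (L : forall P : R -> Prop, (forall y, 0 < y < hT D -> P y) -> locally t P) by (intros P HP; now apply (locally_Ioo 0 (hT D))).
cyl H Ht. unfold hr, hi, dr, di, fr, fi. fold k.
rewrite (mean_plus (fun s => hut D t s * cos (k * s)) (fun s => hvt D t s * sin (k * s))), (mean_plus (fun s => hu D t s * cos (k * s)) (fun s => hv D t s * sin (k * s))) by cnt.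
rewrite (mean_minus (fun s => hvt D t s * cos (k * s)) (fun s => hut D t s * sin (k * s))), (mean_minus (fun s => hv D t s * cos (k * s)) (fun s => hu D t s * sin (k * s))) by cnt.
split; split.
- eapply is_derive_ext_loc; [|apply (is_derive_plus _ _ _ _ _ a1 a7)]. apply L; intros y Hy. simpl. cyl H Hy. symmetry. apply mean_plus; cnt.
- rewrite <- kk, Rmult_plus_distr_l. eapply is_derive_ext_loc; [|apply (is_derive_plus _ _ _ _ _ a2 a8)]. apply L; intros y Hy. simpl. cyl H Hy. symmetry. apply mean_plus; cnt.
- eapply is_derive_ext_loc; [|apply (is_derive_minus _ _ _ _ _ a5 a3)]. apply L; intros y Hy. simpl. cyl H Hy. symmetry. apply mean_minus; cnt.
- rewrite <- kk, Rmult_minus_distr_l. eapply is_derive_ext_loc; [|apply (is_derive_minus _ _ _ _ _ a6 a4)]. apply L; intros y Hy. simpl. cyl H Hy. symmetry. apply mean_minus; cnt.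
Qed.

Lemma kk_solve T (f f1 : R -> R) n t tau : (forall t, 0 < t < T -> is_derive f t (f1 t) /\ is_derive f1 t (IZR (Z.abs n) * IZR (Z.abs n) * f t)) ->
  0 < t -> 0 < tau -> t + tau < T ->
  f1 t + IZR (Z.abs n) * f t = kk tau n * (f (t + tau) - exp (- (IZR (Z.abs n) * tau)) * f t).
Proof.
intros DD h1 h2 h3. unfold kk. destruct Z.eq_dec as [E|E].
- subst n. simpl Z.abs in *. rewrite !Rmult_0_l, Ropp_0, exp_0.
  assert (C1 : forall z, 0 < z < T -> f1 z = f1 t).
  { intros z Hz. apply (const_on 0 T); auto; [|lra]. intros y Hy. destruct (DD y Hy) as [_ Q]. now rewrite !Rmult_0_l in Q. }
  assert (E : f (t + tau) - f1 t * (t + tau) = f t - f1 t * t).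
  { apply (const_on 0 T (fun z => f z - f1 t * z)); try lra. intros z Hz. destruct (DD z Hz) as [Q _]. rewrite C1 in Q by auto.
    replace 0 with (f1 t - f1 t * 1) by ring. apply (is_derive_minus f (fun z => f1 t * z)); auto. auto_derive; auto; ring. }
  replace (f (t + tau)) with (f t + f1 t * tau) by lra. field. lra.
- assert (np : 0 < IZR (Z.abs n)) by (apply IZR_lt; lia). set (nu := IZR (Z.abs n)) in *.
  assert (S := ode_solve T f f1 nu t tau np DD ltac:(lra) ltac:(lra)).
  assert (sp : 0 < sinh (nu * tau)) by (apply sinh_pos, Rmult_lt_0_compat; lra).
  apply (Rmult_eq_reg_r (sinh (nu * tau))); [|lra]. field_simplify; [|lra]. lra.
Qed.

Definition slice_const tau Rb am :=
  20 + 3 * (2 / (1 - am)) + (cosh tau / sinh tau / 2 * ((sinh tau / tau) * (sinh tau / tau)) + (cosh tau / sinh tau - 1 + / tau) * Rb).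

Lemma lim_pick (u : nat -> R) (l e : R) : is_lim_seq u l -> 0 < e -> exists N, forall K, (N <= K)%nat -> l - e < u K < l + e.
Proof.
intros L He. apply is_lim_seq_spec in L. destruct (L (mkposreal e He)) as (N & HN). exists N. intros K HK.
specialize (HN K HK). simpl in HN. apply Rabs_lt_between in HN. lra.
Qed.

Lemma zs_combination K a1 a2 a3 a4 a5 a6 F1 F2 F3 F4 F5 F6 F7 :
  zs K (fun n => a1 * F1 n + a2 * F2 n - a3 * F3 n - a4 * F4 n - a5 * F5 n + a6 * F6 n + F7 n) =
  a1 * zs K F1 + a2 * zs K F2 - a3 * zs K F3 - a4 * zs K F4 - a5 * zs K F5 + a6 * zs K F6 + zs K F7.
Proof. rewrite !zs_plus, !zs_minus, !zs_plus, !zs_scal. ring. Qed.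

(** Put [b = q f], with [f] a partial sum of [h(t, .)], and let [M] be the mean of [q^2 |f|^2]. Up
    to multiples of [e], [half_derivative_bound] and the sign of the weighted derivative give
    [M <= sum kk <b, x - e^(-|n| tau) c>]. By [per_mode] the right side is at most [al U / 2 + r M /
    2 - (r - 1) + (r - 1) (M - 1) / 1.28] minus the surplus terms. As
    [1 - r/2 - (r - 1) / 1.28 > 1/25] for [r <= 4/3] and [M] is at least about 1, what remains is
    [r / 2 <= al U / 2], that is [U >= cosh^2 tau]. The index [K] can be taken large, so that any
    given mode is covered. *)
Lemma slice_inequality D tau am e t a K0 : core D -> 99 / 100 <= tau -> 0 < e <= 1 / 100 -> 0 < t -> t + tau < hT D -> 0 <= a <= am -> am < 1 ->
  (forall s, nsq D t s <= 1 + e) ->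
  0 <= mean (fun s => pk a s * (hu D t s * hut D t s + hv D t s * hvt D t s)) ->
  mean (fun s => pk a s * hu D t s) * mean (fun s => pk a s * hu D t s) + mean (fun s => pk a s * hv D t s) * mean (fun s => pk a s * hv D t s) <= e * e / 4 ->
  let al := / (sinh tau * cosh tau) in
  exists K br bi M, (K0 <= K)%nat /\
    1 / 25 * (M - 1) + 1 / 25 * zs K (fun n => big n * (br n * br n + bi n * bi n)) +
    al / 2 * zs K (fun n => (hr D (t + tau) n - kk tau n / al * br n) * (hr D (t + tau) n - kk tau n / al * br n) + (hi D (t + tau) n - kk tau n / al * bi n) * (hi D (t + tau) n - kk tau n / al * bi n))
    <= al / 2 * (U D (t + tau) - cosh tau * cosh tau) + slice_const tau (hR D) am * e /\
    1 - e <= M /\ zs K (fun n => (br n - hr D t n) * (br n - hr D t n) + (bi n - hi D t n) * (bi n - hi D t n)) <= M - 1 + 4 * e /\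
    br 0%Z * br 0%Z + bi 0%Z * bi 0%Z <= e * e.
Proof.
intros H Htau He Ht0 Hend Ha Ham HN HP HB al.
assert (Ht : 0 < t < hT D) by lra. assert (Htt : 0 < t + tau < hT D) by lra. assert (a1 : 0 <= a < 1) by lra.
assert (R1 := k_R _ H).
cyl H Ht. assert (cN := c1_cont_f (c1_nsq D H) Ht).
assert (Pu := c1_per (k_u _ H) _ Ht). assert (Pv := c1_per (k_v _ H) _ Ht).
assert (Put := c1_per_t (k_u _ H) Ht). assert (Pvt := c1_per_t (k_v _ H) Ht).
assert (Cq : cont (pk a)) by (apply cont_pk; lra). assert (Pq := pk_per a).
assert (Cqq : cont (fun s => pk a s * pk a s)) by cnt. assert (Pqq : periodic (fun s => pk a s * pk a s)) by (apply per_mult; auto).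
assert (Cd : cont (dk a)) by (unfold dk; cnt). assert (Pd : periodic (dk a)) by (intros s; unfold dk; now rewrite Pq).
assert (P1 : periodic (fun _ : R => 1)) by (intros s; auto).
assert (mb := m0_bound a am Ha Ham). assert (mg := m0_ge1 a a1).
set (M0 := 2 / (1 - am)) in *.
assert (q0 : forall s, 0 < pk a s) by (intros; apply pk_pos; lra).
assert (N1 : forall s, 1 < nsq D t s) by (intros s; apply (k_N _ H t s Ht)).
destruct (lim_pick _ _ e (lim_product (fun s => pk a s * pk a s) _ _ _ _ Cqq Pqq c c0 c c0 Pu Pv Pu Pv) (proj1 He)) as (n1 & L1).
destruct (lim_pick _ _ e (lim_product (pk a) _ _ _ _ Cq Pq c c0 c c0 Pu Pv Pu Pv) (proj1 He)) as (n2 & L2).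
destruct (lim_pick _ _ e (lim_product (fun _ => 1) _ _ _ _ (cont_const 1) P1 c c0 c c0 Pu Pv Pu Pv) (proj1 He)) as (n3 & L3).
destruct (lim_pick _ _ e (lim_product (dk a) _ _ _ _ Cd Pd c c0 c c0 Pu Pv Pu Pv) (proj1 He)) as (n4 & L4).
destruct (lim_pick _ _ e (lim_product (pk a) _ _ _ _ Cq Pq c c0 c1 c2 Pu Pv Put Pvt) (proj1 He)) as (n5 & L5).
(* This accuracy changes the mean of [pk a] times [h] by so little that [|b_0|^2 <= e^2] follows
   from the hypothesis [e^2 / 4]. *)
assert (e2p : 0 < e * e / (4 * m0 a)) by (apply Rdiv_lt_0_compat; [apply Rmult_lt_0_compat|]; lra).
destruct (lim_pick _ _ _ (L2_convergence _ _ c c0 Pu Pv) e2p) as (n6 & L6).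
set (K := max K0 (max n1 (max n2 (max n3 (max n4 (max n5 n6)))))).
specialize (L1 K ltac:(lia)). specialize (L2 K ltac:(lia)). specialize (L3 K ltac:(lia)). specialize (L4 K ltac:(lia)). specialize (L5 K ltac:(lia)). specialize (L6 K ltac:(lia)).
set (fu := su (hu D t) (hv D t) K) in *. set (fv := sv (hu D t) (hv D t) K) in *.
assert (Cfu : cont fu) by apply cont_su. assert (Cfv : cont fv) by apply cont_sv.
set (MK := mean (fun s => pk a s * pk a s * (fu s * fu s + fv s * fv s))) in *.
set (mK := mean (fun s => pk a s * (fu s * fu s + fv s * fv s))) in *.
set (lK := mean (fun s => 1 * (fu s * fu s + fv s * fv s))) in *.
set (dK := mean (fun s => dk a s * (fu s * fu s + fv s * fv s))) in *.
set (PK := mean (fun s => pk a s * (fu s * su (hut D t) (hvt D t) K s + fv s * sv (hut D t) (hvt D t) K s))) in *.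
assert (V1 : 1 <= mean (fun s => pk a s * pk a s * (hu D t s * hu D t s + hv D t s * hv D t s))).
{ apply Rle_trans with (m0 a); auto. rewrite <- mean_pk2 by auto. apply mean_le; [cnt..|]. intros s.
  specialize (N1 s). unfold nsq in N1. assert (0 < pk a s * pk a s) by (apply Rmult_lt_0_compat; auto).
  rewrite <- (Rmult_1_r (pk a s * pk a s)) at 1. apply Rmult_le_compat_l; lra. }
assert (V2 : 1 <= mean (fun s => pk a s * (hu D t s * hu D t s + hv D t s * hv D t s)) <= 1 + e).
{ split.
  - rewrite <- (mean_pk a) by auto. apply mean_le; [cnt..|]. intros s. specialize (N1 s). unfold nsq in N1.
    rewrite <- (Rmult_1_r (pk a s)) at 1. apply Rmult_le_compat_l; [apply Rlt_le; auto | lra].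
  - apply Rle_trans with (mean (fun s => (1 + e) * pk a s)). 2: rewrite mean_scal, mean_pk by (auto; cnt); lra.
    apply mean_le; [cnt..|]. intros s. specialize (HN s). unfold nsq in HN. rewrite Rmult_comm. apply Rmult_le_compat_r; [apply Rlt_le; auto | lra]. }
assert (V3 : mean (fun s => 1 * (hu D t s * hu D t s + hv D t s * hv D t s)) <= 1 + e).
{ rewrite <- (mean_const (1 + e)). apply mean_le; [cnt..|]. intros s. specialize (HN s). unfold nsq in HN. lra. }
(* [dk a] has mean zero and [|h|^2] lies between 1 and [1 + e], so only the negative part of [dk a]
   times [e] can be lost. *)
assert (V4 : - (M0 * e) <= mean (fun s => dk a s * (hu D t s * hu D t s + hv D t s * hv D t s))).
{ apply Rle_trans with (mean (fun s => dk a s - m0 a * e * pk a s)).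
  - rewrite mean_minus, mean_scal, mean_pk by (auto; cnt). unfold dk. rewrite mean_minus, mean_scal, mean_pk, mean_pk2 by (auto; cnt).
    assert (m0 a * e <= M0 * e) by (apply Rmult_le_compat_r; lra). lra.
  - apply mean_le; [cnt..|]. intros s. specialize (N1 s). specialize (HN s). unfold nsq in N1, HN. unfold dk. specialize (q0 s).
    set (N := hu D t s * hu D t s + hv D t s * hv D t s) in *.
    assert (0 <= pk a s * pk a s * (N - 1)) by (apply Rmult_le_pos; [apply sq_ge0 | lra]).
    assert (m0 a * pk a s * (N - 1) <= m0 a * pk a s * e) by (apply Rmult_le_compat_l; [apply Rmult_le_pos; lra | lra]). lra. }
set (br := fr (fun s => pk a s * fu s) (fun s => pk a s * fv s)). set (bi := fi (fun s => pk a s * fu s) (fun s => pk a s * fv s)).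
exists K, br, bi, MK. split; [lia|].
assert (B0 : br 0%Z * br 0%Z + bi 0%Z * bi 0%Z <= e * e).
{ assert (er : br 0%Z = mean (fun s => pk a s * fu s)) by (apply mean_ext; intros s; rewrite Rmult_0_l, cos_0, sin_0; ring).
  assert (ei : bi 0%Z = mean (fun s => pk a s * fv s)) by (apply mean_ext; intros s; rewrite Rmult_0_l, cos_0, sin_0; ring).
  rewrite er, ei.
  assert (G : forall f g : R -> R, cont f -> cont g -> mean (fun s => pk a s * f s) * mean (fun s => pk a s * f s) <=
     2 * (mean (fun s => pk a s * g s) * mean (fun s => pk a s * g s)) + 2 * (m0 a * mean (fun s => (g s - f s) * (g s - f s)))).
  { intros f g Cf Cg. assert (CS := mean_CS (pk a) (fun s => g s - f s) ltac:(cnt) ltac:(cnt)). cbv beta in CS. rewrite mean_pk2 in CS by auto.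
    rewrite (mean_ext (fun s => pk a s * (g s - f s)) (fun s => pk a s * g s - pk a s * f s)) in CS by (intros; ring). rewrite mean_minus in CS by cnt.
    set (x := mean (fun s => pk a s * f s)) in *. set (y := mean (fun s => pk a s * g s)) in *. assert (Q := sq_ge0 (x - 2 * y)). lra. }
  assert (G1 := G fu (hu D t) Cfu c). assert (G2 := G fv (hv D t) Cfv c0).
  assert (E6 : mean (fun s => (hu D t s - fu s) * (hu D t s - fu s)) + mean (fun s => (hv D t s - fv s) * (hv D t s - fv s)) <= e * e / (4 * m0 a)).
  { rewrite <- mean_plus by cnt. unfold err in L6. fold fu fv in L6. lra. }
  assert (m0 a * (mean (fun s => (hu D t s - fu s) * (hu D t s - fu s)) + mean (fun s => (hv D t s - fv s) * (hv D t s - fv s))) <= m0 a * (e * e / (4 * m0 a))) by (apply Rmult_le_compat_l; lra).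
  replace (m0 a * (e * e / (4 * m0 a))) with (e * e / 4) in H0 by (field; lra). lra. }
assert (S1 : zs K (fun n => br n * br n + bi n * bi n) <= MK).
{ eapply Rle_trans; [apply bessel; cnt|]. right. apply mean_ext; intros; ring. }
assert (S2 : zs K (fun n => br n * hr D t n + bi n * hi D t n) = mK).
{ etransitivity; [symmetry; apply (pairing K (hr D t) (hi D t) (fun s => pk a s * fu s) (fun s => pk a s * fv s)); cnt|].
  apply mean_ext; intros s. change (tu K (hr D t) (hi D t) s) with (fu s). change (tv K (hr D t) (hi D t) s) with (fv s). ring. }
assert (S3 : zs K (fun n => (br n - hr D t n) * (br n - hr D t n) + (bi n - hi D t n) * (bi n - hi D t n)) <= MK - 2 * mK + lK).
{ apply Rle_trans with (mean (fun s => (pk a s * fu s - fu s) * (pk a s * fu s - fu s) + (pk a s * fv s - fv s) * (pk a s * fv s - fv s))).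
  - eapply Rle_trans; [|apply (bessel K (fun s => pk a s * fu s - fu s) (fun s => pk a s * fv s - fv s)); cnt].
    right. apply zs_ext; intros n Hn. rewrite <- (fr_coef K (hr D t) (hi D t) n Hn), <- (fi_coef K (hr D t) (hi D t) n Hn).
    change (tu K (hr D t) (hi D t)) with fu. change (tv K (hr D t) (hi D t)) with fv.
    unfold br, bi, fr, fi. rewrite <- !mean_minus by cnt. f_equal; f_equal; apply mean_ext; intros; ring.
  - right. unfold MK, mK, lK. rewrite <- mean_scal, <- mean_minus, <- mean_plus by cnt. apply mean_ext; intros; ring. }
split; [|split; [lra | split; [lra | exact B0]]].
assert (S4 : zs K (fun n => hr D (t + tau) n * hr D (t + tau) n + hi D (t + tau) n * hi D (t + tau) n) <= U D (t + tau)).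
{ apply bessel; [apply (c1_cont_f (k_u _ H) Htt) | apply (c1_cont_f (k_v _ H) Htt)]. }
assert (S5 : zs K (fun n => br n * dr D t n + bi n * di D t n) = PK).
{ etransitivity; [symmetry; apply (pairing K (dr D t) (di D t) (fun s => pk a s * fu s) (fun s => pk a s * fv s)); cnt|].
  apply mean_ext; intros s. change (tu K (dr D t) (di D t) s) with (su (hut D t) (hvt D t) K s). change (tv K (dr D t) (di D t) s) with (sv (hut D t) (hvt D t) K s). ring. }
assert (S6 := half_derivative_bound a K (hr D t) (hi D t) a1).
change (tu K (hr D t) (hi D t)) with fu in S6. change (tv K (hr D t) (hi D t)) with fv in S6. fold br bi in S6.
change (mean (fun s => dk a s * (fu s * fu s + fv s * fv s))) with dK in S6.
(* Since [|b_0| <= e], Young's inequality gives [|f - b_0|^2 >= (1 - e) |f|^2 - e]. *)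
assert (S7 : (1 - e) * MK - m0 a * e <= mean (fun s => pk a s * pk a s * ((fu s - br 0%Z) * (fu s - br 0%Z) + (fv s - bi 0%Z) * (fv s - bi 0%Z)))).
{ set (b1 := br 0%Z) in *. set (b2 := bi 0%Z) in *.
  apply Rle_trans with (mean (fun s => (1 - e) * (pk a s * pk a s * (fu s * fu s + fv s * fv s)) - e * (pk a s * pk a s))).
  - rewrite mean_minus, !mean_scal, mean_pk2 by (auto; cnt). unfold MK. lra.
  - apply mean_le; [cnt..|]. intros s. set (x := fu s). set (y := fv s).
    replace ((1 - e) * (pk a s * pk a s * (x * x + y * y)) - e * (pk a s * pk a s)) with (pk a s * pk a s * ((1 - e) * (x * x + y * y) - e)) by ring.
    apply Rmult_le_compat_l; [apply sq_ge0|].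
    assert (Q1 := sq_ge0 (e * x - b1)). assert (Q2 := sq_ge0 (e * y - b2)).
    apply (Rmult_le_reg_l e); [lra|]. assert (0 <= e * (b1 * b1 + b2 * b2)) by (apply Rmult_le_pos; [lra | generalize (sq_ge0 b1) (sq_ge0 b2); lra]). lra. }
assert (S8 : zs K (fun n => kk tau n * (br n * (hr D (t + tau) n - exp (- (IZR (Z.abs n) * tau)) * hr D t n) + bi n * (hi D (t + tau) n - exp (- (IZR (Z.abs n) * tau)) * hi D t n)))
  = PK + zs K (fun n => IZR (Z.abs n) * (br n * hr D t n + bi n * hi D t n))).
{ rewrite <- S5, <- zs_plus. apply zs_ext; intros n _.
  assert (E1 := kk_solve (hT D) (fun t => hr D t n) (fun t => dr D t n) n t tau (fun y Hy => proj1 (coef_derive D n y H Hy)) Ht0 ltac:(lra) Hend).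
  assert (E2 := kk_solve (hT D) (fun t => hi D t n) (fun t => di D t n) n t tau (fun y Hy => proj2 (coef_derive D n y H Hy)) Ht0 ltac:(lra) Hend).
  cbv beta in E1, E2. rewrite Rmult_plus_distr_l.
  replace (kk tau n * (br n * (hr D (t + tau) n - exp (- (IZR (Z.abs n) * tau)) * hr D t n))) with (br n * (kk tau n * (hr D (t + tau) n - exp (- (IZR (Z.abs n) * tau)) * hr D t n))) by ring.
  replace (kk tau n * (bi n * (hi D (t + tau) n - exp (- (IZR (Z.abs n) * tau)) * hi D t n))) with (bi n * (kk tau n * (hi D (t + tau) n - exp (- (IZR (Z.abs n) * tau)) * hi D t n))) by ring.
  rewrite <- E1, <- E2. ring. }
set (r := cosh tau / sinh tau). destruct (r_range tau Htau) as [r1 r2]. fold r in r1, r2.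
set (S9 := zs K (fun n => big n * (br n * br n + bi n * bi n))).
set (S10 := zs K (fun n => (hr D (t + tau) n - kk tau n / al * br n) * _ + _)).
set (E0 := r / 2 * (sinh tau / tau * (sinh tau / tau)) * e + (r - 1 + / tau) * hR D).
assert (Main : PK + zs K (fun n => IZR (Z.abs n) * (br n * hr D t n + bi n * hi D t n)) <=
  al / 2 * U D (t + tau) + r / 2 * MK - (r - 1) * mK - al / 2 * S10 - 1 / 25 * S9 + (r - 1) / (128 / 100) * (MK - 2 * mK + lK) + E0 * e).
{ rewrite <- S8. eapply Rle_trans.
  { apply zs_le. intros n Hn. apply (per_mode tau Htau n (br n) (bi n) (hr D t n) (hi D t n) (hr D (t + tau) n) (hi D (t + tau) n) e (hR D)); [lra | lra |].
    intros ->. split; auto.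
    assert (W := zs_ge_term 0 (fun n => hr D t n * hr D t n + hi D t n * hi D t n) 0 ltac:(lia)). cbv beta in W.
    eapply Rle_trans; [apply W; intros; generalize (sq_ge0 (hr D t n)) (sq_ge0 (hi D t n)); lra|].
    eapply Rle_trans; [apply bessel; auto|]. fold (nsq D t). rewrite <- (mean_const (hR D * hR D)). apply mean_le; [exact cN | cnt |].
    intros s. left. apply (k_N _ H t s Ht). }
  fold r.
  eapply Rle_trans; [right; exact (zs_combination K (al / 2) (r / 2) (r - 1) (al / 2) (1 / 25) ((r - 1) / (128 / 100))
    (fun n => hr D (t + tau) n * hr D (t + tau) n + hi D (t + tau) n * hi D (t + tau) n) (fun n => br n * br n + bi n * bi n)
    (fun n => br n * hr D t n + bi n * hi D t n)
    (fun n => (hr D (t + tau) n - kk tau n / al * br n) * (hr D (t + tau) n - kk tau n / al * br n) + (hi D (t + tau) n - kk tau n / al * bi n) * (hi D (t + tau) n - kk tau n / al * bi n))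
    (fun n => big n * (br n * br n + bi n * bi n))
    (fun n => (br n - hr D t n) * (br n - hr D t n) + (bi n - hi D t n) * (bi n - hi D t n))
    (fun n => if Z.eq_dec n 0 then E0 * e else 0))|].
  rewrite (zs_single K (fun n => if Z.eq_dec n 0 then E0 * e else 0) 0); [|lia | intros; destruct Z.eq_dec; auto; lia].
  rewrite S2. assert (al0 := al_pos tau Htau). change (/ (sinh tau * cosh tau)) with al in al0. fold S9.
  change (zs K (fun n => (hr D (t + tau) n - kk tau n / al * br n) * (hr D (t + tau) n - kk tau n / al * br n) + (hi D (t + tau) n - kk tau n / al * bi n) * (hi D (t + tau) n - kk tau n / al * bi n))) with S10.
  assert (W1 := Rmult_le_compat_l (al / 2) _ _ ltac:(lra) S4). assert (W2 := Rmult_le_compat_l (r / 2) _ _ ltac:(lra) S1).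
  assert (W3 := Rmult_le_compat_l ((r - 1) / (128 / 100)) _ _ ltac:(lra) S3). destruct (Z.eq_dec 0 0); [lra|lia]. }
assert (alC := al_C tau Htau). fold r in alC. change (/ (sinh tau * cosh tau)) with al in alC.
assert (it : 0 < / tau) by (apply Rinv_0_lt_compat; lra).
set (G0 := r / 2 * (sinh tau / tau * (sinh tau / tau))) in *. assert (G00 : 0 <= G0) by (apply Rmult_le_pos; [lra | apply sq_ge0]).
assert (E0b : E0 * e <= (G0 + (r - 1 + / tau) * hR D) * e).
{ apply Rmult_le_compat_r; [lra|]. unfold E0. assert (G0 * e <= G0 * 1) by (apply Rmult_le_compat_l; lra). lra. }
assert (SC : slice_const tau (hR D) am * e = 20 * e + 3 * (M0 * e) + (G0 + (r - 1 + / tau) * hR D) * e) by (unfold slice_const; fold r M0 G0; ring).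
rewrite SC.
(* The coefficient is smallest at [r = 4/3] and [e = 1/100], where it is still about 0.023. This is
   the room that allows the term [(M - 1) / 25]. *)
assert (X1 : 0 <= (1 - r / 2 - (r - 1) / (128 / 100) - e - 1 / 25) * (MK - 1 + e)) by (apply Rmult_le_pos; lra).
assert (X2 : m0 a * e <= M0 * e) by (apply Rmult_le_compat_r; lra).
assert (X3 : (r - 1) * (1 - e) <= (r - 1) * mK) by (apply Rmult_le_compat_l; lra).
assert (X4 : (r - 1) / (128 / 100) * (lK - 2 * mK) <= (r - 1) / (128 / 100) * (- 1 + 4 * e)) by (apply Rmult_le_compat_l; lra).
assert (X5 : r * e <= 4 / 3 * e) by (apply Rmult_le_compat_r; lra).
assert (X6 : e * e <= 1 * e) by (apply Rmult_le_compat_r; lra).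
assert (X7 : 0 <= r * e) by (apply Rmult_le_pos; lra).
assert (X8 : 0 <= M0 * e) by (apply Rmult_le_pos; lra).
assert (X9 := sq_ge0 e). lra.
Qed.

(** [cn] is [|h_n(t)|^2], and [wr] is [|h_n(t + tau) - cosh tau h_n(t)|^2]. Unlike the coefficients
    they are invariant under [rot]. *)
Definition cn D t n := hr D t n * hr D t n + hi D t n * hi D t n.
Definition wr D t tau n := (hr D (t + tau) n - cosh tau * hr D t n) * (hr D (t + tau) n - cosh tau * hr D t n) + (hi D (t + tau) n - cosh tau * hi D t n) * (hi D (t + tau) n - cosh tau * hi D t n).

Lemma coef_rot D x t n : core D -> 0 < t < hT D ->
  hr (rot D x) t n = cos (IZR n * x) * hr D t n - sin (IZR n * x) * hi D t n /\
  hi (rot D x) t n = cos (IZR n * x) * hi D t n + sin (IZR n * x) * hr D t n.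
Proof.
intros H Ht. cyl H Ht. assert (Pu := c1_per (k_u _ H) _ Ht). assert (Pv := c1_per (k_v _ H) _ Ht).
unfold hr, hi, fr, fi, rot; simpl. rewrite <- !mean_scal by cnt. rewrite <- mean_minus, <- mean_plus by cnt.
assert (Cc : cont (fun s => cos (IZR n * s))) by cnt. assert (Cs : cont (fun s => sin (IZR n * s))) by cnt.
assert (c1' : cont (fun s => hu D t (s + x))) by (apply (cont_comp (fun s => s + x)); cnt).
assert (c2' : cont (fun s => hv D t (s + x))) by (apply (cont_comp (fun s => s + x)); cnt).
split.
- rewrite mean_plus by cnt. rewrite (mean_ext (fun s => hu D t (s + x) * cos (IZR n * s)) (fun s => cos (IZR n * s) * hu D t (s + x))) by (intros; ring).
  rewrite (mean_ext (fun s => hv D t (s + x) * sin (IZR n * s)) (fun s => sin (IZR n * s) * hv D t (s + x))) by (intros; ring).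
  rewrite (mean_unshift _ _ x Cc c (per_cosZ n) Pu), (mean_unshift _ _ x Cs c0 (per_sinZ n) Pv), <- mean_plus.
  + apply mean_ext; intros s. rewrite Rmult_minus_distr_l, cos_minus, sin_minus. ring.
  + apply cont_mult; auto. apply (cont_comp (fun s => s - x) (fun s => cos (IZR n * s))); cnt.
  + apply cont_mult; auto. apply (cont_comp (fun s => s - x) (fun s => sin (IZR n * s))); cnt.
- rewrite mean_minus by cnt. rewrite (mean_ext (fun s => hv D t (s + x) * cos (IZR n * s)) (fun s => cos (IZR n * s) * hv D t (s + x))) by (intros; ring).
  rewrite (mean_ext (fun s => hu D t (s + x) * sin (IZR n * s)) (fun s => sin (IZR n * s) * hu D t (s + x))) by (intros; ring).
  rewrite (mean_unshift _ _ x Cc c0 (per_cosZ n) Pv), (mean_unshift _ _ x Cs c (per_sinZ n) Pu), <- mean_minus.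
  + apply mean_ext; intros s. rewrite Rmult_minus_distr_l, cos_minus, sin_minus. ring.
  + apply cont_mult; auto. apply (cont_comp (fun s => s - x) (fun s => cos (IZR n * s))); cnt.
  + apply cont_mult; auto. apply (cont_comp (fun s => s - x) (fun s => sin (IZR n * s))); cnt.
Qed.

Lemma cn_rot D x t n : core D -> 0 < t < hT D -> cn (rot D x) t n = cn D t n.
Proof.
intros H Ht. unfold cn. destruct (coef_rot D x t n H Ht) as [-> ->]. assert (K := sin2_cos2 (IZR n * x)). unfold Rsqr in K.
set (c := cos _) in *. set (s := sin _) in *. transitivity ((s * s + c * c) * (hr D t n * hr D t n + hi D t n * hi D t n)); [ring | rewrite K; ring].
Qed.
Lemma wr_rot D x t tau n : core D -> 0 < t < hT D -> 0 < t + tau < hT D -> wr (rot D x) t tau n = wr D t tau n.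
Proof.
intros H Ht Ht'. unfold wr. destruct (coef_rot D x t n H Ht) as [-> ->]. destruct (coef_rot D x (t + tau) n H Ht') as [-> ->].
assert (K := sin2_cos2 (IZR n * x)). unfold Rsqr in K. set (c := cos _) in *. set (s := sin _) in *.
set (a := hr D (t + tau) n). set (b := hi D (t + tau) n). set (a' := hr D t n). set (b' := hi D t n).
transitivity ((s * s + c * c) * ((a - cosh tau * a') * (a - cosh tau * a') + (b - cosh tau * b') * (b - cosh tau * b'))); [ring | rewrite K; ring].
Qed.

(** An upper bound, through [U <= hR^2], for the term [al / 2 (U - cosh^2 tau)] of
    [slice_inequality]. *)
Definition defect D tau := / (sinh tau * cosh tau) / 2 * (hR D * hR D - cosh tau * cosh tau).

(** The rotation varies from slice to slice. Only rotation-invariant quantities are therefore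
    exported, and the rotated coefficients themselves stay existential. *)
Lemma slices D tau : core D -> 99 / 100 <= tau -> tau < hT D -> exists Cst, 0 <= Cst /\ forall e N, 0 < e <= 1 / 100 ->
  exists t, 0 < t < e /\ t + tau < hT D /\ - (Cst * e) <= defect D tau /\
    forall n, (Z.abs n <= Z.of_nat N)%Z ->
      exists br bi xr xi cr ci, let al := / (sinh tau * cosh tau) in let de := defect D tau + Cst * e in
      (cr * cr + ci * ci = cn D t n) /\ (xr * xr + xi * xi = cn D (t + tau) n) /\
      ((xr - cosh tau * cr) * (xr - cosh tau * cr) + (xi - cosh tau * ci) * (xi - cosh tau * ci) = wr D t tau n) /\
      (Z.abs n <> 1%Z -> br * br + bi * bi <= 25 * de) /\ (br - cr) * (br - cr) + (bi - ci) * (bi - ci) <= 25 * de /\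
      al / 2 * ((xr - kk tau n / al * br) * (xr - kk tau n / al * br) + (xi - kk tau n / al * bi) * (xi - kk tau n / al * bi)) <= de.
Proof.
intros H h1 h2. destruct (good_slice D H) as (am & Ham & GS). assert (R1 := k_R _ H).
destruct (r_range tau h1) as [r1 r2]. destruct (sC tau h1) as (s0 & c0 & cs & _).
set (C1 := slice_const tau (hR D) am). set (al := / (sinh tau * cosh tau)).
assert (alp : 0 < al) by (apply Rinv_0_lt_compat, Rmult_lt_0_compat; auto).
assert (C1p : 0 <= C1).
{ unfold C1, slice_const. assert (0 < 2 / (1 - am)) by (apply Rdiv_lt_0_compat; lra).
  assert (0 < / tau) by (apply Rinv_0_lt_compat; lra).
  assert (0 <= cosh tau / sinh tau / 2 * (sinh tau / tau * (sinh tau / tau))) by (apply Rmult_le_pos; [lra | apply sq_ge0]).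
  assert (0 <= (cosh tau / sinh tau - 1 + / tau) * hR D) by (apply Rmult_le_pos; lra). lra. }
exists (C1 + 1). split; [lra|]. intros e N He.
destruct (k_0 _ H e (proj1 He)) as (d & dp & Hd).
(* The four bounds give in turn [t < e], [|h|^2 <= 1 + e] on the circle, [t + tau < T], and the mean
   bound [e^2 / 4]. *)
set (e' := Rmin (Rmin e d) (Rmin (hT D - tau) (e * e / 4))).
assert (ee : 0 < e * e / 4) by (apply Rdiv_lt_0_compat; [apply Rmult_lt_0_compat|]; lra).
assert (He' : 0 < e' /\ e' <= e /\ e' <= d /\ e' <= hT D - tau /\ e' <= e * e / 4).
{ unfold e'. assert (a1 := Rmin_l (Rmin e d) (Rmin (hT D - tau) (e * e / 4))). assert (a2 := Rmin_r (Rmin e d) (Rmin (hT D - tau) (e * e / 4))).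
  assert (a3 := Rmin_l e d). assert (a4 := Rmin_r e d). assert (a5 := Rmin_l (hT D - tau) (e * e / 4)). assert (a6 := Rmin_r (hT D - tau) (e * e / 4)).
  split; [repeat apply Rmin_pos; lra | lra]. }
destruct (GS e' (proj1 He')) as (t & a & x & Ht & HtT & Ha & P0 & B0).
assert (H' := core_rot D x H).
destruct (slice_inequality (rot D x) tau am e t a N H' h1 He (proj1 Ht) ltac:(simpl; lra) Ha (proj2 Ham)) as (K & br & bi & M & KN & Main & M1 & Dl & b0); auto.
{ intros s. left. apply (Hd t (s + x)); lra. }
{ eapply Rle_trans; [exact B0 | lra]. }
exists t. split; [lra|]. split; [lra|].
change (hR (rot D x)) with (hR D) in Main. fold C1 al in Main.
set (S1 := zs K (fun n => big n * (br n * br n + bi n * bi n))) in *.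
set (f2 := fun n => (hr (rot D x) (t + tau) n - kk tau n / al * br n) * (hr (rot D x) (t + tau) n - kk tau n / al * br n) + (hi (rot D x) (t + tau) n - kk tau n / al * bi n) * (hi (rot D x) (t + tau) n - kk tau n / al * bi n)) in *.
set (f3 := fun n => (br n - hr (rot D x) t n) * (br n - hr (rot D x) t n) + (bi n - hi (rot D x) t n) * (bi n - hi (rot D x) t n)) in *.
assert (bg : forall n, 0 <= big n * (br n * br n + bi n * bi n)).
{ intros n. apply Rmult_le_pos. unfold big; destruct Z_le_dec; lra. generalize (sq_ge0 (br n)) (sq_ge0 (bi n)); lra. }
assert (f2p : forall n, 0 <= f2 n) by (intros n; unfold f2; match goal with |- 0 <= ?a * ?a + ?b * ?b => generalize (sq_ge0 a) (sq_ge0 b) end; lra).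
assert (f3p : forall n, 0 <= f3 n) by (intros n; unfold f3; match goal with |- 0 <= ?a * ?a + ?b * ?b => generalize (sq_ge0 a) (sq_ge0 b) end; lra).
assert (S1p : 0 <= S1) by (apply zs_ge0; auto).
assert (S2p : 0 <= zs K f2) by (apply zs_ge0; auto).
assert (al / 2 * (U (rot D x) (t + tau) - cosh tau * cosh tau) <= defect D tau).
{ unfold defect. fold al. apply Rmult_le_compat_l; [lra|]. assert (Q := U_gt1 (rot D x) (t + tau) H' ltac:(simpl; lra)). simpl in Q. lra. }
assert (S2p' : 0 <= al / 2 * zs K f2) by (apply Rmult_le_pos; lra).
assert (C1e : 0 <= C1 * e) by (apply Rmult_le_pos; lra).
split; [lra|]. intros n Hn.
exists (br n), (bi n), (hr (rot D x) (t + tau) n), (hi (rot D x) (t + tau) n), (hr (rot D x) t n), (hi (rot D x) t n). cbv zeta. fold al.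
split; [apply (cn_rot D x t n); auto|]. split; [apply (cn_rot D x (t + tau) n); auto; lra|]. split; [apply (wr_rot D x t tau n); auto; lra|].
assert (F1 := zs_ge_term K _ n ltac:(lia) bg). assert (F2 := zs_ge_term K _ n ltac:(lia) f2p). assert (F3 := zs_ge_term K _ n ltac:(lia) f3p). fold S1 in F1.
cbv beta in F1. assert (F2' := Rmult_le_compat_l (al / 2) _ _ ltac:(lra) F2).
assert (e2 : e * e <= 1 * e) by (apply Rmult_le_compat_r; lra).
split; [|split].
- intros Hn1. destruct (Z.eq_dec n 0) as [->|]; [lra|]. unfold big in F1. destruct Z_le_dec; [lra|lia].
- eapply Rle_trans; [exact F3 | lra].
- eapply Rle_trans; [exact F2' | lra].
Qed.

Lemma thick_bound D : core D -> 1 <= hT D -> cosh (hT D) <= hR D.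
Proof.
intros H h. assert (R1 := k_R _ H).
assert (B : forall tau, 99 / 100 <= tau -> tau < hT D -> cosh tau * cosh tau <= hR D * hR D).
{ intros tau h1 h2. destruct (slices D tau H h1 h2) as (Cst & Cp & S). destruct (sC tau h1) as (s0 & c0 & _).
  assert (al : 0 < / (sinh tau * cosh tau) / 2) by (apply Rdiv_lt_0_compat; [apply Rinv_0_lt_compat, Rmult_lt_0_compat; auto | lra]).
  assert (0 <= defect D tau).
  { apply Rnot_lt_le; intros L. set (e := Rmin (1 / 100) (- defect D tau / (2 * (Cst + 1)))).
    assert (p : 0 < - defect D tau / (2 * (Cst + 1))) by (apply Rdiv_lt_0_compat; lra).
    assert (m1 := Rmin_l (1 / 100) (- defect D tau / (2 * (Cst + 1)))). assert (m2 := Rmin_r (1 / 100) (- defect D tau / (2 * (Cst + 1)))). fold e in m1, m2.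
    assert (ep : 0 < e) by (apply Rmin_pos; lra).
    destruct (S e 0%nat ltac:(lra)) as (t & _ & _ & D1 & _).
    assert (Cst * e <= - defect D tau / 2); [|lra].
    apply Rle_trans with ((Cst + 1) * (- defect D tau / (2 * (Cst + 1)))). apply Rmult_le_compat; lra. right; field; lra. }
  unfold defect in H0. apply Rnot_lt_le; intros L.
  assert (0 < / (sinh tau * cosh tau) / 2 * (cosh tau * cosh tau - hR D * hR D)) by (apply Rmult_lt_0_compat; lra). lra. }
assert (L : - (hR D * hR D) <= - (cosh (hT D) * cosh (hT D))).
{ apply (limit_ge (fun x => - (cosh x * cosh x)) (hT D) _ (1 / 100)); [|lra|].
  - assert (C : cont (fun x => - (cosh x * cosh x))) by cnt. apply C.
  - intros tau Ht. assert (K := B tau ltac:(lra) ltac:(lra)). lra. }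
apply Rnot_lt_le; intros K. assert (hR D * hR D < cosh (hT D) * cosh (hT D)) by (apply Rmult_le_0_lt_compat; lra). lra.
Qed.

Lemma convex_max T (V V1 V2 : R -> R) a b y m : (forall t, 0 < t < T -> is_derive V t (V1 t) /\ is_derive V1 t (V2 t) /\ 0 <= V2 t) ->
  0 < a -> a < y -> y < b -> b < T -> V a <= m -> V b <= m -> V y <= m.
Proof.
intros DD h1 h2 h3 h4 Va Vb.
assert (Inc : forall x z, 0 < x -> x <= z -> z < T -> V1 x <= V1 z).
{ intros x z k1 k2 k3. apply (incr 0 T V1 V2 x z); auto; intros t Ht; apply (DD t Ht). }
assert (MV : forall x z, 0 < x -> x < z -> z < T -> exists c, x <= c <= z /\ V z - V x = V1 c * (z - x)).
{ intros x z k1 k2 k3. destruct (MVT_gen V x z V1) as (c & Hc & E).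
  - intros w; rewrite Rmin_left, Rmax_right by lra; intros; apply DD; lra.
  - intros w; rewrite Rmin_left, Rmax_right by lra; intros. apply continuity_pt_filterlim. apply (ex_derive_continuous V). destruct (DD w ltac:(lra)) as [Q _]. exists (V1 w). exact Q.
  - rewrite Rmin_left, Rmax_right in Hc by lra. eauto. }
destruct (Rle_dec 0 (V1 y)) as [p|p].
- destruct (MV y b ltac:(lra) h3 h4) as (c & Hc & E). assert (K := Inc y c ltac:(lra) ltac:(lra) ltac:(lra)).
  assert (0 <= V1 c * (b - y)) by (apply Rmult_le_pos; lra). lra.
- destruct (MV a y h1 h2 ltac:(lra)) as (c & Hc & E). assert (K := Inc c y ltac:(lra) ltac:(lra) ltac:(lra)).
  assert (0 <= - V1 c * (y - a)) by (apply Rmult_le_pos; lra). lra.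
Qed.

Lemma cn_convex D n t : core D -> 0 < t < hT D ->
  is_derive (fun t => cn D t n) t (2 * (hr D t n * dr D t n + hi D t n * di D t n)) /\
  is_derive (fun t => 2 * (hr D t n * dr D t n + hi D t n * di D t n)) t
    (2 * (dr D t n * dr D t n + di D t n * di D t n + IZR (Z.abs n) * IZR (Z.abs n) * cn D t n)) /\
  0 <= 2 * (dr D t n * dr D t n + di D t n * di D t n + IZR (Z.abs n) * IZR (Z.abs n) * cn D t n).
Proof.
intros H Ht. destruct (coef_derive D n t H Ht) as [[a1 a2] [a3 a4]]. split; [|split].
- replace (2 * (hr D t n * dr D t n + hi D t n * di D t n)) with ((dr D t n * hr D t n + hr D t n * dr D t n) + (di D t n * hi D t n + hi D t n * di D t n)) by ring.
  apply (is_derive_plus (fun t => hr D t n * hr D t n) (fun t => hi D t n * hi D t n)).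
  + apply (is_derive_mult_R (fun t => hr D t n) (fun t => hr D t n)); auto.
  + apply (is_derive_mult_R (fun t => hi D t n) (fun t => hi D t n)); auto.
- apply (is_derive_scal (fun t => hr D t n * dr D t n + hi D t n * di D t n) t 2).
  unfold cn. set (k := IZR (Z.abs n) * IZR (Z.abs n)) in *.
  replace (dr D t n * dr D t n + di D t n * di D t n + k * (hr D t n * hr D t n + hi D t n * hi D t n)) with ((dr D t n * dr D t n + hr D t n * (k * hr D t n)) + (di D t n * di D t n + hi D t n * (k * hi D t n))) by ring.
  apply (is_derive_plus (fun t => hr D t n * dr D t n) (fun t => hi D t n * di D t n)).
  + apply (is_derive_mult_R (fun t => hr D t n) (fun t => dr D t n)); auto.
  + apply (is_derive_mult_R (fun t => hi D t n) (fun t => di D t n)); auto.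
- assert (q1 := sq_ge0 (dr D t n)). assert (q2 := sq_ge0 (di D t n)). assert (q3 := sq_ge0 (hr D t n)). assert (q4 := sq_ge0 (hi D t n)).
  assert (0 <= IZR (Z.abs n) * IZR (Z.abs n) * cn D t n) by (apply Rmult_le_pos; [apply sq_ge0 | unfold cn; lra]). lra.
Qed.

Lemma cn_bound D n t : core D -> 0 < t < hT D -> 0 <= cn D t n <= hR D * hR D.
Proof.
intros H Ht. split. { unfold cn. generalize (sq_ge0 (hr D t n)) (sq_ge0 (hi D t n)); lra. }
set (K := Z.to_nat (Z.abs n)).
eapply Rle_trans; [apply (zs_ge_term K (fun n => hr D t n * hr D t n + hi D t n * hi D t n) n)|].
- unfold K; lia.
- intros m. generalize (sq_ge0 (hr D t m)) (sq_ge0 (hi D t m)); lra.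
- eapply Rle_trans; [apply bessel; [apply (c1_cont_f (k_u _ H) Ht) | apply (c1_cont_f (k_v _ H) Ht)]|].
  left. apply (U_gt1 D t H Ht).
Qed.

Lemma kk_le tau n : 99 / 100 <= tau -> 0 < kk tau n <= 2.
Proof.
intros h. split; [apply kk_pos; auto|].
assert (it : / tau <= 2) by (rewrite <- (Rinv_inv 2); apply Rinv_le_contravar; lra).
unfold kk. destruct Z.eq_dec; auto. assert (p : 0 < IZR (Z.abs n)) by (apply IZR_lt; lia). set (nu := IZR (Z.abs n)) in *.
assert (sx : nu * tau <= sinh (nu * tau)).
{ assert (K : sinh 0 - 0 <= sinh (nu * tau) - nu * tau).
  - apply (incr (-1) (nu * tau + 1) (fun x => sinh x - x) (fun x => cosh x - 1)); try nra.
    + intros x _. apply (is_derive_minus sinh (fun x => x)); [apply is_derive_sinh | apply (is_derive_id x)].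
    + intros x _. generalize (cosh_ge1 x); lra.
  - rewrite sinh_0 in K; lra. }
assert (nt : 0 < nu * tau) by (apply Rmult_lt_0_compat; lra).
apply Rle_trans with (nu / (nu * tau)).
- unfold Rdiv. apply Rmult_le_compat_l; [lra|]. apply Rinv_le_contravar; auto.
- replace (nu / (nu * tau)) with (/ tau) by (field; lra). auto.
Qed.

Lemma two_sq a b : a * a <= 2 * ((a - b) * (a - b)) + 2 * (b * b).
Proof. generalize (sq_ge0 (a - 2 * b)); lra. Qed.

(* As [tau -> T] and then [t -> 0], the slices force every mode [n <> 1, -1] to vanish at both ends
   and [c' = tanh t c] for the remaining two. *)
Lemma thick_small D y : core D -> 1 <= hT D -> hR D <= cosh (hT D) -> 0 < y < hT D -> exists Cb, 0 <= Cb /\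
  forall eps N, 0 < eps <= 1 / 100 -> exists t tau, 0 < t < eps /\ t < y /\ y < tau /\ t + tau < hT D /\ 99 / 100 <= tau /\
   forall n, (Z.abs n <= Z.of_nat N)%Z ->
    (Z.abs n <> 1%Z -> cn D t n <= Cb * eps /\ cn D (t + tau) n <= Cb * eps) /\ (Z.abs n = 1%Z -> wr D t tau n <= Cb * eps).
Proof.
intros H hT1 hle Hy. set (L := cosh (hT D) * cosh (hT D)). assert (LT := cosh_ge1 (hT D)). assert (L1 : 1 <= L) by (unfold L; nra).
assert (R1 := k_R _ H).
exists (100 + 4 * L + 200 * (L * L) + 50 * L). split; [nra|]. intros eps N He.
assert (C0 : continuous (fun x => cosh x * cosh x) (hT D)) by (assert (C : cont (fun x => cosh x * cosh x)) by cnt; apply C).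
destruct (continuous_eps (fun x => cosh x * cosh x) (hT D) C0 eps (proj1 He)) as (d & dp & Hd).
(* Any [tau] beyond [m] exceeds [y], is in the thick range, and has [cosh^2 tau] within [eps] of
   [cosh^2 T]. *)
set (m := Rmax (Rmax y (99 / 100)) (hT D - d)).
assert (m1 : y <= m /\ 99 / 100 <= m /\ hT D - d <= m).
{ unfold m. assert (a1 := Rmax_l (Rmax y (99/100)) (hT D - d)). assert (a2 := Rmax_r (Rmax y (99/100)) (hT D - d)). assert (a3 := Rmax_l y (99/100)). assert (a4 := Rmax_r y (99/100)). lra. }
assert (m2 : m < hT D) by (unfold m; repeat apply Rmax_lub_lt; lra).
set (tau := (m + hT D) / 2). assert (Htau : m < tau < hT D) by (unfold tau; lra).
assert (Cd : L - cosh tau * cosh tau < eps).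
{ specialize (Hd tau ltac:(rewrite Rabs_left; lra)). apply Rabs_lt_between in Hd. unfold L. lra. }
assert (h99 : 99 / 100 <= tau) by lra.
destruct (sC tau h99) as (s0 & c0 & cs & _). destruct (r_range tau h99) as [r1 r2].
assert (cL : cosh tau * cosh tau <= L).
{ assert (cosh tau <= cosh (hT D)).
  { apply (incr 0 (hT D + 1) cosh sinh); try lra. intros; apply is_derive_cosh. intros; apply sinh_ge0; lra. }
  unfold L. apply Rmult_le_compat; lra. }
assert (s1 : 1 <= sinh tau).
{ assert (cosh tau <= 4 / 3 * sinh tau). { apply (Rmult_le_reg_r (/ sinh tau)). now apply Rinv_0_lt_compat. rewrite Rmult_assoc, Rinv_r by lra. unfold Rdiv in r2. lra. }
  apply Rnot_lt_le; intros K. assert (cosh tau * cosh tau <= 4 / 3 * sinh tau * (4 / 3 * sinh tau)) by (apply Rmult_le_compat; lra).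
  assert (sinh tau * sinh tau < 1 * 1) by (apply Rmult_le_0_lt_compat; lra). lra. }
assert (c1 := cosh_ge1 tau).
set (al := / (sinh tau * cosh tau)).
assert (sc1 : 1 <= sinh tau * cosh tau) by nra.
assert (scL : sinh tau * cosh tau <= L) by nra.
assert (al1 : 0 < al <= 1). { unfold al. split. apply Rinv_0_lt_compat; lra. rewrite <- Rinv_1. apply Rinv_le_contravar; lra. }
assert (ial : / al = sinh tau * cosh tau) by (unfold al; now rewrite Rinv_inv).
destruct (slices D tau H h99 ltac:(lra)) as (Cst & Cp & S).
set (e := Rmin (Rmin eps y) (eps / (2 * (Cst + 1)))).
assert (p1 : 0 < eps / (2 * (Cst + 1))) by (apply Rdiv_lt_0_compat; lra).
assert (He2 : 0 < e /\ e <= eps /\ e <= y /\ e <= eps / (2 * (Cst + 1))).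
{ unfold e. assert (a1 := Rmin_l (Rmin eps y) (eps / (2 * (Cst + 1)))). assert (a2 := Rmin_r (Rmin eps y) (eps / (2 * (Cst + 1)))).
  assert (a3 := Rmin_l eps y). assert (a4 := Rmin_r eps y). split; [repeat apply Rmin_pos; lra | lra]. }
destruct (S e N ltac:(lra)) as (t & Ht & HtT & _ & Q).
exists t, tau. split; [lra|]. split; [lra|]. split; [lra|]. split; [lra|]. split; [lra|].
assert (de : defect D tau + Cst * e <= eps).
{ assert (Cst * e <= eps / 2). { apply Rle_trans with ((Cst + 1) * (eps / (2 * (Cst + 1)))). apply Rmult_le_compat; lra. right; field; lra. }
  assert (defect D tau <= eps / 2); [|lra]. unfold defect. fold al.
  assert (hR D * hR D <= L) by (unfold L; apply Rmult_le_compat; lra).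
  apply Rle_trans with (al / 2 * eps). apply Rmult_le_compat_l; lra. assert (al * eps <= 1 * eps) by (apply Rmult_le_compat_r; lra). lra. }
intros n Hn. destruct (Q n Hn) as (br & bi & xr & xi & cr & ci & E). cbv zeta in E. fold al in E.
destruct E as (E1 & E2 & E3 & B1 & B2 & B3).
set (k := kk tau n / al) in *. destruct (kk_le tau n h99) as [k0 k2].
set (X := (xr - k * br) * (xr - k * br) + (xi - k * bi) * (xi - k * bi)) in *.
assert (XB : X <= 2 * L * eps).
{ assert (X = (/ al) * (2 * (al / 2 * X))) by (field; lra). rewrite H0, ial.
  assert (X0 : 0 <= X) by (unfold X; generalize (sq_ge0 (xr - k * br)) (sq_ge0 (xi - k * bi)); lra).
  replace (2 * L * eps) with (L * (2 * eps)) by ring. apply Rmult_le_compat; try lra. assert (0 <= al / 2 * X) by (apply Rmult_le_pos; lra). lra. }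
assert (kb : k * k <= 4 * (L * L)).
{ assert (0 < k <= 2 * L). { unfold k, Rdiv. rewrite ial. split. apply Rmult_lt_0_compat; lra. apply Rmult_le_compat; lra. }
  assert (k * k <= 2 * L * (2 * L)) by (apply Rmult_le_compat; lra). lra. }
assert (Le : 0 <= L * eps) by (apply Rmult_le_pos; lra). assert (LLe : 0 <= L * L * eps) by (apply Rmult_le_pos; [apply sq_ge0 | lra]).
split; intros Hn1.
- specialize (B1 Hn1). set (be := br * br + bi * bi) in *. split.
  + rewrite <- E1. assert (t1 := two_sq cr br). assert (t2 := two_sq ci bi). unfold be in *. lra.
  + rewrite <- E2. assert (t1 := two_sq xr (k * br)). assert (t2 := two_sq xi (k * bi)).
    assert (be0 : 0 <= be) by (unfold be; generalize (sq_ge0 br) (sq_ge0 bi); lra).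
    assert (k * k * be <= 4 * (L * L) * (25 * eps)) by (apply Rmult_le_compat; try lra; apply sq_ge0).
    assert (k * br * (k * br) + k * bi * (k * bi) = k * k * be) by (unfold be; ring). unfold X in XB. lra.
(* For the modes 1 and -1 the small square reads [|x - cosh tau b|^2]; replacing [b] by the nearby
   [c] gives [wr]. *)
- rewrite <- E3. assert (kC : k = cosh tau). { unfold k, Rdiv. rewrite ial. destruct (s_kk_1 tau h99 n Hn1) as [K1 _]. rewrite (Rmult_comm (sinh tau)), Rmult_comm, Rmult_assoc, K1. ring. }
  set (C := cosh tau) in *. assert (XE : X = (xr - C * br) * (xr - C * br) + (xi - C * bi) * (xi - C * bi)) by (unfold X; rewrite kC; auto).
  assert (t1 := two_sq (xr - C * cr) (C * (br - cr))). assert (t2 := two_sq (xi - C * ci) (C * (bi - ci))).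
  set (dl := (br - cr) * (br - cr) + (bi - ci) * (bi - ci)) in *.
  assert (dl0 : 0 <= dl) by (unfold dl; generalize (sq_ge0 (br - cr)) (sq_ge0 (bi - ci)); lra).
  assert (C * C * dl <= L * (25 * eps)) by (apply Rmult_le_compat; try lra; apply sq_ge0).
  assert (C * (br - cr) * (C * (br - cr)) + C * (bi - ci) * (C * (bi - ci)) = C * C * dl) by (unfold dl; ring).
  replace (xr - C * cr - C * (br - cr)) with (xr - C * br) in t1 by ring. replace (xi - C * ci - C * (bi - ci)) with (xi - C * bi) in t2 by ring. lra.
Qed.

Lemma small_zero x C : 0 <= C -> 0 <= x -> (forall eps, 0 < eps <= 1 / 100 -> x <= C * eps) -> x = 0.
Proof.
intros Cp xp S. apply Rle_antisym; auto. apply Rnot_lt_le; intros L.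
set (e := Rmin (1 / 100) (x / (2 * (C + 1)))). assert (p : 0 < x / (2 * (C + 1))) by (apply Rdiv_lt_0_compat; lra).
assert (m1 := Rmin_l (1/100) (x / (2 * (C + 1)))). assert (m2 := Rmin_r (1/100) (x / (2 * (C + 1)))). fold e in m1, m2.
assert (ep : 0 < e) by (apply Rmin_pos; lra). assert (K := S e ltac:(lra)).
assert (C * e <= (C + 1) * (x / (2 * (C + 1)))) by (apply Rmult_le_compat; lra).
replace ((C + 1) * (x / (2 * (C + 1)))) with (x / 2) in H by (field; lra). lra.
Qed.

(** [cn] is convex in [t] and small at two times that enclose [y]. *)
Lemma thick_vanish D y n : core D -> 1 <= hT D -> hR D <= cosh (hT D) -> 0 < y < hT D -> Z.abs n <> 1%Z -> cn D y n = 0.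
Proof.
intros H h1 hle Hy Hn. destruct (thick_small D y H h1 hle Hy) as (Cb & Cp & S).
apply (small_zero _ Cb Cp). apply (cn_bound D n y H Hy). intros eps He.
destruct (S eps (Z.to_nat (Z.abs n)) He) as (t & tau & Ht & ty & yt & tT & _ & Q).
destruct (Q n ltac:(lia)) as [Q1 _]. destruct (Q1 Hn) as [q1 q2].
apply (convex_max (hT D) (fun t => cn D t n) _ _ t (t + tau) y (Cb * eps) (fun t Ht => cn_convex D n t H Ht)); try lra.
Qed.

Lemma wronskian T (f f1 : R -> R) y t : (forall t, 0 < t < T -> is_derive f t (f1 t) /\ is_derive f1 t (f t)) -> 0 < y < T -> 0 < t < T ->
  f1 y * cosh y - f y * sinh y = f1 t * cosh t - f t * sinh t.
Proof.
intros DD Hy Ht. apply (const_on 0 T (fun t => f1 t * cosh t - f t * sinh t)); auto. intros x Hx. destruct (DD x Hx) as [a b].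
replace 0 with ((f x * cosh x + f1 x * sinh x) - (f1 x * sinh x + f x * cosh x)) by ring.
apply (is_derive_minus (fun t => f1 t * cosh t) (fun t => f t * sinh t)).
- apply (is_derive_mult_R f1 cosh); auto. apply is_derive_cosh.
- apply (is_derive_mult_R f sinh); auto. apply is_derive_sinh.
Qed.

(** The Wronskian with [cosh] is constant in time, so it may be evaluated at the small time [t] of a
    slice. There the term with [sinh t] is small, and [c'(t)] is small because
    [wr = sinh^2 tau |c'(t)|^2]. *)
Lemma thick_tanh D y n : core D -> 1 <= hT D -> hR D <= cosh (hT D) -> 0 < y < hT D -> Z.abs n = 1%Z ->
  dr D y n * cosh y - hr D y n * sinh y = 0 /\ di D y n * cosh y - hi D y n * sinh y = 0.
Proof.
intros H h1 hle Hy Hn. destruct (thick_small D y H h1 hle Hy) as (Cb & Cp & S). assert (R1 := k_R _ H).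
set (a := dr D y n * cosh y - hr D y n * sinh y). set (b := di D y n * cosh y - hi D y n * sinh y).
assert (one : IZR (Z.abs n) = 1) by (rewrite Hn; auto).
set (L := cosh (hT D) * cosh (hT D)). assert (L0 : 0 <= L) by apply sq_ge0.
assert (Z : a * a + b * b = 0).
{ apply (small_zero _ (2 * L * Cb + 2 * (hR D * hR D) * L)).
  - assert (0 <= L * Cb) by (apply Rmult_le_pos; auto). assert (0 <= hR D * hR D * L) by (apply Rmult_le_pos; auto; apply sq_ge0). lra.
  - generalize (sq_ge0 a) (sq_ge0 b); lra.
  - intros eps He. destruct (S eps 1%nat He) as (t & tau & Ht & ty & yt & tT & h99 & Q). destruct (Q n ltac:(lia)) as [_ Q2]. specialize (Q2 Hn).
    assert (Ht' : 0 < t < hT D) by lra.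
    assert (DR : forall t, 0 < t < hT D -> (is_derive (fun t => hr D t n) t (dr D t n) /\ is_derive (fun t => dr D t n) t (hr D t n)) /\ (is_derive (fun t => hi D t n) t (di D t n) /\ is_derive (fun t => di D t n) t (hi D t n))).
    { intros x Hx. destruct (coef_derive D n x H Hx) as [[a1 a2] [a3 a4]]. rewrite one in a2, a4. rewrite !Rmult_1_l in a2, a4. auto. }
    assert (Ea := wronskian (hT D) _ _ y t (fun x Hx => proj1 (DR x Hx)) Hy Ht'). assert (Eb := wronskian (hT D) _ _ y t (fun x Hx => proj2 (DR x Hx)) Hy Ht').
    cbv beta in Ea, Eb. fold a in Ea. fold b in Eb.
    assert (K1 := kk_solve (hT D) _ _ n t tau (fun y Hy => proj1 (coef_derive D n y H Hy)) (proj1 Ht) ltac:(lra) tT).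
    assert (K2 := kk_solve (hT D) _ _ n t tau (fun y Hy => proj2 (coef_derive D n y H Hy)) (proj1 Ht) ltac:(lra) tT).
    cbv beta in K1, K2. destruct (s_kk_1 tau h99 n Hn) as [sk _]. destruct (sC tau h99) as (s0 & c0 & cs & es & _). destruct (r_range tau h99) as [r1 r2].
    rewrite one, !Rmult_1_l, es in K1, K2.
    (* The exact evolution [c(t + tau) = cosh tau c(t) + sinh tau c'(t)] of the modes 1 and -1. *)
    assert (X1 : hr D (t + tau) n - cosh tau * hr D t n = sinh tau * dr D t n).
    { assert (E : sinh tau * (dr D t n + hr D t n) = sinh tau * kk tau n * (hr D (t + tau) n - (cosh tau - sinh tau) * hr D t n)) by (rewrite K1; ring). rewrite sk in E. lra. }
    assert (X2 : hi D (t + tau) n - cosh tau * hi D t n = sinh tau * di D t n).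
    { assert (E : sinh tau * (di D t n + hi D t n) = sinh tau * kk tau n * (hi D (t + tau) n - (cosh tau - sinh tau) * hi D t n)) by (rewrite K2; ring). rewrite sk in E. lra. }
    unfold wr in Q2. rewrite X1, X2 in Q2.
    assert (s1 : 1 <= sinh tau * sinh tau).
    { assert (cosh tau <= 4 / 3 * sinh tau). { apply (Rmult_le_reg_r (/ sinh tau)). now apply Rinv_0_lt_compat. rewrite Rmult_assoc, Rinv_r by lra. unfold Rdiv in r2. lra. }
      assert (cosh tau * cosh tau <= 4 / 3 * sinh tau * (4 / 3 * sinh tau)) by (apply Rmult_le_compat; lra). lra. }
    set (p := dr D t n) in *. set (q := di D t n) in *.
    assert (pq0 : 0 <= p * p + q * q) by (generalize (sq_ge0 p) (sq_ge0 q); lra).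
    assert (pq : p * p + q * q <= Cb * eps).
    { assert (1 * (p * p + q * q) <= sinh tau * sinh tau * (p * p + q * q)) by (apply Rmult_le_compat_r; lra). lra. }
    assert (cb := cn_bound D n t H Ht'). unfold cn in cb. set (g := hr D t n) in *. set (j := hi D t n) in *.
    assert (ct : cosh t * cosh t <= L).
    { assert (cosh t <= cosh (hT D)). { apply (incr 0 (hT D + 1) cosh sinh); try lra. intros; apply is_derive_cosh. intros; apply sinh_ge0; lra. }
      unfold L. apply Rmult_le_compat; try lra; generalize (cosh_ge1 t); lra. }
    assert (st : sinh t * sinh t <= L * eps).
    { assert (0 <= sinh t) by (apply sinh_ge0; lra).
      assert (E : sinh t <= t * sinh (hT D)).
      { assert (K := sinh_star (hT D) (t / hT D)). replace (t / hT D * hT D) with t in K by (field; lra).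
        assert (l1 : 0 <= t / hT D <= t). { split. apply Rlt_le, Rdiv_lt_0_compat; lra. apply (Rmult_le_reg_r (hT D)); [lra|]. replace (t / hT D * hT D) with t by (field; lra). nra. }
        eapply Rle_trans; [apply K; lra|]. apply Rmult_le_compat_r; [apply sinh_ge0; lra | lra]. }
      assert (sinh t * sinh t <= t * sinh (hT D) * (t * sinh (hT D))) by (apply Rmult_le_compat; auto).
      assert (cT := cosh2_sinh2 (hT D)). fold L in cT.
      assert (t * t <= eps * 1) by (apply Rmult_le_compat; lra).
      assert (t * t * (sinh (hT D) * sinh (hT D)) <= eps * 1 * L) by (apply Rmult_le_compat; try lra; apply sq_ge0). lra. }
    rewrite Ea, Eb.
    assert (t1 := two_sq (p * cosh t - g * sinh t) (p * cosh t)). assert (t2 := two_sq (q * cosh t - j * sinh t) (q * cosh t)).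
    assert (Y1 : cosh t * cosh t * (p * p + q * q) <= L * (Cb * eps)) by (apply Rmult_le_compat; try lra; apply sq_ge0).
    assert (Y2 : sinh t * sinh t * (g * g + j * j) <= L * eps * (hR D * hR D)) by (apply Rmult_le_compat; try lra; apply sq_ge0).
    lra. }
assert (qa := sq_ge0 a). assert (qb := sq_ge0 b). split; apply sq_eq0; lra.
Qed.

(** The Fourier partial sums are stationary from [K = 1] on and converge in mean square, so
    [h(t, .)] agrees with them in mean, hence everywhere by continuity. *)
Lemma one_mode D t : core D -> 0 < t < hT D -> (forall n, Z.abs n <> 1%Z -> cn D t n = 0) ->
  forall s, hu D t s = tu 1 (hr D t) (hi D t) s /\ hv D t s = tv 1 (hr D t) (hi D t) s.
Proof.
intros H Ht V. cyl H Ht. assert (Pu := c1_per (k_u _ H) _ Ht). assert (Pv := c1_per (k_v _ H) _ Ht).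
assert (V0 : forall n, Z.abs n <> 1%Z -> hr D t n = 0 /\ hi D t n = 0).
{ intros n Hn. assert (K := V n Hn). unfold cn in K. assert (q1 := sq_ge0 (hr D t n)). assert (q2 := sq_ge0 (hi D t n)). split; apply sq_eq0; lra. }
assert (St : forall K s, (1 <= K)%nat -> su (hu D t) (hv D t) K s = tu 1 (hr D t) (hi D t) s /\ sv (hu D t) (hv D t) K s = tv 1 (hr D t) (hi D t) s).
{ intros K s HK. induction HK as [|K HK IH]; [split; reflexivity|]. destruct IH as [IH1 IH2].
  destruct (V0 (Z.of_nat (S K)) ltac:(lia)) as [z1 z2]. destruct (V0 (- Z.of_nat (S K))%Z ltac:(lia)) as [z3 z4]. unfold hr, hi in z1, z2, z3, z4.
  unfold su, sv, tu, tv in *. rewrite !(zs_S K). rewrite z1, z2, z3, z4. split; [rewrite <- IH1; ring | rewrite <- IH2; ring]. }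
set (f := fun s => (hu D t s - tu 1 (hr D t) (hi D t) s) * (hu D t s - tu 1 (hr D t) (hi D t) s) + (hv D t s - tv 1 (hr D t) (hi D t) s) * (hv D t s - tv 1 (hr D t) (hi D t) s)).
assert (Z : mean f = 0).
{ assert (L := L2_convergence _ _ c c0 Pu Pv).
  assert (L' : is_lim_seq (fun K => mean f) 0).
  { apply (is_lim_seq_ext_loc (err (hu D t) (hv D t))); auto. exists 1%nat. intros K HK. apply mean_ext; intros s.
    destruct (St K s HK) as [-> ->]. reflexivity. }
  assert (E := is_lim_seq_unique _ _ L'). rewrite Lim_seq_const in E. now inversion E. }
assert (Ptu : forall n, periodic (fun s => cos (IZR n * s)) /\ periodic (fun s => sin (IZR n * s))) by (intros; split; [apply per_cosZ | apply per_sinZ]).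
intros s. assert (F0 : f s = 0).
{ apply (mean_sq_zero f); auto.
  - unfold f; cnt.
  - intros x. unfold f. match goal with |- 0 <= ?a * ?a + ?b * ?b => generalize (sq_ge0 a) (sq_ge0 b) end; lra.
  - intros x. unfold f. rewrite Pu, Pv.
    assert (E1 : tu 1 (hr D t) (hi D t) (x + 2 * PI) = tu 1 (hr D t) (hi D t) x) by (apply zs_ext; intros n _; rewrite (proj1 (Ptu n) x), (proj2 (Ptu n) x); auto).
    assert (E2 : tv 1 (hr D t) (hi D t) (x + 2 * PI) = tv 1 (hr D t) (hi D t) x) by (apply zs_ext; intros n _; rewrite (proj1 (Ptu n) x), (proj2 (Ptu n) x); auto).
    now rewrite E1, E2. }
unfold f in F0. set (a := hu D t s - _) in *. set (b := hv D t s - _) in *. assert (qa := sq_ge0 a). assert (qb := sq_ge0 b).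
assert (a = 0) by (apply sq_eq0; lra). assert (b = 0) by (apply sq_eq0; lra). unfold a, b in *. lra.
Qed.

(** With the modes 1 and -1 alone, [h / cosh t] is a fixed linear image of the unit circle. The
    inner limit makes the linear map an isometry, and the positive area selects the rotations. *)
Lemma thick_nitsche D : core D -> 1 <= hT D -> hR D <= cosh (hT D) -> nitsche D.
Proof.
intros H h1 hle. set (t0 := hT D / 2). assert (Ht0 : 0 < t0 < hT D) by (unfold t0; lra).
assert (Q : forall n, Z.abs n = 1%Z -> forall t, 0 < t < hT D -> hr D t n = cosh t * (hr D t0 n / cosh t0) /\ hi D t n = cosh t * (hi D t0 n / cosh t0)).
{ intros n Hn. assert (G : forall f f1 : R -> R, (forall t, 0 < t < hT D -> is_derive f t (f1 t)) -> (forall t, 0 < t < hT D -> f1 t * cosh t - f t * sinh t = 0) ->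
     forall t, 0 < t < hT D -> f t = cosh t * (f t0 / cosh t0)).
  { intros f f1 Df E t Ht. assert (P := cosh_pos t). assert (P0 := cosh_pos t0).
    assert (Z : f t * / cosh t = f t0 * / cosh t0).
    { apply (const_on 0 (hT D) (fun t => f t * / cosh t)); auto. intros x Hx. assert (Px := cosh_pos x).
      replace 0 with (f1 x * / cosh x + f x * (sinh x * - / (cosh x * cosh x))).
      - apply (is_derive_mult_R f (fun t => / cosh t)); auto. apply (is_derive_comp Rinv cosh); [|apply is_derive_cosh]. auto_derive; [lra | field; lra].
      - specialize (E x Hx). apply (Rmult_eq_reg_r (cosh x * cosh x)); [|nra]. field_simplify; [|lra]. lra. }
    unfold Rdiv. rewrite <- Z. field. lra. }
  intros t Ht. split.
  - apply (G (fun t => hr D t n) (fun t => dr D t n)); auto. intros y Hy; exact (proj1 (proj1 (coef_derive D n y H Hy))). intros y Hy. exact (proj1 (thick_tanh D y n H h1 hle Hy Hn)).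
  - apply (G (fun t => hi D t n) (fun t => di D t n)); auto. intros y Hy; exact (proj1 (proj2 (coef_derive D n y H Hy))). intros y Hy. exact (proj2 (thick_tanh D y n H h1 hle Hy Hn)). }
set (A := hr D t0 1 / cosh t0). set (B := hi D t0 1 / cosh t0). set (A' := hr D t0 (-1) / cosh t0). set (B' := hi D t0 (-1) / cosh t0).
set (al := A + A'). set (be := B' - B). set (ga := B + B'). set (dl := A - A').
assert (F : forall t s, 0 < t < hT D -> hu D t s = cosh t * (al * cos s + be * sin s) /\ hv D t s = cosh t * (ga * cos s + dl * sin s)).
{ intros t s Ht. destruct (one_mode D t H Ht (fun n Hn => thick_vanish D t n H h1 hle Ht Hn) s) as [-> ->].
  destruct (Q 1%Z eq_refl t Ht) as [e1 e2]. destruct (Q (-1)%Z eq_refl t Ht) as [e3 e4]. fold A in e1. fold B in e2. fold A' in e3. fold B' in e4.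
  assert (z := thick_vanish D t 0 H h1 hle Ht ltac:(lia)). unfold cn in z. assert (q1 := sq_ge0 (hr D t 0)). assert (q2 := sq_ge0 (hi D t 0)).
  assert (z1 : hr D t 0 = 0) by (apply sq_eq0; lra). assert (z2 : hi D t 0 = 0) by (apply sq_eq0; lra).
  unfold tu, tv. rewrite !zs_S, !zs_O. change (Z.of_nat 1) with 1%Z. change (- (1))%Z with (-1)%Z.
  rewrite e1, e2, e3, e4, z1, z2. replace (IZR 1 * s) with s by ring. replace (IZR (-1) * s) with (- s) by ring. rewrite cos_neg, sin_neg.
  unfold al, be, ga, dl. split; ring. }
assert (Fs : forall t s, 0 < t < hT D -> hus D t s = cosh t * (- al * sin s + be * cos s) /\ hvs D t s = cosh t * (- ga * sin s + dl * cos s)).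
{ intros t s Ht. split.
  - rewrite <- (is_derive_unique _ _ _ (c1_ds (k_u _ H) t s Ht)). apply is_derive_unique.
    apply (is_derive_ext (fun s => cosh t * (al * cos s + be * sin s))). intros x. symmetry; apply (F t x Ht).
    generalize (cosh t); intros k. auto_derive; auto; ring.
  - rewrite <- (is_derive_unique _ _ _ (c1_ds (k_v _ H) t s Ht)). apply is_derive_unique.
    apply (is_derive_ext (fun s => cosh t * (ga * cos s + dl * sin s))). intros x. symmetry; apply (F t x Ht).
    generalize (cosh t); intros k. auto_derive; auto; ring. }
assert (Dt : 0 < al * dl - be * ga).
{ assert (K := area_ge1 D t0 H Ht0). unfold area in K. rewrite (mean_ext _ (fun _ => cosh t0 * cosh t0 * (al * dl - be * ga))) in K.
  - rewrite mean_const in K. apply Rnot_le_lt; intros L. assert (0 <= cosh t0 * cosh t0 * - (al * dl - be * ga)) by (apply Rmult_le_pos; [apply sq_ge0 | lra]). lra.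
  - intros s. unfold omega. destruct (F t0 s Ht0) as [-> ->]. destruct (Fs t0 s Ht0) as [-> ->]. assert (SC := sin2_cos2 s). unfold Rsqr in SC.
    transitivity (cosh t0 * cosh t0 * (al * dl - be * ga) * (sin s * sin s + cos s * cos s)); [ring | rewrite SC; ring]. }
assert (N1 : forall s, (al * cos s + be * sin s) * (al * cos s + be * sin s) + (ga * cos s + dl * sin s) * (ga * cos s + dl * sin s) = 1).
{ intros s. set (m := _ + _ * _). assert (m0 : 0 <= m) by (unfold m; match goal with |- 0 <= ?a * ?a + ?b * ?b => generalize (sq_ge0 a) (sq_ge0 b) end; lra).
  assert (NN : forall t, 0 < t < hT D -> nsq D t s = cosh t * cosh t * m).
  { intros t Ht. unfold nsq. destruct (F t s Ht) as [-> ->]. unfold m; ring. }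
  apply Rle_antisym.
  - apply le_epsilon. intros e He. destruct (k_0 _ H e He) as (d & dp & Hd).
    set (x := Rmin (d/2) t0). assert (Hx : 0 < x /\ x < d /\ x <= t0) by (unfold x, Rmin; destruct Rle_dec; lra).
    assert (K := Hd x s ltac:(lra) ltac:(lra)). rewrite NN in K by lra. assert (1 <= cosh x * cosh x) by (generalize (cosh_ge1 x); intros; nra).
    assert (1 * m <= cosh x * cosh x * m) by (apply Rmult_le_compat_r; auto). lra.
  - apply le_epsilon. intros e He. assert (ep : 0 < e / (m + 1)) by (apply Rdiv_lt_0_compat; lra).
    destruct (continuous_eps (fun t => cosh t * cosh t) 0 ltac:(apply (cont_mult cosh cosh); cnt) (e / (m + 1)) ep) as (d & dp & Hd).
    set (x := Rmin (d/2) t0). assert (Hx : 0 < x /\ x < d /\ x <= t0) by (unfold x, Rmin; destruct Rle_dec; lra).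
    assert (K := k_N _ H x s ltac:(lra)). rewrite NN in K by lra. specialize (Hd x ltac:(rewrite Rminus_0_r, Rabs_right; lra)). rewrite cosh_0 in Hd. apply Rabs_lt_between in Hd.
    assert (cosh x * cosh x * m <= (1 + e / (m + 1)) * m) by (apply Rmult_le_compat_r; lra).
    assert (e / (m + 1) * m <= e / (m + 1) * (m + 1)) by (apply Rmult_le_compat_l; lra). replace (e / (m + 1) * (m + 1)) with e in H1 by (field; lra). lra. }
(* The angles 0 and [PI / 2] give columns of unit length; [PI / 4] and [- PI / 4] give their
   orthogonality. *)
assert (n1 := N1 0). rewrite sin_0, cos_0 in n1. assert (n2 := N1 (PI / 2)). rewrite sin_PI2, cos_PI2 in n2.
assert (n3 := N1 (PI / 4)). assert (n4 := N1 (- (PI / 4))). rewrite sin_neg, cos_neg in n4. rewrite cos_PI4, sin_PI4 in n3, n4.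
assert (or : al * be + ga * dl = 0).
{ set (q := 1 / sqrt 2) in *. assert (0 < sqrt 2) by (apply sqrt_lt_R0; lra). assert (0 < q) by (apply Rdiv_lt_0_compat; lra). assert (0 < q * q) by (apply Rmult_lt_0_compat; auto).
  apply (Rmult_eq_reg_l (4 * (q * q))); [|lra]. lra. }
destruct (unit_angle al ga) as (c & Ec & Es); [lra|].
exists c. intros t s Ht. destruct (F t s Ht) as [-> ->].
(* The determinant [p] has square 1 by Lagrange's identity and is positive, so [p = 1], and the
   distance to a rotation matrix vanishes. *)
assert (dE : dl = al /\ be = - ga).
{ assert (q1 := sq_ge0 (dl - al)). assert (q2 := sq_ge0 (be + ga)).
  set (p := al * dl - be * ga) in *.
  assert (P1 : p * p = 1).
  { transitivity ((al * al + ga * ga) * (be * be + dl * dl) - (al * be + ga * dl) * (al * be + ga * dl)); [unfold p; ring|]. rewrite or.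
    replace (al * al + ga * ga) with 1 by lra. replace (be * be + dl * dl) with 1 by lra. ring. }
  assert (p = 1). { assert ((p - 1) * (p + 1) = 0) by lra. apply Rmult_integral in H0. destruct H0; lra. }
  assert ((dl - al) * (dl - al) + (be + ga) * (be + ga) = 0) by (unfold p in *; lra).
  split; [assert (dl - al = 0) | assert (be + ga = 0)]; try (apply sq_eq0; lra); lra. }
destruct dE as [-> ->]. rewrite Ec, Es, cos_plus, sin_plus. split; ring.
Qed.

Theorem core_bound_main D : core D -> cosh (hT D) <= hR D.
Proof.
intros H. destruct (Rle_dec 1 (hT D)) as [h|h]; [now apply thick_bound|]. assert (R1 := k_R _ H). assert (TP := k_T _ H).
assert (L : - (hR D * hR D) <= - (cosh (hT D) * cosh (hT D))).
{ apply (limit_ge (fun x => - (cosh x * cosh x)) (hT D) _ (hT D)); [|lra|].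
  - assert (C : cont (fun x => - (cosh x * cosh x))) by cnt. apply C.
  - intros tau Ht. assert (K := local_bound D tau H ltac:(lra) ltac:(lra) ltac:(lra)). assert (K2 := U_gt1 D tau H ltac:(lra)). lra. }
apply Rnot_lt_le; intros K. assert (hR D * hR D < cosh (hT D) * cosh (hT D)) by (apply Rmult_le_0_lt_compat; lra). lra.
Qed.

Theorem core_equality D : core D -> hR D <= cosh (hT D) -> nitsche D.
Proof.
intros H hle. destruct (Rle_dec 1 (hT D)) as [h|h]; [now apply thick_nitsche|].
apply dev_nitsche; auto. apply local_dev; auto. lra.
Qed.

(** * Conformal charts of minimal graphs *)

Lemma cnorm_sq x y : cnorm x y * cnorm x y = x * x + y * y /\ 0 <= cnorm x y.
Proof. unfold cnorm. split. apply sqrt_sqrt. generalize (sq_ge0 x) (sq_ge0 y); lra. apply sqrt_pos. Qed.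

Lemma annulus_sq a b x y : 0 <= a -> 0 < b -> annulus a b x y <-> a * a < x * x + y * y < b * b.
Proof.
intros Ha Hb. destruct (cnorm_sq x y) as [E P]. unfold annulus. rewrite <- E. split.
- intros [h1 h2]. split; apply Rmult_le_0_lt_compat; lra.
- intros [h1 h2]. split; apply Rnot_le_lt; intros L.
  + assert (cnorm x y * cnorm x y <= a * a) by (apply Rmult_le_compat; lra). lra.
  + assert (b * b <= cnorm x y * cnorm x y) by (apply Rmult_le_compat; lra). lra.
Qed.

Lemma cont_sq_norm x y : continuity_2d_pt (fun x y => x * x + y * y) x y.
Proof. apply continuity_2d_pt_plus; apply continuity_2d_pt_mult; (apply continuity_2d_pt_id1 || apply continuity_2d_pt_id2). Qed.

Lemma annulus_open a b x y : 0 <= a -> 0 < b -> annulus a b x y -> locally_2d (annulus a b) x y.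
Proof.
intros Ha Hb A. apply annulus_sq in A; auto.
set (e := Rmin (x * x + y * y - a * a) (b * b - (x * x + y * y))). assert (ep : 0 < e) by (apply Rmin_pos; lra).
destruct (cont_sq_norm x y (mkposreal e ep)) as [d Hd]. exists d. intros u v hu hv. apply annulus_sq; auto. specialize (Hd u v hu hv). simpl in Hd.
apply Rabs_lt_between in Hd. assert (m1 := Rmin_l (x * x + y * y - a * a) (b * b - (x * x + y * y))). assert (m2 := Rmin_r (x * x + y * y - a * a) (b * b - (x * x + y * y))). fold e in m1, m2. lra.
Qed.

Lemma cont2_at_2d f x y : cont2_at f x y -> continuity_2d_pt f x y.
Proof.
intros C eps. destruct (C eps (cond_pos eps)) as (d & dp & Hd). exists (mkposreal (d/2) ltac:(lra)); simpl. intros u v hu hv. apply Hd.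
apply Rabs_lt_between in hu. apply Rabs_lt_between in hv.
assert (Q : forall z, - (d/2) < z < d/2 -> z * z < d * d / 4).
{ intros z Hz. assert (0 < (d/2 - z) * (d/2 + z)) by (apply Rmult_lt_0_compat; lra). lra. }
assert (q1 := Q _ hu). assert (q2 := Q _ hv). assert (0 < d * d) by (apply Rmult_lt_0_compat; auto). lra.
Qed.

Lemma C1_on_diff a b f fx fy x y : 0 <= a -> 0 < b -> C1_on (annulus a b) f fx fy -> annulus a b x y ->
  differentiable_pt_lim f x y (fx x y) (fy x y).
Proof.
intros Ha Hb C A. apply C1_differentiable.
- destruct (annulus_open a b x y Ha Hb A) as [d Hd]. exists d. intros u v hu hv. apply is_derive_Reals. apply (C u v (Hd u v hu hv)).
- destruct (annulus_open a b x y Ha Hb A) as [d Hd]. exists d. intros u v hu hv. apply is_derive_Reals. apply (C u v (Hd u v hu hv)).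
- apply cont2_at_2d. apply (C x y A).
- apply cont2_at_2d. apply (C x y A).
Qed.

Lemma cont_comp2 G f g t s : continuity_2d_pt G (f t s) (g t s) -> continuity_2d_pt f t s -> continuity_2d_pt g t s ->
  continuity_2d_pt (fun t s => G (f t s) (g t s)) t s.
Proof.
intros CG Cf Cg eps. destruct (CG eps) as [d Hd]. destruct (Cf d) as [d1 H1]. destruct (Cg d) as [d2 H2].
exists (mkposreal (Rmin d1 d2) ltac:(apply Rmin_pos; apply cond_pos)); simpl. assert (m1 := Rmin_l d1 d2). assert (m2 := Rmin_r d1 d2).
intros u v hu hv. apply Hd; [apply H1 | apply H2]; lra.
Qed.

Lemma c1_comp2 a b G Gx Gy lo hi f ft fs g gt gs : 0 <= a -> 0 < b -> C1_on (annulus a b) G Gx Gy -> C1cyl lo hi f ft fs -> C1cyl lo hi g gt gs ->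
  (forall t s, lo < t < hi -> annulus a b (f t s) (g t s)) ->
  C1cyl lo hi (fun t s => G (f t s) (g t s)) (fun t s => Gx (f t s) (g t s) * ft t s + Gy (f t s) (g t s) * gt t s)
    (fun t s => Gx (f t s) (g t s) * fs t s + Gy (f t s) (g t s) * gs t s).
Proof.
intros Ha Hb C F Q In.
assert (CC : forall H, (H = Gx \/ H = Gy) -> forall t s, lo < t < hi -> continuity_2d_pt (fun t s => H (f t s) (g t s)) t s).
{ intros H HH t s Ht. apply cont_comp2; [|now apply (c1_cf F) | now apply (c1_cf Q)].
  apply cont2_at_2d. destruct (C _ _ (In t s Ht)) as (_ & _ & k1 & k2). destruct HH; subst; auto. }
constructor; intros.
- apply is_derive_Reals. apply (derivable_pt_lim_comp_2d G (fun t => f t s) (fun t => g t s)).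
  + apply (C1_on_diff a b); auto.
  + apply is_derive_Reals. now apply F.
  + apply is_derive_Reals. now apply Q.
- apply is_derive_Reals. apply (derivable_pt_lim_comp_2d G (fun s => f t s) (fun s => g t s)).
  + apply (C1_on_diff a b); auto.
  + apply is_derive_Reals. now apply F.
  + apply is_derive_Reals. now apply Q.
- apply continuity_2d_pt_plus; apply continuity_2d_pt_mult; auto; [now apply F | now apply Q].
- apply continuity_2d_pt_plus; apply continuity_2d_pt_mult; auto; [now apply F | now apply Q].
- intros s. rewrite (c1_per F t H), (c1_per Q t H). auto.
Qed.

(** [minimal_graph] provides the two mixed derivatives as separate functions; continuity makes
    Schwarz's theorem applicable. *)
Lemma mixed_partials a b w wx wy wxx wxy wyx wyy x y : 0 <= a -> 0 < b -> C1_on (annulus a b) w wx wy -> C1_on (annulus a b) wx wxx wxy -> C1_on (annulus a b) wy wyx wyy ->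
  annulus a b x y -> wxy x y = wyx x y.
Proof.
intros Ha Hb C Cx Cy A.
assert (D1 : forall u v, annulus a b u v -> Derive (fun z => w z v) u = wx u v) by (intros u v K; apply is_derive_unique, is_derive_Reals, (C u v K)).
assert (D2 : forall u v, annulus a b u v -> Derive (fun z => w u z) v = wy u v) by (intros u v K; apply is_derive_unique, is_derive_Reals, (C u v K)).
assert (Op : forall u v, annulus a b u v -> exists d : posreal, forall u' v', Rabs (u' - u) < d -> Rabs (v' - v) < d -> annulus a b u' v') by (intros u v K; apply (annulus_open a b u v Ha Hb K)).
assert (I1 : forall u v, annulus a b u v -> is_derive (fun z => Derive (fun t => w t z) u) v (wxy u v)).
{ intros u v K. apply (is_derive_ext_loc (fun z => wx u z)).
  - destruct (Op u v K) as [d Hd]. exists d. intros z Hz. symmetry; apply D1. apply Hd; auto. rewrite Rminus_diag, Rabs_R0; apply cond_pos.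
  - apply is_derive_Reals, (Cx u v K). }
assert (I2 : forall u v, annulus a b u v -> is_derive (fun z => Derive (fun t => w z t) v) u (wyx u v)).
{ intros u v K. apply (is_derive_ext_loc (fun z => wy z v)).
  - destruct (Op u v K) as [d Hd]. exists d. intros z Hz. symmetry; apply D2. apply Hd; auto. rewrite Rminus_diag, Rabs_R0; apply cond_pos.
  - apply is_derive_Reals, (Cy u v K). }
rewrite <- (is_derive_unique _ _ _ (I1 x y A)), <- (is_derive_unique _ _ _ (I2 x y A)). symmetry.
apply (Schwarz w x y).
- destruct (Op x y A) as [d Hd]. exists d. intros u v hu hv. assert (K := Hd u v hu hv). repeat split.
  + eexists; apply is_derive_Reals, (C u v K).
  + eexists; apply is_derive_Reals, (C u v K).
  + eexists; apply (I2 u v K).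
  + eexists; apply (I1 u v K).
- apply (continuity_2d_pt_ext_loc wyx). destruct (Op x y A) as [d Hd]. exists d. intros u v hu hv. symmetry. apply is_derive_unique, I2; auto.
  apply cont2_at_2d, (Cy x y A).
- apply (continuity_2d_pt_ext_loc wxy). destruct (Op x y A) as [d Hd]. exists d. intros u v hu hv. symmetry. apply is_derive_unique, I1; auto.
  apply cont2_at_2d, (Cx x y A).
Qed.

(* The relations say that the conjugate differential of [a] is the pull-back of
   [((1 + q^2) dy + p q dx) / W], a form that is closed by the minimal surface equation. *)
Lemma coordinate_harmonic T a at' as' b bt bs P Pt Ps Q Qt Qs pxx pxy pyy eps :
  C1cyl 0 T a at' as' -> C1cyl 0 T b bt bs -> C1cyl 0 T P Pt Ps -> C1cyl 0 T Q Qt Qs ->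
  (forall t s, 0 < t < T -> Pt t s = pxx t s * at' t s + pxy t s * bt t s /\ Ps t s = pxx t s * as' t s + pxy t s * bs t s /\
     Qt t s = pxy t s * at' t s + pyy t s * bt t s /\ Qs t s = pxy t s * as' t s + pyy t s * bs t s) ->
  (forall t s, 0 < t < T -> (1 + Q t s * Q t s) * pxx t s - 2 * P t s * Q t s * pxy t s + (1 + P t s * P t s) * pyy t s = 0) ->
  (forall t s, 0 < t < T -> at' t s = eps * (((1 + Q t s * Q t s) * bs t s + P t s * Q t s * as' t s) / sqrt (1 + P t s * P t s + Q t s * Q t s))) ->
  (forall t s, 0 < t < T -> as' t s = - eps * ((P t s * Q t s * at' t s + (1 + Q t s * Q t s) * bt t s) / sqrt (1 + P t s * P t s + Q t s * Q t s))) ->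
  weak_harmonic T at' as'.
Proof.
intros Ha Hb HP HQ PQ MSE Et Es p pt ps Hp t Ht.
assert (Wp : forall t s, 0 < 1 + P t s * P t s + Q t s * Q t s) by (intros x s; generalize (sq_ge0 (P x s)) (sq_ge0 (Q x s)); lra).
assert (exists I It Is, C1cyl 0 T I It Is /\ (forall t s, I t s = / sqrt (1 + P t s * P t s + Q t s * Q t s)) /\
  (forall t s, It t s = - (I t s * I t s * I t s) * (P t s * Pt t s + Q t s * Qt t s)) /\
  (forall t s, Is t s = - (I t s * I t s * I t s) * (P t s * Ps t s + Q t s * Qs t s))) as (I & It & Is & HI & EI & EIt & EIs).
{ assert (X := c1_plus (c1_plus (c1_const 0 T 1) (c1_mult HP HP)) (c1_mult HQ HQ)). simpl in X.
  assert (Y := c1_comp _ _ (fun x => / sqrt x) (fun x => - / (2 * x * sqrt x)) _ _ _ X). simpl in Y.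
  match type of Y with ?A -> ?B -> ?C => assert (HA : A); [|assert (HB : B); [|specialize (Y HA HB)]] end.
  { intros x s Hx. apply inv_sqrt_derive. apply Wp. }
  { intros x s Hx. assert (K := Wp x s). assert (K2 := sqrt_lt_R0 _ K). apply (ex_derive_continuous (fun x => - / (2 * x * sqrt x))). auto_derive. repeat split; auto.
    repeat apply Rmult_integral_contrapositive_currified; lra. }
  eexists. eexists. eexists. split; [exact Y|]. split; [reflexivity|].
  assert (E : forall t s, / (2 * (1 + P t s * P t s + Q t s * Q t s) * sqrt (1 + P t s * P t s + Q t s * Q t s)) = / 2 * (/ sqrt (1 + P t s * P t s + Q t s * Q t s) * / sqrt (1 + P t s * P t s + Q t s * Q t s) * / sqrt (1 + P t s * P t s + Q t s * Q t s))).
  { intros x s. assert (K := Wp x s). assert (K2 := sqrt_lt_R0 _ K). assert (K3 := sqrt_sqrt _ (Rlt_le _ _ K)). set (r := sqrt _) in *. set (m := 1 + _ + _) in *.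
    rewrite <- K3. field. lra. }
  split; intros x s; rewrite E; field; apply Rgt_not_eq, sqrt_lt_R0, Wp. }
assert (II : forall t s, I t s * I t s * (1 + P t s * P t s + Q t s * Q t s) = 1).
{ intros x s. rewrite EI. assert (K := Wp x s). assert (K2 := sqrt_lt_R0 _ K). assert (K3 := sqrt_sqrt _ (Rlt_le _ _ K)). set (r := sqrt _) in *. rewrite <- K3 at 1. field. lra. }
assert (Et' : forall t s, 0 < t < T -> at' t s = eps * (((1 + Q t s * Q t s) * bs t s + P t s * Q t s * as' t s) * I t s)) by (intros; rewrite EI; now apply Et).
assert (Es' : forall t s, 0 < t < T -> as' t s = - eps * ((P t s * Q t s * at' t s + (1 + Q t s * Q t s) * bt t s) * I t s)) by (intros; rewrite EI; now apply Es).
clear Et Es.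
assert (HA := c1_mult (c1_plus (c1_const 0 T 1) (c1_mult HQ HQ)) HI).
assert (HB := c1_mult (c1_mult HP HQ) HI).
assert (S1 := mean_stokes t (c1_mult Hp HA) Hb Ht).
assert (S2 := mean_stokes t (c1_mult Hp HB) Ha Ht). simpl in S1, S2.
assert (S := is_derive_scal _ _ eps _ (is_derive_plus _ _ _ _ _ S1 S2)).
assert (k1 := c1_cont_t Ha Ht). assert (k2 := c1_cont_s Ha Ht). assert (k3 := c1_cont_t Hb Ht). assert (k4 := c1_cont_s Hb Ht).
assert (k5 := c1_cont_f Hp Ht). assert (k6 := c1_cont_t Hp Ht). assert (k7 := c1_cont_s Hp Ht).
assert (k8 := c1_cont_f HI Ht). assert (k9 := c1_cont_t HI Ht). assert (k10 := c1_cont_s HI Ht).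
assert (k11 := c1_cont_f HP Ht). assert (k12 := c1_cont_t HP Ht). assert (k13 := c1_cont_s HP Ht).
assert (k14 := c1_cont_f HQ Ht). assert (k15 := c1_cont_t HQ Ht). assert (k16 := c1_cont_s HQ Ht).
match type of S with is_derive _ _ ?l => replace (mean (fun s => pt t s * at' t s + ps t s * as' t s)) with l end.
- eapply is_derive_ext_loc; [|exact S]. apply (locally_Ioo 0 T); auto. intros x Hx. simpl.
  assert (j2 := c1_cont_s Ha Hx). assert (j4 := c1_cont_s Hb Hx). assert (j5 := c1_cont_f Hp Hx).
  assert (j8 := c1_cont_f HI Hx). assert (j11 := c1_cont_f HP Hx). assert (j14 := c1_cont_f HQ Hx).
  unfold plus; simpl. rewrite <- mean_plus by cnt. unfold scal; simpl; unfold mult; simpl. rewrite <- mean_scal by cnt. apply mean_ext; intros s. rewrite (Et' x s Hx). ring.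
- unfold plus; simpl. unfold scal; simpl; unfold mult; simpl.
  rewrite <- mean_plus, <- mean_scal by cnt. apply mean_ext; intros s.
  rewrite (EIt t s), (EIs t s). specialize (II t s). specialize (MSE t s Ht). specialize (Et' t s Ht). specialize (Es' t s Ht). destruct (PQ t s Ht) as (e1 & e2 & e3 & e4).
  set (i := I t s) in *. set (P0 := P t s) in *. set (Q0 := Q t s) in *. set (a1 := at' t s) in *. set (a2 := as' t s) in *. set (b1 := bt t s) in *. set (b2 := bs t s) in *.
  set (p1 := Pt t s) in *. set (p2 := Ps t s) in *. set (q1 := Qt t s) in *. set (q2 := Qs t s) in *.
  (* The exterior derivative of the one-form, that is what remains when the test function is not
     differentiated. It equals [- P J / W^3] times the minimal surface operator, with [J] the
     Jacobian of [(a, b)]. *)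
  set (br := i * (2 * Q0 * (q1 * b2 - q2 * b1) + (p1 * Q0 + P0 * q1) * a2 - (p2 * Q0 + P0 * q2) * a1)
    - i * i * i * ((1 + Q0 * Q0) * ((P0 * p1 + Q0 * q1) * b2 - (P0 * p2 + Q0 * q2) * b1) + P0 * Q0 * ((P0 * p1 + Q0 * q1) * a2 - (P0 * p2 + Q0 * q2) * a1))).
  assert (Z : br = 0).
  { transitivity (i * (i * i * (1 + P0 * P0 + Q0 * Q0)) * (2 * Q0 * (q1 * b2 - q2 * b1) + (p1 * Q0 + P0 * q1) * a2 - (p2 * Q0 + P0 * q2) * a1)
    - i * i * i * ((1 + Q0 * Q0) * ((P0 * p1 + Q0 * q1) * b2 - (P0 * p2 + Q0 * q2) * b1) + P0 * Q0 * ((P0 * p1 + Q0 * q1) * a2 - (P0 * p2 + Q0 * q2) * a1))).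
    - rewrite II. unfold br. ring.
    - transitivity (- P0 * (a1 * b2 - a2 * b1) * (i * i * i) * ((1 + Q0 * Q0) * pxx t s - 2 * P0 * Q0 * pxy t s + (1 + P0 * P0) * pyy t s)); [rewrite e1, e2, e3, e4; ring | rewrite MSE; ring]. }
  transitivity (pt t s * (eps * (((1 + Q0 * Q0) * b2 + P0 * Q0 * a2) * i)) + ps t s * (- eps * ((P0 * Q0 * a1 + (1 + Q0 * Q0) * b1) * i)) + eps * p t s * br).
  + unfold br. ring.
  + rewrite <- Et', <- Es', Z. ring.
Qed.

(** Lagrange's identity for the two tangent vectors gives [J^2 W^2 = e^2], hence [J] is nonzero and
    [e = J W] when it is positive. The four relations say that the second tangent vector is the
    first one turned by a right angle in the tangent plane, in graph coordinates. *)
Lemma frame a1 a2 b1 b2 p q : let c1 := p * a1 + q * b1 in let c2 := p * a2 + q * b2 in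
  a1 * a1 + b1 * b1 + c1 * c1 = a2 * a2 + b2 * b2 + c2 * c2 -> a1 * a2 + b1 * b2 + c1 * c2 = 0 -> 0 < a1 * a1 + b1 * b1 + c1 * c1 ->
  let J := a1 * b2 - a2 * b1 in let W := sqrt (1 + p * p + q * q) in
  J <> 0 /\ (0 < J -> a1 = ((1 + q * q) * b2 + p * q * a2) / W /\ a2 = - ((p * q * a1 + (1 + q * q) * b1) / W) /\
    b1 = - (((1 + p * p) * a2 + q * p * b2) / W) /\ b2 = (q * p * b1 + (1 + p * p) * a1) / W).
Proof.
intros c1 c2 E F P J W. set (e := a1 * a1 + b1 * b1 + c1 * c1) in *.
assert (Wp : 0 < 1 + p * p + q * q) by (generalize (sq_ge0 p) (sq_ge0 q); lra).
assert (W0 := sqrt_lt_R0 _ Wp). fold W in W0. assert (WW := sqrt_sqrt _ (Rlt_le _ _ Wp)). fold W in WW.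
assert (K : J * J * (W * W) = e * e).
{ rewrite WW. transitivity (e * (a2 * a2 + b2 * b2 + c2 * c2) - (a1 * a2 + b1 * b2 + c1 * c2) * (a1 * a2 + b1 * b2 + c1 * c2)); [unfold J, e, c1, c2; ring | rewrite <- E, F; ring]. }
split. { intros Z. rewrite Z in K. assert (0 < e * e) by (apply Rmult_lt_0_compat; auto). lra. }
intros Jp. assert (eJ : e = J * W).
{ assert (Q : (e - J * W) * (e + J * W) = 0) by lra. assert (0 < J * W) by (apply Rmult_lt_0_compat; auto). apply Rmult_integral in Q. destruct Q; lra. }
assert (D : forall x y, e * x = J * y -> x = y / W).
{ intros x y H. rewrite eJ in H. apply (Rmult_eq_reg_l (J * W)); [|apply Rgt_not_eq, Rmult_lt_0_compat; auto]. rewrite H. field. lra. }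
assert (X1 : e * a1 = J * ((1 + q * q) * b2 + p * q * a2)).
{ rewrite E. transitivity (a1 * (a2 * a2 + b2 * b2 + c2 * c2) - a2 * (a1 * a2 + b1 * b2 + c1 * c2)); [rewrite F; ring | unfold J, c1, c2; ring]. }
assert (X2 : e * - a2 = J * (p * q * a1 + (1 + q * q) * b1)).
{ transitivity (- a2 * e + a1 * (a1 * a2 + b1 * b2 + c1 * c2)); [rewrite F; ring | unfold J, e, c1, c2; ring]. }
assert (X3 : e * - b1 = J * ((1 + p * p) * a2 + q * p * b2)).
{ rewrite E. transitivity (- b1 * (a2 * a2 + b2 * b2 + c2 * c2) + b2 * (a1 * a2 + b1 * b2 + c1 * c2)); [rewrite F; ring | unfold J, c1, c2; ring]. }
assert (X4 : e * b2 = J * (q * p * b1 + (1 + p * p) * a1)).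
{ transitivity (b2 * e - b1 * (a1 * a2 + b1 * b2 + c1 * c2)); [rewrite F; ring | unfold J, e, c1, c2; ring]. }
apply D in X1. apply D in X2. apply D in X3. apply D in X4. lra.
Qed.

(** [minimal_graph] with the first derivatives exposed, since the charts refer to them. *)
Definition msurf rs Rs (w wx wy : R -> R -> R) := exists wxx wxy wyx wyy : R -> R -> R,
  C1_on (annulus rs Rs) w wx wy /\ C1_on (annulus rs Rs) wx wxx wxy /\ C1_on (annulus rs Rs) wy wyx wyy /\
  forall x y, annulus rs Rs x y -> (1 + wy x y * wy x y) * wxx x y - 2 * wx x y * wy x y * wxy x y + (1 + wx x y * wx x y) * wyy x y = 0.

Section Chart.
Variables (rs Rs : R) (w wx wy : R -> R -> R).

(** [ct] and [cs] are the partial derivatives of the height [w(h)], the third components of the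
    tangent vectors. *)
Definition ct D t s := wx (hu D t s) (hv D t s) * hut D t s + wy (hu D t s) (hv D t s) * hvt D t s.
Definition cs D t s := wx (hu D t s) (hv D t s) * hus D t s + wy (hu D t s) (hv D t s) * hvs D t s.

(** The conformal equivalence in logarithmic coordinates. Injectivity in the angle is stated through
    [cos] and [sin], since [s] runs over the whole line. *)
Record chart (D : cylmap) : Prop := {
  ch_T : 0 < hT D;
  ch_u : C1cyl 0 (hT D) (hu D) (hut D) (hus D);
  ch_v : C1cyl 0 (hT D) (hv D) (hvt D) (hvs D);
  ch_in : forall t s, 0 < t < hT D -> annulus rs Rs (hu D t s) (hv D t s);
  ch_surj : forall x y, annulus rs Rs x y -> exists t s, 0 < t < hT D /\ hu D t s = x /\ hv D t s = y;
  ch_inj : forall t s t' s', 0 < t < hT D -> 0 < t' < hT D -> hu D t s = hu D t' s' -> hv D t s = hv D t' s' -> t = t' /\ cos s = cos s' /\ sin s = sin s';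
  ch_E : forall t s, 0 < t < hT D -> hut D t s * hut D t s + hvt D t s * hvt D t s + ct D t s * ct D t s = hus D t s * hus D t s + hvs D t s * hvs D t s + cs D t s * cs D t s;
  ch_F : forall t s, 0 < t < hT D -> hut D t s * hus D t s + hvt D t s * hvs D t s + ct D t s * cs D t s = 0;
  ch_pos : forall t s, 0 < t < hT D -> 0 < hut D t s * hut D t s + hvt D t s * hvt D t s + ct D t s * ct D t s }.

Lemma chart_jac D t s : chart D -> 0 < t < hT D -> jac D t s <> 0.
Proof.
intros H Ht. apply (frame (hut D t s) (hus D t s) (hvt D t s) (hvs D t s) (wx (hu D t s) (hv D t s)) (wy (hu D t s) (hv D t s)) (ch_E _ H t s Ht) (ch_F _ H t s Ht) (ch_pos _ H t s Ht)).
Qed.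

Lemma chart_harmonic D : 0 < rs -> rs < Rs -> msurf rs Rs w wx wy -> chart D -> (forall t s, 0 < t < hT D -> 0 < jac D t s) ->
  weak_harmonic (hT D) (hut D) (hus D) /\ weak_harmonic (hT D) (hvt D) (hvs D).
Proof.
intros r0 r1 (wxx & wxy & wyx & wyy & Cw & Cx & Cy & MSE) H J.
assert (r0' : 0 <= rs) by lra. assert (r2 : 0 < Rs) by lra.
assert (HP := c1_comp2 rs Rs wx wxx wxy _ _ _ _ _ _ _ _ r0' r2 Cx (ch_u _ H) (ch_v _ H) (ch_in _ H)).
assert (HQ := c1_comp2 rs Rs wy wyx wyy _ _ _ _ _ _ _ _ r0' r2 Cy (ch_u _ H) (ch_v _ H) (ch_in _ H)).
assert (Sy : forall t s, 0 < t < hT D -> wxy (hu D t s) (hv D t s) = wyx (hu D t s) (hv D t s)).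
{ intros t s Ht. apply (mixed_partials rs Rs w wx wy wxx wxy wyx wyy); auto. now apply (ch_in _ H). }
assert (Fr : forall t s (Ht : 0 < t < hT D), let p := wx (hu D t s) (hv D t s) in let q := wy (hu D t s) (hv D t s) in
   let W := sqrt (1 + p * p + q * q) in
   hut D t s = ((1 + q * q) * hvs D t s + p * q * hus D t s) / W /\ hus D t s = - ((p * q * hut D t s + (1 + q * q) * hvt D t s) / W) /\
   hvt D t s = - (((1 + p * p) * hus D t s + q * p * hvs D t s) / W) /\ hvs D t s = (q * p * hvt D t s + (1 + p * p) * hut D t s) / W).
{ intros t s Ht. apply (frame (hut D t s) (hus D t s) (hvt D t s) (hvs D t s) (wx (hu D t s) (hv D t s)) (wy (hu D t s) (hv D t s)) (ch_E _ H t s Ht) (ch_F _ H t s Ht) (ch_pos _ H t s Ht)).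
  exact (J t s Ht). }
split.
- apply (coordinate_harmonic (hT D) _ _ _ _ _ _ _ _ _ _ _ _ (fun t s => wxx (hu D t s) (hv D t s)) (fun t s => wxy (hu D t s) (hv D t s)) (fun t s => wyy (hu D t s) (hv D t s)) 1 (ch_u _ H) (ch_v _ H) HP HQ).
  + intros t s Ht. rewrite (Sy t s Ht). auto.
  + intros t s Ht. apply MSE, (ch_in _ H); auto.
  + intros t s Ht. destruct (Fr t s Ht) as (e & _). rewrite Rmult_1_l. exact e.
  + intros t s Ht. destruct (Fr t s Ht) as (_ & e & _). rewrite Ropp_mult_distr_l_reverse, Rmult_1_l. exact e.
(* The same lemma with the two coordinates exchanged; the exchange reverses the orientation, hence
   the sign -1. *)
- apply (coordinate_harmonic (hT D) _ _ _ _ _ _ _ _ _ _ _ _ (fun t s => wyy (hu D t s) (hv D t s)) (fun t s => wxy (hu D t s) (hv D t s)) (fun t s => wxx (hu D t s) (hv D t s)) (-1) (ch_v _ H) (ch_u _ H) HQ HP).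
  + intros t s Ht. rewrite (Sy t s Ht). repeat split; ring.
  + intros t s Ht. rewrite <- (MSE _ _ (ch_in _ H t s Ht)). ring.
  + intros t s Ht. destruct (Fr t s Ht) as (_ & _ & e & _). replace (1 + wy (hu D t s) (hv D t s) * wy (hu D t s) (hv D t s) + wx (hu D t s) (hv D t s) * wx (hu D t s) (hv D t s)) with (1 + wx (hu D t s) (hv D t s) * wx (hu D t s) (hv D t s) + wy (hu D t s) (hv D t s) * wy (hu D t s) (hv D t s)) by ring. rewrite e at 1. ring.
  + intros t s Ht. destruct (Fr t s Ht) as (_ & _ & _ & e). replace (1 + wy (hu D t s) (hv D t s) * wy (hu D t s) (hv D t s) + wx (hu D t s) (hv D t s) * wx (hu D t s) (hv D t s)) with (1 + wx (hu D t s) (hv D t s) * wx (hu D t s) (hv D t s) + wy (hu D t s) (hv D t s) * wy (hu D t s) (hv D t s)) by ring. rewrite e at 1. ring.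
Qed.

Lemma strip_IVT T (f : R -> R -> R) t1 s1 t2 s2 y : (forall t s, 0 < t < T -> continuity_2d_pt f t s) -> 0 < t1 < T -> 0 < t2 < T ->
  f t1 s1 <= y <= f t2 s2 -> exists t s, Rmin t1 t2 <= t <= Rmax t1 t2 /\ f t s = y.
Proof.
intros C h1 h2 Hy. set (g := fun l => f (t1 + l * (t2 - t1)) (s1 + l * (s2 - s1))).
assert (Rg : forall l, 0 <= l <= 1 -> Rmin t1 t2 <= t1 + l * (t2 - t1) <= Rmax t1 t2).
{ intros l Hl. unfold Rmin, Rmax; destruct Rle_dec.
  - assert (0 <= l * (t2 - t1)) by (apply Rmult_le_pos; lra). assert (0 <= (1 - l) * (t2 - t1)) by (apply Rmult_le_pos; lra). lra.
  - assert (0 <= l * (t1 - t2)) by (apply Rmult_le_pos; lra). assert (0 <= (1 - l) * (t1 - t2)) by (apply Rmult_le_pos; lra). lra. }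
destruct (IVT_Icc g 0 1 y) as (l & Hl & E); [lra | | |].
- intros l Hl. assert (Ht : 0 < t1 + l * (t2 - t1) < T).
  { assert (K := Rg l Hl). assert (0 < Rmin t1 t2) by (apply Rmin_pos; lra). assert (Rmax t1 t2 < T) by (apply Rmax_lub_lt; lra). lra. }
  apply filterlim_locally. intros eps. destruct (C _ (s1 + l * (s2 - s1)) Ht eps) as [d Hd].
  assert (Ca : cont (fun l => t1 + l * (t2 - t1))) by cnt. assert (Cb : cont (fun l => s1 + l * (s2 - s1))) by cnt.
  destruct (continuous_eps _ l (Ca l) d (cond_pos d)) as (d1 & p1 & H1). destruct (continuous_eps _ l (Cb l) d (cond_pos d)) as (d2 & p2 & H2).
  assert (m1 := Rmin_l d1 d2). assert (m2 := Rmin_r d1 d2). assert (0 < Rmin d1 d2) by (apply Rmin_pos; auto).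
  apply (locally_Ioo (l - Rmin d1 d2) (l + Rmin d1 d2)); [lra|]. intros z Hz. assert (Hz' : Rabs (z - l) < Rmin d1 d2) by (apply Rabs_def1; lra).
  apply Hd; [apply H1 | apply H2]; eapply Rlt_le_trans; eauto.
- left. unfold g. rewrite !Rmult_0_l, !Rmult_1_l, !Rplus_0_r. replace (t1 + (t2 - t1)) with t2 by ring. replace (s1 + (s2 - s1)) with s2 by ring. auto.
- exists (t1 + l * (t2 - t1)), (s1 + l * (s2 - s1)). split; auto.
Qed.

Lemma jac_2d D t s : chart D -> 0 < t < hT D -> continuity_2d_pt (jac D) t s.
Proof.
intros H Ht. apply continuity_2d_pt_minus; apply continuity_2d_pt_mult; first [now apply (ch_u _ H) | now apply (ch_v _ H)].
Qed.

Lemma jac_sign D : chart D -> (forall t s, 0 < t < hT D -> 0 < jac D t s) \/ (forall t s, 0 < t < hT D -> jac D t s < 0).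
Proof.
intros H. apply NNPP; intros N. apply not_or_and in N. destruct N as [N1 N2].
apply N1. intros t s Ht. apply Rnot_le_lt; intros L1. apply N2. intros t' s' Ht'. apply Rnot_le_lt; intros L2.
destruct (strip_IVT (hT D) (jac D) t s t' s' 0) as (x & z & Hx & E); auto. intros; now apply jac_2d.
assert (0 < Rmin t t') by (apply Rmin_pos; lra). assert (Rmax t t' < hT D) by (apply Rmax_lub_lt; lra).
apply (chart_jac D x z H); auto. lra.
Qed.

Definition flip_s D := {| hT := hT D; hR := hR D;
  hu := fun t s => hu D t (- s); hut := fun t s => hut D t (- s); hus := fun t s => - hus D t (- s);
  hv := fun t s => hv D t (- s); hvt := fun t s => hvt D t (- s); hvs := fun t s => - hvs D t (- s) |}.
Definition flip_t D := {| hT := hT D; hR := hR D;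
  hu := fun t s => hu D (hT D - t) s; hut := fun t s => - hut D (hT D - t) s; hus := fun t s => hus D (hT D - t) s;
  hv := fun t s => hv D (hT D - t) s; hvt := fun t s => - hvt D (hT D - t) s; hvs := fun t s => hvs D (hT D - t) s |}.

Lemma c1_flip_s lo hi f ft fs : C1cyl lo hi f ft fs -> C1cyl lo hi (fun t s => f t (- s)) (fun t s => ft t (- s)) (fun t s => - fs t (- s)).
Proof.
intros F. assert (G := c1_reflect _ _ _ _ _ 0 F). constructor; intros.
- now apply F.
- replace (- fs t (- s)) with ((-1) * fs t (- s)) by ring. apply (is_derive_comp (f t) (fun y => - y)). now apply F. auto_derive; auto; ring.
- apply (continuity_2d_pt_ext (fun t s => ft t (0 - s))). intros; f_equal; ring. now apply G.
- apply (continuity_2d_pt_ext (fun t s => - fs t (0 - s))). intros; f_equal; f_equal; ring. now apply G.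
- intros s. assert (K := c1_per G t H s). cbv beta in K. rewrite !Rminus_0_l in K. exact K.
Qed.

Lemma c1_flip_t T f ft fs : C1cyl 0 T f ft fs -> C1cyl 0 T (fun t s => f (T - t) s) (fun t s => - ft (T - t) s) (fun t s => fs (T - t) s).
Proof.
intros F.
assert (G : forall g t s, continuity_2d_pt g (T - t) s -> continuity_2d_pt (fun t s => g (T - t) s) t s).
{ intros g t s C eps. destruct (C eps) as [d Hd]. exists d. intros u v Hu Hv. apply Hd; auto.
  replace (T - u - (T - t)) with (- (u - t)) by ring. now rewrite Rabs_Ropp. }
constructor; intros.
- replace (- ft (T - t) s) with ((-1) * ft (T - t) s) by ring. apply (is_derive_comp (fun t => f t s) (fun t => T - t)). apply F; lra. auto_derive; auto; ring.
- apply F; lra.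
- apply continuity_2d_pt_opp. apply (G ft). apply F; lra.
- apply G. apply F; lra.
- apply F; lra.
Qed.

Lemma chart_flip_s D : chart D -> chart (flip_s D).
Proof.
intros H. constructor; simpl.
- apply H.
- apply c1_flip_s, H.
- apply c1_flip_s, H.
- intros; now apply (ch_in _ H).
- intros x y A. destruct (ch_surj _ H x y A) as (t & s & Ht & e1 & e2). exists t, (- s). rewrite Ropp_involutive. auto.
- intros t s t' s' Ht Ht' e1 e2. destruct (ch_inj _ H t (-s) t' (-s') Ht Ht' e1 e2) as (k1 & k2 & k3). rewrite !cos_neg in k2. rewrite !sin_neg in k3. repeat split; lra.
- intros t s Ht. assert (K := ch_E _ H t (- s) Ht). unfold ct, cs in *. simpl. lra.
- intros t s Ht. assert (K := ch_F _ H t (- s) Ht). unfold ct, cs in *. simpl. lra.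
- intros t s Ht. assert (K := ch_pos _ H t (- s) Ht). unfold ct, cs in *. simpl. lra.
Qed.

Lemma chart_flip_t D : chart D -> chart (flip_t D).
Proof.
intros H. constructor; simpl.
- apply H.
- apply c1_flip_t, H.
- apply c1_flip_t, H.
- intros; apply (ch_in _ H); lra.
- intros x y A. destruct (ch_surj _ H x y A) as (t & s & Ht & e1 & e2). exists (hT D - t), s. replace (hT D - (hT D - t)) with t by ring. split; auto; lra.
- intros t s t' s' Ht Ht' e1 e2. destruct (ch_inj _ H (hT D - t) s (hT D - t') s' ltac:(lra) ltac:(lra) e1 e2) as (k1 & k2 & k3). repeat split; lra.
- intros t s Ht. assert (K := ch_E _ H (hT D - t) s ltac:(lra)). unfold ct, cs in *. simpl. lra.
- intros t s Ht. assert (K := ch_F _ H (hT D - t) s ltac:(lra)). unfold ct, cs in *. simpl. lra.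
- intros t s Ht. assert (K := ch_pos _ H (hT D - t) s ltac:(lra)). unfold ct, cs in *. simpl. lra.
Qed.
End Chart.
Arguments ch_T {rs Rs wx wy D} _.
Arguments ch_u {rs Rs wx wy D} _.
Arguments ch_v {rs Rs wx wy D} _.
Arguments ch_in {rs Rs wx wy D} _.
Arguments ch_surj {rs Rs wx wy D} _.
Arguments ch_inj {rs Rs wx wy D} _.
Arguments ch_E {rs Rs wx wy D} _.
Arguments ch_F {rs Rs wx wy D} _.
Arguments ch_pos {rs Rs wx wy D} _.

(** * Boundary behaviour *)

Lemma is_derive_min (f : R -> R) a b c l : is_derive f c l -> a < c < b -> (forall x, a < x < b -> f c <= f x) -> l = 0.
Proof.
intros D Hc M. apply is_derive_Reals in D.
assert (pr : derivable_pt f c) by (exists l; exact D).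
rewrite <- (derive_pt_eq_0 f c l pr D). apply (deriv_minimum f a b c pr); auto; lra.
Qed.

Section Ends.
Variables (rs Rs : R) (wx wy : R -> R -> R).
Hypothesis rs0 : 0 < rs.
Hypothesis rs1 : rs < Rs.
Variable D : cylmap.
Hypothesis H : chart rs Rs wx wy D.

Lemma dist_2d x y t s : 0 < t < hT D -> continuity_2d_pt (fun t s => (hu D t s - x) * (hu D t s - x) + (hv D t s - y) * (hv D t s - y)) t s.
Proof.
intros Ht. assert (Cu := c1_cf (s := s) (ch_u H) Ht). assert (Cv := c1_cf (s := s) (ch_v H) Ht).
apply continuity_2d_pt_plus; apply continuity_2d_pt_mult; apply continuity_2d_pt_minus; auto; apply continuity_2d_pt_const.
Qed.

(* The squared distance to a point near [h(t0, s0)] attains its minimum over a box inside the box;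
   there its gradient vanishes, and the Jacobian is not zero. *)
Lemma local_surjectivity t0 s0 : 0 < t0 < hT D -> exists be m, 0 < be /\ 0 < m /\ 0 < t0 - be /\ t0 + be < hT D /\
  forall x y, Rabs (x - hu D t0 s0) < m -> Rabs (y - hv D t0 s0) < m ->
    exists t s, t0 - be <= t <= t0 + be /\ hu D t s = x /\ hv D t s = y.
Proof.
intros Ht0. set (be := Rmin (Rmin t0 (hT D - t0)) 1 / 2).
assert (Hbe : 0 < be <= 1 / 2 /\ be < t0 /\ be < hT D - t0).
{ assert (a1 := Rmin_l (Rmin t0 (hT D - t0)) 1). assert (a2 := Rmin_r (Rmin t0 (hT D - t0)) 1). assert (a3 := Rmin_l t0 (hT D - t0)). assert (a4 := Rmin_r t0 (hT D - t0)).
  assert (0 < Rmin (Rmin t0 (hT D - t0)) 1) by (repeat apply Rmin_pos; lra). unfold be; lra. }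
set (a0 := hu D t0 s0). set (b0 := hv D t0 s0).
set (F := fun x y t s => (hu D t s - x) * (hu D t s - x) + (hv D t s - y) * (hv D t s - y)).
assert (CF : forall x y t s, t0 - be <= t <= t0 + be -> continuity_2d_pt (F x y) t s) by (intros x y t s Ht; apply dist_2d; lra).
assert (F0 : forall x y t s, 0 <= F x y t s) by (intros; unfold F; generalize (sq_ge0 (hu D t s - x)) (sq_ge0 (hv D t s - y)); lra).
(* By injectivity the value at the centre is not taken on the boundary of the box. For the sides
   [s = s0 - be] and [s = s0 + be] this uses [cos be < 1], ensured by [be <= 1/2]. *)
assert (Edge : forall t s, t0 - be <= t <= t0 + be -> (t <> t0 \/ (s = s0 - be \/ s = s0 + be)) -> 0 < F a0 b0 t s).
{ intros t s Ht Hs. apply Rnot_le_lt; intros L. assert (P := F0 a0 b0 t s). unfold F in *. assert (q1 := sq_ge0 (hu D t s - a0)). assert (q2 := sq_ge0 (hv D t s - b0)).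
  assert (e1 : hu D t s - a0 = 0) by (apply sq_eq0; lra). assert (e2 : hv D t s - b0 = 0) by (apply sq_eq0; lra).
  destruct (ch_inj H t s t0 s0 ltac:(lra) Ht0) as (k1 & k2 & k3); [unfold a0 in e1; lra | unfold b0 in e2; lra|].
  destruct Hs as [Hs|Hs]; [lra|].
  assert (C1 : cos (s - s0) = 1). { rewrite cos_minus, k2, k3. assert (K := sin2_cos2 s0). unfold Rsqr in K. lra. }
  assert (PI1 := PI2_1). unfold PI2 in PI1.
  assert (cos be < 1) by (rewrite <- cos_0; apply cos_decreasing_1; lra).
  destruct Hs; subst s; [replace (s0 - be - s0) with (- be) in C1 by ring; rewrite cos_neg in C1 | replace (s0 + be - s0) with be in C1 by ring]; lra. }
destruct (evt2 (F a0 b0) (t0 - be) (t0 - be) (s0 - be) (s0 + be)) as (x1 & y1 & X1 & Y1 & M1); [lra | lra | intros; apply CF; lra |].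
destruct (evt2 (F a0 b0) (t0 + be) (t0 + be) (s0 - be) (s0 + be)) as (x2 & y2 & X2 & Y2 & M2); [lra | lra | intros; apply CF; lra |].
destruct (evt2 (F a0 b0) (t0 - be) (t0 + be) (s0 - be) (s0 - be)) as (x3 & y3 & X3 & Y3 & M3); [lra | lra | intros; apply CF; lra |].
destruct (evt2 (F a0 b0) (t0 - be) (t0 + be) (s0 + be) (s0 + be)) as (x4 & y4 & X4 & Y4 & M4); [lra | lra | intros; apply CF; lra |].
assert (P1 := Edge x1 y1 ltac:(lra) ltac:(left; lra)). assert (P2 := Edge x2 y2 ltac:(lra) ltac:(left; lra)).
assert (P3 := Edge x3 y3 ltac:(lra) ltac:(right; left; lra)). assert (P4 := Edge x4 y4 ltac:(lra) ltac:(right; right; lra)).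
set (mu := Rmin (Rmin (F a0 b0 x1 y1) (F a0 b0 x2 y2)) (Rmin (F a0 b0 x3 y3) (F a0 b0 x4 y4))).
assert (mup : 0 < mu) by (repeat apply Rmin_pos; auto).
assert (mul : mu <= F a0 b0 x1 y1 /\ mu <= F a0 b0 x2 y2 /\ mu <= F a0 b0 x3 y3 /\ mu <= F a0 b0 x4 y4).
{ unfold mu. repeat split; [eapply Rle_trans; [apply Rmin_l | apply Rmin_l] | eapply Rle_trans; [apply Rmin_l | apply Rmin_r] | eapply Rle_trans; [apply Rmin_r | apply Rmin_l] | eapply Rle_trans; [apply Rmin_r | apply Rmin_r]]. }
destruct mul as (l1 & l2 & l3 & l4).
(* A target within [m] of the centre value in each coordinate is then closer to that value than to
   the image of the boundary, so the minimum lies inside the box. *)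
set (m := Rmin 1 (mu / 16)). assert (Hm : 0 < m <= 1 /\ m <= mu / 16).
{ assert (a1 := Rmin_l 1 (mu/16)). assert (a2 := Rmin_r 1 (mu/16)). unfold m. split; [split|]; auto. apply Rmin_pos; lra. }
exists be, m. split; [lra|]. split; [lra|]. split; [lra|]. split; [lra|]. intros x y Hx Hy.
assert (mm : m * m <= mu / 16) by (assert (m * m <= m * 1) by (apply Rmult_le_compat_l; lra); lra).
assert (Sq : forall z, Rabs z < m -> z * z <= m * m).
{ intros z Hz. apply Rabs_lt_between in Hz. assert (0 <= (m - z) * (m + z)) by (apply Rmult_le_pos; lra). lra. }
apply Sq in Hx. apply Sq in Hy.
assert (G0 : F x y t0 s0 <= 2 * (m * m)).
{ unfold F. fold a0 b0. replace ((a0 - x) * (a0 - x)) with ((x - a0) * (x - a0)) by ring. replace ((b0 - y) * (b0 - y)) with ((y - b0) * (y - b0)) by ring. lra. }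
assert (GE : forall t s, mu <= F a0 b0 t s -> 2 * (m * m) < F x y t s).
{ intros t s Hmu. unfold F in *.
  assert (t1 := sq_ge0 (hu D t s - x - (x - a0))). assert (t2 := sq_ge0 (hv D t s - y - (y - b0))). lra. }
destruct (evt2 (F x y) (t0 - be) (t0 + be) (s0 - be) (s0 + be)) as (t & s & Ht & Hs & M); [lra | lra | intros; apply CF; lra |].
assert (G1 : F x y t s <= 2 * (m * m)) by (eapply Rle_trans; [apply (M t0 s0); lra | exact G0]).
assert (It : t0 - be < t < t0 + be).
{ split; apply Rnot_le_lt; intros L.
  - assert (t = t0 - be) by lra. assert (K := GE t s). assert (mu <= F a0 b0 t s) by (eapply Rle_trans; [exact l1 | apply (M1 t s); lra]). lra.
  - assert (t = t0 + be) by lra. assert (K := GE t s). assert (mu <= F a0 b0 t s) by (eapply Rle_trans; [exact l2 | apply (M2 t s); lra]). lra. }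
assert (Is : s0 - be < s < s0 + be).
{ split; apply Rnot_le_lt; intros L.
  - assert (s = s0 - be) by lra. assert (K := GE t s). assert (mu <= F a0 b0 t s) by (eapply Rle_trans; [exact l3 | apply (M3 t s); lra]). lra.
  - assert (s = s0 + be) by lra. assert (K := GE t s). assert (mu <= F a0 b0 t s) by (eapply Rle_trans; [exact l4 | apply (M4 t s); lra]). lra. }
exists t, s. split; [lra|]. assert (HtT : 0 < t < hT D) by lra.
assert (Dt : is_derive (fun t => F x y t s) t (2 * ((hu D t s - x) * hut D t s + (hv D t s - y) * hvt D t s))).
{ assert (du := c1_dt (ch_u H) t s HtT). assert (dv := c1_dt (ch_v H) t s HtT).
  assert (du' : is_derive (fun t => hu D t s - x) t (hut D t s)) by (rewrite <- (Rminus_0_r (hut D t s)); apply (is_derive_minus (fun t => hu D t s) (fun _ => x)); [auto | apply (is_derive_const x)]).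
  assert (dv' : is_derive (fun t => hv D t s - y) t (hvt D t s)) by (rewrite <- (Rminus_0_r (hvt D t s)); apply (is_derive_minus (fun t => hv D t s) (fun _ => y)); [auto | apply (is_derive_const y)]).
  replace (2 * ((hu D t s - x) * hut D t s + (hv D t s - y) * hvt D t s)) with ((hut D t s * (hu D t s - x) + (hu D t s - x) * hut D t s) + (hvt D t s * (hv D t s - y) + (hv D t s - y) * hvt D t s)) by ring.
  apply (is_derive_plus (fun t => (hu D t s - x) * (hu D t s - x)) (fun t => (hv D t s - y) * (hv D t s - y))).
  apply (is_derive_mult_R (fun t => hu D t s - x) (fun t => hu D t s - x)); auto.
  apply (is_derive_mult_R (fun t => hv D t s - y) (fun t => hv D t s - y)); auto. }
assert (Ds : is_derive (fun s => F x y t s) s (2 * ((hu D t s - x) * hus D t s + (hv D t s - y) * hvs D t s))).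
{ assert (du := c1_ds (ch_u H) t s HtT). assert (dv := c1_ds (ch_v H) t s HtT).
  assert (du' : is_derive (fun s => hu D t s - x) s (hus D t s)) by (rewrite <- (Rminus_0_r (hus D t s)); apply (is_derive_minus (fun s => hu D t s) (fun _ => x)); [auto | apply (is_derive_const x)]).
  assert (dv' : is_derive (fun s => hv D t s - y) s (hvs D t s)) by (rewrite <- (Rminus_0_r (hvs D t s)); apply (is_derive_minus (fun s => hv D t s) (fun _ => y)); [auto | apply (is_derive_const y)]).
  replace (2 * ((hu D t s - x) * hus D t s + (hv D t s - y) * hvs D t s)) with ((hus D t s * (hu D t s - x) + (hu D t s - x) * hus D t s) + (hvs D t s * (hv D t s - y) + (hv D t s - y) * hvs D t s)) by ring.
  apply (is_derive_plus (fun s => (hu D t s - x) * (hu D t s - x)) (fun s => (hv D t s - y) * (hv D t s - y))).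
  apply (is_derive_mult_R (fun s => hu D t s - x) (fun s => hu D t s - x)); auto.
  apply (is_derive_mult_R (fun s => hv D t s - y) (fun s => hv D t s - y)); auto. }
assert (Z1 := is_derive_min _ (t0 - be) (t0 + be) t _ Dt It ltac:(intros; apply M; lra)).
assert (Z2 := is_derive_min _ (s0 - be) (s0 + be) s _ Ds Is ltac:(intros; apply M; lra)).
assert (J := chart_jac _ _ _ _ D t s H HtT). unfold jac in J.
split.
- assert ((hu D t s - x) * (hut D t s * hvs D t s - hus D t s * hvt D t s) = 0) by (transitivity (hvs D t s * (2 * ((hu D t s - x) * hut D t s + (hv D t s - y) * hvt D t s)) / 2 - hvt D t s * (2 * ((hu D t s - x) * hus D t s + (hv D t s - y) * hvs D t s)) / 2); [field | rewrite Z1, Z2; field]).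
  apply Rmult_integral in H0. destruct H0; [lra | contradiction].
- assert ((hv D t s - y) * (hut D t s * hvs D t s - hus D t s * hvt D t s) = 0) by (transitivity (hut D t s * (2 * ((hu D t s - x) * hus D t s + (hv D t s - y) * hvs D t s)) / 2 - hus D t s * (2 * ((hu D t s - x) * hut D t s + (hv D t s - y) * hvt D t s)) / 2); [field | rewrite Z1, Z2; field]).
  apply Rmult_integral in H0. destruct H0; [lra | contradiction].
Qed.

Lemma nsq_range t s : 0 < t < hT D -> rs * rs < nsq D t s < Rs * Rs.
Proof. intros Ht. assert (K := ch_in H t s Ht). apply annulus_sq in K; [exact K | lra | lra]. Qed.

(** Near each point of the compact annulus all values are taken inside one compact box of the
    cylinder, and by injectivity nowhere else. In polar coordinates [compact_rect] makes the
    distance to the ends uniform. *)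
Lemma proper r1 r2 : rs < r1 -> r1 <= r2 -> r2 < Rs -> exists et, 0 < et /\ forall t s, 0 < t < hT D -> r1 * r1 <= nsq D t s <= r2 * r2 -> et <= t <= hT D - et.
Proof.
intros h1 h2 h3.
destruct (compact_rect r1 r2 0 (2 * PI) (fun d x y => forall t s, 0 < t < hT D -> hu D t s = x * cos y -> hv D t s = x * sin y -> d <= t <= hT D - d)) as (d & dp & Hd).
- intros d d' x y Hdd Q t s Ht e1 e2. specialize (Q t s Ht e1 e2). lra.
- intros x y Hx Hy.
  assert (SC := sin2_cos2 y). unfold Rsqr in SC.
  assert (A : annulus rs Rs (x * cos y) (x * sin y)).
  { apply annulus_sq; try lra. replace (x * cos y * (x * cos y) + x * sin y * (x * sin y)) with (x * x * (sin y * sin y + cos y * cos y)) by ring. rewrite SC, Rmult_1_r.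
    split; apply Rmult_le_0_lt_compat; lra. }
  destruct (ch_surj H _ _ A) as (t0 & s0 & Ht0 & e1 & e2).
  destruct (local_surjectivity t0 s0 Ht0) as (be & m & bp & mp & b1 & b2 & LS). rewrite e1, e2 in LS.
  assert (C1 : continuity_2d_pt (fun x y => x * cos y) x y).
  { apply continuity_2d_pt_mult; [apply continuity_2d_pt_id1|]. apply (continuity_1d_2d_pt_comp cos (fun _ y => y)); [apply continuity_cos | apply continuity_2d_pt_id2]. }
  assert (C2 : continuity_2d_pt (fun x y => x * sin y) x y).
  { apply continuity_2d_pt_mult; [apply continuity_2d_pt_id1|]. apply (continuity_1d_2d_pt_comp sin (fun _ y => y)); [apply continuity_sin | apply continuity_2d_pt_id2]. }
  destruct (C1 (mkposreal m mp)) as [d1 H1]. destruct (C2 (mkposreal m mp)) as [d2 H2]. simpl in H1, H2.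
  set (d := Rmin (Rmin d1 d2) (Rmin (t0 - be) (hT D - t0 - be))).
  assert (dd : 0 < d /\ d <= d1 /\ d <= d2 /\ d <= t0 - be /\ d <= hT D - t0 - be).
  { assert (q1 := cond_pos d1). assert (q2 := cond_pos d2). assert (a1 := Rmin_l (Rmin d1 d2) (Rmin (t0 - be) (hT D - t0 - be))). assert (a2 := Rmin_r (Rmin d1 d2) (Rmin (t0 - be) (hT D - t0 - be))).
    assert (a3 := Rmin_l d1 d2). assert (a4 := Rmin_r d1 d2). assert (a5 := Rmin_l (t0 - be) (hT D - t0 - be)). assert (a6 := Rmin_r (t0 - be) (hT D - t0 - be)).
    split; [unfold d; repeat apply Rmin_pos; lra | unfold d; lra]. }
  exists d. split; [lra|]. intros x' y' _ _ hx hy t s Ht f1 f2.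
  destruct (LS (x' * cos y') (x' * sin y')) as (t' & s' & Ht' & g1 & g2); [apply H1; lra | apply H2; lra |].
  destruct (ch_inj H t s t' s' Ht ltac:(lra)) as (k & _); lra.
- exists d. split; auto. intros t s Ht Hn.
  set (x := sqrt (nsq D t s)). assert (N0 : 0 <= nsq D t s) by (generalize (sq_ge0 r1); lra).
  assert (xx : x * x = nsq D t s) by (apply sqrt_sqrt; auto). assert (x0 : 0 <= x) by apply sqrt_pos.
  assert (Hx : r1 <= x <= r2).
  { split; apply Rnot_lt_le; intros L.
    - assert (x * x < r1 * r1) by (apply Rmult_le_0_lt_compat; lra). lra.
    - assert (r2 * r2 < x * x) by (apply Rmult_le_0_lt_compat; lra). lra. }
  destruct (unit_angle (hu D t s / x) (hv D t s / x)) as (c & E1 & E2).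
  { unfold nsq in xx. apply (Rmult_eq_reg_r (x * x)); [|nra]. field_simplify; [|lra]. simpl; lra. }
  destruct (per_reduce c) as (y & Hy & E).
  apply (Hd x y Hx Hy t s Ht).
  + replace (cos y) with (cos c). rewrite <- E1; field; lra. apply (E cos). intros z. replace (z + 2 * PI) with (z + 2 * INR 1 * PI) by (simpl; ring). apply cos_period.
  + replace (sin y) with (sin c). rewrite <- E2; field; lra. apply (E sin). intros z. replace (z + 2 * PI) with (z + 2 * INR 1 * PI) by (simpl; ring). apply sin_period.
Qed.

Definition mid := (rs + Rs) / 2.
Definition inner_end := exists et, 0 < et /\ forall t s, 0 < t < hT D -> t < et -> nsq D t s < mid * mid.
Definition outer_end := exists et, 0 < et /\ forall t s, 0 < t < hT D -> t < et -> mid * mid < nsq D t s.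

Lemma nsq_2d t s : 0 < t < hT D -> continuity_2d_pt (nsq D) t s.
Proof.
intros Ht. assert (Cu := c1_cf (s := s) (ch_u H) Ht). assert (Cv := c1_cf (s := s) (ch_v H) Ht).
apply continuity_2d_pt_plus; apply continuity_2d_pt_mult; auto.
Qed.

(** By properness the circle of radius [mid] is not met near the end, and the part of the strip near
    the end is connected. *)
Lemma end_dichotomy : inner_end \/ outer_end.
Proof.
destruct (proper mid mid) as (et & ep & He); [unfold mid; lra.. |].
destruct (classic inner_end) as [h|h]; auto. right. exists et. split; auto. intros t s Ht Hte.
apply Rnot_le_lt; intros L. apply h. exists et. split; auto. intros t' s' Ht' Hte'.
apply Rnot_le_lt; intros L'.
destruct (strip_IVT (hT D) (nsq D) t s t' s' (mid * mid)) as (x & y & Hx & E); auto. intros; now apply nsq_2d.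
assert (0 < Rmin t t') by (apply Rmin_pos; lra). assert (Rmax t t' < hT D) by (apply Rmax_lub_lt; lra). assert (Rmax t t' < et) by (apply Rmax_lub_lt; lra).
assert (K := He x y ltac:(lra) ltac:(lra)). lra.
Qed.

Lemma inner_limit : inner_end -> forall e, 0 < e -> exists d, 0 < d /\ forall t s, 0 < t < hT D -> t < d -> nsq D t s < rs * rs + e.
Proof.
intros (et & ep & He) e Hp. set (de := Rmin ((Rs - rs) / 2) (e / (2 * rs + Rs))).
assert (p : 0 < e / (2 * rs + Rs)) by (apply Rdiv_lt_0_compat; lra).
assert (Hd : 0 < de /\ de <= (Rs - rs) / 2 /\ de <= e / (2 * rs + Rs)).
{ unfold de. split; [apply Rmin_pos; lra | split; [apply Rmin_l | apply Rmin_r]]. }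
destruct (proper (rs + de) mid) as (e2 & ep2 & He2); [lra | unfold mid; lra | unfold mid; lra |].
exists (Rmin et e2). split; [apply Rmin_pos; auto|]. intros t s Ht Hte. assert (m1 := Rmin_l et e2). assert (m2 := Rmin_r et e2).
assert (K1 := He t s Ht ltac:(lra)). assert (K : nsq D t s < (rs + de) * (rs + de)).
{ apply Rnot_le_lt; intros L. assert (K := He2 t s Ht ltac:(lra)). lra. }
assert (de * (2 * rs + de) <= e / (2 * rs + Rs) * (2 * rs + Rs)) by (apply Rmult_le_compat; lra).
replace (e / (2 * rs + Rs) * (2 * rs + Rs)) with e in H0 by (field; lra). lra.
Qed.

Lemma outer_limit : outer_end -> forall e, 0 < e -> exists d, 0 < d /\ forall t s, 0 < t < hT D -> t < d -> Rs * Rs - e < nsq D t s.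
Proof.
intros (et & ep & He) e Hp. set (de := Rmin ((Rs - rs) / 2) (e / (2 * Rs))).
assert (p : 0 < e / (2 * Rs)) by (apply Rdiv_lt_0_compat; lra).
assert (Hd : 0 < de /\ de <= (Rs - rs) / 2 /\ de <= e / (2 * Rs)).
{ unfold de. split; [apply Rmin_pos; lra | split; [apply Rmin_l | apply Rmin_r]]. }
destruct (proper mid (Rs - de)) as (e2 & ep2 & He2); [unfold mid; lra | unfold mid; lra | lra |].
exists (Rmin et e2). split; [apply Rmin_pos; auto|]. intros t s Ht Hte. assert (m1 := Rmin_l et e2). assert (m2 := Rmin_r et e2).
assert (K1 := He t s Ht ltac:(lra)). assert (K : (Rs - de) * (Rs - de) < nsq D t s).
{ apply Rnot_le_lt; intros L. assert (K := He2 t s Ht ltac:(lra)). lra. }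
assert (de * (2 * Rs) <= e / (2 * Rs) * (2 * Rs)) by (apply Rmult_le_compat; lra).
replace (e / (2 * Rs) * (2 * Rs)) with e in H0 by (field; lra). generalize (sq_ge0 de). lra.
Qed.

Lemma attained z : rs * rs < z < Rs * Rs -> exists t s, 0 < t < hT D /\ nsq D t s = z.
Proof.
intros Hz. assert (z0 : 0 <= z) by (generalize (sq_ge0 rs); lra).
destruct (ch_surj H (sqrt z) 0) as (t & s & Ht & e1 & e2).
- apply annulus_sq; try lra. rewrite sqrt_sqrt by auto. lra.
- exists t, s. split; auto. unfold nsq. rewrite e1, e2, sqrt_sqrt by auto. ring.
Qed.

Lemma nsq_per t : 0 < t < hT D -> periodic (nsq D t).
Proof. intros Ht s. unfold nsq. now rewrite (c1_per (ch_u H) t Ht s), (c1_per (ch_v H) t Ht s). Qed.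

(** Otherwise [|h|] would be at most [mid] or at most its maximum over a compact part of the
    cylinder, while all radii up to [Rs] are attained. *)
Lemma not_both_inner : inner_end -> ~ (exists et, 0 < et /\ forall t s, 0 < t < hT D -> hT D - et < t -> nsq D t s < mid * mid).
Proof.
intros (e1 & p1 & H1) (e2 & p2 & H2). assert (TP := ch_T H).
set (e := Rmin (Rmin e1 e2) (hT D) / 3). assert (He : 0 < e /\ e < e1 /\ e < e2 /\ 3 * e <= hT D).
{ assert (a1 := Rmin_l (Rmin e1 e2) (hT D)). assert (a2 := Rmin_r (Rmin e1 e2) (hT D)). assert (a3 := Rmin_l e1 e2). assert (a4 := Rmin_r e1 e2).
  assert (0 < Rmin (Rmin e1 e2) (hT D)) by (repeat apply Rmin_pos; auto). unfold e; lra. }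
destruct (strip_bounded 0 (hT D) (fun t s => - nsq D t s) e (hT D - e)) as (t0 & s0 & Ht0 & M); try lra.
{ intros; apply continuity_2d_pt_opp; now apply nsq_2d. } { intros t Ht s. now rewrite nsq_per. }
assert (K0 := nsq_range t0 s0 ltac:(lra)). assert (mm : rs * rs < mid * mid < Rs * Rs) by (unfold mid; split; apply Rmult_le_0_lt_compat; lra).
set (z := (Rmax (mid * mid) (nsq D t0 s0) + Rs * Rs) / 2). assert (a1 := Rmax_l (mid * mid) (nsq D t0 s0)). assert (a2 := Rmax_r (mid * mid) (nsq D t0 s0)).
assert (a3 : Rmax (mid * mid) (nsq D t0 s0) < Rs * Rs) by (apply Rmax_lub_lt; lra).
destruct (attained z) as (t & s & Ht & E); [unfold z; lra|].
destruct (Rlt_dec t e) as [h|h]; [assert (K := H1 t s Ht ltac:(lra)); unfold z in E; lra|].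
destruct (Rlt_dec (hT D - e) t) as [h'|h']; [assert (K := H2 t s Ht ltac:(lra)); unfold z in E; lra|].
assert (K := M t s ltac:(lra)). unfold z in E; lra.
Qed.

Lemma not_both_outer : outer_end -> ~ (exists et, 0 < et /\ forall t s, 0 < t < hT D -> hT D - et < t -> mid * mid < nsq D t s).
Proof.
intros (e1 & p1 & H1) (e2 & p2 & H2). assert (TP := ch_T H).
set (e := Rmin (Rmin e1 e2) (hT D) / 3). assert (He : 0 < e /\ e < e1 /\ e < e2 /\ 3 * e <= hT D).
{ assert (a1 := Rmin_l (Rmin e1 e2) (hT D)). assert (a2 := Rmin_r (Rmin e1 e2) (hT D)). assert (a3 := Rmin_l e1 e2). assert (a4 := Rmin_r e1 e2).
  assert (0 < Rmin (Rmin e1 e2) (hT D)) by (repeat apply Rmin_pos; auto). unfold e; lra. }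
destruct (strip_bounded 0 (hT D) (nsq D) e (hT D - e)) as (t0 & s0 & Ht0 & M); try lra.
{ intros; now apply nsq_2d. } { intros t Ht s. now rewrite nsq_per. }
assert (K0 := nsq_range t0 s0 ltac:(lra)). assert (mm : rs * rs < mid * mid < Rs * Rs) by (unfold mid; split; apply Rmult_le_0_lt_compat; lra).
set (z := (Rmin (mid * mid) (nsq D t0 s0) + rs * rs) / 2). assert (a1 := Rmin_l (mid * mid) (nsq D t0 s0)). assert (a2 := Rmin_r (mid * mid) (nsq D t0 s0)).
assert (a3 : rs * rs < Rmin (mid * mid) (nsq D t0 s0)) by (apply Rmin_glb_lt; lra).
destruct (attained z) as (t & s & Ht & E); [unfold z; lra|].
destruct (Rlt_dec t e) as [h|h]; [assert (K := H1 t s Ht ltac:(lra)); unfold z in E; lra|].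
destruct (Rlt_dec (hT D - e) t) as [h'|h']; [assert (K := H2 t s Ht ltac:(lra)); unfold z in E; lra|].
assert (K := M t s ltac:(lra)). unfold z in E; lra.
Qed.
End Ends.

(** * Reduction to the normalised situation and the existence of charts *)

Definition scale rs Rs D := {| hT := hT D; hR := Rs / rs;
  hu := fun t s => / rs * hu D t s; hut := fun t s => / rs * hut D t s; hus := fun t s => / rs * hus D t s;
  hv := fun t s => / rs * hv D t s; hvt := fun t s => / rs * hvt D t s; hvs := fun t s => / rs * hvs D t s |}.

Lemma wh_scal T k f ft fs : C1cyl 0 T f ft fs -> weak_harmonic T ft fs -> weak_harmonic T (fun t s => k * ft t s) (fun t s => k * fs t s).
Proof.
intros F W p pt ps P t Ht. assert (K := is_derive_scal _ _ k _ (W _ _ _ P t Ht)).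
assert (a1 := c1_cont_t P Ht). assert (a2 := c1_cont_s P Ht). assert (a3 := c1_cont_t F Ht). assert (a4 := c1_cont_s F Ht).
replace (mean (fun s => pt t s * (k * ft t s) + ps t s * (k * fs t s))) with (k * mean (fun s => pt t s * ft t s + ps t s * fs t s)).
2:{ rewrite <- mean_scal by cnt. apply mean_ext; intros; ring. }
eapply is_derive_ext_loc; [|exact K]. apply (locally_Ioo 0 T); auto. intros x Hx. simpl.
assert (b1 := c1_cont_f P Hx). assert (b2 := c1_cont_t F Hx).
unfold scal; simpl; unfold mult; simpl. rewrite <- mean_scal by cnt. apply mean_ext; intros; ring.
Qed.

Lemma nsq_scale rs Rs D t s : 0 < rs -> nsq (scale rs Rs D) t s = nsq D t s / (rs * rs).
Proof. intros h. unfold nsq; simpl. field. lra. Qed.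

Lemma chart_core rs Rs w wx wy D : 0 < rs -> rs < Rs -> msurf rs Rs w wx wy -> chart rs Rs wx wy D -> (forall t s, 0 < t < hT D -> 0 < jac D t s) ->
  inner_end rs Rs D -> outer_end rs Rs (flip_t D) -> core (scale rs Rs D).
Proof.
intros r0 r1 M H J In Out. destruct (chart_harmonic rs Rs w wx wy D r0 r1 M H J) as [W1 W2].
assert (r2 : 0 < rs * rs) by (apply Rmult_lt_0_compat; auto).
assert (RR : Rs / rs * (Rs / rs) = Rs * Rs / (rs * rs)) by (field; lra).
assert (HF := chart_flip_t rs Rs wx wy D H).
constructor.
- apply (ch_T H).
- simpl. apply (Rmult_lt_reg_r rs); auto. unfold Rdiv. rewrite Rmult_assoc, Rinv_l; lra.
- apply c1_scal, (ch_u H).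
- apply c1_scal, (ch_v H).
- eapply wh_scal; [apply (ch_u H) | exact W1].
- eapply wh_scal; [apply (ch_v H) | exact W2].
- intros t s Ht. unfold jac; simpl. replace (/ rs * hut D t s * (/ rs * hvs D t s) - / rs * hus D t s * (/ rs * hvt D t s)) with (/ rs * / rs * jac D t s) by (unfold jac; ring).
  assert (0 < / rs) by (apply Rinv_0_lt_compat; auto). repeat apply Rmult_lt_0_compat; auto.
- intros t s Ht. rewrite nsq_scale by auto. assert (K := nsq_range rs Rs wx wy r0 r1 D H t s Ht). change (hR (scale rs Rs D)) with (Rs / rs). rewrite RR.
  split; apply (Rmult_lt_reg_r (rs * rs)); auto; unfold Rdiv; rewrite ?Rmult_assoc, ?Rinv_l by lra; lra.
- intros e He. destruct (inner_limit rs Rs wx wy r0 r1 D H In (e * (rs * rs))) as (d & dp & Hd). apply Rmult_lt_0_compat; auto.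
  exists d. split; auto. intros t s Ht Htd. rewrite nsq_scale by auto. apply (Rmult_lt_reg_r (rs * rs)); auto. unfold Rdiv; rewrite ?Rmult_assoc, ?Rinv_l by lra.
  specialize (Hd t s Ht Htd). lra.
- intros e He. destruct (outer_limit rs Rs wx wy r0 r1 (flip_t D) HF Out (e * (rs * rs))) as (d & dp & Hd). apply Rmult_lt_0_compat; auto.
  exists d. split; auto. intros t s Ht Htd. rewrite nsq_scale by auto. change (hR (scale rs Rs D)) with (Rs / rs). rewrite RR.
  simpl in Ht, Htd. assert (K := Hd (hT D - t) s ltac:(simpl; lra) ltac:(lra)).
  assert (E : nsq (flip_t D) (hT D - t) s = nsq D t s) by (unfold nsq; simpl; replace (hT D - (hT D - t)) with t by ring; auto). rewrite E in K.
  apply (Rmult_lt_reg_r (rs * rs)); auto. unfold Rdiv. rewrite Rmult_minus_distr_r, ?Rmult_assoc, ?Rinv_l by lra. lra.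
Qed.

(** The ends are put in order first: [flip_t] also changes the sign of the Jacobian, whereas
    [flip_s] corrects that sign and leaves the ends alone. *)
Lemma normal_form rs Rs w wx wy D : 0 < rs -> rs < Rs -> msurf rs Rs w wx wy -> chart rs Rs wx wy D ->
  exists D', hT D' = hT D /\ chart rs Rs wx wy D' /\ core (scale rs Rs D').
Proof.
intros r0 r1 M H.
assert (S1 : exists D1, hT D1 = hT D /\ chart rs Rs wx wy D1 /\ inner_end rs Rs D1 /\ outer_end rs Rs (flip_t D1)).
{ assert (HF := chart_flip_t rs Rs wx wy D H).
  assert (NN : forall t s, nsq (flip_t D) t s = nsq D (hT D - t) s) by reflexivity.
  destruct (end_dichotomy rs Rs wx wy r0 r1 D H) as [I|O].
  - exists D. split; [reflexivity|]. split; [exact H|]. split; [exact I|].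
    destruct (end_dichotomy rs Rs wx wy r0 r1 (flip_t D) HF) as [I2|O2]; auto. exfalso.
    apply (not_both_inner rs Rs wx wy r0 r1 D H I). destruct I2 as (e & ep & He). exists e. split; auto. intros t s Ht Hte.
    assert (K := He (hT D - t) s ltac:(simpl; lra) ltac:(lra)). rewrite NN in K. replace (hT D - (hT D - t)) with t in K by ring. auto.
  - exists (flip_t D). split; [reflexivity|]. split; auto. split.
    + destruct (end_dichotomy rs Rs wx wy r0 r1 (flip_t D) HF) as [I2|O2]; auto. exfalso.
      apply (not_both_outer rs Rs wx wy r0 r1 D H O). destruct O2 as (e & ep & He). exists e. split; auto. intros t s Ht Hte.
      assert (K := He (hT D - t) s ltac:(simpl; lra) ltac:(lra)). rewrite NN in K. replace (hT D - (hT D - t)) with t in K by ring. auto.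
    + destruct O as (e & ep & He). exists e. split; auto. intros t s Ht Hte. simpl in Ht.
      assert (E : nsq (flip_t (flip_t D)) t s = nsq D t s) by (unfold nsq; simpl; replace (hT D - (hT D - t)) with t by ring; auto). rewrite E. auto. }
destruct S1 as (D1 & T1 & C1 & I1 & O1).
destruct (jac_sign rs Rs wx wy D1 C1) as [J|J].
- exists D1. split; auto. split; auto. apply (chart_core rs Rs w wx wy); auto.
- exists (flip_s D1). split; auto. assert (C2 := chart_flip_s rs Rs wx wy D1 C1). split; auto. apply (chart_core rs Rs w wx wy); auto.
  + intros t s Ht. assert (K := J t (- s) Ht). unfold jac in *; simpl. lra.
  + destruct I1 as (e & ep & He). exists e. split; auto. intros t s Ht Hte. apply (He t (- s)); auto.
  + destruct O1 as (e & ep & He). exists e. split; auto. intros t s Ht Hte. apply (He t (- s)); auto.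
Qed.

Lemma polar_c1 r lo hi : C1cyl lo hi (fun t s => r * exp t * cos s) (fun t s => r * exp t * cos s) (fun t s => - (r * exp t * sin s)) /\
  C1cyl lo hi (fun t s => r * exp t * sin s) (fun t s => r * exp t * sin s) (fun t s => r * exp t * cos s).
Proof.
assert (E : C1cyl lo hi (fun t _ => r * exp t) (fun t _ => r * exp t) (fun _ _ => 0)).
{ apply (c1_time lo hi (fun t => r * exp t) (fun t => r * exp t)). intros; auto_derive; auto; ring.
  intros t _. apply (ex_derive_continuous (fun t => r * exp t)). auto_derive; auto. }
assert (dc : forall s, is_derive cos s (- sin s)) by (intros; auto_derive; auto; ring).
assert (ds : forall s, is_derive sin s (cos s)) by (intros; auto_derive; auto; ring).
assert (Pc : periodic cos) by (intros y; replace (y + 2 * PI) with (y + 2 * INR 1 * PI) by (simpl; ring); apply cos_period).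
assert (Ps : periodic sin) by (intros y; replace (y + 2 * PI) with (y + 2 * INR 1 * PI) by (simpl; ring); apply sin_period).
split.
- eapply c1_ext; [| | apply (c1_mult E (c1_circle lo hi cos (fun s => - sin s) dc ltac:(cnt) Pc))]; intros; simpl; ring.
- eapply c1_ext; [| | apply (c1_mult E (c1_circle lo hi sin cos ds ltac:(cnt) Ps))]; intros; simpl; ring.
Qed.

Lemma polar_annulus r R0 t s : 0 < r -> r < R0 -> 0 < t < ln (R0 / r) -> annulus r R0 (r * exp t * cos s) (r * exp t * sin s).
Proof.
intros h1 h2 Ht. apply annulus_sq; try lra. assert (SC := sin2_cos2 s). unfold Rsqr in SC.
replace (r * exp t * cos s * (r * exp t * cos s) + r * exp t * sin s * (r * exp t * sin s)) with (r * exp t * (r * exp t) * (sin s * sin s + cos s * cos s)) by ring.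
rewrite SC, Rmult_1_r. assert (e1 : 1 < exp t) by (rewrite <- exp_0; apply exp_increasing; lra).
assert (e2 : exp t < R0 / r). { rewrite <- (exp_ln (R0 / r)). apply exp_increasing; lra. apply Rdiv_lt_0_compat; lra. }
assert (e3 : r * exp t < R0). { apply Rlt_le_trans with (r * (R0 / r)). apply Rmult_lt_compat_l; auto. right; field; lra. }
assert (r < r * exp t) by (rewrite <- (Rmult_1_r r) at 1; apply Rmult_lt_compat_l; auto).
split; apply Rmult_le_0_lt_compat; lra.
Qed.

Lemma chart_exists rs Rs w wx wy r R0 : 0 < rs -> rs < Rs -> msurf rs Rs w wx wy -> 0 < r -> r < R0 -> graph_conf_equiv_annulus rs Rs w r R0 ->
  exists D, hT D = ln (R0 / r) /\ chart rs Rs wx wy D.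
Proof.
intros r0 r1 (wxx & wxy & wyx & wyy & Cw & _) h0 h1 (u & v & In & Su & Ij & us & ut & vs & vt & hs & ht & Cu & Cv & Ch & Cf).
assert (T0 : 0 < ln (R0 / r)). { rewrite <- ln_1. apply ln_increasing; [lra|]. apply (Rmult_lt_reg_r r); auto. unfold Rdiv. rewrite Rmult_assoc, Rinv_l; lra. }
set (T := ln (R0 / r)) in *.
set (X := fun t s => r * exp t * cos s). set (Y := fun t s => r * exp t * sin s).
destruct (polar_c1 r 0 T) as [CX CY]. fold X Y in CX, CY.
assert (A : forall t s, 0 < t < T -> annulus r R0 (X t s) (Y t s)) by (intros; now apply polar_annulus).
assert (r0' : 0 <= r) by lra. assert (R0' : 0 < R0) by lra.
assert (Du := c1_comp2 r R0 u us ut _ _ _ _ _ _ _ _ r0' R0' Cu CX CY A). assert (Dv := c1_comp2 r R0 v vs vt _ _ _ _ _ _ _ _ r0' R0' Cv CX CY A).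
(* The radius [hR] is a placeholder here; it receives its value in [scale]. *)
exists {| hT := T; hR := 0; hu := fun t s => u (X t s) (Y t s); hut := fun t s => us (X t s) (Y t s) * X t s + ut (X t s) (Y t s) * Y t s;
  hus := fun t s => us (X t s) (Y t s) * - Y t s + ut (X t s) (Y t s) * X t s; hv := fun t s => v (X t s) (Y t s);
  hvt := fun t s => vs (X t s) (Y t s) * X t s + vt (X t s) (Y t s) * Y t s; hvs := fun t s => vs (X t s) (Y t s) * - Y t s + vt (X t s) (Y t s) * X t s |}.
split; [reflexivity|].
(* The given [hs] and [ht] are derivatives of the composed height; uniqueness of derivatives and the
   chain rule express them through [wx] and [wy]. *)
assert (Hs : forall x y, annulus r R0 x y -> hs x y = wx (u x y) (v x y) * us x y + wy (u x y) (v x y) * vs x y /\ ht x y = wx (u x y) (v x y) * ut x y + wy (u x y) (v x y) * vt x y).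
{ intros x y Axy. assert (Dw := C1_on_diff rs Rs w wx wy (u x y) (v x y) ltac:(lra) ltac:(lra) Cw (In x y Axy)).
  destruct (Ch x y Axy) as (d1 & d2 & _). destruct (Cu x y Axy) as (e1 & e2 & _). destruct (Cv x y Axy) as (f1 & f2 & _). split.
  - apply (uniqueness_limite _ _ _ _ d1). apply (derivable_pt_lim_comp_2d w (fun x => u x y) (fun x => v x y) x _ _ _ _ Dw e1 f1).
  - apply (uniqueness_limite _ _ _ _ d2). apply (derivable_pt_lim_comp_2d w (fun y => u x y) (fun y => v x y) y _ _ _ _ Dw e2 f2). }
assert (XY : forall t s, X t s * X t s + Y t s * Y t s = (r * exp t) * (r * exp t)).
{ intros t s. assert (SC := sin2_cos2 s). unfold Rsqr in SC. unfold X, Y. transitivity (r * exp t * (r * exp t) * (sin s * sin s + cos s * cos s)); [ring | rewrite SC; ring]. }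
assert (ep : forall t, 0 < r * exp t) by (intros; apply Rmult_lt_0_compat; auto; apply exp_pos).
constructor; unfold ct, cs; simpl.
- exact T0.
- exact Du.
- exact Dv.
- intros t s Ht. apply In, A; auto.
- intros x y Axy. destruct (Su x y Axy) as (p & q & Apq & <- & <-).
  assert (Apq' := Apq). apply annulus_sq in Apq'; try lra. destruct (cnorm_sq p q) as [cE c0].
  assert (cp : 0 < cnorm p q) by (destruct Apq; lra).
  destruct (unit_angle (p / cnorm p q) (q / cnorm p q)) as (c & E1 & E2).
  { apply (Rmult_eq_reg_r (cnorm p q * cnorm p q)); [|apply Rgt_not_eq, Rmult_lt_0_compat; auto]. transitivity (p * p + q * q); [field; lra | lra]. }
  exists (ln (cnorm p q / r)), c.
  assert (ee : r * exp (ln (cnorm p q / r)) = cnorm p q) by (rewrite exp_ln by (apply Rdiv_lt_0_compat; lra); field; lra).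
  assert (eX : X (ln (cnorm p q / r)) c = p) by (unfold X; rewrite ee, <- E1; field; lra).
  assert (eY : Y (ln (cnorm p q / r)) c = q) by (unfold Y; rewrite ee, <- E2; field; lra).
  rewrite eX, eY. split; auto. destruct Apq as [k1 k2]. split.
  + rewrite <- ln_1. apply ln_increasing; [lra|]. apply (Rmult_lt_reg_r r); auto. unfold Rdiv. rewrite Rmult_assoc, Rinv_l; lra.
  + apply ln_increasing. apply Rdiv_lt_0_compat; lra. unfold Rdiv. apply Rmult_lt_compat_r; auto. apply Rinv_0_lt_compat; auto.
- intros t s t' s' Ht Ht' e1 e2. destruct (Ij _ _ _ _ (A t s Ht) (A t' s' Ht') e1 e2) as [k1 k2].
  assert (E : r * exp t * (r * exp t) = r * exp t' * (r * exp t')) by (rewrite <- (XY t s), <- (XY t' s'), k1, k2; auto).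
  assert (p1 := ep t). assert (p2 := ep t').
  assert (E2 : r * exp t = r * exp t').
  { assert (Q : (r * exp t - r * exp t') * (r * exp t + r * exp t') = 0) by lra. apply Rmult_integral in Q. destruct Q; lra. }
  assert (E3 : t = t') by (apply exp_inv; apply (Rmult_eq_reg_l r); lra). subst t'. split; auto.
  split; apply (Rmult_eq_reg_l (r * exp t)); auto; lra.
- intros t s Ht. destruct (Cf _ _ (A t s Ht)) as (c1 & c2 & _). destruct (Hs _ _ (A t s Ht)) as [h2 h3]. rewrite h2, h3 in c1, c2.
  set (x := X t s) in *. set (y := Y t s) in *. set (p := wx _ _) in *. set (q := wy _ _) in *.
  set (a1 := us x y) in *. set (a2 := ut x y) in *. set (b1 := vs x y) in *. set (b2 := vt x y) in *.
  set (g1 := p * a1 + q * b1) in *. set (g2 := p * a2 + q * b2) in *.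
  replace (p * (a1 * x + a2 * y) + q * (b1 * x + b2 * y)) with (g1 * x + g2 * y) by (unfold g1, g2; ring).
  replace (p * (a1 * - y + a2 * x) + q * (b1 * - y + b2 * x)) with (- g1 * y + g2 * x) by (unfold g1, g2; ring).
  (* The exponential parametrisation is conformal: each new conformality relation is a combination
     of the old ones, with coefficients quadratic in [x] and [y]. *)
  assert (Z : (a1 * a1 + b1 * b1 + g1 * g1) * (x * x - y * y) - (a2 * a2 + b2 * b2 + g2 * g2) * (x * x - y * y) + 4 * x * y * (a1 * a2 + b1 * b2 + g1 * g2) = 0) by (rewrite c1, c2; ring). lra.
- intros t s Ht. destruct (Cf _ _ (A t s Ht)) as (c1 & c2 & _). destruct (Hs _ _ (A t s Ht)) as [h2 h3]. rewrite h2, h3 in c1, c2.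
  set (x := X t s) in *. set (y := Y t s) in *. set (p := wx _ _) in *. set (q := wy _ _) in *.
  set (a1 := us x y) in *. set (a2 := ut x y) in *. set (b1 := vs x y) in *. set (b2 := vt x y) in *.
  set (g1 := p * a1 + q * b1) in *. set (g2 := p * a2 + q * b2) in *.
  replace (p * (a1 * x + a2 * y) + q * (b1 * x + b2 * y)) with (g1 * x + g2 * y) by (unfold g1, g2; ring).
  replace (p * (a1 * - y + a2 * x) + q * (b1 * - y + b2 * x)) with (- g1 * y + g2 * x) by (unfold g1, g2; ring).
  assert (Z : ((a1 * a1 + b1 * b1 + g1 * g1) - (a2 * a2 + b2 * b2 + g2 * g2)) * (x * y) + (y * y - x * x) * (a1 * a2 + b1 * b2 + g1 * g2) = 0) by (rewrite c1, c2; ring). lra.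
- intros t s Ht. destruct (Cf _ _ (A t s Ht)) as (c1 & c2 & c3). destruct (Hs _ _ (A t s Ht)) as [h2 h3]. rewrite h2, h3 in c1, c2. rewrite h2 in c3.
  assert (xy := XY t s). assert (pp : 0 < r * exp t * (r * exp t)) by (apply Rmult_lt_0_compat; auto).
  set (x := X t s) in *. set (y := Y t s) in *. set (p := wx _ _) in *. set (q := wy _ _) in *.
  set (a1 := us x y) in *. set (a2 := ut x y) in *. set (b1 := vs x y) in *. set (b2 := vt x y) in *.
  set (g1 := p * a1 + q * b1) in *. set (g2 := p * a2 + q * b2) in *.
  replace (p * (a1 * x + a2 * y) + q * (b1 * x + b2 * y)) with (g1 * x + g2 * y) by (unfold g1, g2; ring).
  replace ((a1 * x + a2 * y) * (a1 * x + a2 * y) + (b1 * x + b2 * y) * (b1 * x + b2 * y) + (g1 * x + g2 * y) * (g1 * x + g2 * y))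
    with ((a1 * a1 + b1 * b1 + g1 * g1) * (x * x) + (a2 * a2 + b2 * b2 + g2 * g2) * (y * y) + 2 * x * y * (a1 * a2 + b1 * b2 + g1 * g2)) by ring.
  rewrite <- c1, c2. assert (0 < (a1 * a1 + b1 * b1 + g1 * g1) * (x * x + y * y)) by (apply Rmult_lt_0_compat; lra). lra.
Qed.

Lemma cosh_exp x : 0 <= x -> exp x = cosh x + sqrt (cosh x * cosh x - 1).
Proof.
intros Hx. assert (K := cosh2_sinh2 x). replace (cosh x * cosh x - 1) with (sinh x * sinh x) by lra.
assert (S := sinh_ge0 x Hx). rewrite sqrt_square by auto. unfold cosh, sinh. field.
Qed.

(** [ln (q + sqrt (q^2 - 1))] is the inverse of [cosh] on the positive axis, and [cosh] is
    increasing there. *)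
Lemma modulus_bound T q : 0 < T -> 1 < q -> (T <= ln (q + sqrt (q * q - 1)) <-> cosh T <= q) /\ (T = ln (q + sqrt (q * q - 1)) <-> cosh T = q).
Proof.
intros HT Hq. assert (q2 : 0 < q * q - 1) by nra. assert (sp := sqrt_lt_R0 _ q2). assert (ss := sqrt_sqrt _ (Rlt_le _ _ q2)). set (z := sqrt (q * q - 1)) in *.
assert (E : exp T = cosh T + sqrt (cosh T * cosh T - 1)) by (apply cosh_exp; lra). assert (c1 := cosh_ge1 T).
set (L := ln (q + z)). assert (eL : exp L = q + z) by (apply exp_ln; lra).
assert (cL : cosh L = q).
{ assert (exp (- L) = q - z). { rewrite exp_Ropp, eL. apply (Rmult_eq_reg_r (q + z)); [|lra]. rewrite Rinv_l by lra. lra. }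
  unfold cosh. rewrite eL, H. field. }
assert (L0 : 0 < L) by (unfold L; rewrite <- ln_1; apply ln_increasing; lra).
assert (Mono : forall x y, 0 < x -> x < y -> cosh x < cosh y).
{ intros x y hx hy. destruct (MVT_gen cosh x y sinh) as (c & Hc & Eq).
  - intros w _; apply is_derive_cosh.
  - intros w _. apply continuity_pt_filterlim. apply (cont_cosh w).
  - rewrite Rmin_left, Rmax_right in Hc by lra. assert (0 < sinh c * (y - x)) by (apply Rmult_lt_0_compat; [apply sinh_pos|]; lra). lra. }
rewrite <- cL. split; split.
- intros [h|h]; [left; apply Mono; auto | right; now rewrite h].
- intros h. apply Rnot_lt_le; intros K. assert (Q := Mono L T L0 K). lra.
- intros ->; auto.
- intros h. destruct (Rtotal_order T L) as [K|[K|K]]; auto; [assert (Q := Mono T L HT K) | assert (Q := Mono L T L0 K)]; lra.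
Qed.

(** * The equality case *)

Lemma nitsche_catenoid rs Rs w wx wy D : 0 < rs -> rs < Rs -> msurf rs Rs w wx wy -> chart rs Rs wx wy D -> nitsche (scale rs Rs D) ->
  exists c sgn, (sgn = 1 \/ sgn = -1) /\ forall x y, annulus rs Rs x y -> w x y = catenoid_height rs c sgn x y.
Proof.
intros r0 r1 (wxx & wxy & wyx & wyy & Cw & Cx & Cy & _) H (c & Nt). assert (TP := ch_T H). simpl in Nt.
assert (ir : 0 < / rs) by (apply Rinv_0_lt_compat; auto).
assert (F : forall t s, 0 < t < hT D -> hu D t s = rs * cosh t * cos (s + c) /\ hv D t s = rs * cosh t * sin (s + c)).
{ intros t s Ht. destruct (Nt t s Ht) as [e1 e2]. rewrite Rmult_assoc, <- e1, Rmult_assoc, <- e2. split; field; lra. }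
assert (Du : forall t s, 0 < t < hT D -> hut D t s = rs * sinh t * cos (s + c) /\ hvt D t s = rs * sinh t * sin (s + c) /\
   hus D t s = - (rs * cosh t * sin (s + c)) /\ hvs D t s = rs * cosh t * cos (s + c)).
{ intros t s Ht.
  assert (Gt : forall k, is_derive (fun t => rs * cosh t * k) t (rs * sinh t * k)).
  { intros k. replace (rs * sinh t * k) with (rs * k * sinh t) by ring. apply (is_derive_ext (fun t => rs * k * cosh t)). intros; simpl; ring.
    apply (is_derive_scal cosh t (rs * k)). apply is_derive_cosh. }
  split; [|split; [|split]].
  - rewrite <- (is_derive_unique _ _ _ (c1_dt (ch_u H) t s Ht)). apply is_derive_unique.
    apply (is_derive_ext_loc (fun t => rs * cosh t * cos (s + c))); [|apply Gt]. apply (locally_Ioo 0 (hT D)); auto. intros x Hx. symmetry; now apply F.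
  - rewrite <- (is_derive_unique _ _ _ (c1_dt (ch_v H) t s Ht)). apply is_derive_unique.
    apply (is_derive_ext_loc (fun t => rs * cosh t * sin (s + c))); [|apply Gt]. apply (locally_Ioo 0 (hT D)); auto. intros x Hx. symmetry; now apply F.
  - rewrite <- (is_derive_unique _ _ _ (c1_ds (ch_u H) t s Ht)). apply is_derive_unique.
    apply (is_derive_ext (fun s => rs * cosh t * cos (s + c))). intros x. symmetry; now apply F. generalize (cosh t); intros k. auto_derive; auto; ring.
  - rewrite <- (is_derive_unique _ _ _ (c1_ds (ch_v H) t s Ht)). apply is_derive_unique.
    apply (is_derive_ext (fun s => rs * cosh t * sin (s + c))). intros x. symmetry; now apply F. generalize (cosh t); intros k. auto_derive; auto; ring. }
assert (CC : forall t s, 0 < t < hT D -> ct wx wy D t s * ct wx wy D t s = rs * rs /\ cs wx wy D t s = 0).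
{ intros t s Ht. assert (E := ch_E H t s Ht). assert (G := ch_F H t s Ht). destruct (Du t s Ht) as (e1 & e2 & e3 & e4). rewrite e1, e2, e3, e4 in E, G.
  assert (SC := sin2_cos2 (s + c)). unfold Rsqr in SC. assert (K := cosh2_sinh2 t).
  set (a := ct wx wy D t s) in *. set (b := cs wx wy D t s) in *. set (cx := cos (s + c)) in *. set (sx := sin (s + c)) in *.
  assert (E' : a * a = rs * rs + b * b).
  { transitivity (rs * cosh t * (rs * cosh t) * (sx * sx + cx * cx) + b * b - rs * sinh t * (rs * sinh t) * (sx * sx + cx * cx)); [lra|]. rewrite SC. replace (cosh t) with (cosh t) by auto.
    transitivity (rs * rs * (cosh t * cosh t - sinh t * sinh t) + b * b); [ring | rewrite K; ring]. }
  assert (AB : a * b = 0) by lra. assert (r2 : 0 < rs * rs) by (apply Rmult_lt_0_compat; auto).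
  apply Rmult_integral in AB. destruct AB as [Z|Z]; rewrite Z in E' |- *; [generalize (sq_ge0 b); lra | lra]. }
assert (Fw := c1_comp2 rs Rs w wx wy _ _ _ _ _ _ _ _ (Rlt_le _ _ r0) ltac:(lra) Cw (ch_u H) (ch_v H) (ch_in H)).
change (C1cyl 0 (hT D) (fun t s => w (hu D t s) (hv D t s)) (ct wx wy D) (cs wx wy D)) in Fw.
set (t0 := hT D / 2). assert (Ht0 : 0 < t0 < hT D) by (unfold t0; lra).
(* The derivative of the height is [rs] or [- rs] and never vanishes, so its sign cannot change; one
   sample fixes it. *)
set (sgn := if Rlt_dec 0 (ct wx wy D t0 0) then 1 else -1).
assert (Sg : sgn = 1 \/ sgn = -1) by (unfold sgn; destruct Rlt_dec; auto).
assert (V : forall t, 0 < t < hT D -> ct wx wy D t 0 = rs \/ ct wx wy D t 0 = - rs).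
{ intros t Ht. destruct (CC t 0 Ht) as [E _]. assert (Q : (ct wx wy D t 0 - rs) * (ct wx wy D t 0 + rs) = 0) by lra. apply Rmult_integral in Q. destruct Q; [left | right]; lra. }
assert (NZ : forall t s, 0 < t < hT D -> ct wx wy D t s <> 0).
{ intros t s Ht Z. destruct (CC t s Ht) as [E _]. rewrite Z in E. assert (0 < rs * rs) by (apply Rmult_lt_0_compat; auto). lra. }
assert (Cst : forall t, 0 < t < hT D -> ct wx wy D t 0 = sgn * rs).
{ assert (IV : forall a b, 0 < a < hT D -> 0 < b < hT D -> ct wx wy D a 0 <= 0 <= ct wx wy D b 0 -> False).
  { intros a b ha hb hab. destruct (strip_IVT (hT D) (ct wx wy D) a 0 b 0 0) as (x & y & Hx & E); auto. intros; now apply Fw.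
    assert (0 < Rmin a b) by (apply Rmin_pos; lra). assert (Rmax a b < hT D) by (apply Rmax_lub_lt; lra). apply (NZ x y); auto; lra. }
  intros t Ht. unfold sgn. destruct (V t Ht) as [e|e]; destruct (V t0 Ht0) as [e0|e0]; destruct Rlt_dec; try lra.
  - exfalso. apply (IV t0 t); lra.
  - exfalso. apply (IV t t0); lra. }
exists (w (hu D t0 0) (hv D t0 0) - sgn * rs * t0), sgn. split; auto.
intros x y A. destruct (ch_surj H x y A) as (t & s & Ht & <- & <-).
assert (E1 : w (hu D t s) (hv D t s) = w (hu D t 0) (hv D t 0)).
{ apply (const_R (fun s => w (hu D t s) (hv D t s))). intros z. destruct (CC t z Ht) as [_ K]. rewrite <- K. now apply Fw. }
assert (E2 : w (hu D t 0) (hv D t 0) - sgn * rs * t = w (hu D t0 0) (hv D t0 0) - sgn * rs * t0).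
{ apply (const_on 0 (hT D) (fun t => w (hu D t 0) (hv D t 0) - sgn * rs * t)); auto. intros z Hz.
  assert (e0 : ct wx wy D z 0 - sgn * rs * 1 = 0) by (rewrite Cst by auto; ring).
  enough (Q : is_derive (fun t => w (hu D t 0) (hv D t 0) - sgn * rs * t) z (ct wx wy D z 0 - sgn * rs * 1)) by (rewrite e0 in Q; exact Q).
  apply (is_derive_minus (fun t => w (hu D t 0) (hv D t 0)) (fun t => sgn * rs * t)). apply (c1_dt Fw z 0 Hz). auto_derive; auto; ring. }
rewrite E1. unfold catenoid_height.
assert (nn : cnorm (hu D t s) (hv D t s) = rs * cosh t).
{ unfold cnorm. destruct (F t s Ht) as [-> ->]. assert (SC := sin2_cos2 (s + c)). unfold Rsqr in SC.
  replace (rs * cosh t * cos (s + c) * (rs * cosh t * cos (s + c)) + rs * cosh t * sin (s + c) * (rs * cosh t * sin (s + c))) with (rs * cosh t * (rs * cosh t) * (sin (s + c) * sin (s + c) + cos (s + c) * cos (s + c))) by ring.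
  rewrite SC, Rmult_1_r. apply sqrt_square. apply Rmult_le_pos; [lra | apply Rlt_le, cosh_pos]. }
rewrite nn. replace (rs * cosh t * (rs * cosh t) - rs * rs) with (rs * rs * (cosh t * cosh t - 1)) by ring.
assert (c1 := cosh_ge1 t). rewrite sqrt_mult, (sqrt_square rs) by (try nra; lra).
replace ((rs * cosh t + rs * sqrt (cosh t * cosh t - 1)) / rs) with (cosh t + sqrt (cosh t * cosh t - 1)) by (field; lra).
rewrite <- cosh_exp, ln_exp by lra. lra.
Qed.

(** [arcosh (sqrt x)]: the height of the catenoid with neck radius 1 above the points with
    [|xi|^2 = x]. *)
Definition ta x := ln (sqrt x + sqrt (x - 1)).
Definition dta x := / (2 * sqrt x * sqrt (x - 1)).

Lemma ta_derive x : 1 < x -> is_derive ta x (dta x).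
Proof.
intros Hx. assert (s1 : 0 < sqrt x) by (apply sqrt_lt_R0; lra). assert (s2 : 0 < sqrt (x - 1)) by (apply sqrt_lt_R0; lra).
unfold ta, dta. auto_derive. { repeat split; try lra. replace (x + - (1)) with (x - 1) by ring. lra. }
replace (x + - (1)) with (x - 1) by ring. field. lra.
Qed.

(** Unlike differentiability, continuity includes [x = 1], the inner boundary, where the limits of
    [ta] are taken. *)
Lemma ta_cont x : 0 < x -> continuous ta x.
Proof.
intros Hx. assert (C : cont (fun x => sqrt x + sqrt (x - 1))) by (apply cont_plus; [apply (cont_Rsqrt (fun x => x)) | apply (cont_Rsqrt (fun x => x - 1))]; cnt).
apply (continuous_comp (fun x => sqrt x + sqrt (x - 1)) ln); [apply C|].
apply (ex_derive_continuous ln). auto_derive. assert (0 < sqrt x) by (apply sqrt_lt_R0; auto). assert (K := sqrt_pos (x - 1)). lra.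
Qed.

Lemma dta_cont x : 1 < x -> continuous dta x.
Proof.
intros Hx. assert (s1 : 0 < sqrt x) by (apply sqrt_lt_R0; lra). assert (s2 : 0 < sqrt (x - 1)) by (apply sqrt_lt_R0; lra).
apply (ex_derive_continuous dta). unfold dta. auto_derive. replace (x + - (1)) with (x - 1) by ring. repeat split; try lra.
repeat apply Rmult_integral_contrapositive_currified; lra.
Qed.

Lemma cosh_ta x : 1 <= x -> cosh (ta x) = sqrt x.
Proof.
intros Hx. assert (s1 : 0 < sqrt x) by (apply sqrt_lt_R0; lra). assert (s2 := sqrt_pos (x - 1)).
assert (k1 := sqrt_sqrt x ltac:(lra)). assert (k2 := sqrt_sqrt (x - 1) ltac:(lra)).
unfold cosh, ta. rewrite exp_Ropp, exp_ln by lra.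
replace (/ (sqrt x + sqrt (x - 1))) with (sqrt x - sqrt (x - 1)). field.
apply (Rmult_eq_reg_r (sqrt x + sqrt (x - 1))); [|lra]. rewrite Rinv_l by lra. lra.
Qed.

(** Conformality and positive orientation amount to the Cauchy-Riemann equations. *)
Lemma conformal_pair x1 x2 y1 y2 : x1 * x1 + y1 * y1 = x2 * x2 + y2 * y2 -> x1 * x2 + y1 * y2 = 0 -> 0 < x1 * y2 - x2 * y1 -> x1 = y2 /\ x2 = - y1.
Proof.
intros E F P. set (S := x1 * x1 + y1 * y1) in *. set (d := x1 * y2 - x2 * y1) in *.
assert (S0 : 0 <= S) by (unfold S; generalize (sq_ge0 x1) (sq_ge0 y1); lra).
assert (K : d * d = S * S).
{ transitivity (S * (x2 * x2 + y2 * y2) - (x1 * x2 + y1 * y2) * (x1 * x2 + y1 * y2)); [unfold d, S; ring | rewrite <- E, F; ring]. }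
assert (dS : d = S). { assert (Q : (d - S) * (d + S) = 0) by lra. apply Rmult_integral in Q. destruct Q; lra. }
assert (Z : (x1 - y2) * (x1 - y2) + (x2 + y1) * (x2 + y1) = 0) by (unfold S, d in *; lra).
assert (q1 := sq_ge0 (x1 - y2)). assert (q2 := sq_ge0 (x2 + y1)).
assert (x1 - y2 = 0) by (apply sq_eq0; lra). assert (x2 + y1 = 0) by (apply sq_eq0; lra). lra.
Qed.

(* [tau = ta (nsq D)] is the catenoid height; it is conjugate to the angle of [h], hence its circle variance is
   convex, and it vanishes at both ends. *)
Lemma catenoid_rotation D : core D ->
  let tt t s := dta (nsq D t s) * (2 * (hu D t s * hut D t s + hv D t s * hvt D t s)) in
  let ts t s := dta (nsq D t s) * (2 * (hu D t s * hus D t s + hv D t s * hvs D t s)) in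
  (forall t s, 0 < t < hT D -> hut D t s * hut D t s + hvt D t s * hvt D t s + tt t s * tt t s = hus D t s * hus D t s + hvs D t s * hvs D t s + ts t s * ts t s) ->
  (forall t s, 0 < t < hT D -> hut D t s * hus D t s + hvt D t s * hvs D t s + tt t s * ts t s = 0) ->
  exists W, 1 <= W /\ (exists k : Z, W = IZR k) /\ forall t s, 0 < t < hT D -> ta (nsq D t s) = W * t /\ hus D t s = - W * hv D t s /\ hvs D t s = W * hu D t s.
Proof.
intros H tt ts E F. assert (TP := k_T _ H). assert (R1 := k_R _ H).
set (t0 := hT D / 2). assert (Ht0 : 0 < t0 < hT D) by (unfold t0; lra).
set (W := wind D t0). assert (W1 : 1 <= W) by (apply wind_ge1; auto).
assert (Wt : forall t, 0 < t < hT D -> wind D t = W) by (intros; apply wind_const; auto).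
assert (CT : C1cyl 0 (hT D) (fun t s => ta (nsq D t s)) tt ts).
{ apply (c1_comp _ _ ta dta _ _ _ (c1_nsq D H)); intros; [apply ta_derive | apply dta_cont]; now apply (k_N _ H). }
(* On the catenoid [ta] and the angle of [h] are isothermal coordinates, with metric
   [n (d ta^2 + d theta^2)]. A conformal chart therefore makes them a conjugate pair; the second
   identity is the Jacobian of that pair. *)
assert (CR : forall t s, 0 < t < hT D -> tt t s = / nsq D t s * omega D t s /\ 2 * jac D t s * dta (nsq D t s) = tt t s * tt t s + ts t s * ts t s).
{ intros t s Ht. assert (N := k_N _ H t s Ht). assert (J := k_J _ H t s Ht). specialize (E t s Ht). specialize (F t s Ht).
  set (n := nsq D t s) in *. set (q := sqrt n * sqrt (n - 1)).
  assert (s1 : 0 < sqrt n) by (apply sqrt_lt_R0; lra). assert (s2 : 0 < sqrt (n - 1)) by (apply sqrt_lt_R0; lra).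
  assert (qp : 0 < q) by (apply Rmult_lt_0_compat; auto).
  assert (qq : q * q = n * (n - 1)). { unfold q. transitivity ((sqrt n * sqrt n) * (sqrt (n - 1) * sqrt (n - 1))); [ring|]. rewrite !sqrt_sqrt by lra. auto. }
  assert (dq : dta n * 2 * q = 1) by (unfold dta, q; field; lra).
  set (x1 := tt t s) in *. set (x2 := ts t s) in *.
  assert (r1 : hu D t s * hut D t s + hv D t s * hvt D t s = x1 * q).
  { unfold x1, tt. fold n. transitivity ((dta n * 2 * q) * (hu D t s * hut D t s + hv D t s * hvt D t s)); [rewrite dq; ring | ring]. }
  assert (r2 : hu D t s * hus D t s + hv D t s * hvs D t s = x2 * q).
  { unfold x2, ts. fold n. transitivity ((dta n * 2 * q) * (hu D t s * hus D t s + hv D t s * hvs D t s)); [rewrite dq; ring | ring]. }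
  assert (nE : n = hu D t s * hu D t s + hv D t s * hv D t s) by reflexivity.
  set (u := hu D t s) in *. set (v := hv D t s) in *. set (a1 := hut D t s) in *. set (b1 := hvt D t s) in *. set (a2 := hus D t s) in *. set (b2 := hvs D t s) in *.
  set (y1 := / n * (u * b1 - v * a1)). set (y2 := / n * (u * b2 - v * a2)).
  assert (m1 : u * b1 - v * a1 = n * y1) by (unfold y1; field; lra). assert (m2 : u * b2 - v * a2 = n * y2) by (unfold y2; field; lra).
  assert (l1 : a1 * a1 + b1 * b1 = x1 * x1 * (n - 1) + n * (y1 * y1)).
  { apply (Rmult_eq_reg_l n); [|lra]. transitivity ((u * a1 + v * b1) * (u * a1 + v * b1) + (u * b1 - v * a1) * (u * b1 - v * a1)); [rewrite nE; ring|]. rewrite r1, m1.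
    transitivity (x1 * x1 * (q * q) + n * n * (y1 * y1)); [ring | rewrite qq; ring]. }
  assert (l2 : a2 * a2 + b2 * b2 = x2 * x2 * (n - 1) + n * (y2 * y2)).
  { apply (Rmult_eq_reg_l n); [|lra]. transitivity ((u * a2 + v * b2) * (u * a2 + v * b2) + (u * b2 - v * a2) * (u * b2 - v * a2)); [rewrite nE; ring|]. rewrite r2, m2.
    transitivity (x2 * x2 * (q * q) + n * n * (y2 * y2)); [ring | rewrite qq; ring]. }
  assert (l3 : a1 * a2 + b1 * b2 = x1 * x2 * (n - 1) + n * (y1 * y2)).
  { apply (Rmult_eq_reg_l n); [|lra]. transitivity ((u * a1 + v * b1) * (u * a2 + v * b2) + (u * b1 - v * a1) * (u * b2 - v * a2)); [rewrite nE; ring|]. rewrite r1, r2, m1, m2.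
    transitivity (x1 * x2 * (q * q) + n * n * (y1 * y2)); [ring | rewrite qq; ring]. }
  assert (l4 : jac D t s = q * (x1 * y2 - x2 * y1)).
  { unfold jac. fold a1 b1 a2 b2. apply (Rmult_eq_reg_l n); [|lra].
    transitivity ((u * a1 + v * b1) * (u * b2 - v * a2) - (u * a2 + v * b2) * (u * b1 - v * a1)); [rewrite nE; ring|]. rewrite r1, r2, m1, m2. ring. }
  destruct (conformal_pair x1 x2 y1 y2) as [g1 g2].
  - apply (Rmult_eq_reg_l n); [|lra]. lra.
  - apply (Rmult_eq_reg_l n); [|lra]. lra.
  - apply (Rmult_lt_reg_l q); auto. lra.
  - split; [exact g1|]. rewrite l4, <- g1. assert (y1 = - x2) by lra. rewrite H0.
    transitivity ((dta n * 2 * q) * (x1 * x1 + x2 * x2)); [ring | rewrite dq; ring]. }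
set (A := fun t => mean (fun s => ta (nsq D t s))). set (V := fun t => mean (fun s => ta (nsq D t s) * ta (nsq D t s))).
assert (DA : forall t, 0 < t < hT D -> is_derive A t W).
{ intros t Ht. rewrite <- (Wt t Ht). unfold wind. rewrite <- (mean_ext (tt t) (fun s => / nsq D t s * omega D t s)) by (intros s; apply (CR t s Ht)). apply (mean_derive t CT Ht). }
assert (DV : forall t, 0 < t < hT D -> is_derive V t (2 * mean (fun s => ta (nsq D t s) * tt t s))).
{ intros t Ht. assert (K := mean_derive t (c1_mult CT CT) Ht). simpl in K.
  assert (k1 := c1_cont_f CT Ht). assert (k2 := c1_cont_t CT Ht).
  rewrite <- mean_scal by cnt. erewrite mean_ext; [exact K|]. intros; simpl; ring. }
assert (DV2 : forall t, 0 < t < hT D -> is_derive (fun t => mean (fun s => ta (nsq D t s) * tt t s)) t (mean (fun s => tt t s * tt t s + ts t s * ts t s))).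
{ intros t Ht. assert (K := psi_form D (fun x => ta x * / x) (fun x => dta x * / x + ta x * - / (x * x)) t H Ht).
  assert (K' : is_derive (fun t => mean (fun s => ta (nsq D t s) * / nsq D t s * omega D t s)) t (mean (fun s => 2 * jac D t s * (ta (nsq D t s) * / nsq D t s + nsq D t s * (dta (nsq D t s) * / nsq D t s + ta (nsq D t s) * - / (nsq D t s * nsq D t s)))))).
  { apply K.
    - intros x Hx. apply is_derive_mult_R. now apply ta_derive. auto_derive; [lra | field; lra].
    - intros x Hx. apply (continuous_plus (fun x => dta x * / x) (fun x => ta x * - / (x * x))).
      + apply (continuous_mult dta (fun x => / x)). now apply dta_cont. apply (ex_derive_continuous (fun x => / x)). auto_derive; lra.
      + apply (continuous_mult ta (fun x => - / (x * x))). apply ta_cont; lra. apply (ex_derive_continuous (fun x => - / (x * x))). auto_derive; nra. }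
  rewrite (mean_ext (fun s => tt t s * tt t s + ts t s * ts t s) (fun s => 2 * jac D t s * (ta (nsq D t s) * / nsq D t s + nsq D t s * (dta (nsq D t s) * / nsq D t s + ta (nsq D t s) * - / (nsq D t s * nsq D t s))))).
  2:{ intros s. destruct (CR t s Ht) as [_ <-]. assert (N := k_N _ H t s Ht). field. lra. }
  eapply is_derive_ext_loc; [|exact K']. apply (locally_Ioo 0 (hT D)); auto. intros x Hx. simpl. apply mean_ext; intros s. destruct (CR x s Hx) as [-> _]. ring. }
set (g := fun t => V t - A t * A t).
assert (g0 : forall t c, 0 < t < hT D -> 0 <= g t /\ g t <= mean (fun s => (ta (nsq D t s) - c) * (ta (nsq D t s) - c)) /\ mean (fun s => (ta (nsq D t s) - A t) * (ta (nsq D t s) - A t)) = g t).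
{ intros t c Ht. assert (k1 := c1_cont_f CT Ht). cbv beta in k1.
  assert (X : forall c, mean (fun s => (ta (nsq D t s) - c) * (ta (nsq D t s) - c)) = V t - 2 * c * A t + c * c).
  { intros d. unfold V, A. rewrite <- (mean_const (d * d)), <- mean_scal, <- mean_minus, <- mean_plus by cnt. apply mean_ext; intros; ring. }
  assert (P : 0 <= mean (fun s => (ta (nsq D t s) - A t) * (ta (nsq D t s) - A t))) by (apply mean_ge0; [cnt | intros; apply sq_ge0]).
  rewrite X in P. rewrite !X. unfold g. assert (Q := sq_ge0 (c - A t)). split; [|split]; lra. }
(* [g] is the variance of [ta] over a circle. Its second derivative is
   [2 mean (tt^2 + ts^2) - 2 W^2], nonnegative by Cauchy-Schwarz because [tt] has mean [W]. At both
   ends [|h|] is uniformly close to a constant, and so is [ta]. *)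
assert (gz : forall y, 0 < y < hT D -> g y = 0).
{ intros y Hy. apply (small_zero _ 1); [lra | apply (g0 y 0 Hy) |]. intros eps He. rewrite Rmult_1_l.
  assert (Cl : forall c, 1 <= c -> exists d, 0 < d /\ forall z, 1 <= z -> Rabs (z - c) < d -> (ta z - ta c) * (ta z - ta c) <= eps).
  { intros c Hc. destruct (continuous_eps ta c (ta_cont c ltac:(lra)) eps (proj1 He)) as (d & dp & Hd).
    exists d. split; auto. intros z Hz Hz2. assert (B := Hd z Hz2).
    apply Rabs_lt_between in B. assert (0 <= (eps - (ta z - ta c)) * (eps + (ta z - ta c))) by (apply Rmult_le_pos; lra). nra. }
  destruct (Cl 1 ltac:(lra)) as (d1 & p1 & C1). destruct (Cl (hR D * hR D) ltac:(nra)) as (d2 & p2 & C2).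
  destruct (k_0 _ H d1 p1) as (e1 & q1 & K1). destruct (k_1 _ H d2 p2) as (e2 & q2 & K2).
  set (a := Rmin e1 y / 2). assert (Ha : 0 < a /\ a < e1 /\ a < y). { assert (x1 := Rmin_l e1 y). assert (x2 := Rmin_r e1 y). assert (0 < Rmin e1 y) by (apply Rmin_pos; lra). unfold a; lra. }
  set (b := hT D - Rmin e2 (hT D - y) / 2). assert (Hb : y < b /\ b < hT D /\ hT D - e2 < b). { assert (x1 := Rmin_l e2 (hT D - y)). assert (x2 := Rmin_r e2 (hT D - y)). assert (0 < Rmin e2 (hT D - y)) by (apply Rmin_pos; lra). unfold b; lra. }
  assert (End : forall t c, 0 < t < hT D -> (forall s, (ta (nsq D t s) - c) * (ta (nsq D t s) - c) <= eps) -> g t <= eps).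
  { intros t c Ht Hs. destruct (g0 t c Ht) as (_ & G & _). eapply Rle_trans; [exact G|]. rewrite <- (mean_const eps).
    assert (k1 := c1_cont_f CT Ht). cbv beta in k1. apply mean_le; [cnt | cnt | auto]. }
  apply (convex_max (hT D) g (fun t => 2 * mean (fun s => ta (nsq D t s) * tt t s) - (W * A t + A t * W)) (fun t => 2 * mean (fun s => tt t s * tt t s + ts t s * ts t s) - (W * W + W * W)) a b y eps); try lra.
  - intros t Ht. split; [|split].
    + apply (is_derive_minus V (fun t => A t * A t)). now apply DV. apply (is_derive_mult_R A A); auto.
    + apply (is_derive_minus (fun t => 2 * mean (fun s => ta (nsq D t s) * tt t s)) (fun t => W * A t + A t * W)).
      apply (is_derive_scal (fun t => mean (fun s => ta (nsq D t s) * tt t s)) t 2). now apply DV2.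
      apply (is_derive_plus (fun t => W * A t) (fun t => A t * W)). apply (is_derive_scal A t W); auto.
      apply (is_derive_ext (fun t => W * A t)). intros; simpl; ring. apply (is_derive_scal A t W); auto.
    + assert (k2 := c1_cont_t CT Ht). assert (k3 := c1_cont_s CT Ht).
      assert (M : mean (tt t) = W) by (rewrite <- (Wt t Ht); apply mean_ext; intros s; apply (CR t s Ht)).
      assert (CS := mean_CS (tt t) (fun _ => 1) k2 (cont_const 1)). cbv beta in CS. rewrite (mean_ext (fun x => tt t x * 1) (tt t)), (mean_ext (fun x => 1 * 1) (fun _ => 1)), M, mean_const in CS by (intros; ring).
      assert (mean (fun s => tt t s * tt t s) <= mean (fun s => tt t s * tt t s + ts t s * ts t s)) by (apply mean_le; [cnt..|]; intros s; generalize (sq_ge0 (ts t s)); lra). lra.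
  - apply (End a (ta 1)); [lra|]. intros s. assert (n := k_N _ H a s ltac:(lra)). assert (n2 := K1 a s ltac:(lra) ltac:(lra)). apply C1; [lra | rewrite Rabs_right; lra].
  - apply (End b (ta (hR D * hR D))); [lra|]. intros s. assert (n := k_N _ H b s ltac:(lra)). assert (n2 := K2 b s ltac:(lra) ltac:(lra)). apply C2; [lra | rewrite Rabs_left1; lra]. }
assert (tA : forall t s, 0 < t < hT D -> ta (nsq D t s) = A t).
{ intros t s Ht. destruct (g0 t 0 Ht) as (_ & _ & G). rewrite gz in G by auto. assert (k1 := c1_cont_f CT Ht). cbv beta in k1.
  assert (Z : (ta (nsq D t s) - A t) * (ta (nsq D t s) - A t) = 0).
  { apply (mean_sq_zero (fun s => (ta (nsq D t s) - A t) * (ta (nsq D t s) - A t))); auto. cnt. intros; apply sq_ge0.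
    intros x. now rewrite (c1_per CT t Ht x). }
  assert (ta (nsq D t s) - A t = 0) by (apply sq_eq0; exact Z). lra. }
(* The mean [A] has derivative [W] and tends to [ta 1 = 0] at the inner end. *)
assert (AW : forall t, 0 < t < hT D -> A t = W * t).
{ intros t Ht. assert (E0 : A t - W * t = 0).
  { assert (Q : (A t - W * t) * (A t - W * t) = 0); [|apply sq_eq0; exact Q].
    apply (small_zero _ (2 + 2 * (W * W))); [nra | apply sq_ge0 |]. intros eps He.
    destruct (continuous_eps ta 1 (ta_cont 1 ltac:(lra)) eps (proj1 He)) as (d & dp & Hd).
    destruct (k_0 _ H d dp) as (e1 & q1 & K1).
    set (x := Rmin (Rmin e1 (hT D)) eps / 2). assert (Hx : 0 < x /\ x < e1 /\ x < hT D /\ x < eps).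
    { assert (x1 := Rmin_l (Rmin e1 (hT D)) eps). assert (x2 := Rmin_r (Rmin e1 (hT D)) eps). assert (x3 := Rmin_l e1 (hT D)). assert (x4 := Rmin_r e1 (hT D)).
      assert (0 < Rmin (Rmin e1 (hT D)) eps) by (repeat apply Rmin_pos; lra). unfold x; lra. }
    assert (Ec : A t - W * t = A x - W * x).
    { apply (const_on 0 (hT D) (fun t => A t - W * t)); try lra. intros z Hz. assert (e0 : W - W * 1 = 0) by ring. enough (Q : is_derive (fun t => A t - W * t) z (W - W * 1)) by (rewrite e0 in Q; exact Q). apply (is_derive_minus A (fun t => W * t)); auto. auto_derive; auto; ring. }
    rewrite Ec. rewrite <- (tA x 0) by lra. assert (n := k_N _ H x 0 ltac:(lra)). assert (n2 := K1 x 0 ltac:(lra) ltac:(lra)).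
    assert (B := Hd (nsq D x 0) ltac:(rewrite Rabs_right; lra)).
    assert (t1 : ta 1 = 0) by (unfold ta; rewrite sqrt_1, Rminus_diag, sqrt_0, Rplus_0_r; apply ln_1). rewrite t1 in B.
    apply Rabs_lt_between in B. set (z := ta (nsq D x 0)) in *.
    assert (zz : z * z <= eps). { assert (0 <= (eps - z) * (eps + z)) by (apply Rmult_le_pos; lra). nra. }
    assert (xx : W * x * (W * x) <= W * W * eps). { replace (W * x * (W * x)) with (W * W * (x * x)) by ring. apply Rmult_le_compat_l; [apply sq_ge0|]. nra. }
    assert (t2 := sq_ge0 (z + W * x)). lra. }
  lra. }
exists W. split; auto. split. { destruct (wind_Z D t0 H Ht0) as (k & _ & K). exists k. exact K. }
intros t s Ht. split; [rewrite tA, AW; auto|].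
assert (N := k_N _ H t s Ht).
assert (st : tt t s = W).
{ rewrite <- (is_derive_unique _ _ _ (c1_dt CT t s Ht)). apply is_derive_unique. apply (is_derive_ext_loc A); auto. apply (locally_Ioo 0 (hT D)); auto. intros x Hx. symmetry; now apply tA. }
assert (ss : ts t s = 0).
{ rewrite <- (is_derive_unique _ _ _ (c1_ds CT t s Ht)). apply is_derive_unique. apply (is_derive_ext (fun _ => A t)). intros x. symmetry; now apply tA. apply (is_derive_const (A t)). }
destruct (CR t s Ht) as [cr _]. rewrite st in cr. unfold ts in ss.
assert (dn : dta (nsq D t s) <> 0). { unfold dta. apply Rinv_neq_0_compat. assert (0 < sqrt (nsq D t s)) by (apply sqrt_lt_R0; lra). assert (0 < sqrt (nsq D t s - 1)) by (apply sqrt_lt_R0; lra). apply Rgt_not_eq. repeat apply Rmult_lt_0_compat; lra. }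
apply Rmult_integral in ss. destruct ss as [ss|ss]; [contradiction|].
assert (om : omega D t s = W * nsq D t s) by (rewrite cr; field; lra).
unfold omega in om. assert (nE : nsq D t s = hu D t s * hu D t s + hv D t s * hv D t s) by reflexivity.
set (u := hu D t s) in *. set (v := hv D t s) in *. set (a := hus D t s) in *. set (b := hvs D t s) in *. set (n := nsq D t s) in *.
assert (p1 : u * a + v * b = 0) by lra.
split; apply (Rmult_eq_reg_l n); try lra.
- rewrite nE. transitivity (u * (u * a + v * b) - v * (u * b - v * a)); [ring|]. rewrite p1, om, nE. ring.
- rewrite nE. transitivity (v * (u * a + v * b) + u * (u * b - v * a)); [ring|]. rewrite p1, om, nE. ring.
Qed.

Lemma catenoid_modulus rs Rs w wx wy D c sgn : 0 < rs -> rs < Rs -> msurf rs Rs w wx wy -> chart rs Rs wx wy D -> core (scale rs Rs D) ->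
  (sgn = 1 \/ sgn = -1) -> (forall x y, annulus rs Rs x y -> w x y = catenoid_height rs c sgn x y) -> cosh (hT D) = Rs / rs.
Proof.
intros r0 r1 (wxx & wxy & wyx & wyy & Cw & _) H HC Sg Cat. set (E := scale rs Rs D) in *.
assert (ir : 0 < / rs) by (apply Rinv_0_lt_compat; auto). assert (sg2 : sgn * sgn = 1) by (destruct Sg; subst; ring).
assert (TE : hT E = hT D) by reflexivity.
assert (Fw := c1_comp2 rs Rs w wx wy _ _ _ _ _ _ _ _ (Rlt_le _ _ r0) ltac:(lra) Cw (ch_u H) (ch_v H) (ch_in H)).
change (C1cyl 0 (hT D) (fun t s => w (hu D t s) (hv D t s)) (ct wx wy D) (cs wx wy D)) in Fw.
assert (CT := c1_comp _ _ ta dta _ _ _ (c1_nsq E HC) (fun t s Ht => ta_derive _ (proj1 (k_N _ HC t s Ht))) (fun t s Ht => dta_cont _ (proj1 (k_N _ HC t s Ht)))). simpl in CT.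
assert (Ew : forall t s, 0 < t < hT D -> w (hu D t s) (hv D t s) = c + sgn * rs * ta (nsq E t s)).
{ intros t s Ht. rewrite Cat by now apply (ch_in H). unfold catenoid_height. f_equal. f_equal. unfold ta. f_equal.
  assert (N := k_N _ HC t s Ht). assert (nE : nsq D t s = rs * rs * nsq E t s) by (unfold E; rewrite nsq_scale by auto; field; lra).
  assert (cn : cnorm (hu D t s) (hv D t s) = rs * sqrt (nsq E t s)).
  { unfold cnorm. change (hu D t s * hu D t s + hv D t s * hv D t s) with (nsq D t s). rewrite nE, sqrt_mult, sqrt_square by (try lra; apply sq_ge0). auto. }
  rewrite cn. replace (rs * sqrt (nsq E t s) * (rs * sqrt (nsq E t s)) - rs * rs) with (rs * rs * (nsq E t s - 1)).
  - rewrite sqrt_mult, sqrt_square by (try lra; apply sq_ge0). field. lra.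
  - transitivity (rs * rs * (sqrt (nsq E t s) * sqrt (nsq E t s)) - rs * rs); [rewrite sqrt_sqrt by lra; ring | ring]. }
assert (Dw : forall t s, 0 < t < hT D -> ct wx wy D t s = sgn * rs * (dta (nsq E t s) * (2 * (hu E t s * hut E t s + hv E t s * hvt E t s))) /\
  cs wx wy D t s = sgn * rs * (dta (nsq E t s) * (2 * (hu E t s * hus E t s + hv E t s * hvs E t s)))).
{ intros t s Ht. split.
  - rewrite <- (is_derive_unique _ _ _ (c1_dt Fw t s Ht)). apply is_derive_unique. apply (is_derive_ext_loc (fun t => c + sgn * rs * ta (nsq E t s))).
    apply (locally_Ioo 0 (hT D)); auto. intros x Hx. symmetry; now apply Ew.
    match goal with |- is_derive _ _ ?l => replace l with (0 + l) by ring end. apply (is_derive_plus (fun _ => c) (fun t => sgn * rs * ta (nsq E t s))). apply (is_derive_const c).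
    apply (is_derive_scal (fun t => ta (nsq E t s)) t (sgn * rs)). apply (c1_dt CT t s Ht).
  - rewrite <- (is_derive_unique _ _ _ (c1_ds Fw t s Ht)). apply is_derive_unique. apply (is_derive_ext (fun s => c + sgn * rs * ta (nsq E t s))).
    intros x. symmetry; now apply Ew.
    match goal with |- is_derive _ _ ?l => replace l with (0 + l) by ring end. apply (is_derive_plus (fun _ => c) (fun s => sgn * rs * ta (nsq E t s))). apply (is_derive_const c).
    apply (is_derive_scal (fun s => ta (nsq E t s)) s (sgn * rs)). apply (c1_ds CT t s Ht). }
assert (r2 : 0 < rs * rs) by (apply Rmult_lt_0_compat; auto).
destruct (catenoid_rotation E HC) as (W & W1 & (k & Wk) & Rot).
{ intros t s Ht. assert (e := ch_E H t s Ht). destruct (Dw t s Ht) as [dt ds].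
  rewrite dt, ds in e. set (x1 := dta _ * (2 * (_ * hut E t s + _))) in *. set (x2 := dta _ * (2 * (_ * hus E t s + _))) in *.
  unfold E; simpl. apply (Rmult_eq_reg_l (rs * rs)); [|lra].
  transitivity (hut D t s * hut D t s + hvt D t s * hvt D t s + (sgn * sgn) * (rs * x1 * (rs * x1))); [rewrite sg2; field; lra|].
  transitivity (hus D t s * hus D t s + hvs D t s * hvs D t s + (sgn * sgn) * (rs * x2 * (rs * x2))); [lra | rewrite sg2; field; lra]. }
{ intros t s Ht. assert (e := ch_F H t s Ht). destruct (Dw t s Ht) as [dt ds].
  rewrite dt, ds in e. set (x1 := dta _ * (2 * (_ * hut E t s + _))) in *. set (x2 := dta _ * (2 * (_ * hus E t s + _))) in *.
  unfold E; simpl. apply (Rmult_eq_reg_l (rs * rs)); [|lra].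
  transitivity (hut D t s * hus D t s + hvt D t s * hvs D t s + (sgn * sgn) * (rs * x1 * (rs * x2))); [rewrite sg2; field; lra|]. lra. }
assert (TP := ch_T H). set (t0 := hT D / 2). assert (Ht0 : 0 < t0 < hT D) by (unfold t0; lra).
(* For [W >= 2] the angle [2 PI / W], at most [PI], would have the same image as the angle 0,
   against injectivity. *)
assert (We : W = 1).
{ destruct (Z.eq_dec k 1) as [->|nk]; [rewrite Wk; auto|]. exfalso.
  assert (kp : (1 < k)%Z). { rewrite Wk in W1. apply (le_IZR 1) in W1. lia. }
  assert (W2 : 2 <= W) by (rewrite Wk; apply (IZR_le 2); lia). assert (iW : 0 < / W) by (apply Rinv_0_lt_compat; lra).
  assert (iW2 : / W <= / 2) by (apply Rinv_le_contravar; lra). assert (PI0 := PI_RGT_0).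
  assert (der : forall f df, (forall s, is_derive f s (df s)) -> forall s, is_derive (fun s => f (s / W)) s (df (s / W) / W)).
  { intros f df K s. replace (df (s / W) / W) with (/ W * df (s / W)) by (unfold Rdiv; ring). apply (is_derive_comp f (fun s => s / W)); [apply K | auto_derive; auto; field; lra]. }
  destruct (rotation_ode (fun s => hu E t0 (s / W)) (fun s => hv E t0 (s / W))) with (s := 2 * PI) as [e1 e2].
  - intros s. destruct (Rot t0 (s / W) Ht0) as (_ & q1 & q2). replace (- hv E t0 (s / W)) with (hus E t0 (s / W) / W) by (rewrite q1; field; lra).
    apply (der (hu E t0) (hus E t0)). intros x. apply (c1_ds (k_u _ HC) t0 x Ht0).
  - intros s. destruct (Rot t0 (s / W) Ht0) as (_ & q1 & q2). replace (hu E t0 (s / W)) with (hvs E t0 (s / W) / W) by (rewrite q2; field; lra).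
    apply (der (hv E t0) (hvs E t0)). intros x. apply (c1_ds (k_v _ HC) t0 x Ht0).
  - rewrite cos_2PI, sin_2PI in e1, e2. unfold Rdiv in e1, e2. rewrite Rmult_0_l in e1, e2. unfold E in e1, e2; simpl in e1, e2.
    destruct (ch_inj H t0 (2 * PI * / W) t0 0 Ht0 Ht0) as (_ & e3 & _).
    apply (Rmult_eq_reg_l (/ rs)); lra. apply (Rmult_eq_reg_l (/ rs)); lra.
    rewrite cos_0 in e3. assert (0 < 2 * PI * / W) by (apply Rmult_lt_0_compat; lra). assert (2 * PI * / W <= 2 * PI * / 2) by (apply Rmult_le_compat_l; lra).
    assert (K := cos_decreasing_1 0 (2 * PI * / W)). rewrite cos_0 in K. lra. }
(* One inequality is the general bound. For the other, [ta = t] means [|h| = cosh t < cosh T], while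
   [|h|] comes arbitrarily close to [Rs / rs]. *)
apply Rle_antisym.
- rewrite <- TE. change (Rs / rs) with (hR E). now apply core_bound_main.
- assert (c0 := cosh_pos (hT D)). assert (q0 : 0 < Rs / rs) by (apply Rdiv_lt_0_compat; lra).
  apply Rsqr_incr_0; try lra. unfold Rsqr. apply Rnot_lt_le. intros Lt.
  destruct (k_1 _ HC (hR E * hR E - cosh (hT D) * cosh (hT D))) as (e & He & K). unfold E; simpl; lra.
  set (x := hT D - Rmin e (hT D) / 2). assert (Hx : 0 < x < hT D /\ hT D - e < x).
  { assert (x1 := Rmin_l e (hT D)). assert (x2 := Rmin_r e (hT D)). assert (0 < Rmin e (hT D)) by (apply Rmin_pos; lra). unfold x; lra. }
  assert (Q := K x 0 ltac:(rewrite TE; lra) ltac:(rewrite TE; lra)). destruct (Rot x 0 (proj1 Hx)) as (q & _). rewrite We, Rmult_1_l in q.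
  assert (N := k_N _ HC x 0 ltac:(rewrite TE; lra)). assert (ch := cosh_ta (nsq E x 0) ltac:(lra)). rewrite q in ch.
  assert (cx := cosh_pos x). assert (mon : cosh x <= cosh (hT D)) by (apply (incr 0 (hT D + 1) cosh sinh); try lra; [intros; apply is_derive_cosh | intros z Hz; rewrite <- sinh_0; apply Rlt_le, sinh_lt; lra]).
  assert (mon2 : cosh x * cosh x <= cosh (hT D) * cosh (hT D)) by (apply Rmult_le_compat; lra).
  assert (sq : cosh x * cosh x = nsq E x 0) by (rewrite ch; apply sqrt_sqrt; lra). lra.
Qed.

Theorem theorem1p2 (rs Rs : R) (w : R -> R -> R) (r R0 : R) :
  0 < rs -> rs < Rs ->
  minimal_graph (annulus rs Rs) w ->
  0 < r -> r < R0 ->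
  graph_conf_equiv_annulus rs Rs w r R0 ->
  ln (R0 / r) <= ln (Rs / rs + sqrt (Rs * Rs / (rs * rs) - 1)) /\
  (ln (R0 / r) = ln (Rs / rs + sqrt (Rs * Rs / (rs * rs) - 1)) <->
   exists c : R, exists sgn : R, (sgn = 1 \/ sgn = -1) /\
     forall x y, annulus rs Rs x y -> w x y = catenoid_height rs c sgn x y).
Proof.
intros r0 r1 (wx & wy & wxx & wxy & wyx & wyy & Cw & Cx & Cy & M) p0 p1 G.
assert (MS : msurf rs Rs w wx wy) by (exists wxx, wxy, wyx, wyy; auto).
destruct (chart_exists rs Rs w wx wy r R0) as (D1 & T1 & H1); auto.
destruct (normal_form rs Rs w wx wy D1) as (D & TD & H & HC); auto.
rewrite <- T1, <- TD.
replace (Rs * Rs / (rs * rs)) with (Rs / rs * (Rs / rs)) by (field; lra).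
assert (q1 : 1 < Rs / rs) by (apply (Rmult_lt_reg_r rs); auto; unfold Rdiv; rewrite Rmult_assoc, Rinv_l; lra).
destruct (modulus_bound (hT D) (Rs / rs)) as [B1 B2]; auto. { apply (ch_T H). }
assert (B := core_bound_main _ HC). change (cosh (hT D) <= Rs / rs) in B.
split; [apply B1, B|]. rewrite B2. split.
- intros e. apply (nitsche_catenoid rs Rs w wx wy D); auto. apply core_equality; auto. change (Rs / rs <= cosh (hT D)). lra.
- intros (c & sgn & Sg & Cat). now apply (catenoid_modulus rs Rs w wx wy D c sgn).
Qed.
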